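(* Subset Sum with multiplicities can be solved in randomized time $\widetilde{\mathcal{O}}(n+s^{5/3})$ by a one-sided error algorithm that returns a correct answer with high probability, where $n$ is the number of distinct items and $s=\max_{i\in[n]} s_i$ is the maximum item size.
   Context: Subset Sum with multiplicities: the input consists of $n$ distinct items, item $i\in[n]$ having a positive integer size $s_i$ and a binary-encoded positive integer multiplicity $u_i$, together with a target $t$. The question is whether there exist integers $x_i$ with $0\le x_i\le u_i$ and $\sum_{i\in[n]} s_i x_i=t$ (the algorithm can also return such $x$). $\widetilde{\mathcal{O}}(\cdot)$ hides polylogarithmic factors. The model of computation is the word RAM, where each input integer fits in one word and arithmetic on integers polynomial in the sum of the input integers takes constant time. *)

(* Defs.v *)
From mathcomp Require Import all_boot all_order all_algebra.
From mathcomp Require Import reals exp.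

Set Implicit Arguments.
Unset Strict Implicit.
Unset Printing Implicit Defensive.

Import Order.TTheory GRing.Theory Num.Theory.

Definition subset_sum (n : nat) (s u : 'I_n -> nat) (t : nat) : Prop :=
  exists x : 'I_n -> nat,
    (forall i, x i <= u i) /\ \sum_(i < n) s i * x i = t.

(** * Randomized word RAM with [w]-bit words

    A program is a finite list of instructions. It works on registers, which
    are named statically, and on a memory addressed by words. Every
    instruction has unit cost. *)

Inductive binop := Add | Sub | Mul | Div | Mod | Lt | Eq.

Inductive instr :=
  | Const of nat & nat           (* Const d v:   d := v *)
  | Op of binop & nat & nat & nat (* Op o d x y: d := x o y *)
  | Read of nat & nat            (* Read d x:    d := memory[x] *)
  | Write of nat & nat           (* Write x y:   memory[x] := y *)
  | Rand of nat                  (* Rand d:      d := a uniformly random word *)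
  | Jzero of nat & nat           (* Jzero x l:   if x = 0 go to line l *)
  | Halt of bool.                (* stop with this answer *)

Definition program := seq instr.

(* Subtraction wraps around, as is usual for machine words; division by 0
   follows the library ([x %/ 0 = 0], [x %% 0 = x]). *)
Definition eval_op (w : nat) (o : binop) (x y : nat) : nat :=
  match o with
  | Add => (x + y) %% 2 ^ w
  | Sub => (x + (2 ^ w - y)) %% 2 ^ w
  | Mul => (x * y) %% 2 ^ w
  | Div => x %/ y
  | Mod => x %% y
  | Lt => (x < y) %% 2 ^ w
  | Eq => (x == y) %% 2 ^ w
  end.

Record state := State { pc : nat; regs : nat -> nat; mem : nat -> nat }.

Definition update (f : nat -> nat) (d v : nat) : nat -> nat :=
  fun x => if x == d then v else f x.

(* Running past the last line answers "no". *)
Definition current (P : program) (q : state) : instr :=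
  nth (Halt false) P (pc q).

(* [r] is the random word available at this step; only [Rand] reads it. *)
Definition step (w : nat) (P : program) (q : state) (r : nat) : state :=
  let: State l g m := q in
  match current P q with
  | Const d v => State l.+1 (update g d (v %% 2 ^ w)) m
  | Op o d x y => State l.+1 (update g d (eval_op w o (g x) (g y))) m
  | Read d x => State l.+1 (update g d (m (g x))) m
  | Write x y => State l.+1 g (update m (g x) (g y))
  | Rand d => State l.+1 (update g d r) m
  | Jzero x l' => State (if g x == 0 then l' else l.+1) g m
  | Halt _ => q
  end.

(* The instance is stored as n, t, s_0, ..., s_(n-1), u_0, ..., u_(n-1) from
   address 0 on; all other cells and all registers are 0. *)
Definition input_seq (n : nat) (s u : 'I_n -> nat) (t : nat) : seq nat :=
  [:: n; t] ++ [seq s i | i <- enum 'I_n] ++ [seq u i | i <- enum 'I_n].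

Definition init (n : nat) (s u : 'I_n -> nat) (t : nat) : state :=
  State 0 (fun=> 0) (nth 0 (input_seq s u t)).

Definition input_sum (n : nat) (s u : 'I_n -> nat) (t : nat) : nat :=
  t + \sum_(i < n) (s i + u i).

(* With N the sum of the input integers, N ^ c < 2 ^ w <= (2 * N) ^ c when
   0 < c: one word holds any integer up to a fixed polynomial in N. *)
Definition word_size (c n : nat) (s u : 'I_n -> nat) (t : nat) : nat :=
  c * (trunc_log 2 (input_sum s u t)).+1.

(* The answer after T steps for the given random words, [None] if the program
   is still running. *)
Definition answer (w : nat) (P : program) (n : nat) (s u : 'I_n -> nat)
    (t T : nat) (omega : T.-tuple 'I_(2 ^ w)) : option bool :=
  if current P (foldl (step w P) (init s u t) [seq val r | r <- omega])
    is Halt b then Some b else None.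

Definition Pr (R : realType) (Omega : finType) (A : pred Omega) : R :=
  (#|A|%:R / #|Omega|%:R)%R.
Arguments Pr R {Omega} A.

(* Main.v *)
(** Items of equal size are merged, so that only the multiplicity [U v] of
    each size [v <= S] matters. With [q] about [S^(1/3)] and
    [m = 16 q^2 (log S + 3)] there are two cases.

    Fewer than [m] distinct sizes. Exchanging groups of items of equal total
    size turns some solution into one that differs from the greedy filling of
    [t] by a polynomial amount in each size. Subtracting the greedy part leaves
    residual multiplicities of polynomial size, and these are split into
    [O(log S)] binary levels whose multiplicities are at most 2. A solution is
    assembled level by level; each level and each carry lies in a window
    [0, D] with [D = 2 S cnt], [cnt] being the number of distinct sizes.

    At least [m] distinct sizes. By pigeonhole every divisor class that can
    obstruct has a modulus [d <= q], and if [d] is chosen suitably there are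
    many pairs of items differing by [d]. Then a target [t] that is at
    distance more than [D = 2 S m] from both 0 and the total is reachable iff
    its residue modulo [d] is, which a residue table decides; nearer targets
    are subset sums at most [D] of the items or of the complement.

    Both cases need all bounded subset sums up to [D] in time
    [~O(D + S)]. Each size gets a random weight [r_v]; a coefficient of
    [prod_v sum_(j <= U v) (r_v X^v)^j] modulo a prime [p > 4 D] is a
    polynomial in the weights, nonzero iff the sum is attained, hence by
    Schwartz-Zippel nonzero with probability at least 1/2. The
    coefficients follow from the logarithmic derivative by a linear
    recurrence, evaluated by online convolution; the convolutions are
    computed by a recursive transform over rings containing roots of unity
    modulo a power of two. Repeating [T] times makes the failure probability
    [2^-T], and an answer "yes" always has a witness.

    As [S m] is [~O(S^(5/3))], the time is as claimed. The algorithm is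
    written in a small while language whose compiler to the word RAM
    preserves the running time up to a constant. *)

Require Import Defs.
From mathcomp Require Import all_boot all_order all_algebra.
From mathcomp Require Import reals exp boolp.
From mathcomp Require Import zify ring lra.
Require Import Defs.

Set Implicit Arguments.
Unset Strict Implicit.
Unset Printing Implicit Defensive.

Import Order.TTheory GRing.Theory Num.Theory.

(** * A while language *)

(** The word ring [Z/2^w] lacks roots of unity and an inverse of 2. The transform therefore works
    modulo [z ^ n + 1], where [z] itself is a root of unity, and never divides: each level scales
    the result by a power of two, and the accumulated factor is removed at the end by an exact
    division of naturals, as the scaled coefficients still fit in a word. Correctness is stated for
    every ring with [2 ^ w = 0] and every [z] with [z ^ n = -1]; a quotient ring appears only once,
    to read off coefficients.

    Randomness is handled without a probabilistic semantics. All computation before the random words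
    are drawn is deterministic, so the [i]-th word comes from a fixed place of the random tape;
    afterwards the words are ordinary data. Every later statement is deterministic too: a positive
    answer is sound for all words, and the answer is complete if the words are good for each
    generating function in use. Only the bad tapes are counted.

    The recurrence divides by each [i <= D], which needs [D < p], and a failure rate of 1/2 needs
    [p] above [4D]. A single prime of size [~O(D)] serves both. *)

Inductive expr :=
  | Cst of nat | Var of nat | Bin of binop & expr & expr
  | Wrap of binop & expr & expr | Arr of nat & expr | Inp of expr.

Inductive cmd :=
  | Skip | Asg of nat & expr | Sto of nat & expr & expr | Seq of cmd & cmd
  | If of expr & cmd & cmd | For of nat & nat & expr & cmd.

Record st := St { rg : nat -> nat; ar : nat -> nat -> nat }.

Definition setr s x v := St (fun z => if z == x then v else rg s z) (ar s).
Definition seta s a i v :=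
  St (rg s) (fun b j => if (b == a) && (j == i) then v else ar s b j).

(** Exact counterpart of [eval_op]. [Bin] uses it and [okE] demands that the value fits in a word,
    so programs are verified over the naturals; [Wrap] keeps the modular operation where wrap-around
    or full-size words are intended. *)
Definition iop (o : binop) (x y : nat) : nat :=
  match o with
  | Add => x + y | Sub => x - y | Mul => x * y | Div => x %/ y
  | Mod => x %% y | Lt => x < y | Eq => x == y
  end.

Fixpoint wv c : seq nat :=
  match c with
  | Skip | Sto _ _ _ => [::]
  | Asg x _ => [:: x]
  | Seq c1 c2 | If _ c1 c2 => wv c1 ++ wv c2
  | For x y _ c => x :: y :: wv c
  end.

Fixpoint wa c : seq nat :=
  match c with
  | Skip | Asg _ _ => [::]
  | Sto a _ _ => [:: a]
  | Seq c1 c2 | If _ c1 c2 => wa c1 ++ wa c2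
  | For _ _ _ c => wa c
  end.

Fixpoint edepth e : nat :=
  match e with
  | Cst _ | Var _ => 0
  | Bin _ a b | Wrap _ a b => maxn (edepth a) (edepth b).+1
  | Arr _ e => maxn (edepth e) 1
  | Inp e => edepth e
  end.

Fixpoint ewf e : bool :=
  match e with
  | Cst _ | Var _ => true
  | Bin _ a b | Wrap _ a b => ewf a && ewf b
  | Arr a e => (a < 32) && ewf e
  | Inp e => ewf e
  end.

(** Intermediate values live in registers 2 to 29 and program variables start at register 30; depth
    below 25 leaves enough room when evaluation starts at register 2 or 3. *)
Definition egood e := ewf e && (edepth e < 25).

Fixpoint cwf c : bool :=
  match c with
  | Skip => true
  | Asg _ e => egood e
  | Sto a e1 e2 => [&& a < 32, egood e1 & egood e2]
  | Seq c1 c2 => cwf c1 && cwf c2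
  | If e c1 c2 => [&& egood e, cwf c1 & cwf c2]
  | For x y e c =>
      [&& egood e, cwf c, x != y, x \notin wv c & y \notin wv c]
  end.

(** * Semantics, cost, and Hoare rules with time bounds *)

Section Semantics.
Variables (w : nat) (inp : nat -> nat) (ilim lim : nat).
Local Notation W := (2 ^ w).

Fixpoint eval e s : nat :=
  match e with
  | Cst v => v
  | Var x => rg s x
  | Bin o a b => iop o (eval a s) (eval b s)
  | Wrap o a b => eval_op w o (eval a s) (eval b s)
  | Arr a e => ar s a (eval e s)
  | Inp e => inp (eval e s)
  end.

Fixpoint okE e s : bool :=
  match e with
  | Cst v => v < W
  | Var _ => true
  | Bin o a b => [&& okE a s, okE b s, iop o (eval a s) (eval b s) < W
                   & if o is Sub then eval b s <= eval a s < W else true]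
  | Wrap o a b => okE a s && okE b s
  | Arr a e => okE e s && (eval e s < lim)
  | Inp e => okE e s && (eval e s < ilim)
  end.

(** [For] evaluates its bound once, keeps it in [y], and leaves the counter equal to the bound. This
    is the state of the compiled loop at the moment its test fails. *)
Fixpoint exec c s : st :=
  match c with
  | Skip => s
  | Asg x e => setr s x (eval e s)
  | Sto a e1 e2 => seta s a (eval e1 s) (eval e2 s)
  | Seq c1 c2 => exec c2 (exec c1 s)
  | If e c1 c2 => if eval e s == 0 then exec c2 s else exec c1 s
  | For x y e c =>
      let N := eval e s in
      setr (iteri N (fun j s1 => exec c (setr s1 x j)) (setr s y N)) x N
  end.

Fixpoint ticks c s : nat :=
  match c with
  | Skip => 0
  | Asg _ _ | Sto _ _ _ => 1
  | Seq c1 c2 => ticks c1 s + ticks c2 (exec c1 s)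
  | If e c1 c2 => (if eval e s == 0 then ticks c2 s else ticks c1 s).+1
  | For x y e c =>
      let N := eval e s in
      (\sum_(j < N) (ticks c (setr (iteri j (fun j s1 => exec c (setr s1 x j))
                                         (setr s y N)) x j)).+1).+2
  end.

Fixpoint ok c s : Prop :=
  match c with
  | Skip => True
  | Asg _ e => okE e s
  | Sto _ e1 e2 => [/\ okE e1 s, okE e2 s & eval e1 s < lim]
  | Seq c1 c2 => ok c1 s /\ ok c2 (exec c1 s)
  | If e c1 c2 => okE e s /\ (if eval e s == 0 then ok c2 s else ok c1 s)
  | For x y e c =>
      let N := eval e s in
      [/\ okE e s, N < W & forall j, j < N ->
        ok c (setr (iteri j (fun j s1 => exec c (setr s1 x j)) (setr s y N)) x j)]
  end.

Lemma exec_rg c s x : x \notin wv c -> rg (exec c s) x = rg s x.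
Proof.
elim: c s => [|y e|a e1 e2|c1 IH1 c2 IH2|e c1 IH1 c2 IH2|y z e c IH] s //=.
- by rewrite inE => /negbTE ->.
- by rewrite mem_cat => /norP[h1 h2]; rewrite IH2 // IH1.
- by rewrite mem_cat => /norP[h1 h2]; case: ifP => _; [apply: IH2|apply: IH1].
- rewrite !inE => /norP[/negbTE nxy /norP[/negbTE nxz h]]; rewrite nxy.
  elim: (eval e s) {2}(eval e s) => [|N IHN] M /=; first by rewrite nxz.
  by rewrite IH //= nxy IHN.
Qed.

Lemma exec_ar c s a : a \notin wa c -> ar (exec c s) a = ar s a.
Proof.
elim: c s => [|y e|b e1 e2|c1 IH1 c2 IH2|e c1 IH1 c2 IH2|y z e c IH] s //=.
- by rewrite inE => /negbTE ->.
- by rewrite mem_cat => /norP[h1 h2]; rewrite IH2 // IH1.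
- by rewrite mem_cat => /norP[h1 h2]; case: ifP => _; [apply: IH2|apply: IH1].
- move=> h; elim: (eval e s) {2}(eval e s) => [|N IHN] M //=.
  by rewrite IH //= IHN.
Qed.

Definition triple c s T (Q : st -> Prop) :=
  [/\ ok c s, ticks c s <= T & Q (exec c s)].

Lemma t_weak c s T (Q Q' : st -> Prop) T' :
  triple c s T Q -> T <= T' -> (forall s', Q s' -> Q' s') -> triple c s T' Q'.
Proof. by case=> h1 h2 h3 hT hQ; split=> //; [apply: leq_trans hT|apply: hQ]. Qed.

Lemma t_frame c s T (Q : st -> Prop) :
  triple c s T Q ->
  triple c s T (fun s' => [/\ Q s',
     forall x, x \notin wv c -> rg s' x = rg s x &
     forall a, a \notin wa c -> ar s' a = ar s a]).
Proof.
by case=> h1 h2 h3; split=> //; split=> // x hx; [apply: exec_rg|apply: exec_ar].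
Qed.

Lemma t_seq c1 c2 s T1 T2 T (Q : st -> Prop) Q1 :
  triple c1 s T1 Q1 -> T1 + T2 <= T ->
  (forall s1, Q1 s1 -> (forall x, x \notin wv c1 -> rg s1 x = rg s x) ->
     (forall a, a \notin wa c1 -> ar s1 a = ar s a) -> triple c2 s1 T2 Q) ->
  triple (Seq c1 c2) s T Q.
Proof.
move=> /t_frame[h1 h2 [h3 h4 h5]] hT h.
have [k1 k2 k3] := h _ h3 h4 h5.
split=> //=; apply: leq_trans hT; exact: leq_add.
Qed.

Lemma t_asg x e c s T Q :
  okE e s -> triple c (setr s x (eval e s)) T Q -> triple (Seq (Asg x e) c) s T.+1 Q.
Proof. by move=> h [h1 h2 h3]. Qed.

Lemma t_asg1 x e s T (Q : st -> Prop) :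
  okE e s -> 0 < T -> Q (setr s x (eval e s)) -> triple (Asg x e) s T Q.
Proof. by []. Qed.

Lemma t_sto a e1 e2 c s T Q :
  okE e1 s -> okE e2 s -> eval e1 s < lim ->
  triple c (seta s a (eval e1 s) (eval e2 s)) T Q ->
  triple (Seq (Sto a e1 e2) c) s T.+1 Q.
Proof. by move=> h1 h2 h [k1 k2 k3]. Qed.

Lemma t_sto1 a e1 e2 s T (Q : st -> Prop) :
  okE e1 s -> okE e2 s -> eval e1 s < lim -> 0 < T ->
  Q (seta s a (eval e1 s) (eval e2 s)) -> triple (Sto a e1 e2) s T Q.
Proof. by []. Qed.

Lemma t_skip s T (Q : st -> Prop) : Q s -> triple Skip s T Q.
Proof. by []. Qed.

Lemma t_if e c1 c2 s T (Q : st -> Prop) :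
  okE e s -> (eval e s != 0 -> triple c1 s T Q) ->
  (eval e s = 0 -> triple c2 s T Q) -> triple (If e c1 c2) s T.+1 Q.
Proof.
move=> he h1 h2; rewrite /triple /=; case: eqP => [/h2[]//|/eqP /h1[]//].
Qed.

(** The premise for the body may use that everything the body never writes still has its value from
    loop entry, so an invariant mentions only what changes. *)
Lemma t_for x y e c s N B T (I : nat -> st -> Prop) (Q : st -> Prop) :
  okE e s -> eval e s = N -> N < W ->
  I 0 (setr s y N) ->
  (forall j s1, j < N -> I j s1 ->
     (forall z, z \notin x :: wv c -> rg s1 z = rg (setr s y N) z) ->
     (forall a, a \notin wa c -> ar s1 a = ar s a) ->
     triple c (setr s1 x j) (B j) (I j.+1)) ->
  \sum_(j < N) (B j).+1 + 2 <= T ->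
  (forall s1, I N s1 -> 
     (forall z, z \notin x :: wv c -> rg s1 z = rg (setr s y N) z) ->
     (forall a, a \notin wa c -> ar s1 a = ar s a) -> Q (setr s1 x N)) ->
  triple (For x y e c) s T Q.
Proof.
move=> he eN hN h0 hI hT hQ.
pose S j := iteri j (fun j s1 => exec c (setr s1 x j)) (setr s y N).
have fr j : (forall z, z \notin x :: wv c -> rg (S j) z = rg (setr s y N) z) /\
            (forall a, a \notin wa c -> ar (S j) a = ar s a).
  elim: j => [|j [IH1 IH2]]; first by split.
  split=> [z hz|a ha] /=.
    move: (hz); rewrite inE => /norP[nzx hz']; rewrite exec_rg //= (negbTE nzx).
    exact: IH1.
  by rewrite exec_ar //= IH2.
have IS j : j <= N -> I j (S j).
  elim: j => [//|j IHj] hj; have [f1 f2] := fr j.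
  by have [] := hI j (S j) hj (IHj (ltnW hj)) f1 f2.
split=> /=; rewrite ?eN.
- split=> // j hj; have [f1 f2] := fr j.
  by have [] := hI j (S j) hj (IS j (ltnW hj)) f1 f2.
- apply: leq_trans hT; rewrite addn2 !ltnS; apply: leq_sum => j _.
  have [f1 f2] := fr j.
  by have [] := hI j (S j) (ltn_ord j) (IS j (ltnW (ltn_ord j))) f1 f2.
- by have [f1 f2] := fr N; apply: hQ => //; apply: IS.
Qed.

End Semantics.

(** * Absence of overflow by degree counting *)

Section Degree.
Variables (w : nat) (inp : nat -> nat) (ilim lim M : nat).
Local Notation W := (2 ^ w).
Local Notation eval := (eval w inp).
Hypotheses (M2 : 1 < M) (MW : M ^ 12 < W) (Mlim : M ^ 5 < lim).

(** If the leaves are at most [M], the value is at most [M ^ dg e]. A sum raises the exponent by one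
    because [2 <= M]; differences, quotients and remainders are bounded by their first argument. *)
Fixpoint dg e : nat :=
  match e with
  | Bin Add a b => (maxn (dg a) (dg b)).+1
  | Bin Mul a b => dg a + dg b
  | Bin Sub a _ | Bin Div a _ | Bin Mod a _ => dg a
  | _ => 1
  end.

Fixpoint bnd e s : bool :=
  match e with
  | Cst v => v <= M
  | Var x => rg s x <= M
  | Bin Add a b | Bin Mul a b => bnd a s && bnd b s
  | Bin Sub a _ | Bin Div a _ | Bin Mod a _ => bnd a s
  | Bin _ _ _ => true
  | Arr a e => ar s a (eval e s) <= M
  | Inp e => inp (eval e s) <= M
  | Wrap _ _ _ => false
  end.

Fixpoint okd e s : bool :=
  match e with
  | Cst v => v <= M
  | Var _ => true
  | Bin o a b => [&& okd a s, okd b s, bnd (Bin o a b) s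
                   & if o is Sub then eval b s <= eval a s else true]
  | Wrap o a b => okd a s && okd b s
  | Arr a e => okd e s && bnd e s
  | Inp e => okd e s && (eval e s < ilim)
  end.

Fixpoint dgok e : bool :=
  match e with
  | Bin _ a b => [&& dgok a, dgok b & dg e <= 12]
  | Wrap _ a b => dgok a && dgok b
  | Arr _ e => dgok e && (dg e <= 5)
  | Inp e => dgok e
  | _ => true
  end.

Lemma bnd_le e s : bnd e s -> eval e s <= M ^ dg e.
Proof.
have Mp k : 0 < M ^ k by rewrite expn_gt0 (ltnW M2).
have M1 : 1 <= M ^ 1 by [].
elim: e => [v|x|o a IHa b IHb|//|a e _|e _] /=; rewrite ?expn1 //.
case: o => /=.
- move=> /andP[/IHa ha /IHb hb]; rewrite expnS.
  have h1 : M ^ dg a <= M ^ maxn (dg a) (dg b) by rewrite leq_exp2l // leq_maxl.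
  have h2 : M ^ dg b <= M ^ maxn (dg a) (dg b) by rewrite leq_exp2l // leq_maxr.
  apply: (@leq_trans (2 * M ^ maxn (dg a) (dg b))); last by rewrite leq_mul2r M2 orbT.
  by rewrite mul2n -addnn; apply: leq_add; [apply: leq_trans h1|apply: leq_trans h2].
- by move=> /IHa h; apply: leq_trans h; apply: leq_subr.
- by move=> /andP[/IHa ha /IHb hb]; rewrite expnD; apply: leq_mul.
- by move=> /IHa h; apply: leq_trans h; apply: leq_div.
- by move=> /IHa h; apply: leq_trans h; apply: leq_mod.
- by move=> _; case: (_ < _) => //=; rewrite expn1 ltnW.
- by move=> _; case: (_ == _) => //=; rewrite expn1 ltnW.
Qed.

(** Splits the overflow check into [dgok], which is computed from the syntax, and bounds on the
    leaves. The exponent 12 matches the word size [M ^ 12 < W], the exponent 5 the array length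
    [M ^ 5 < lim]. *)
Lemma okd_ok e s : dgok e -> okd e s -> okE w inp ilim lim e s.
Proof.
have M1 : M <= M ^ 12 by rewrite -{1}(expn1 M) leq_exp2l.
elim: e => [v|x|o a IHa b IHb|o a IHa b IHb|a e IHe|e IHe] //=.
- by move=> _ h; exact: leq_ltn_trans (leq_trans h M1) MW.
- move=> /and3P[ga gb gd] /and4P[oa ob hb hs]; rewrite IHa ?IHb //=.
  have -> /= : iop o (eval a s) (eval b s) < W; last first.
    case: (o) hs hb gd => //= -> hb gd; apply: leq_ltn_trans MW.
    by apply: leq_trans (@bnd_le a s hb) _; rewrite leq_exp2l.
  apply: leq_ltn_trans MW; apply: leq_trans (@bnd_le (Bin o a b) s hb) _.
  by rewrite leq_exp2l.
- by move=> /andP[ga gb] /andP[oa ob]; rewrite IHa ?IHb.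
- move=> /andP[ge gd] /andP[oe be]; rewrite IHe //=.
  by apply: leq_ltn_trans Mlim; apply: leq_trans (bnd_le be) _; rewrite leq_exp2l.
- by move=> ge /andP[oe ->]; rewrite IHe.
Qed.

End Degree.

(** * Compilation to the word RAM *)

Section Compilation.
Variables (w : nat) (inp : nat -> nat) (ilim lim : nat) (P : program).
Local Notation W := (2 ^ w).
Hypotheses (W1 : 32 < W) (fitW : ilim + 32 * lim <= W).

(** The value is left in register [d], the next registers being scratch. Register 0 stays 0, so
    [Op Mod d x 0] is a move and a [Jzero] on it an unconditional jump. Register 1 holds [ilim], the
    base address of 32 interleaved arrays. *)
Fixpoint cExpr e d : seq instr :=
  match e with
  | Cst v => [:: Const d v]
  | Var x => [:: Op Mod d (30 + x) 0]
  | Bin o a b | Wrap o a b => cExpr a d ++ cExpr b d.+1 ++ [:: Op o d d d.+1]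
  | Arr a e => cExpr e d ++ [:: Const d.+1 32; Op Mul d d d.+1; Const d.+1 a;
                             Op Add d d d.+1; Op Add d 1 d; Read d d]
  | Inp e => cExpr e d ++ [:: Read d d]
  end.

Definition cAddr a e d := cExpr e d ++ [:: Const d.+1 32; Op Mul d d d.+1;
                          Const d.+1 a; Op Add d d d.+1; Op Add d 1 d].

Fixpoint len c : nat :=
  match c with
  | Skip => 0
  | Asg _ e => (size (cExpr e 2)).+1
  | Sto a e1 e2 => size (cAddr a e1 2) + (size (cExpr e2 3)).+1
  | Seq c1 c2 => len c1 + len c2
  | If e c1 c2 => size (cExpr e 2) + (len c1 + len c2).+2
  | For _ _ e c => size (cExpr e 2) + (len c).+1.+4.+2
  end.

Fixpoint cC c l : seq instr :=
  match c with
  | Skip => [::]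
  | Asg x e => cExpr e 2 ++ [:: Op Mod (30 + x) 2 0]
  | Sto a e1 e2 => cAddr a e1 2 ++ cExpr e2 3 ++ [:: Write 2 3]
  | Seq c1 c2 => cC c1 l ++ cC c2 (l + len c1)
  | If e c1 c2 =>
      let l1 := (l + size (cExpr e 2)).+1 in
      let l2 := (l1 + len c1).+1 in
      cExpr e 2 ++ [:: Jzero 2 l2] ++ cC c1 l1 ++ [:: Jzero 0 (l2 + len c2)]
        ++ cC c2 l2
  | For x y e c =>
      let l1 := l + size (cExpr e 2) + 2 in
      cExpr e 2 ++ [:: Op Mod (30 + y) 2 0; Const (30 + x) 0;
        Op Lt 2 (30 + x) (30 + y); Jzero 2 (l1 + len c).+1.+4]
        ++ cC c (l1 + 2)
        ++ [:: Const 2 1; Op Add (30 + x) (30 + x) 2; Jzero 0 l1]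
  end.

Lemma size_cC c l : size (cC c l) = len c.
Proof.
elim: c l => [|x e|a e1 e2|c1 IH1 c2 IH2|e c1 IH1 c2 IH2|x y e c IH] l //=;
  rewrite ?size_cat /= ?size_cat /= ?IH1 ?IH2 ?IH; lia.
Qed.

Definition code_at l (cs : seq instr) :=
  forall i, i < size cs -> nth (Halt false) P (l + i) = nth (Halt false) cs i.

Lemma code_cat l c1 c2 : code_at l (c1 ++ c2) ->
  code_at l c1 /\ code_at (l + size c1) c2.
Proof.
move=> h; split=> i hi.
  by rewrite h ?nth_cat ?hi // size_cat; lia.
rewrite -addnA h ?size_cat ?ltn_add2l // nth_cat ltnNge leq_addr /=.
by rewrite addKn.
Qed.

Lemma code_cons l i c : code_at l (i :: c) ->
  nth (Halt false) P l = i /\ code_at l.+1 c.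
Proof.
move=> /(@code_cat l [:: i] c)[h1 h2]; split; last by rewrite addn1 in h2.
by rewrite -[l]addn0 h1.
Qed.

(** Quantifying over the tape [r] records that the code behaves the same for all random words and
    takes exactly [n] steps. *)
Definition runs n q q' :=
  forall r : seq nat, size r = n -> foldl (step w P) q r = q'.

Lemma runs0 q : runs 0 q q.
Proof. by case. Qed.

Lemma runs_cat n1 n2 q1 q2 q3 :
  runs n1 q1 q2 -> runs n2 q2 q3 -> runs (n1 + n2) q1 q3.
Proof.
move=> h1 h2 r hr; rewrite -(cat_take_drop n1 r) foldl_cat h1 ?h2 //.
  by rewrite size_drop hr addKn.
by rewrite size_takel // hr leq_addr.
Qed.

Lemma runs1 q q' : (forall r, step w P q r = q') -> runs 1 q q'.
Proof. by move=> h [|r [|]] //= _. Qed.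

Definition addr a i := ilim + (32 * i + a).

Definition rel s q :=
  [/\ regs q 0 = 0, regs q 1 = ilim, forall x, regs q (30 + x) = rg s x,
      forall a i, a < 32 -> i < lim -> mem q (addr a i) = ar s a i
    & forall j, j < ilim -> mem q j = inp j].

Lemma eval_opE o x y : iop o x y < W -> (if o is Sub then y <= x < W else true) ->
  eval_op w o x y = iop o x y.
Proof.
case: o => //= h h1; try by rewrite modn_small.
case/andP: h1 => yx xW; move: W h xW => V h xW.
by rewrite (_ : x + (V - y) = x - y + V) ?modnDr ?modn_small //; lia.
Qed.

Ltac one H := apply: runs1 => ?; rewrite /step /current /= H.

Lemma cE_ok e s l g m d :
  okE w inp ilim lim e s -> ewf e -> 1 < d -> d + edepth e < 30 ->
  code_at l (cExpr e d) ->
  rel s (State l g m) ->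
  exists g', [/\ runs (size (cExpr e d)) (State l g m) (State (l + size (cExpr e d)) g' m),
    g' d = eval w inp e s & forall x, x < d \/ 29 < x -> g' x = g x].
Proof.
move: l g d; have op2 a b o l g d :
    (forall l g d, 1 < d -> d + edepth a < 30 -> code_at l (cExpr a d) ->
      rel s (State l g m) -> exists g', [/\ runs (size (cExpr a d)) (State l g m)
        (State (l + size (cExpr a d)) g' m),
        g' d = eval w inp a s & forall x, x < d \/ 29 < x -> g' x = g x]) ->
    (forall l g d, 1 < d -> d + edepth b < 30 -> code_at l (cExpr b d) ->
      rel s (State l g m) -> exists g', [/\ runs (size (cExpr b d)) (State l g m)
        (State (l + size (cExpr b d)) g' m),
        g' d = eval w inp b s & forall x, x < d \/ 29 < x -> g' x = g x]) ->
    1 < d -> d + maxn (edepth a) (edepth b).+1 < 30 ->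
    code_at l (cExpr a d ++ cExpr b d.+1 ++ [:: Op o d d d.+1]) -> rel s (State l g m) ->
    let n := size (cExpr a d ++ cExpr b d.+1 ++ [:: Op o d d d.+1]) in
    exists g', [/\ runs n (State l g m) (State (l + n) g' m),
      g' d = eval_op w o (eval w inp a s) (eval w inp b s)
      & forall x, x < d \/ 29 < x -> g' x = g x].
  move=> IHa IHb hd hdd /code_cat[ca /code_cat[cb /code_cons[cc _]]] hrel.
  have [|g1 [h1 h2 h3]] := IHa l g d hd _ ca hrel; first by lia.
  have [r0 r1 r2 r3 r4] := hrel.
  have rel1 : rel s (State (l + size (cExpr a d)) g1 m).
    by split=> //= [||x]; rewrite h3; try lia; [exact: r0|exact: r1|exact: r2].
  have [||g2 [k1 k2 k3]] := IHb _ g1 d.+1 _ _ cb rel1; [lia|lia|].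
  exists (update g2 d (eval_op w o (g2 d) (g2 d.+1))); split.
  - rewrite !size_cat /= !addnA; apply: runs_cat (runs_cat h1 k1) _.
    by one cc; rewrite addn1.
  - by rewrite /update eqxx k2 k3 ?h2 //; lia.
  - by move=> x hx; rewrite /update; case: eqP => [?|_]; [lia|rewrite k3 ?h3 //; lia].
elim: e => [v|x|o a IHa b IHb|o a IHa b IHb|a e IHe|e IHe] l g d /=.
- move=> hv _ hd hdd /code_cons[hc _] _.
  exists (update g d v); split=> //.
  + by rewrite addn1; one hc; rewrite modn_small.
  + by rewrite /update eqxx.
  + by move=> y hy; rewrite /update; case: eqP => // ?; lia.
- move=> _ _ hd hdd /code_cons[hc _] [/= r0 r1 r2 _ _].
  exists (update g d (rg s x)); split=> //.
  + by rewrite addn1; one hc; rewrite r0 -r2 ?modn0.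
  + by rewrite /update eqxx.
  + by move=> y hy; rewrite /update; case: eqP => // ?; lia.
- move=> /and4P[oa ob ho hs] /andP[wa0 wb0] hd hdd hc hrel.
  have [||g' [h1 h2 h3]] := op2 a b o l g d _ _ hd hdd hc hrel.
  + by move=> *; apply: IHa.
  + by move=> *; apply: IHb.
  by exists g'; split=> //; rewrite h2 eval_opE.
- move=> /andP[oa ob] /andP[wa0 wb0] hd hdd hc hrel.
  by apply: op2 => //; move=> *; [apply: IHa|apply: IHb].
- move=> /andP[oe he] /andP[ha we] hd hdd /code_cat[hc1].
  move=> /code_cons[c1 /code_cons[c2 /code_cons[c3 /code_cons[c4 /code_cons[c5 /code_cons[c6 _]]]]]].
  move=> hrel; have [|g' [h1 h2 h3]] := IHe l g d oe we hd _ hc1 hrel; first by lia.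
  have [r0 r1 r2 r3 r4] := hrel.
  set v := eval w inp e s in h2 he *.
  have e1 : (v * 32) %% W = v * 32 by rewrite modn_small //; lia.
  have e2 : (v * 32 + a) %% W = v * 32 + a by rewrite modn_small //; lia.
  have e3 : (ilim + (v * 32 + a)) %% W = ilim + (v * 32 + a) by rewrite modn_small //; lia.
  pose g1 := update g' d.+1 32; pose g2 := update g1 d (v * 32).
  pose g3 := update g2 d.+1 a; pose g4 := update g3 d (v * 32 + a).
  have dd : (d == d.+1) = false by lia.
  have dd' : (d.+1 == d) = false by lia.
  have d1 : (1 == d) = false by lia.
  have d1' : (1 == d.+1) = false by lia.
  have G1 : g1 d = v by rewrite /g1 /update dd.
  have G1' : g1 d.+1 = 32 by rewrite /g1 /update eqxx.
  have G3 : g3 d = v * 32 by rewrite /g3 /g2 /update dd eqxx.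
  have G3' : g3 d.+1 = a by rewrite /g3 /update eqxx.
  have G4 : g4 d = v * 32 + a by rewrite /g4 /update eqxx.
  have G41 : g4 1 = ilim.
    by rewrite /g4 /g3 /g2 /g1 /update d1 d1' h3; [exact: r1|lia].
  pose g5 := update g4 d (ilim + (v * 32 + a)).
  exists (update g5 d (ar s a v)); split.
  + rewrite size_cat /=; apply: runs_cat h1 _.
    set l' := l + _ in c1 c2 c3 c4 c5 c6 *.
    have -> : l + (size (cExpr e d) + 6) = l'.+4.+2 by rewrite /l'; lia.
    rewrite -[6]/(1 + (1 + (1 + (1 + (1 + 1))))).
    apply: (@runs_cat 1 _ _ (State l'.+1 g1 m)).
      by one c1; rewrite modn_small.
    apply: (@runs_cat 1 _ _ (State l'.+2 g2 m)).
      by one c2; rewrite G1 G1' /= e1.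
    apply: (@runs_cat 1 _ _ (State l'.+3 g3 m)).
      by one c3; rewrite modn_small //; lia.
    apply: (@runs_cat 1 _ _ (State l'.+4 g4 m)).
      by one c4; rewrite G3 G3' /= e2.
    apply: (@runs_cat 1 _ _ (State l'.+4.+1 g5 m)).
      by one c5; rewrite G4 G41 /= e3.
    one c6; have -> : g5 d = ilim + (v * 32 + a) by rewrite /g5 /update eqxx.
    by have := r3 a v ha he; rewrite /= /addr mulnC => ->.
  + by rewrite /update eqxx.
  + move=> x hx; rewrite /g5 /g4 /g3 /g2 /g1 /update.
    have -> : (x == d) = false by lia.
    have -> : (x == d.+1) = false by lia.
    exact: h3.
- move=> /andP[oe he] we hd hdd /code_cat[hc1] /code_cons[c1 _].
  move=> hrel; have [|g' [h1 h2 h3]] := IHe l g d oe we hd _ hc1 hrel; first by lia.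
  have [r0 r1 r2 r3 r4] := hrel.
  exists (update g' d (inp (eval w inp e s))); split.
  + rewrite size_cat addnA addn1 addn1 -addn1; apply: runs_cat h1 _.
    by have /= r4' := r4 _ he; one c1; rewrite h2 r4'.
  + by rewrite /update eqxx.
  + by move=> y hy; rewrite /update h3 //; case: eqP => // ?; lia.
Qed.

Lemma rel_pc s l l' g g' m : rel s (State l g m) ->
  (forall x, x < 2 \/ 29 < x -> g' x = g x) -> rel s (State l' g' m).
Proof.
move=> [/= r0 r1 r2 r3 r4] h; split=> //= [||x]; rewrite h; try lia.
exact: r2.
Qed.

Arguments rel_pc {s l l' g g' m}.

Lemma rel_setr s l l' g m x v : rel s (State l g m) ->
  rel (setr s x v) (State l' (update g (30 + x) v) m).
Proof.
by move=> [/= r0 r1 r2 r3 r4]; split=> //= z; rewrite /update eqn_add2l r2.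
Qed.

Lemma rel_seta s l l' g m a i v : a < 32 -> i < lim -> rel s (State l g m) ->
  rel (seta s a i v) (State l' g (update m (addr a i) v)).
Proof.
move=> ha hi [/= r0 r1 r2 r3 r4]; split=> //= [b j hb hj|j hj].
  rewrite /update -[RHS]/(if (b == a) && (j == i) then v else ar s b j) -r3 //.
  suff -> : (addr b j == addr a i) = (b == a) && (j == i) by [].
  by rewrite /addr; lia.
rewrite /update (_ : (j == addr a i) = false) ?r4 //.
by rewrite /addr; lia.
Qed.

Lemma cA_ok a e s l g m d :
  okE w inp ilim lim e s -> ewf e -> a < 32 -> eval w inp e s < lim ->
  1 < d -> d + maxn (edepth e) 1 < 30 -> code_at l (cAddr a e d) ->
  rel s (State l g m) ->
  exists g', [/\ runs (size (cAddr a e d)) (State l g m) (State (l + size (cAddr a e d)) g' m),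
    g' d = addr a (eval w inp e s) & forall x, x < d \/ 29 < x -> g' x = g x].
Proof.
move=> oe we ha he hd hdd /code_cat[hc1].
move=> /code_cons[c1 /code_cons[c2 /code_cons[c3 /code_cons[c4 /code_cons[c5 _]]]]].
move=> hrel; have [|g' [h1 h2 h3]] := cE_ok oe we hd _ hc1 hrel; first by lia.
have [r0 r1 r2 r3 r4] := hrel.
set v := eval w inp e s in h2 he *.
have e1 : (v * 32) %% W = v * 32 by rewrite modn_small //; lia.
have e2 : (v * 32 + a) %% W = v * 32 + a by rewrite modn_small //; lia.
have e3 : (ilim + (v * 32 + a)) %% W = ilim + (v * 32 + a) by rewrite modn_small //; lia.
pose g1 := update g' d.+1 32; pose g2 := update g1 d (v * 32).
pose g3 := update g2 d.+1 a; pose g4 := update g3 d (v * 32 + a).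
have dd : (d == d.+1) = false by lia.
have dd' : (d.+1 == d) = false by lia.
have d1 : (1 == d) = false by lia.
have d1' : (1 == d.+1) = false by lia.
have G1 : g1 d = v by rewrite /g1 /update dd.
have G1' : g1 d.+1 = 32 by rewrite /g1 /update eqxx.
have G3 : g3 d = v * 32 by rewrite /g3 /g2 /update dd eqxx.
have G3' : g3 d.+1 = a by rewrite /g3 /update eqxx.
have G4 : g4 d = v * 32 + a by rewrite /g4 /update eqxx.
have G41 : g4 1 = ilim.
  by rewrite /g4 /g3 /g2 /g1 /update d1 d1' h3; [exact: r1|lia].
exists (update g4 d (ilim + (v * 32 + a))); split.
- rewrite size_cat /=; apply: runs_cat h1 _.
  set l' := l + _ in c1 c2 c3 c4 c5 *.
  have -> : l + (size (cExpr e d) + 5) = l'.+4.+1 by rewrite /l'; lia.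
  rewrite -[5]/(1 + (1 + (1 + (1 + 1)))).
  apply: (@runs_cat 1 _ _ (State l'.+1 g1 m)).
    by one c1; rewrite modn_small.
  apply: (@runs_cat 1 _ _ (State l'.+2 g2 m)).
    by one c2; rewrite G1 G1' /= e1.
  apply: (@runs_cat 1 _ _ (State l'.+3 g3 m)).
    by one c3; rewrite modn_small //; lia.
  apply: (@runs_cat 1 _ _ (State l'.+4 g4 m)).
    by one c4; rewrite G3 G3' /= e2.
  by one c5; rewrite G4 G41 /= e3.
- by rewrite /update eqxx /addr mulnC.
- move=> x hx; rewrite /g4 /g3 /g2 /g1 /update.
  have -> : (x == d) = false by lia.
  have -> : (x == d.+1) = false by lia.
  exact: h3.
Qed.
(** Bounds the instructions executed per tick and not the code length: subcommands are paid for by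
    their own ticks. The 5 counts the test, the increment and the jump back of one loop round. *)
Fixpoint csz c : nat :=
  match c with
  | Skip => 0
  | Asg _ e => size (cExpr e 2) + 1
  | Sto a e1 e2 => size (cAddr a e1 2) + size (cExpr e2 3) + 1
  | Seq c1 c2 => maxn (csz c1) (csz c2)
  | If e c1 c2 => maxn (size (cExpr e 2) + 2) (maxn (csz c1) (csz c2))
  | For _ _ e c => maxn (size (cExpr e 2) + 5) (csz c)
  end.

Lemma compile_ok K c s l g m :
  ok w inp ilim lim c s -> cwf c -> csz c <= K -> code_at l (cC c l) ->
  rel s (State l g m) ->
  exists n g' m', [/\ runs n (State l g m) (State (l + len c) g' m'),
    rel (exec w inp c s) (State (l + len c) g' m') & n <= K * ticks w inp c s].
Proof.
elim: c s l g m => [|x e|a e1 e2|c1 IH1 c2 IH2|e c1 IH1 c2 IH2|x y e c IH] s l g m /=.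
- by move=> _ _ _ _ hrel; exists 0, g, m; rewrite addn0; split=> //; apply: runs0.
- move=> oe /andP[we de] hK /code_cat[c1 /code_cons[c2 _]] hrel.
  have [|g' [h1 h2 h3]] := cE_ok (d := 2) oe we isT _ c1 hrel; first by lia.
  have [/= r0 _ _ _ _] := rel_pc (l' := l) hrel (g' := g') (fun x hx => h3 x hx).
  exists (size (cExpr e 2) + 1), (update g' (30 + x) (eval w inp e s)), m; split.
  + rewrite [l + _]addnS; apply: runs_cat h1 _; one c2.
    by rewrite r0 h2 ?modn0.
  + by apply: (@rel_setr _ 0); apply: rel_pc hrel _.
  + by rewrite muln1.
- move=> [o1 o2 hi] /and3P[ha /andP[w1 d1] /andP[w2 d2]] hK.
  move=> /code_cat[c1 /code_cat[c2 /code_cons[c3 _]]] hrel.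
  have [|g1 [h1 h2 h3]] := cA_ok (d := 2) o1 w1 ha hi isT _ c1 hrel; first by lia.
  have rel1 := rel_pc (l' := l + size (cAddr a e1 2)) hrel h3.
  have [|g2 [k1 k2 k3]] := cE_ok (d := 3) o2 w2 isT _ c2 rel1; first by lia.
  exists (size (cAddr a e1 2) + size (cExpr e2 3) + 1), g2,
    (update m (addr a (eval w inp e1 s)) (eval w inp e2 s)); split.
  + rewrite [l + _]addnA [l + _ + _.+1]addnS; apply: runs_cat (runs_cat h1 k1) _; one c3.
    by rewrite k2 k3 ?h2 //; lia.
  + by apply: (@rel_seta s (l + size (cAddr a e1 2))) => //; apply: (rel_pc rel1) => x [hx|hx]; apply: k3; lia.
  + by rewrite muln1.
- move=> [o1 o2] /andP[w1 w2] hK /code_cat[h1 h2] hrel.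
  rewrite size_cC in h2.
  have [|n1 [g1 [m1 [k1 k2 k3]]]] := IH1 s l g m o1 w1 _ h1 hrel; first by lia.
  have [|n2 [g2 [m2 [j1 j2 j3]]]] := IH2 _ _ g1 m1 o2 w2 _ h2 k2; first by lia.
  exists (n1 + n2), g2, m2; rewrite addnA; split=> //; first exact: runs_cat k1 j1.
  by rewrite mulnDr; apply: leq_add.
- move=> [oe oc] /and3P[/andP[we de] w1 w2] hK.
  move=> /code_cat[c0 /code_cons[j1 /code_cat[h1 /code_cons[j2 h2]]]] hrel.
  have [|g' [k1 k2 k3]] := cE_ok (d := 2) oe we isT _ c0 hrel; first by lia.
  rewrite size_cC in j2 h2.
  have rel1 l' := rel_pc (l' := l') hrel k3.
  have r0 : g' 0 = 0 by have [] := rel1 0.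
  set l1 := (l + size (cExpr e 2)).+1 in j1 h1 j2 h2 *.
  case: ifP oc => he oc.
  + have [|n2 [g2 [m2 [i1 i2 i3]]]] := IH2 _ _ g' m oc w2 _ h2 (rel1 _); first by lia.
    rewrite (_ : l + _ = (l1 + len c1).+1 + len c2); last by rewrite /l1; lia.
    exists (size (cExpr e 2) + 1 + n2), g2, m2; split=> //; last by rewrite mulnS; lia.
    by apply: runs_cat i1; apply: runs_cat k1 _; one j1; rewrite k2 he.
  + have [|n2 [g2 [m2 [i1 i2 i3]]]] := IH1 _ _ g' m oc w1 _ h1 (rel1 _); first by lia.
    rewrite (_ : l + _ = (l1 + len c1).+1 + len c2); last by rewrite /l1; lia.
    exists (size (cExpr e 2) + 1 + n2 + 1), g2, m2; split=> //; last by rewrite mulnS; lia.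
    * apply: (@runs_cat _ 1 _ (State (l1 + len c1) g2 m2)).
        by apply: runs_cat i1; apply: runs_cat k1 _; one j1; rewrite k2 he.
      by one j2; have [/= -> _ _ _ _] := i2.
- move=> [oe hN oc] /and5P[/andP[we de] wc nxy xc yc] hK.
  move=> /code_cat[c0 /code_cons[j1 /code_cons[j2 /code_cons[j3 /code_cons[j4 /code_cat[h1]]]]]].
  rewrite size_cC => /code_cons[j5 /code_cons[j6 /code_cons[j7 _]]] hrel.
  have [|g' [k1 k2 k3]] := cE_ok (d := 2) oe we isT _ c0 hrel; first by lia.
  set N := eval w inp e s in k2 hN oc *.
  have rel1 l' := rel_pc (l' := l') hrel k3.
  have r0 : g' 0 = 0 by have [] := rel1 0.
  set lE := l + size (cExpr e 2) in k1 j1 j2 j3 j4 h1 j5 j6 j7 *.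
  rewrite (_ : lE + 2 + 2 = lE.+4) in h1; last by lia.
  rewrite addn2 in j4 j7.
  pose S j := iteri j (fun j s1 => exec w inp c (setr s1 x j)) (setr s y N).
  pose tk j := ticks w inp c (setr (S j) x j).
  have Sy j : rg (S j) y = N.
    elim: j => [|j IHj] /=; first by rewrite eqxx.
    by rewrite exec_rg //= eq_sym (negbTE nxy).
  have loop j : j <= N -> exists n g1 m1,
      [/\ runs n (State l g m) (State lE.+2 g1 m1),
          rel (setr (S j) x j) (State lE.+2 g1 m1) &
          n <= size (cExpr e 2) + 2 + K * \sum_(i < j) (tk i).+1].
    elim: j => [_|j IHj hj].
      exists (size (cExpr e 2) + 2), (update (update g' (30 + y) N) (30 + x) 0), m.
      split; last by rewrite big_ord0 muln0 addn0.
      + apply: runs_cat k1 _; rewrite -[2]/(1 + 1).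
        apply: (@runs_cat 1 _ _ (State lE.+1 (update g' (30 + y) N) m)).
          by one j1; rewrite r0 k2 ?modn0.
        by one j2; rewrite mod0n.
      + by apply: (@rel_setr _ 0); apply: (@rel_setr _ 0); apply: (rel1 0).
    have [n [g1 [m1 [i1 i2 i3]]]] := IHj (ltnW hj).
    have [/= s0 s1 s2 _ _] := i2.
    have sx : g1 (30 + x) = j by rewrite s2 /= eqxx.
    have sy : g1 (30 + y) = N by rewrite s2 /= eq_sym (negbTE nxy) Sy.
    have i2' : rel (setr (S j) x j) (State lE.+4 (update g1 2 1) m1).
      by apply: rel_pc i2 _ => z hz; rewrite /update; case: eqP => // ?; lia.
    have [|n2 [g2 [m2 [a1 a2 a3]]]] := IH _ _ _ m1 (oc j hj) wc _ h1 i2'; first by lia.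
    have [/= t0 t1 t2 _ _] := a2.
    have tx : g2 (30 + x) = j by rewrite t2 exec_rg //= eqxx.
    exists (n + (1 + (1 + (n2 + (1 + (1 + 1)))))).
    exists (update (update g2 2 1) (30 + x) j.+1), m2.
    split.
    + apply: runs_cat i1 _.
      apply: (@runs_cat 1 _ _ (State lE.+3 (update g1 2 1) m1)).
        by one j3; rewrite sx sy /= hj modn_small //; lia.
      apply: (@runs_cat 1 _ _ (State lE.+4 (update g1 2 1) m1)).
        by one j4; rewrite /update eqxx.
      apply: runs_cat a1 _.
      apply: (@runs_cat 1 _ _ (State (lE.+4 + len c).+1 (update g2 2 1) m2)).
        by one j5; rewrite modn_small //; lia.
      apply: (@runs_cat 1 _ _ (State (lE.+4 + len c).+2 (update (update g2 2 1) (30 + x) j.+1) m2)).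
        have u : eval_op w Add (update g2 2 1 (30 + x)) (update g2 2 1 2) = j.+1.
          by rewrite /update /= tx addn1 modn_small //; lia.
        by apply: runs1 => ?; rewrite /step /current [pc _]/= j6 u.
      by one j7; rewrite /update /= t0.
    + apply: (@rel_setr _ 0); apply: (rel_pc (l := lE.+4 + len c) a2) => z hz.
      by rewrite /update; case: eqP => // ?; lia.
    + rewrite big_ord_recr /=; move: i3 a3; rewrite -/(tk j).
      move: (\sum_(i < j) _) (tk j) => A B; rewrite mulnDr mulnS.
      by move: (K * A) (K * B) => A' B'; lia.
  have [n [g1 [m1 [i1 i2 i3]]]] := loop N (leqnn N).
  have [/= s0 s1 s2 _ _] := i2.
  have sx : g1 (30 + x) = N by rewrite s2 /= eqxx.
  have sy : g1 (30 + y) = N by rewrite s2 /= eq_sym (negbTE nxy) Sy.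
  have pcE : l + (size (cExpr e 2) + (len c).+1.+4.+2) = (lE.+2 + len c).+1.+4.
    by rewrite /lE; lia.
  exists (n + (1 + 1)), (update g1 2 0), m1; rewrite pcE; split.
  + apply: runs_cat i1 _; apply: (@runs_cat 1 _ _ (State lE.+3 (update g1 2 0) m1)).
      by one j3; rewrite sx sy /= ltnn mod0n.
    by one j4; rewrite /update eqxx.
  + by apply: rel_pc i2 _ => z hz; rewrite /update; case: eqP => // ?; lia.
  + move: i3; rewrite /tk /S; move: (\sum_(j < N) _) => A; rewrite !mulnS.
    by move: (K * A) => A'; lia.
Qed.

End Compilation.

(** * Fast polynomial multiplication *)

Lemma big_ord_mul (R : nmodType) (a b : nat) (F : nat -> R) :
  (\sum_(k < a * b) F k = \sum_(i < b) \sum_(j < a) F (a * i + j)%N)%R.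
Proof.
elim: b => [|b IHb]; first by rewrite muln0 !big_ord0.
by rewrite big_ord_recr /= -IHb mulnS addnC big_split_ord.
Qed.

Lemma big_ord_double (R : nmodType) (a : nat) (F : nat -> R) :
  (\sum_(j < 2 * a) F j = \sum_(j < a) (F j + F (a + j)%N))%R.
Proof. by rewrite mul2n -addnn big_split_ord big_split. Qed.

(** * Butterflies over negacyclic rings *)

Section Words.
Variable w : nat.
Local Notation W := (2 ^ w).

Definition addw x y := eval_op w Add x y.
Definition subw x y := eval_op w Sub x y.
Definition mulw x y := eval_op w Mul x y.
Definition wbd (P : nat -> nat) := forall k, P k < W.

Lemma W_gt0 : 0 < W. Proof. by rewrite expn_gt0. Qed.
Lemma addw_lt x y : addw x y < W. Proof. by rewrite ltn_mod W_gt0. Qed.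
Lemma subw_lt x y : subw x y < W. Proof. by rewrite ltn_mod W_gt0. Qed.
Lemma mulw_lt x y : mulw x y < W. Proof. by rewrite ltn_mod W_gt0. Qed.

(** Multiplication by [y ^ t] on coefficient vectors of length [b], where [y ^ b = -1]. [ishf]
    multiplies by the inverse power, which is [- y ^ (b - t)]. *)
Definition shf b t (f : nat -> nat) i :=
  if i < t then subw 0 (f (i + b - t)) else f (i - t).
Definition ishf b t (f : nat -> nat) i :=
  if i + t < b then f (i + t) else subw 0 (f (i + t - b)).

(** A block of [b] words is one element of the ring with [y ^ b = -1]. The stage reduces a
    polynomial known modulo [x ^ (2L) - y ^ (2t)] to its residues modulo [x ^ L - y ^ t] and
    [x ^ L + y ^ t], where [t] depends on the node [q] of the splitting tree. *)
Definition stg b L (t : nat -> nat) (P : nat -> nat) k :=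
  let B := k %/ b in let i := k %% b in let q := B %/ (2 * L) in
  if B %% (2 * L) < L
  then addw (P k) (shf b (t q) (fun i => P ((B + L) * b + i)) i)
  else subw (P ((B - L) * b + i)) (shf b (t q) (fun i => P (B * b + i)) i).

Definition istg b L (t : nat -> nat) (P : nat -> nat) k :=
  let B := k %/ b in let i := k %% b in let q := B %/ (2 * L) in
  if B %% (2 * L) < L then addw (P k) (P ((B + L) * b + i))
  else ishf b (t q) (fun i => subw (P ((B - L) * b + i)) (P (B * b + i))) i.

(** Node [q] at depth [d] stands for the modulus [x ^ (2 ^ (D - d)) - y ^ ex b d q], and [tw] is
    half of this exponent, the shift with which the node splits further. The odd child adds [b]
    because [y ^ b = -1]. *)
Fixpoint tw b d q :=
  if d is d'.+1 then (tw b d' (q %/ 2) + (q %% 2) * b) %/ 2 else 0.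

Definition ex b d q :=
  if d is d'.+1 then tw b d' (q %/ 2) + (q %% 2) * b else 0.

Lemma shf_lt b t f i : wbd f -> shf b t f i < W.
Proof. by move=> h; rewrite /shf; case: ifP => _ //; apply: subw_lt. Qed.
Lemma ishf_lt b t f i : wbd f -> ishf b t f i < W.
Proof. by move=> h; rewrite /ishf; case: ifP => _ //; apply: subw_lt. Qed.
Lemma stg_wbd b L t P : wbd (stg b L t P).
Proof. by move=> k; rewrite /stg; case: ifP => _; [apply: addw_lt|apply: subw_lt]. Qed.
Lemma istg_wbd b L t P : wbd (istg b L t P).
Proof.
move=> k; rewrite /istg; case: ifP => _; first exact: addw_lt.
by apply: ishf_lt => i; apply: subw_lt.
Qed.

Lemma tw_lt b d q : 0 < b -> tw b d q < b.
Proof.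
move=> b0; elim: d q => [//|d IHd] q /=; have := IHd (q %/ 2).
by have := ltn_pmod q (isT : 0 < 2); move: (tw _ _ _) (q %% 2); nia.
Qed.

(** All halvings are exact down to depth [m]; hence the ring with [b = 2 ^ m] carries transforms of
    length up to [2 * b]. *)
Lemma tw_dvd m b d q : b = 2 ^ m -> d <= m -> 2 ^ (m - d) %| tw b d q.
Proof.
move=> -> hd; elim: d q hd => [|d IHd] q hd /=; first exact: dvdn0.
have := IHd (q %/ 2) (ltnW hd).
rewrite {1}(_ : m - d = (m - d.+1).+1); last by lia.
rewrite expnS => /dvdnP[k ->].
have -> : 2 ^ m = 2 ^ d * (2 * 2 ^ (m - d.+1)) by rewrite -!expnS -expnD; congr (_ ^ _); lia.
apply/dvdnP; exists (k + (q %% 2) * 2 ^ d).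
set T := 2 ^ (m - d.+1).
by rewrite (_ : _ + _ = (k + (q %% 2) * 2 ^ d) * T * 2) ?mulnK //; ring.
Qed.

Lemma ex_tw m b d q : b = 2 ^ m -> d <= m -> ex b d q = (tw b d q).*2.
Proof.
case: d => [|d] //= hb hd; rewrite -muln2 divnK // dvdn_add //.
  by apply: dvdn_trans (@tw_dvd m b d (q %/ 2) hb (ltnW hd)); rewrite dvdn_exp //; lia.
by rewrite dvdn_mull // hb dvdn_exp //; lia.
Qed.

(** The exponents depend only on the place within one transform, so a single pass serves a batch of
    transforms stored one after the other. *)
Lemma tw_period b d c q : tw b d (c * 2 ^ d + q) = tw b d q.
Proof.
elim: d c q => [//|d IHd] c q /=.
by rewrite expnSr mulnA divnMDl // modnMDl IHd.
Qed.

Lemma ex_period b d c q : ex b d (c * 2 ^ d + q) = ex b d q.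
Proof.
case: d => [//|d] /=.
by rewrite expnSr mulnA divnMDl // modnMDl tw_period.
Qed.

Section Ring.
Open Scope ring_scope.
Variables (K : comNzRingType) (W0 : (W%:R = 0 :> K)).

Lemma modW x : (x %% W)%N%:R = x%:R :> K.
Proof. by rewrite {2}(divn_eq x W) natrD natrM W0 mulr0 add0r. Qed.
Lemma addwK x y : (addw x y)%:R = x%:R + y%:R :> K.
Proof. by rewrite modW natrD. Qed.
Lemma mulwK x y : (mulw x y)%:R = x%:R * y%:R :> K.
Proof. by rewrite modW natrM. Qed.
Lemma subwK x y : (y <= W)%N -> (subw x y)%:R = x%:R - y%:R :> K.
Proof. by move=> h; rewrite modW natrD natrB // W0 sub0r. Qed.

Variables (b : nat) (y : K).
Hypotheses (b0 : (0 < b)%N) (yb : y ^+ b = -1).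

Definition evb (f : nat -> nat) : K := \sum_(i < b) (f i)%:R * y ^+ i.

Lemma evbE f : evb f = \sum_(0 <= i < b) (f i)%:R * y ^+ i.
Proof. by rewrite big_mkord. Qed.

Lemma evb_shf t f : (t <= b)%N -> wbd f -> evb (shf b t f) = y ^+ t * evb f.
Proof.
move=> ht hf; rewrite !evbE.
rewrite (big_cat_nat (n := t)) //= [X in _ = _ * X](big_cat_nat (n := (b - t)%N)) ?leq_subr //=.
rewrite mulrDr addrC; congr (_ + _).
- rewrite big_distrr /= -{1}[t]add0n big_addn !big_nat; apply: eq_bigr => i /andP[_ hi].
  rewrite /shf ltnNge leq_addl /= addnK exprD; ring.
- rewrite -[X in \sum_(X <= i < b) _]add0n big_addn subKn // big_distrr /=.
  rewrite !big_nat; apply: eq_bigr => i /andP[_ hi].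
  rewrite /shf hi subwK ?(ltnW (hf _)) // addnBA // sub0r.
  rewrite mulrCA -exprD (_ : (t + (i + b - t) = b + i)%N); last by lia.
  by rewrite exprD yb mulN1r mulrN mulNr.
Qed.

Lemma evbB f g : wbd g -> evb (fun i => subw (f i) (g i)) = evb f - evb g.
Proof.
move=> hg; rewrite /evb -sumrB; apply: eq_bigr => i _.
by rewrite subwK ?mulrBl // ltnW.
Qed.

Lemma evbD f g : evb (fun i => addw (f i) (g i)) = evb f + evb g.
Proof. by rewrite /evb -big_split; apply: eq_bigr => i _; rewrite addwK mulrDl. Qed.

Lemma eq_evb f g : (forall i, (i < b)%N -> f i = g i) -> evb f = evb g.
Proof. by move=> h; apply: eq_bigr => i _; rewrite h. Qed.

Lemma evb_ishf t f : (t <= b)%N -> wbd f -> evb (ishf b t f) = - y ^+ (b - t) * evb f.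
Proof.
move=> ht hf; rewrite mulNr -evb_shf ?leq_subr //.
rewrite /evb -sumrN; apply: eq_bigr => i _; rewrite -mulNr; congr (_ * _).
rewrite /ishf /shf; have hi := ltn_ord i.
have [h|h] := ltnP (i + t)%N b.
  rewrite (_ : (i < b - t)%N); last by lia.
  rewrite subwK ?(ltnW (hf _)) // sub0r opprK.
  by congr (f _)%:R; lia.
rewrite (_ : (i < b - t)%N = false); last by lia.
rewrite subwK ?(ltnW (hf _)) // sub0r.
by congr (- (f _)%:R); lia.
Qed.

Definition sb (P : nat -> nat) B := evb (fun i => P (B * b + i)%N).

Definition stgK L (t : nat -> nat) (V : nat -> K) B :=
  if (B %% (2 * L) < L)%N then V B + y ^+ t (B %/ (2 * L))%N * V (B + L)%N
  else V (B - L)%N - y ^+ t (B %/ (2 * L))%N * V B.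

Definition istgK L (t : nat -> nat) (V : nat -> K) B :=
  if (B %% (2 * L) < L)%N then V B + V (B + L)%N
  else - y ^+ (b - t (B %/ (2 * L)))%N * (V (B - L)%N - V B).

Lemma sb_stg L t P B : (forall q, (t q < b)%N) -> wbd P ->
  sb (stg b L t P) B = stgK L t (sb P) B.
Proof.
move=> ht hP.
have hd i : (i < b)%N -> ((B * b + i) %/ b = B)%N by move=> ?; rewrite divnMDl // divn_small ?addn0.
have hm i : (i < b)%N -> ((B * b + i) %% b = i)%N by move=> ?; rewrite modnMDl modn_small.
have hP' B' : wbd (fun i => P (B' * b + i)%N) by move=> i; apply: hP.
rewrite /stgK; case: ifP => h.
- rewrite /sb -evb_shf ?(ltnW (ht _)) // -evbD; apply: eq_evb => i hi.
  by rewrite /stg hd // hm // h.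
- rewrite /sb -evb_shf ?(ltnW (ht _)) // -evbB; last by move=> i; apply: shf_lt.
  by apply: eq_evb => i hi; rewrite /stg hd // hm // h.
Qed.

Lemma sb_istg L t P B : (forall q, (t q < b)%N) -> wbd P ->
  sb (istg b L t P) B = istgK L t (sb P) B.
Proof.
move=> ht hP.
have hd i : (i < b)%N -> ((B * b + i) %/ b = B)%N by move=> ?; rewrite divnMDl // divn_small ?addn0.
have hm i : (i < b)%N -> ((B * b + i) %% b = i)%N by move=> ?; rewrite modnMDl modn_small.
have hP' B' : wbd (fun i => P (B' * b + i)%N) by move=> i; apply: hP.
rewrite /istgK; case: ifP => h.
- by rewrite /sb -evbD; apply: eq_evb => i hi; rewrite /istg hd // hm // h.
- rewrite /sb -evbB // -evb_ishf ?(ltnW (ht _)) //; last by move=> i; apply: subw_lt.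
  by apply: eq_evb => i hi; rewrite /istg hd // hm // h.
Qed.

(** An inverse stage returns twice its preimage, since halving is impossible modulo a power of two.
    The factor [c] lets these doublings accumulate over the stages. *)
Lemma istgK_stgK L t R c (U V : nat -> K) : (forall q, (t q < b)%N) -> (0 < L)%N ->
  (2 * L %| R)%N ->
  (forall B, (B < R)%N -> U B = c * stgK L t V B) ->
  forall B, (B < R)%N -> istgK L t U B = c * 2%:R * V B.
Proof.
move=> ht L0 /dvdnP[r hR] hU B hB; rewrite /istgK.
set q := (B %/ (2 * L))%N; have eB : (B = q * (2 * L) + B %% (2 * L))%N := divn_eq _ _.
have hq : (q < r)%N by rewrite ltn_divLR //; lia.
have hm : (B %% (2 * L) < 2 * L)%N by rewrite ltn_mod; lia.
set r' := (B %% (2 * L))%N in eB hm *.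
have hi j : (j < 2 * L)%N -> (q * (2 * L) + j < R)%N.
  by rewrite hR => ?; apply: (@leq_trans (q.+1 * (2 * L))); rewrite ?leq_mul2r ?hq ?orbT // mulSn; lia.
have sv j : (j < 2 * L)%N -> stgK L t V (q * (2 * L) + j)%N =
   if (j < L)%N then V (q * (2 * L) + j)%N + y ^+ t q * V (q * (2 * L) + j + L)%N
   else V (q * (2 * L) + j - L)%N - y ^+ t q * V (q * (2 * L) + j)%N.
  by move=> hj; rewrite /stgK modnMDl divnMDl ?muln_gt0 // modn_small // (divn_small hj) addn0.
case: ifP => h.
- rewrite hU // eB -addnA hU; last by apply: hi; lia.
  rewrite sv // sv; last by lia.
  rewrite h (_ : (r' + L < L)%N = false); last by lia.
  rewrite !addnA addnK; ring.
- have eB' : (B - L = q * (2 * L) + (r' - L))%N by lia.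
  have h1 : stgK L t V B = V (B - L)%N - y ^+ t q * V B by rewrite /stgK -/r' h.
  have h2 : stgK L t V (B - L)%N = V (B - L)%N + y ^+ t q * V B.
    have l1 : (r' - L < L)%N by lia.
    have l2 : (r' - L < 2 * L)%N by lia.
    have l3 : (q * (2 * L) + (r' - L) + L = B)%N by lia.
    by rewrite {1}eB' (sv _ l2) l1 l3 -eB'.
  have l4 : (B - L < R)%N by lia.
  rewrite (hU _ l4) (hU _ hB).
  rewrite h1 h2.
  set A := V (B - L)%N; set C := V B.
  have -> : c * (A + y ^+ t q * C) - c * (A - y ^+ t q * C) = c * 2%:R * C * y ^+ t q by ring.
  rewrite mulrCA mulNr -exprD subnK ?(ltnW (ht _)) // yb; ring.
Qed.

Fixpoint fwdK D n (V : nat -> K) : nat -> K :=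
  if n is n'.+1 then stgK (2 ^ (D - n)) (tw b n') (fwdK D n' V) else V.

(** Invariant of the splitting tree: at any root [x] of the modulus of a node, the residue stored
    there takes the same value as the whole input polynomial. At depth [D] a residue is a single
    coefficient, hence a value. *)
Lemma fwdK_node m D n V Q (x : K) : b = (2 ^ m)%N -> (D <= m.+1)%N -> (n <= D)%N ->
  x ^+ (2 ^ (D - n)) = y ^+ ex b n Q ->
  \sum_(j < 2 ^ (D - n)) fwdK D n V (Q * 2 ^ (D - n) + j)%N * x ^+ j =
  \sum_(j < 2 ^ D) V (Q %/ 2 ^ n * 2 ^ D + j)%N * x ^+ j.
Proof.
move=> hb hD; elim: n Q => [|n IHn] Q hn hx; first by rewrite subn0 expn0 divn1.
set L := (2 ^ (D - n.+1))%N in hx *.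
have eL : (2 ^ (D - n) = 2 * L)%N by rewrite -expnS; congr (_ ^ _)%N; lia.
have hx2 : x ^+ (2 ^ (D - n)) = y ^+ ex b n (Q %/ 2).
  rewrite eL mulnC exprM hx /= (ex_tw _ hb); last by lia.
  rewrite -exprM.
  (* Squaring removes the sign [y ^ b = -1], so both children square to the root condition of their
     parent. *)
  have -> : ((tw b n (Q %/ 2) + Q %% 2 * b) * 2 = tw b n (Q %/ 2) * 2 + b * (2 * (Q %% 2)))%N by ring.
  by rewrite exprD -muln2 (exprM y b) yb (exprM (-1) 2) sqrrN !expr1n mulr1.
have IH := IHn _ (ltnW hn) hx2.
rewrite expnS divnMA -IH eL.
have L0 : (0 < L)%N by rewrite expn_gt0.
have hQ := divn_eq Q 2; set q := (Q %/ 2)%N in hQ hx *; set bt := (Q %% 2)%N in hQ hx.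
have hbt : (bt < 2)%N by rewrite ltn_mod.
have hxL : x ^+ L = (-1) ^+ bt * y ^+ tw b n q.
  by rewrite hx /= exprD [(_ * b)%N]mulnC exprM yb mulrC.
rewrite mul2n -addnn big_split_ord /= addnn -mul2n.
under [X in _ = _ + X]eq_bigr => i _ do rewrite exprD mulrCA.
rewrite -big_distrr /= hxL big_distrr /= -big_split /=.
apply: eq_bigr => j _; rewrite -/L.
have hj := ltn_ord j.
have e1 : (Q * L + j = q * (2 * L) + (bt * L + j))%N by rewrite hQ; ring.
have h1 : (bt * L + j < 2 * L)%N by move: hbt; case: (bt) => [|[|]] // _; lia.
rewrite /stgK e1 modnMDl (modn_small h1) divnMDl ?muln_gt0 // (divn_small h1) addn0.
move: hbt; case: (bt) => [|[|]] // _.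
  rewrite mul0n add0n hj expr0 mul1r.
  have -> : (q * (2 * L) + j + L = q * (2 * L) + (L + j))%N by lia.
  ring.
rewrite mul1n ltnNge leq_addr /= expr1.
have -> : (q * (2 * L) + (L + j) - L = q * (2 * L) + j)%N by lia.
ring.
Qed.

Fixpoint invK D n (U : nat -> K) : nat -> K :=
  if n is n'.+1 then invK D n' (istgK (2 ^ (D - n)) (tw b n') U) else U.

Lemma invK_fwdK D n R c (U V : nat -> K) : (n <= D)%N ->
  (forall B, (B < R * 2 ^ D)%N -> U B = c * fwdK D n V B) ->
  forall B, (B < R * 2 ^ D)%N -> invK D n U B = c * 2%:R ^+ n * V B.
Proof.
elim: n c U => [|n IHn] c U hn hU B hB /=; first by rewrite expr0 mulr1 hU.
rewrite exprS mulrA; apply: (IHn _ _ (ltnW hn)) => // {hB} B hB.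
apply: istgK_stgK hB => //; first by move=> q; apply: tw_lt.
  by rewrite expn_gt0.
by rewrite dvdn_mull // -expnS dvdn_exp2l //; lia.
Qed.
End Ring.

(** With [y = z ^ a], a polynomial in [z] becomes one of degree below [a] in [z] over the ring of
    [y]: coefficient [a * i + j] moves to place [i] of block [j]. The [a] zero blocks appended to
    each polynomial make room for a product. *)
Definition relay a b (P : nat -> nat) k :=
  let r := k %% (2 * a * b) in
  if r %/ b < a then P (k %/ (2 * a * b) * (a * b) + (a * (r %% b) + r %/ b)) else 0.

(** Substitutes [z ^ a = y] back: the upper [a] blocks of a product are multiplied by [y], a shift
    by one place, and added to the lower ones. *)
Definition unrelay a b (Z : nat -> nat) k :=
  let c := k %/ (a * b) in let r := k %% (a * b) in let i := r %/ a in
  addw (Z ((c * (2 * a) + r %% a) * b + i))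
       (shf b 1 (fun i => Z ((c * (2 * a) + a + r %% a) * b + i)) i).

Fixpoint fwdP b D n (P : nat -> nat) : nat -> nat :=
  if n is n'.+1 then stg b (2 ^ (D - n)) (tw b n') (fwdP b D n' P) else P.

Fixpoint invP b D n (Z : nat -> nat) : nat -> nat :=
  if n is n'.+1 then invP b D n' (istg b (2 ^ (D - n)) (tw b n') Z) else Z.

Lemma relay_wbd a b P : wbd P -> wbd (relay a b P).
Proof. by move=> h k; rewrite /relay; case: ifP => _ //; rewrite W_gt0. Qed.

Lemma fwdP_wbd b D n P : wbd P -> wbd (fwdP b D n P).
Proof. by case: n => // n _; apply: stg_wbd. Qed.

Lemma invP_wbd b D n P : wbd P -> wbd (invP b D n P).
Proof. by elim: n P => // n IHn P _; apply: IHn; apply: istg_wbd. Qed.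

Lemma unrelay_wbd a b P : wbd (unrelay a b P).
Proof. by move=> k; apply: addw_lt. Qed.

(* [P] holds [2 * R] polynomials of length [n], [Z] holds their [R] scaled
   negacyclic products; quantifying over [K] and [z] says this without
   quotient rings. *)
Definition negaprod n R kap (P Z : nat -> nat) :=
  forall (K : comNzRingType) (z : K), (W%:R = 0 :> K)%R -> (z ^+ n = -1 :> K)%R ->
  forall c, c < R ->
    (sb n z Z c = kap%:R * sb n z P c * sb n z P (c + R)%N :> K)%R.

Section Level.
Variables (m D R kap : nat) (P Z : nat -> nat).
Let b := 2 ^ m.
Let a := 2 ^ D.-1.
Hypotheses (D0 : 0 < D) (Dm : D <= m.+1) (hP : wbd P) (hZ : wbd Z).
Let P2 := fwdP b D D (relay a b P).
Let Z1 := invP b D D Z.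
Hypothesis Hsub : negaprod b (R * 2 ^ D) kap P2 Z.

Let b0 : 0 < b. Proof. by rewrite expn_gt0. Qed.
Let a0 : 0 < a. Proof. by rewrite expn_gt0. Qed.
Let D2 : 2 ^ D = 2 * a. Proof. by rewrite /a -expnS prednK. Qed.

(** The substitution [y = z ^ a] trades [R] products of length [a * b] for [R * 2 ^ D] products of
    length [b], in a ring where [y] supplies the roots of unity. The unnormalised inverse transform
    multiplies the scale by [2 ^ D]. *)
Lemma negaprod_level : negaprod (a * b) R (kap * 2 ^ D) P (unrelay a b Z1).
Proof.
move=> K z W0 zn; pose y : K := (z ^+ a)%R.
have yb : (y ^+ b = -1 :> K)%R by rewrite /y -exprM.
pose V0 := sb b y (relay a b P).
have twb q d : tw b d q < b by apply: tw_lt.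
have eF n : sb b y (fwdP b D n (relay a b P)) = fwdK b y D n V0.
  elim: n => [//|n IHn]; apply: funext => B /=; rewrite -IHn.
  by apply: sb_stg => //; apply: fwdP_wbd; apply: relay_wbd.
have eI n U : wbd U -> sb b y (invP b D n U) = invK b y D n (sb b y U).
  elim: n U => [//|n IHn] U hU /=; rewrite IHn; last exact: istg_wbd.
  by congr (invK _ _ _ _ _); apply: funext => B; apply: sb_istg.
have vV0 c j : j < 2 * a -> V0 (c * (2 * a) + j) =
   if j < a then (\sum_(i < b) (P (c * (a * b) + (a * i + j)))%:R * y ^+ i)%R else 0%R.
  move=> hj; rewrite /V0 /sb /evb.
  have e i : i < b -> relay a b P ((c * (2 * a) + j) * b + i) =
      if j < a then P (c * (a * b) + (a * i + j)) else 0.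
    move=> hi; have eK : (c * (2 * a) + j) * b + i = c * (2 * a * b) + (j * b + i) by ring.
    have hji : j * b + i < 2 * a * b.
      by apply: (@leq_trans (j.+1 * b)); rewrite ?leq_mul2r ?hj ?orbT // mulSn; lia.
    have e1 : (c * (2 * a * b) + (j * b + i)) %% (2 * a * b) = j * b + i.
      by rewrite modnMDl (modn_small hji).
    have e2 : (c * (2 * a * b) + (j * b + i)) %/ (2 * a * b) = c.
      by rewrite divnMDl ?(divn_small hji) ?addn0 // !muln_gt0 a0 b0.
    have e3 : (j * b + i) %/ b = j by rewrite divnMDl // (divn_small hi) addn0.
    have e4 : (j * b + i) %% b = i by rewrite modnMDl (modn_small hi).
    by rewrite /relay eK e1 e2 e3 e4.
  case: ifP => hja.
    by apply: eq_bigr => i _; rewrite e // hja.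
  by apply: big1 => i _; rewrite e // hja mul0r.
pose PA c := (\poly_(j < a) V0 (c * 2 ^ D + j)%N)%R.
have leaf Q : fwdK b y D D V0 Q = (PA (Q %/ 2 ^ D)%N).[y ^+ ex b D Q]%R.
  have := @fwdK_node K b y b0 yb m D D V0 Q (y ^+ ex b D Q)%R erefl Dm (leqnn D).
  rewrite subnn expn0 expr1 big_ord1 muln1 addn0 expr0 mulr1 => -> //.
  move: (y ^+ ex b D Q)%R => xi; rewrite horner_poly D2.
  rewrite (big_ord_double a (fun j => V0 (Q %/ (2 * a) * (2 * a) + j)%N * xi ^+ j)%R).
  apply: eq_bigr => j _; have hj := ltn_ord j.
  have haj : a + j < 2 * a by lia.
  by rewrite (vV0 _ _ haj) ltnNge leq_addr mul0r addr0.
(* [G] lists the coefficients of the true products, which have at most [2 ^ D] coefficients thanks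
   to the padding. Its transform is the pointwise product of the two transforms, so the inverse
   stages applied to the subproducts return a multiple of [G]. *)
pose G B := ((PA (B %/ 2 ^ D)%N * PA (B %/ 2 ^ D + R)%N)`_(B %% 2 ^ D))%R.
have sPA c : (size (PA c) <= a)%N by apply: size_poly.
have sPP c c' : size (PA c * PA c')%R <= 2 ^ D.
  by apply: leq_trans (size_polyMleq _ _) _; have := sPA c; have := sPA c'; lia.
have Gx c x : (\sum_(j < 2 ^ D) G (c * 2 ^ D + j)%N * x ^+ j = (PA c).[x] * (PA (c + R)%N).[x])%R.
  rewrite -hornerM (horner_coef_wide _ (sPP _ _)); apply: eq_bigr => j _.
  by rewrite /G modnMDl divnMDl ?expn_gt0 // divn_small // addn0 modn_small.
have leafG Q : fwdK b y D D G Q =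
    (fwdK b y D D V0 Q * fwdK b y D D V0 (Q + R * 2 ^ D)%N)%R.
  have := @fwdK_node K b y b0 yb m D D G Q (y ^+ ex b D Q)%R erefl Dm (leqnn D).
  rewrite subnn expn0 expr1 big_ord1 muln1 addn0 expr0 mulr1 => -> //.
  rewrite Gx !leaf; congr (_ * _)%R.
  by rewrite [Q + R * _]addnC ex_period divnMDl ?expn_gt0 // [R + _]addnC.
have hG B : B < R * 2 ^ D -> sb b y Z1 B = (kap%:R * 2%:R ^+ D * G B)%R.
  move=> hB; rewrite /Z1 eI //; apply: (@invK_fwdK K b y b0 yb D D R) hB => //.
  by move=> {}B hB; rewrite Hsub // !eF leafG mulrA.
move=> c hc.
have evP c' : sb (a * b) z P c' = (PA c').[z]%R.
  rewrite /sb /evb (big_ord_mul a b (fun k => (P (c' * (a * b) + k)%N)%:R * z ^+ k)%R).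
  rewrite exchange_big /= horner_poly; apply: eq_bigr => j _.
  rewrite D2 vV0 ?ltn_ord; last by have := ltn_ord j; lia.
  rewrite big_distrl /=; apply: eq_bigr => i _.
  by rewrite exprD exprM mulrA.
rewrite !evP natrM natrX -mulrA -Gx.
rewrite /sb /evb (big_ord_mul a b (fun k => (unrelay a b Z1 (c * (a * b) + k)%N)%:R * z ^+ k)%R).
rewrite exchange_big /=.
have hZ1 : wbd Z1 by apply: invP_wbd.
have eU j : j < a -> (\sum_(i < b) (unrelay a b Z1 (c * (a * b) + (a * i + j)))%:R * y ^+ i =
   sb b y Z1 (c * (2 * a) + j)%N + y * sb b y Z1 (c * (2 * a) + (a + j))%N :> K)%R.
  move=> hj; have hZ' B : wbd (fun i => Z1 (B * b + i)) by move=> i; apply: hZ1.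
  rewrite {2}/sb -[X in (X * evb _ _ _)%R]expr1 -evb_shf // -evbD //.
  apply: eq_bigr => i _; congr (_%:R * _)%R; rewrite /unrelay.
  have hij : a * i + j < a * b.
    by apply: (@leq_trans (a * i.+1)); rewrite ?leq_mul2l ?ltn_ord ?orbT // mulnS; lia.
  have e1 : (c * (a * b) + (a * i + j)) %% (a * b) = a * i + j.
    by rewrite modnMDl (modn_small hij).
  have e2 : (c * (a * b) + (a * i + j)) %/ (a * b) = c.
    by rewrite divnMDl ?(divn_small hij) ?addn0 // muln_gt0 a0 b0.
  have e3 : (a * i + j) %/ a = i by rewrite mulnC divnMDl // (divn_small hj) addn0.
  have e4 : (a * i + j) %% a = j by rewrite mulnC modnMDl (modn_small hj).
  by rewrite e1 e2 e3 e4 -addnA.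
have -> : (\sum_(j < a) \sum_(i < b) (unrelay a b Z1 (c * (a * b) + (a * i + j)))%:R * z ^+ (a * i + j)
   = \sum_(j < a) (sb b y Z1 (c * (2 * a) + j)%N + y * sb b y Z1 (c * (2 * a) + (a + j))%N) * z ^+ j :> K)%R.
  apply: eq_bigr => j _; rewrite -eU // big_distrl /=; apply: eq_bigr => i _.
  by rewrite exprD exprM mulrA.
have hc2 j : j < 2 * a -> c * (2 * a) + j < R * 2 ^ D.
  by rewrite D2 => hj; apply: (@leq_trans (c.+1 * (2 * a))); rewrite ?leq_mul2r ?hc ?orbT // mulSn; lia.
rewrite D2 (big_ord_double a (fun j => G (c * (2 * a) + j)%N * z ^+ j)%R) big_distrr /=.
apply: eq_bigr => j _; have hj := ltn_ord j.
rewrite !hG ?hc2; try lia.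
rewrite exprD -/y; ring.
Qed.
End Level.
End Words.

(* The multiplication as a program *)
Declare Scope expr_scope.
Delimit Scope expr_scope with X.
Notation "a + b" := (Bin Add a b) : expr_scope.
Notation "a - b" := (Bin Sub a b) : expr_scope.
Notation "a * b" := (Bin Mul a b) : expr_scope.
Notation "a / b" := (Bin Div a b) : expr_scope.
Notation "a %% b" := (Bin Mod a b) : expr_scope.
Notation "a < b" := (Bin Lt a b) : expr_scope.
Notation "a == b" := (Bin Eq a b) : expr_scope.
Notation "! x" := (Var x) (at level 1, format "! x") : expr_scope.
Notation "# n" := (Cst n) (at level 1, format "# n") : expr_scope.
Notation "a $[ e ]" := (Arr a e) (at level 2, e at level 99) : expr_scope.
Notation "x ::= e" := (Asg x e%X) (at level 60, e at level 59).
Notation "'sto' a $[ i ] ::= e" := (Sto a i%X e%X)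
  (at level 60, a at level 0, i at level 99, e at level 59).
Notation "c1 ;; c2" := (Seq c1 c2) (at level 62, right associativity).
Notation "'for' x 'upto' e 'in' y {{ c }}" := (For x y e%X c)
  (at level 60, x at level 0, y at level 0, e at level 59).
Notation "'If' e {{ c1 }} 'Else' {{ c2 }}" := (If e%X c1 c2) (at level 60, e at level 59).

Notation cMU := 0 (only parsing). Notation cmu := 1 (only parsing).
Notation cR := 2 (only parsing). Notation cK := 3 (only parsing).
Notation cA := 4 (only parsing). Notation cB := 5 (only parsing).
Notation cD := 6 (only parsing). Notation cl := 7 (only parsing).
Notation cl' := 8 (only parsing). Notation cd := 9 (only parsing).
Notation cd' := 10 (only parsing). Notation cu := 11 (only parsing).
Notation cu' := 12 (only parsing). Notation ct := 13 (only parsing).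
Notation cq := 14 (only parsing). Notation cL := 15 (only parsing).
Notation cdv := 16 (only parsing). Notation ci := 17 (only parsing).
Notation ci' := 18 (only parsing). Notation clo := 19 (only parsing).
Notation chi := 20 (only parsing). Notation cx := 21 (only parsing).
Notation cy := 22 (only parsing). Notation ck := 23 (only parsing).
Notation ck' := 24 (only parsing). Notation cE := 25 (only parsing).
Notation cr := 26 (only parsing). Notation cS := 27 (only parsing).
Notation cj := 28 (only parsing).

Notation aP := 9 (only parsing). Notation aQ := 10 (only parsing).
Notation aT := 11 (only parsing). Notation aN := 12 (only parsing).

Definition c_copy := for ci upto !cB in ci' {{ sto aT$[!ci] ::= aP$[!chi + !ci] }}.

Definition c_bfly :=
  for ci upto !cB in ci' {{
    If !ci < !ct {{ cx ::= Wrap Sub #0 (aT$[!ci + !cB - !ct]) }}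
    Else {{ cx ::= aT$[!ci - !ct] }};;
    cy ::= aP$[!clo + !ci];;
    sto aP$[!clo + !ci] ::= Wrap Add !cy !cx;;
    sto aP$[!chi + !ci] ::= Wrap Sub !cy !cx }}.

Definition c_idiff :=
  for ci upto !cB in ci' {{
    cx ::= aP$[!clo + !ci];; cy ::= aP$[!chi + !ci];;
    sto aT$[!ci] ::= Wrap Sub !cx !cy;;
    sto aP$[!clo + !ci] ::= Wrap Add !cx !cy }}.

Definition c_ishift :=
  for ci upto !cB in ci' {{
    If !ci + !ct < !cB {{ cx ::= aT$[!ci + !ct] }}
    Else {{ cx ::= Wrap Sub #0 (aT$[!ci + !ct - !cB]) }};;
    sto aP$[!chi + !ci] ::= !cx }}.

(** Runs the recursion of [tw] from the leading bit of [q] downwards; [cE] holds [2 ^ d], from which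
    the divisors are obtained by halving. *)
Definition c_tw :=
  ct ::= #0;; cdv ::= !cE;;
  for ci upto !cd in ci' {{
    cdv ::= !cdv / #2;; ct ::= (!ct + (!cq / !cdv %% #2) * !cB) / #2 }}.

Definition c_pos :=
  cq ::= !cu / !cL;; clo ::= (!cq * (#2 * !cL) + !cu %% !cL) * !cB;;
  chi ::= !clo + !cL * !cB.

Definition c_stage :=
  for cu upto !cS in cu' {{ c_pos;; c_tw;; c_copy;; c_bfly }}.

Definition c_istage :=
  for cu upto !cS in cu' {{ c_pos;; c_tw;; c_idiff;; c_ishift }}.

(** Number of the butterfly in which block [B] takes part. After [u] rounds the loop over
    butterflies has updated exactly the blocks whose number is below [u]. *)
Definition bidx L B := B %/ (2 * L) * L + (B %% (2 * L)) %% L.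

Lemma bidx_inv L B u : 0 < L -> bidx L B = u ->
  B = u %/ L * (2 * L) + u %% L \/ B = u %/ L * (2 * L) + u %% L + L.
Proof.
move=> L0 <-; rewrite /bidx.
have hr : B %% (2 * L) < 2 * L by rewrite ltn_mod muln_gt0.
rewrite divnMDl // modnMDl (divn_small (ltn_pmod _ L0)) addn0 modn_mod.
have hB := divn_eq B (2 * L).
have [h|h] := ltnP (B %% (2 * L)) L.
  by left; rewrite modn_small.
right; have e : B %% (2 * L) = 1 * L + (B %% (2 * L) - L) by lia.
rewrite e modnMDl modn_small; lia.
Qed.

Lemma bidx_lo L u : 0 < L -> let B := u %/ L * (2 * L) + u %% L in
  [/\ B %/ (2 * L) = u %/ L, B %% (2 * L) = u %% L & bidx L B = u].
Proof.
move=> L0 /=; have hu : u %% L < L by rewrite ltn_mod.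
have hu2 : u %% L < 2 * L by lia.
have e1 : (u %/ L * (2 * L) + u %% L) %/ (2 * L) = u %/ L.
  by rewrite divnMDl ?muln_gt0 // (divn_small hu2) addn0.
have e2 : (u %/ L * (2 * L) + u %% L) %% (2 * L) = u %% L.
  by rewrite modnMDl modn_small.
by split=> //; rewrite /bidx e1 e2 modn_mod -divn_eq.
Qed.

Lemma bidx_hi L u : 0 < L -> let B := u %/ L * (2 * L) + u %% L + L in
  [/\ B %/ (2 * L) = u %/ L, B %% (2 * L) = u %% L + L & bidx L B = u].
Proof.
move=> L0 /=; have hu : u %% L < L by rewrite ltn_mod.
have hu2 : u %% L + L < 2 * L by lia.
rewrite -addnA.
have e1 : (u %/ L * (2 * L) + (u %% L + L)) %/ (2 * L) = u %/ L.
  by rewrite divnMDl ?muln_gt0 // (divn_small hu2) addn0.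
have e2 : (u %/ L * (2 * L) + (u %% L + L)) %% (2 * L) = u %% L + L.
  by rewrite modnMDl modn_small.
by split=> //; rewrite /bidx e1 e2 modnDr modn_mod -divn_eq.
Qed.

Lemma bidx_lt L B S : 0 < L -> L %| S -> (bidx L B < S) = (B < 2 * S).
Proof.
move=> L0 /dvdnP[k ->]; rewrite /bidx mulnCA -[in RHS]ltn_divLR ?muln_gt0 //.
have hr : (B %% (2 * L)) %% L < L by rewrite ltn_mod.
by move: (B %/ _) (_ %% L) hr => q r hr; apply/idP/idP => h; nia.
Qed.

Lemma shf_ext w b t f g i : t <= b -> i < b -> (forall i, i < b -> f i = g i) ->
  shf w b t f i = shf w b t g i.
Proof. by move=> tb hi h; rewrite /shf; case: ifP => hc; rewrite h //; lia. Qed.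

Lemma ishf_ext w b t f g i : t <= b -> i < b -> (forall i, i < b -> f i = g i) ->
  ishf w b t f i = ishf w b t g i.
Proof. by move=> tb hi h; rewrite /ishf; case: ifP => hc; rewrite h //; lia. Qed.

Lemma divn_blk b B k : 0 < b -> (B * b <= k < B * b + b) = (k %/ b == B).
Proof.
move=> b0; rewrite eqn_leq leq_divRL // -[k %/ b <= B]ltnS ltn_divLR // mulSn andbC.
by rewrite [b + _]addnC.
Qed.

Section Conv.
Variables (w : nat) (inp : nat -> nat) (ilim lim M : nat).
Local Notation W := (2 ^ w).
Local Notation triple := (triple w inp ilim lim).
Local Notation wbd := (wbd w).
Hypotheses (M2 : 100 < M) (MW : M ^ 12 < W) (Mlim : M ^ 5 < lim).

Let M1 : 1 < M. Proof. exact: ltn_trans M2. Qed.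
Lemma M_W x : x <= M -> x < W.
Proof.
move=> h; apply: leq_ltn_trans MW; apply: leq_trans h _.
by rewrite -{1}(expn1 M) leq_exp2l.
Qed.
Lemma M_lim x : x <= M -> x < lim.
Proof.
move=> h; apply: leq_ltn_trans Mlim; apply: leq_trans h _.
by rewrite -{1}(expn1 M) leq_exp2l.
Qed.

Ltac okt := apply: (okd_ok M1 MW Mlim) => //=; try lia.

Lemma c_copy_ok s b hi : rg s cB = b -> rg s chi = hi -> hi + b <= M ->
  triple c_copy s (2 * b + 2)
   (fun s' => forall k, ar s' aT k = if k < b then ar s aP (hi + k) else ar s aT k).
Proof.
move=> hb hhi hM.
apply: (@t_for _ _ _ _ _ _ _ _ _ b (fun=> 1) _
  (fun j s1 => forall k, ar s1 aT k = if k < j then ar s aP (hi + k) else ar s aT k)).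
- okt.
- by [].
- by apply: M_W; lia.
- by [].
- move=> j s1 hj hI fr fa; have /= f1 := fr cB isT; have /= f2 := fr chi isT.
  apply: t_sto1 => //; first okt.
  + by apply: M_lim => /=; lia.
  + move=> k /=; rewrite f2 hhi hI ltnS [k <= j]leq_eqVlt (fa aP isT).
    by case: eqP => [->|_].
- by rewrite sum_nat_const card_ord; lia.
- by [].
Qed.

Ltac dcase := repeat match goal with
  |- context [if ?c then _ else _] => let H := fresh "E" in case H : c end.

Definition bf b t lo hi (T P : nat -> nat) k :=
  if lo <= k < lo + b then addw w (P k) (shf w b t T (k - lo))
  else if hi <= k < hi + b then subw w (P (k - hi + lo)) (shf w b t T (k - hi))
  else P k.

Lemma c_bfly_ok s b t lo hi : rg s cB = b -> rg s ct = t -> rg s clo = lo ->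
  rg s chi = hi -> t <= b -> lo + b <= hi -> hi + b <= M ->
  triple c_bfly s (6 * b + 2) (fun s' => ar s' aP =1 bf b t lo hi (ar s aT) (ar s aP)).
Proof.
move=> hb ht hlo hhi tb lh hM; set P := ar s aP; set T := ar s aT.
apply: (@t_for _ _ _ _ _ _ _ _ _ b (fun=> 5) _ (fun j s1 => forall k, ar s1 aP k =
   if (lo <= k < lo + j) || (hi <= k < hi + j) then bf b t lo hi T P k else P k)).
- okt.
- by [].
- by apply: M_W; lia.
- by move=> k /=; rewrite !addn0; dcase => //; lia.
- move=> j s1 hj hI fr fa; have /= f1 := fr cB isT; have /= f2 := fr chi isT.
  have /= f3 := fr ct isT; have /= f4 := fr clo isT; have aT1 := fa aT isT.
  apply: (@t_seq _ _ _ _ _ _ _ 2 3 _ _ (fun s2 => rg s2 cx = shf w b t T j)) => //.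
    apply: t_if; first okt.
    + rewrite /= f3 ht /shf => h; apply: t_asg1 => //; first okt.
      by rewrite /= f1 f3 ht hb (_ : j < t) ?aT1 //; lia.
    + rewrite /= f3 ht /shf => h; apply: t_asg1 => //; first okt.
      by rewrite /= f3 ht (_ : (j < t) = false) ?aT1 //; lia.
  move=> s2 h2 fr2 fa2; have /= g2 := fr2 chi isT; have /= g4 := fr2 clo isT.
  have /= g5 := fr2 ci isT; have /= a2 := fa2 aP isT.
  apply: t_asg; first okt.
  apply: t_sto; first okt; first okt.
    by apply: M_lim => /=; lia.
  apply: t_sto1; [okt|okt| |by []|].
    by apply: M_lim => /=; lia.
  move=> k /=; rewrite !g2 !g4 !g5 !h2 f2 f4 hhi hlo a2 !hI.
  have e1 : (lo <= lo + j < lo + j) || (hi <= lo + j < hi + j) = false by lia.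
  rewrite e1; case: (eqVneq k (hi + j)) => [->|k1] /=.
    have -> : (lo <= hi + j < lo + j.+1) || (hi <= hi + j < hi + j.+1) by lia.
    rewrite /bf (_ : (lo <= hi + j < lo + b) = false); last by lia.
    rewrite (_ : hi <= hi + j < hi + b); last by lia.
    by rewrite addKn [j + lo]addnC.
  case: (eqVneq k (lo + j)) => [->|k2] /=.
    have -> : (lo <= lo + j < lo + j.+1) || (hi <= lo + j < hi + j.+1) by lia.
    rewrite /bf (_ : lo <= lo + j < lo + b); last by lia.
    by rewrite addKn.
  by congr (if _ then _ else _); lia.
- by rewrite sum_nat_const card_ord; lia.
- move=> s1 hI _ _ k /=; rewrite hI; case: ifP => // h.
  by rewrite /bf; dcase => //; lia.
Qed.

Lemma c_idiff_ok s b lo hi : rg s cB = b -> rg s clo = lo ->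
  rg s chi = hi -> lo + b <= hi -> hi + b <= M ->
  triple c_idiff s (5 * b + 2) (fun s' =>
    (forall k, k < b -> ar s' aT k = subw w (ar s aP (lo + k)) (ar s aP (hi + k))) /\
    (forall k, ar s' aP k = if lo <= k < lo + b
       then addw w (ar s aP k) (ar s aP (k - lo + hi)) else ar s aP k)).
Proof.
move=> hb hlo hhi lh hM; set P := ar s aP.
apply: (@t_for _ _ _ _ _ _ _ _ _ b (fun=> 4) _ (fun j s1 =>
  (forall k, k < j -> ar s1 aT k = subw w (P (lo + k)) (P (hi + k))) /\
  (forall k, ar s1 aP k = if lo <= k < lo + j
       then addw w (P k) (P (k - lo + hi)) else P k))).
- okt.
- by [].
- by apply: M_W; lia.
- by split=> // k /=; rewrite addn0; dcase => //; lia.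
- move=> j s1 hj [hT hP] fr fa; have /= f2 := fr chi isT; have /= f4 := fr clo isT.
  apply: t_asg; first okt.
  apply: t_asg; first okt.
  apply: t_sto; [okt|okt| |].
    by apply: M_lim => /=; lia.
  apply: t_sto1; [okt|okt| |by []|].
    by apply: M_lim => /=; lia.
  rewrite /= f2 f4 hlo hhi !hP.
  have -> : (lo <= lo + j < lo + j) = false by lia.
  have -> : (lo <= hi + j < lo + j) = false by lia.
  split=> k /=.
    by rewrite ltnS leq_eqVlt; case: eqP => [->//|_] /=; apply: hT.
  rewrite hP; case: eqP => [->|k1].
    by rewrite leq_addr addnS ltnSn /= addKn [j + hi]addnC.
  by congr (if _ then _ else _); lia.
- by rewrite sum_nat_const card_ord; lia.
- by [].
Qed.

Lemma c_ishift_ok s b t hi : rg s cB = b -> rg s ct = t -> rg s chi = hi ->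
  t <= b -> hi + b <= M ->
  triple c_ishift s (4 * b + 2) (fun s' => forall k, ar s' aP k =
     if hi <= k < hi + b then ishf w b t (ar s aT) (k - hi) else ar s aP k).
Proof.
move=> hb ht hhi tb hM; set P := ar s aP; set T := ar s aT.
apply: (@t_for _ _ _ _ _ _ _ _ _ b (fun=> 3) _ (fun j s1 => forall k, ar s1 aP k =
     if hi <= k < hi + j then ishf w b t T (k - hi) else P k)).
- okt.
- by [].
- by apply: M_W; lia.
- by move=> k /=; rewrite addn0; dcase => //; lia.
- move=> j s1 hj hP fr fa; have /= f1 := fr cB isT; have /= f2 := fr chi isT.
  have /= f3 := fr ct isT; have aT1 := fa aT isT.
  apply: (@t_seq _ _ _ _ _ _ _ 2 1 _ _ (fun s2 => rg s2 cx = ishf w b t T j)) => //.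
    apply: t_if; first okt.
    + rewrite /= f1 f3 ht hb /ishf => h; apply: t_asg1 => //; first okt.
      by rewrite /= f3 ht (_ : j + t < b) ?aT1 //; lia.
    + rewrite /= f1 f3 ht hb /ishf => h; apply: t_asg1 => //; first okt.
      by rewrite /= f1 f3 hb ht (_ : (j + t < b) = false) ?aT1 //; lia.
  move=> s2 h2 fr2 fa2; have /= g2 := fr2 chi isT; have /= g5 := fr2 ci isT.
  apply: t_sto1; [okt|okt| |by []|].
    by apply: M_lim => /=; lia.
  move=> k /=; rewrite g2 g5 f2 hhi h2 (fa2 aP isT) /= hP.
  case: eqP => [->|k1].
    by rewrite leq_addr addnS ltnSn /= addKn.
  by congr (if _ then _ else _); lia.
- by rewrite sum_nat_const card_ord; lia.
- by [].
Qed.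

Lemma c_tw_ok s b d q : rg s cB = b -> rg s cd = d -> rg s cq = q ->
  rg s cE = 2 ^ d -> 0 < b -> b <= M -> q <= M -> 2 ^ d <= M ->
  triple c_tw s (3 * d + 4) (fun s' => rg s' ct = tw b d q).
Proof.
move=> hb hd hq hE b0 bM qM dM.
have dM' : d <= M by apply: leq_trans dM; apply: ltnW; apply: ltn_expl.
rewrite addnC; apply: t_asg; first okt.
apply: t_asg; first okt.
apply: (@t_for _ _ _ _ _ _ _ _ _ d (fun=> 2) _ (fun j s1 =>
   rg s1 cdv = 2 ^ (d - j) /\ rg s1 ct = tw b j (q %/ 2 ^ (d - j)))).
- okt.
- by [].
- by apply: M_W; lia.
- by rewrite /= subn0; split.
- move=> j s1 hj [h1 h2] fr fa.
  have /= f1 := fr cB isT; have /= f2 := fr cq isT.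
  have e1 : 2 ^ (d - j) = 2 ^ (d - j.+1) * 2 by rewrite -expnSr; congr (_ ^ _); lia.
  have l1 : 2 ^ (d - j) <= M by apply: leq_trans dM; rewrite leq_exp2l //; lia.
  have l2 := tw_lt j (q %/ 2 ^ (d - j)) b0.
  apply: t_asg; first okt.
  apply: t_asg1 => //; first okt.
  rewrite /= f1 f2 h1 h2 e1 mulnK // hb hq; split=> //.
  by rewrite divnMA mulnC.
- by rewrite sum_nat_const card_ord; lia.
- by move=> s1 [_ h] _ _; rewrite /= h subnn divn1.
Qed.

Section Stage.
Variables (b d L S : nat).
Hypotheses (b0 : 0 < b) (L0 : 0 < L) (LS : L %| S) (SM : 2 * S * b <= M)
  (dM : 2 ^ d <= M).

Definition hypos s := [/\ rg s cB = b, rg s cd = d, rg s cL = L, rg s cE = 2 ^ d & rg s cS = S].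

Lemma c_pos_ok s u T Q c : hypos s -> rg s cu = u -> u < S ->
  (forall s1, hypos s1 -> rg s1 cq = u %/ L -> rg s1 cu = u ->
     rg s1 clo = (u %/ L * (2 * L) + u %% L) * b ->
     rg s1 chi = (u %/ L * (2 * L) + u %% L + L) * b -> ar s1 = ar s ->
     triple c s1 T Q) ->
  triple (Seq c_pos c) s (3 + T) Q.
Proof.
move=> [h1 h2 h3 h4 h5] hu uS H.
have SM' : 2 * S <= M by apply: leq_trans SM; rewrite leq_pmulr.
have LM : 2 * L <= M.
  by apply: leq_trans SM'; rewrite leq_mul2l dvdn_leq //; lia.
have uM : u <= M by lia.
have hb : b <= M by apply: leq_trans SM; rewrite leq_pmull //; lia.
have [_ _ hlt] := bidx_hi u L0.
have hB : u %/ L * (2 * L) + u %% L + L < 2 * S by rewrite -(bidx_lt _ L0 LS) hlt.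
have hBb : (u %/ L * (2 * L) + u %% L + L) * b <= M.
  by apply: leq_trans SM; rewrite leq_mul2r ltnW ?orbT.
have uL : u %/ L <= M by apply: leq_trans uM; apply: leq_div.
have uL' : u %% L <= M by apply: leq_trans uM; apply: leq_mod.
apply: (@t_seq _ _ _ _ _ _ _ 3 T _ _ (fun s1 => [/\ hypos s1, rg s1 cq = u %/ L,
  rg s1 clo = (u %/ L * (2 * L) + u %% L) * b &
  rg s1 chi = (u %/ L * (2 * L) + u %% L + L) * b])) => //.
  apply: t_asg; first okt.
  apply: t_asg; first by okt; rewrite hu h3; lia.
  apply: t_asg1 => //; first by okt; rewrite hu h3 h1; move: hBb; rewrite mulnDl; lia.
  by split; rewrite /= ?hu ?h3 ?h1 ?mulnDl.
move=> s1 [k1 k2 k3 k4] fr fa; apply: H => //; first by rewrite fr.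
by apply: funext => a; rewrite fa.
Qed.

Lemma c_stage_ok s : hypos s ->
  triple c_stage s (S * (8 * b + 3 * d + 12) + 2) (fun s' => forall k, ar s' aP k =
     if k < 2 * S * b then stg w b L (tw b d) (ar s aP) k else ar s aP k).
Proof.
move=> hs; set P := ar s aP; have [hB hd hL hE hS] := hs.
have SM' : 2 * S <= M by apply: leq_trans SM; rewrite leq_pmulr.
have hbM : b <= M \/ S = 0 by nia.
apply: (@t_for _ _ _ _ _ _ _ _ _ S (fun=> 8 * b + 3 * d + 11) _ (fun u s1 =>
   forall k, ar s1 aP k = if bidx L (k %/ b) < u then stg w b L (tw b d) P k else P k)).
- okt.
- by [].
- by apply: M_W; lia.
- by [].
- move=> u s1 hu hI fr fa.
  have bM : b <= M by lia.
  have hs1 : hypos (setr s1 cu u) by split; rewrite /= ?(fr cB isT) ?(fr cd isT)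
     ?(fr cL isT) ?(fr cE isT) ?(fr cS isT).
  have -> : 8 * b + 3 * d + 11 = 3 + (8 * b + 3 * d + 8) by lia.
  apply: (c_pos_ok hs1 (u := u)) => // s2 hs2 eq2 eu2 elo2 ehi2 ea2.
  have [kB kd kL kE kS] := hs2.
  have [_ _ hlt] := bidx_hi u L0.
  set Blo := u %/ L * (2 * L) + u %% L in elo2 ehi2 hlt.
  have hBhi : Blo + L < 2 * S by rewrite -(bidx_lt _ L0 LS) hlt.
  have hiM : (Blo + L) * b + b <= M.
    by apply: leq_trans SM; rewrite -mulSnr leq_mul2r hBhi orbT.
  have uM : u %/ L <= M by apply: (leq_trans (leq_div _ _)); lia.
  have lh : Blo * b + b <= (Blo + L) * b by rewrite -mulSnr leq_mul2r; lia.
  have tb : tw b d (u %/ L) <= b by apply: ltnW; apply: tw_lt.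
  apply: (t_seq (c_tw_ok kB kd eq2 kE b0 bM uM dM) (T2 := 8 * b + 4)); first by lia.
  move=> s3 h3 fr3 fa3.
  apply: (t_seq (c_copy_ok (b := b) (hi := (Blo + L) * b) _ _ _) (T2 := 6 * b + 2)).
  + by rewrite fr3.
  + by rewrite fr3.
  + by [].
  + by lia.
  move=> s4 h4 fr4 fa4.
  have gB : rg s4 cB = b by rewrite fr4 // fr3.
  have gt : rg s4 ct = tw b d (u %/ L) by rewrite fr4.
  have glo : rg s4 clo = Blo * b by rewrite fr4 // fr3.
  have ghi : rg s4 chi = (Blo + L) * b by rewrite fr4 // fr3.
  apply: t_weak (c_bfly_ok gB gt glo ghi tb lh hiM) (leqnn _) _.
  move=> s5 h5 k; rewrite h5.
  have eP k' : ar s4 aP k' = ar s1 aP k' by rewrite fa4 // fa3 // ea2.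
  have eT i : i < b -> ar s4 aT i = P ((Blo + L) * b + i).
    move=> hi; rewrite h4 hi fa3 // ea2 /= hI.
    rewrite (_ : (_ + i) %/ b = Blo + L); last by rewrite divnMDl // divn_small ?addn0.
    by rewrite hlt (ltnn u).
  have [q1 q2 q3] := bidx_lo u L0; have [q4 q5 q6] := bidx_hi u L0.
  rewrite -/Blo in q1 q2 q3 q4 q5 q6.
  have hk := divn_eq k b; have hkm : k %% b < b by rewrite ltn_mod.
  rewrite /bf !divn_blk // !eP !hI.
  case: (eqVneq (k %/ b) Blo) => [e1|n1].
    have hj : u %% L < L by rewrite ltn_mod.
    rewrite e1 q3 (ltnn u) (ltnSn u) /stg e1 q1 q2 hj.
    have -> : k - Blo * b = k %% b by rewrite {1}hk e1 addKn.
    by congr (addw _ _ _); apply: shf_ext.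
  case: (eqVneq (k %/ b) (Blo + L)) => [e1|n2].
    have hj : (u %% L + L < L) = false by lia.
    rewrite e1 q6 (ltnSn u) /stg e1 q4 q5 hj.
    have -> : k - (Blo + L) * b = k %% b by rewrite {1}hk e1 addKn.
    rewrite (_ : (k %% b + Blo * b) %/ b = Blo); last first.
      by rewrite addnC divnMDl // (divn_small hkm) addn0.
    rewrite q3 (ltnn u) addnK [k %% b + _]addnC; congr (subw _ _ _).
    by apply: shf_ext.
  have n3 : bidx L (k %/ b) != u.
    by apply/eqP => /(bidx_inv L0); rewrite -/Blo => -[]; apply/eqP.
  by rewrite ltnS [bidx _ _ <= u]leq_eqVlt (negbTE n3).
- rewrite sum_nat_const card_ord; lia.
- move=> s1 hI _ _ k /=; rewrite hI bidx_lt // ltn_divLR //.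
Qed.

Lemma c_istage_ok s : hypos s ->
  triple c_istage s (S * (9 * b + 3 * d + 12) + 2) (fun s' => forall k, ar s' aP k =
     if k < 2 * S * b then istg w b L (tw b d) (ar s aP) k else ar s aP k).
Proof.
move=> hs; set P := ar s aP; have [hB hd hL hE hS] := hs.
have SM' : 2 * S <= M by apply: leq_trans SM; rewrite leq_pmulr.
have hbM : b <= M \/ S = 0 by nia.
apply: (@t_for _ _ _ _ _ _ _ _ _ S (fun=> 9 * b + 3 * d + 11) _ (fun u s1 =>
   forall k, ar s1 aP k = if bidx L (k %/ b) < u then istg w b L (tw b d) P k else P k)).
- okt.
- by [].
- by apply: M_W; lia.
- by [].
- move=> u s1 hu hI fr fa.
  have bM : b <= M by lia.
  have hs1 : hypos (setr s1 cu u) by split; rewrite /= ?(fr cB isT) ?(fr cd isT)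
     ?(fr cL isT) ?(fr cE isT) ?(fr cS isT).
  have -> : 9 * b + 3 * d + 11 = 3 + (9 * b + 3 * d + 8) by lia.
  apply: (c_pos_ok hs1 (u := u)) => // s2 hs2 eq2 eu2 elo2 ehi2 ea2.
  have [kB kd kL kE kS] := hs2.
  have [_ _ hlt] := bidx_hi u L0.
  set Blo := u %/ L * (2 * L) + u %% L in elo2 ehi2 hlt.
  have hBhi : Blo + L < 2 * S by rewrite -(bidx_lt _ L0 LS) hlt.
  have hiM : (Blo + L) * b + b <= M.
    by apply: leq_trans SM; rewrite -mulSnr leq_mul2r hBhi orbT.
  have uM : u %/ L <= M by apply: (leq_trans (leq_div _ _)); lia.
  have lh : Blo * b + b <= (Blo + L) * b by rewrite -mulSnr leq_mul2r; lia.
  have tb : tw b d (u %/ L) <= b by apply: ltnW; apply: tw_lt.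
  apply: (t_seq (c_tw_ok kB kd eq2 kE b0 bM uM dM) (T2 := 9 * b + 4)); first by lia.
  move=> s3 h3 fr3 fa3.
  apply: (t_seq (c_idiff_ok (b := b) (lo := Blo * b) (hi := (Blo + L) * b) _ _ _ lh hiM)
           (T2 := 4 * b + 2)); rewrite ?fr3 //; first by lia.
  move=> s4 [h4 h4'] fr4 fa4.
  have gB : rg s4 cB = b by rewrite fr4 // fr3.
  have gt : rg s4 ct = tw b d (u %/ L) by rewrite fr4.
  have ghi : rg s4 chi = (Blo + L) * b by rewrite fr4 // fr3.
  apply: t_weak (c_ishift_ok gB gt ghi tb hiM) (leqnn _) _.
  move=> s5 h5 k; rewrite h5.
  have [q1 q2 q3] := bidx_lo u L0; have [q4 q5 q6] := bidx_hi u L0.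
  rewrite -/Blo in q1 q2 q3 q4 q5 q6.
  have hdv B i : i < b -> (B * b + i) %/ b = B.
    by move=> hi; rewrite divnMDl // (divn_small hi) addn0.
  have eT i : i < b -> ar s4 aT i = subw w (P (Blo * b + i)) (P ((Blo + L) * b + i)).
    move=> hi; rewrite h4 // fa3 // ea2 /= !hI !hdv //.
    by rewrite q3 q6 (ltnn u).
  have hk := divn_eq k b; have hkm : k %% b < b by rewrite ltn_mod.
  rewrite h4' !divn_blk // !fa3 // !ea2 /= !hI.
  case: (eqVneq (k %/ b) (Blo + L)) => [e1|n2].
    have hj : (u %% L + L < L) = false by lia.
    rewrite e1 q6 (ltnSn u) /istg e1 q4 q5 hj.
    have -> : k - (Blo + L) * b = k %% b by rewrite {1}hk e1 addKn.
    by rewrite addnK; apply: ishf_ext.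
  case: (eqVneq (k %/ b) Blo) => [e1|n1].
    have -> : k - Blo * b + (Blo + L) * b = (Blo + L) * b + k %% b.
      by rewrite {1}hk e1 addKn addnC.
    have hj : u %% L < L by rewrite ltn_mod.
    by rewrite (hdv _ _ hkm) e1 q3 q6 (ltnn u) (ltnSn u) /istg e1 q1 q2 hj.
  have n3 : bidx L (k %/ b) != u.
    by apply/eqP => /(bidx_inv L0); rewrite -/Blo => -[]; apply/eqP.
  by rewrite ltnS [bidx _ _ <= u]leq_eqVlt (negbTE n3).
- rewrite sum_nat_const card_ord; lia.
- move=> s1 hI _ _ k /=; rewrite hI bidx_lt // ltn_divLR //.
Qed.
End Stage.
End Conv.

Definition c_pow x y := x ::= #1;; for ci upto !y in ci' {{ x ::= !x * #2 }}.

Definition c_par :=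
  cx ::= !cmu / #2 + #1;; cD ::= !cmu - !cmu / #2 + #1;; cy ::= !cD - #1;;
  c_pow cB cx;; c_pow cA cy.

Definition c_relay :=
  for ck upto !cR * (#2 * (#2 * !cA * !cB)) in ck' {{
    cr ::= !ck %% (#2 * !cA * !cB);;
    If !cr / !cB < !cA
    {{ sto aQ$[!ck] ::= aP$[!ck / (#2 * !cA * !cB) * (!cA * !cB)
                            + (!cA * (!cr %% !cB) + !cr / !cB)] }}
    Else {{ sto aQ$[!ck] ::= #0 }} }};;
  for ck upto !cR * (#2 * (#2 * !cA * !cB)) in ck' {{ sto aP$[!ck] ::= aQ$[!ck] }}.

Definition c_unrelay :=
  for ck upto !cR * (!cA * !cB) in ck' {{
    cr ::= !ck %% (!cA * !cB);;
    ci ::= !cr / !cA;;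
    cq ::= !ck / (!cA * !cB) * (#2 * !cA) + !cr %% !cA;;
    cx ::= aP$[!cq * !cB + !ci];;
    cj ::= (!cq + !cA) * !cB;;
    If !ci < #1
    {{ cy ::= Wrap Sub #0 (aP$[!cj + (!ci + !cB - #1)]) }}
    Else {{ cy ::= aP$[!cj + (!ci - #1)] }};;
    sto aQ$[!ck] ::= Wrap Add !cx !cy }};;
  for ck upto !cR * (!cA * !cB) in ck' {{ sto aP$[!ck] ::= aQ$[!ck] }}.

Definition c_base :=
  for ck upto !cR in ck' {{
    cx ::= aP$[#2 * !ck];; cy ::= aP$[#2 * !ck + #1];;
    clo ::= aP$[#2 * !cR + #2 * !ck];; chi ::= aP$[#2 * !cR + #2 * !ck + #1];;
    sto aP$[#2 * !ck] ::= Wrap Sub (Wrap Mul !cx !clo) (Wrap Mul !cy !chi);;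
    sto aP$[#2 * !ck + #1] ::= Wrap Add (Wrap Mul !cx !chi) (Wrap Mul !cy !clo) }}.

Ltac okd_tac M1 MW Mlim := apply: (okd_ok M1 MW Mlim) => //=; try lia.

Ltac splitb := repeat match goal with |- is_true (_ && _) => apply/andP; split end.
Ltac oks_tac M1 MW Mlim := apply: (okd_ok M1 MW Mlim) => //=; splitb => //.

(** Balanced split of the length [2 ^ mu.+1] into [mA mu * mB mu]. The transform length
    [2 * mA mu = 2 ^ mD mu] is at most [2 * mB mu], the order of the available root, and the
    subproblems have parameter [mu %/ 2]. *)
Definition mB mu := 2 ^ (mu %/ 2).+1.
Definition mD mu := (mu - mu %/ 2).+1.
Definition mA mu := 2 ^ (mD mu).-1.

Lemma mAB mu : mA mu * mB mu = 2 ^ mu.+1.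
Proof. by rewrite /mA /mB -expnD /=; congr (_ ^ _); have := leq_div mu 2; lia. Qed.
Lemma mA_gt0 mu : 0 < mA mu. Proof. by rewrite expn_gt0. Qed.
Lemma mB_gt0 mu : 0 < mB mu. Proof. by rewrite expn_gt0. Qed.
Lemma mA2 mu : 2 * mA mu = 2 ^ mD mu.
Proof. by rewrite /mA -expnS. Qed.
Section Conv2.
Variables (w : nat) (inp : nat -> nat) (ilim lim M : nat).
Local Notation W := (2 ^ w).
Local Notation triple := (triple w inp ilim lim).
Local Notation wbd := (wbd w).
Hypotheses (M2 : 100 < M) (MW : M ^ 12 < W) (Mlim : M ^ 5 < lim).
Let M1 : 1 < M. Proof. exact: ltn_trans M2. Qed.
Local Notation M_W := (M_W M2 MW).
Local Notation M_lim := (M_lim M2 Mlim).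
Ltac okt := okd_tac M1 MW Mlim.
Ltac oks := oks_tac M1 MW Mlim.

Lemma c_pow_ok x y s n : x \notin [:: ci; ci'] -> y \notin [:: x; ci; ci'] ->
  rg s y = n -> n <= M -> 2 ^ n <= M ->
  triple (c_pow x y) s (2 * n + 3) (fun s' => rg s' x = 2 ^ n).
Proof.
rewrite !inE !negb_or => /andP[x1 x2] /and3P[y1 y2 y3] hy nM nM'.
rewrite addnS; apply: t_asg; first by okt.
apply: (@t_for _ _ _ _ _ _ _ _ _ n (fun=> 1) _ (fun j s1 => rg s1 x = 2 ^ j)) => //=.
- by rewrite (negbTE y1).
- by apply: M_W.
- by rewrite (negbTE x2) eqxx.
- move=> j s1 hj h1 fr fa; apply: t_asg1 => //.
    have h : 2 ^ j <= M by apply: leq_trans nM'; rewrite leq_exp2l // ltnW.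
    by okt; rewrite (negbTE x1) h1; lia.
  by rewrite /= eqxx (negbTE x1) h1 mulnC expnS.
- by rewrite sum_nat_const card_ord; lia.
- by move=> s1 h _ _; rewrite (negbTE x1).
Qed.

Lemma c_par_ok s mu : rg s cmu = mu -> 2 ^ mu.+1 <= M ->
  triple c_par s (2 * mu + 12) (fun s' =>
    [/\ rg s' cB = mB mu, rg s' cA = mA mu & rg s' cD = mD mu]).
Proof.
move=> hmu hM; have l1 := leq_div mu 2.
have muM : mu.+1 <= M by apply: leq_trans hM; apply: ltnW; apply: ltn_expl.
have -> : 2 * mu + 12 = (2 * mu + 9).+3 by lia.
apply: t_asg; first okt.
apply: t_asg; first okt.
apply: t_asg; first okt.
apply: (t_seq (c_pow_ok (x := cB) (y := cx) (n := (mu %/ 2).+1) _ _ _ _ _)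
   (T2 := 2 * (mu - mu %/ 2) + 3)) => //=; try lia.
  by apply: leq_trans hM; rewrite leq_exp2l //; lia.
move=> s1 h1 fr fa.
apply: t_weak (t_frame (c_pow_ok (x := cA) (y := cy) (n := mu - mu %/ 2) (s := s1) _ _ _ _ _)) _ _ => //.
- by rewrite fr //= hmu addnK.
- by lia.
- by apply: leq_trans hM; rewrite leq_exp2l //; lia.
move=> s2 [h2 fr2 fa2]; split=> //; first by rewrite fr2.
by rewrite fr2 // fr //= hmu addn1.
Qed.

(** Programs compute the transforms on a prefix of the array only, while [fwdP] and [invP] are
    functions on all indices; program and function are compared on that prefix. *)
Definition agree T (f g : nat -> nat) := forall k, k < T -> f k = g k.

Lemma c_relay_ok s R mu : 0 < R -> rg s cR = R -> rg s cA = mA mu -> rg s cB = mB mu ->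
  R * (2 * (2 * 2 ^ mu.+1)) <= M ->
  triple c_relay s (6 * (R * (2 * (2 * 2 ^ mu.+1))) + 4) (fun s' =>
   agree (R * (2 * (2 * 2 ^ mu.+1))) (ar s' aP) (relay (mA mu) (mB mu) (ar s aP)) /\
   (forall k, R * (2 * (2 * 2 ^ mu.+1)) <= k -> ar s' aP k = ar s aP k)).
Proof.
move=> R0 hR hA hB hM; rewrite -mAB in hM *.
set a := mA mu in hA hM *; set b := mB mu in hB hM *; set N := R * _ in hM *.
have a0 : 0 < a by apply: mA_gt0.
have b0 : 0 < b by apply: mB_gt0.
have eN : R * (2 * (2 * a * b)) = N by rewrite /N; ring.
have h1 : R <= N by rewrite /N leq_pmulr // !muln_gt0 a0 b0.
have h2 : 2 * a * b <= N by rewrite -eN mulnCA mulnA leq_pmull // muln_gt0.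
have h3 : a * b <= N by apply: leq_trans h2; rewrite -mulnA leq_pmull.
have h4 : 2 * a <= N by apply: leq_trans h2; rewrite leq_pmulr.
have h5 : b <= N by apply: leq_trans h3; rewrite leq_pmull.
have h6 : a <= N by lia.
have hE s' : rg s' cR = R -> rg s' cA = a -> rg s' cB = b -> 
  okE w inp ilim lim (!cR * (#2 * (#2 * !cA * !cB)))%X s' /\
  eval w inp (!cR * (#2 * (#2 * !cA * !cB)))%X s' = N.
  by move=> e1 e2 e3; split; [okt|rewrite /= e1 e2 e3].
have [o1 o2] := hE s hR hA hB.
apply: (@t_seq _ _ _ _ _ _ _ (N * 4 + 2) (N * 2 + 2) _ _ (fun s1 =>
  forall k, k < N -> ar s1 aQ k = relay a b (ar s aP) k)); last 2 first.
- by lia.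
- move=> s1 hI fr fa.
  have [||| o3 o4] := hE s1; rewrite ?fr //.
  apply: (@t_for _ _ _ _ _ _ _ _ _ N (fun=> 1) _ (fun j s2 => forall k,
     ar s2 aP k = if k < j then relay a b (ar s aP) k else ar s aP k)) => //.
  + by apply: M_W.
  + by move=> k /=; rewrite fa.
  + move=> j s2 hj h7 fr2 fa2; apply: t_sto1 => //; first okt.
      by apply: M_lim => /=; lia.
    move=> k /=; rewrite h7 (fa2 aQ isT) hI // ltnS [k <= j]leq_eqVlt.
    by case: eqP => [->|].
  + by rewrite sum_nat_const card_ord; lia.
  + move=> s2 h7 _ _; split=> k hk /=; rewrite h7 ?hk //.
    by rewrite ltnNge hk.
apply: (@t_for _ _ _ _ _ _ _ _ _ N (fun=> 3) _ (fun j s1 => forall k, k < j ->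
     ar s1 aQ k = relay a b (ar s aP) k)) => //.
- by apply: M_W.
- move=> j s1 hj hI fr fa; have /= f1 := fr cR isT; have /= f2 := fr cA isT.
  have /= f3 := fr cB isT; rewrite ?hR ?hA ?hB in f1 f2 f3.
  have jM : j <= M by apply: ltnW; apply: leq_trans hM.
  have jm : j %% (2 * a * b) <= M by apply: leq_trans jM; apply: leq_mod.
  have aM := leq_trans h6 hM; have bM := leq_trans h5 hM.
  have c2 : 2 <= M by exact: M1.
  apply: t_asg; first by oks; rewrite ?f2 ?f3.
  apply: t_if; first by oks; rewrite ?f2 ?f3.
  + move=> /= h; apply: t_sto1 => //.
    * by oks; rewrite ?f2 ?f3.
    * by apply: M_lim.
    move=> k /= hk; rewrite f2 f3 fa //.
    case: eqP => [->|/eqP kj]; last by apply: hI; lia.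
    rewrite /relay; move: h; rewrite f2 f3.
    by case: ifP.
  + move=> /= h; apply: t_sto1 => //; first by oks.
      by apply: M_lim.
    move=> k /= hk.
    case: eqP => [->|/eqP kj]; last by apply: hI; lia.
    rewrite /relay; move: h; rewrite f2 f3.
    by case: ifP.
- by rewrite sum_nat_const card_ord; lia.
Qed.

Lemma c_unrelay_ok s R mu : 0 < R -> rg s cR = R -> rg s cA = mA mu -> rg s cB = mB mu ->
  R * (2 * (2 * 2 ^ mu.+1)) <= M ->
  triple c_unrelay s (11 * (R * 2 ^ mu.+1) + 4) (fun s' =>
   agree (R * 2 ^ mu.+1) (ar s' aP) (unrelay w (mA mu) (mB mu) (ar s aP)) /\
   (forall k, R * 2 ^ mu.+1 <= k -> ar s' aP k = ar s aP k)).
Proof.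
move=> R0 hR hA hB hM; rewrite -mAB in hM *.
set a := mA mu in hA hM *; set b := mB mu in hB hM *; set N := R * (a * b).
have a0 : 0 < a by apply: mA_gt0.
have b0 : 0 < b by apply: mB_gt0.
have hM4 : 4 * N <= M by apply: leq_trans hM; rewrite /N; lia.
have h1 : R <= N by rewrite /N leq_pmulr // muln_gt0 a0 b0.
have h3 : a * b <= N by rewrite /N leq_pmull.
have h5 : b <= N by apply: leq_trans h3; rewrite leq_pmull.
have h6 : a <= N by apply: leq_trans h3; rewrite leq_pmulr.
have c2 : 2 <= M by exact: M1.
have c1 : 1 <= M by exact: ltnW M1.
have [RM NM] : R <= M /\ N <= M by lia.
have [aM bM] : a <= M /\ b <= M by lia.
have hE s' : rg s' cR = R -> rg s' cA = a -> rg s' cB = b ->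
  okE w inp ilim lim (!cR * (!cA * !cB))%X s' /\
  eval w inp (!cR * (!cA * !cB))%X s' = N.
  by move=> e1 e2 e3; split; [oks; rewrite ?e1 ?e2 ?e3|rewrite /= e1 e2 e3].
have [o1 o2] := hE s hR hA hB.
apply: (@t_seq _ _ _ _ _ _ _ (N * 9 + 2) (N * 2 + 2) _ _ (fun s1 =>
  forall k, k < N -> ar s1 aQ k = unrelay w a b (ar s aP) k)); last 2 first.
- by lia.
- move=> s1 hI fr fa.
  have [||| o3 o4] := hE s1; rewrite ?fr //.
  apply: (@t_for _ _ _ _ _ _ _ _ _ N (fun=> 1) _ (fun j s2 => forall k,
     ar s2 aP k = if k < j then unrelay w a b (ar s aP) k else ar s aP k)) => //.
  + by apply: M_W.
  + by move=> k /=; rewrite fa.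
  + move=> j s2 hj h7 fr2 fa2; apply: t_sto1 => //; first by oks => /=; lia.
      by apply: M_lim => /=; lia.
    move=> k /=; rewrite h7 (fa2 aQ isT) hI // ltnS [k <= j]leq_eqVlt.
    by case: eqP => [->|].
  + by rewrite sum_nat_const card_ord; lia.
  + move=> s2 h7 _ _; split=> k hk /=; rewrite h7 ?hk //.
    by rewrite ltnNge hk.
apply: (@t_for _ _ _ _ _ _ _ _ _ N (fun=> 8) _ (fun j s1 => forall k, k < j ->
     ar s1 aQ k = unrelay w a b (ar s aP) k)) => //.
- by apply: M_W.
- move=> j s1 hj hI fr fa; have /= f1 := fr cR isT; have /= f2 := fr cA isT.
  have /= f3 := fr cB isT; rewrite ?hR ?hA ?hB in f1 f2 f3.
  have ea := fa aP isT.
  have jM : j <= M by lia.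
  set c := j %/ (a * b); set r := j %% (a * b).
  have hc : c < R by rewrite ltn_divLR // muln_gt0 a0 b0.
  have hr : r < a * b by rewrite ltn_mod muln_gt0 a0 b0.
  have rM : r <= M by lia.
  set i := r %/ a; have hi : i < b by rewrite ltn_divLR // mulnC.
  set v := (c * (2 * a) + r %% a) * b + i.
  set x := (c * (2 * a) + a + r %% a) * b.
  have hx : x + b <= 2 * N.
    have hra : r %% a < a by rewrite ltn_mod.
    have h : (c * (2 * a) + a + r %% a).+1 <= R * (2 * a).
      apply: (@leq_trans (c.+1 * (2 * a))); last by rewrite leq_mul2r hc orbT.
      by rewrite [c.+1 * _]mulSn; move: (r %% a) hra (c * (2 * a)) => ra hra C; lia.
    rewrite /x -[_ * b + b]mulSnr; apply: (@leq_trans (R * (2 * a) * b)); first by rewrite leq_mul2r h orbT.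
    by rewrite /N mulnA mulnCA !mulnA.
  have hv : v <= 2 * N.
    apply: leq_trans hx; rewrite /v /x; apply: leq_add (ltnW hi).
    by rewrite leq_mul2r leq_add2r leq_addr orbT.
  have h2N : 2 * N <= M by apply: leq_trans hM4; rewrite leq_mul2r orbT.
  have hxM := leq_trans hx h2N; have hvM := leq_trans hv h2N.
  have iM : i <= M := leq_trans (ltnW hi) bM.
  have xM : x <= M := leq_trans (leq_addr _ _) hxM.
  apply: t_asg; first by oks; rewrite ?f2 ?f3.
  apply: t_asg; first by oks; rewrite ?f2 ?f3.
  apply: t_asg; first by oks; rewrite ?f2 ?f3.
  have ex : (c * (2 * a) + r %% a + a) * b = x by rewrite /x addnAC.
  have yM : c * (2 * a) + r %% a <= M.
    apply: leq_trans hvM; rewrite /v; apply: leq_trans (leq_addr _ _).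
    by rewrite leq_pmulr.
  apply: t_asg; first by oks; rewrite ?f2 ?f3.
  apply: t_asg; first by oks; rewrite ?f2 ?f3.
  rewrite /= f2 f3 -/c -/r -/i -/v ex ea.
  apply: (@t_seq _ _ _ _ _ _ _ 2 1 _ _ (fun s2 => rg s2 cy =
    shf w b 1 (fun i => ar s aP (x + i)) i)) => //.
    apply: t_if; first by oks => /=; lia.
    + rewrite /= => h.
      apply: t_asg1 => //; first by oks => /=; rewrite ?f3; try lia.
      by rewrite /= f3 ea /shf (_ : i < 1) //; lia.
    + rewrite /= => h.
      apply: t_asg1 => //; first by oks => /=; rewrite ?f3; try lia.
      by rewrite /= ea /shf (_ : (i < 1) = false) //; lia.
  move=> s2 h2 fr2 fa2; apply: t_sto1 => //.
  + by apply: M_lim => /=; rewrite (fr2 ck isT).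
  + move=> k /= hk; rewrite (fr2 ck isT) /= (fr2 cx isT) /= h2.
    case: eqP => [->|/eqP kj]; last by rewrite (fa2 aQ isT); apply: hI; lia.
    by rewrite /unrelay -/c -/r -/i -/v -/x.
- by rewrite sum_nat_const card_ord; lia.
Qed.

(** At length 2 the element [z] is a square root of -1, and the product is that of complex
    numbers. *)
Lemma c_base_ok s R : rg s cR = R -> 4 * R <= M -> wbd (ar s aP) ->
  triple c_base s (7 * R + 2) (fun s' => [/\ negaprod w 2 R 1 (ar s aP) (ar s' aP),
     wbd (ar s' aP) & forall k, 2 * R <= k -> ar s' aP k = ar s aP k]).
Proof.
move=> hR hM hP; set P := ar s aP.
pose Z k := if ~~ odd k
  then subw w (mulw w (P k) (P (2 * R + k))) (mulw w (P k.+1) (P (2 * R + k).+1))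
  else addw w (mulw w (P k.-1) (P (2 * R + k))) (mulw w (P k) (P (2 * R + k).-1)).
have c2 : 2 <= M by exact: M1.
have c1 : 1 <= M by exact: ltnW M1.
apply: (@t_for _ _ _ _ _ _ _ _ _ R (fun=> 6) _ (fun j s1 => forall k,
   ar s1 aP k = if k < 2 * j then Z k else P k)) => //.
- by apply: M_W; lia.
- move=> j s1 hj hI fr fa; have /= f1 := fr cR isT.
  apply: t_asg; first by oks => /=; lia.
  apply: t_asg; first by oks => /=; lia.
  apply: t_asg; first by oks => /=; rewrite ?f1; lia.
  apply: t_asg; first by oks => /=; rewrite ?f1; lia.
  apply: t_sto; [by oks => /=; lia|by []|by apply: M_lim => /=; lia|].
  apply: t_sto1 => //; [by oks => /=; lia|by apply: M_lim => /=; lia|].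
  move=> k /=; rewrite !f1 hR !hI.
  have -> : (2 * j < 2 * j) = false by lia.
  have -> : (2 * j + 1 < 2 * j) = false by lia.
  have -> : (2 * R + 2 * j < 2 * j) = false by lia.
  have -> : (2 * R + 2 * j + 1 < 2 * j) = false by lia.
  rewrite !addn1.
  case: eqP => [->|/eqP k1].
    rewrite (_ : (2 * j).+1 < 2 * j.+1); last by lia.
    by rewrite /Z oddS mul2n odd_double /= addnS.
  case: eqP => [->|/eqP k2].
    rewrite (_ : 2 * j < 2 * j.+1); last by lia.
    by rewrite /Z mul2n odd_double /=.
  by rewrite (_ : (k < 2 * j.+1) = (k < 2 * j)); last by lia.
- by rewrite sum_nat_const card_ord; lia.
- move=> s1 hI _ _; split=> /=.
  + move=> K z W0 z2 c hc; rewrite /sb /evb !big_ord_recr !big_ord0 /= !addn0 !hI.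
    rewrite (_ : c * 2 < 2 * R); last by lia.
    rewrite (_ : c * 2 + 1 < 2 * R); last by lia.
    have Ze : Z (c * 2) = subw w (mulw w (P (c * 2)) (P ((c + R) * 2)))
        (mulw w (P (c * 2 + 1)) (P ((c + R) * 2 + 1))).
      by rewrite /Z oddM andbF mulnDl addnC [R * 2]mulnC !addn1 addnC.
    have Zo : Z (c * 2 + 1) = addw w (mulw w (P (c * 2)) (P ((c + R) * 2 + 1)))
        (mulw w (P (c * 2 + 1)) (P ((c + R) * 2))).
      rewrite /Z addn1 oddS oddM andbF /= mulnDl [R * 2]mulnC addn1.
      by rewrite addnS /= [_ + 2 * R]addnC.
    rewrite Ze Zo subwK ?(ltnW (mulw_lt _ _ _)) // addwK // !mulwK //.
    move: z2; rewrite expr2 => z2; rewrite !expr0 !expr1 !add0r.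
    set p := (P _)%:R%R; set q := (P _)%:R%R; set p' := (P _)%:R%R; set q' := (P _)%:R%R.
    rewrite -[LHS]addr0 -(subrr (p' * q' * (z * z))%R) {2}z2; ring.
  + move=> k; rewrite hI; case: ifP => // _; rewrite /Z; case: ifP => _;
    [exact: subw_lt|exact: addw_lt].
  + by move=> k hk; rewrite hI ltnNge hk.
Qed.
End Conv2.

Section Agree.
Variables (w b L T : nat) (t : nat -> nat).
Hypotheses (b0 : 0 < b) (L0 : 0 < L) (LT : 2 * L * b %| T) (tb : forall q, t q < b).

Lemma agree_node f g k : agree T f g -> k < T ->
  let B := k %/ b in let i := k %% b in
  if B %% (2 * L) < L
  then forall j, j < b -> f ((B + L) * b + j) = g ((B + L) * b + j)
  else forall j, j < b -> f ((B - L) * b + j) = g ((B - L) * b + j) /\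
                         f (B * b + j) = g (B * b + j).
Proof.
case/dvdnP: LT => r eT h hk /=.
have hB : k %/ b < r * (2 * L) by rewrite ltn_divLR // -mulnA -eT.
set B := k %/ b in hB *.
have hq := divn_eq B (2 * L); have hm : B %% (2 * L) < 2 * L by rewrite ltn_mod muln_gt0.
have hq' : B %/ (2 * L) < r by rewrite ltn_divLR // muln_gt0.
have idx B' j : B' < r * (2 * L) -> j < b -> B' * b + j < T.
  move=> hB' hj; rewrite eT mulnA; apply: (@leq_trans (B'.+1 * b)).
    by rewrite [B'.+1 * _]mulSn; lia.
  by rewrite leq_mul2r hB' orbT.
case: ifP => hc j hj.
  apply: h; apply: idx => //.
  apply: (@leq_trans ((B %/ (2 * L)).+1 * (2 * L))); last by rewrite leq_mul2r hq' orbT.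
  have aux q r' : r' < L -> q * (2 * L) + r' + L < q.+1 * (2 * L).
    by move=> hr'; rewrite [q.+1 * _]mulSn; lia.
  by rewrite {1}hq; apply: aux.
by split; apply: h; apply: idx => //; apply: leq_ltn_trans hB; apply: leq_subr.
Qed.

Lemma agree_stg f g : agree T f g -> agree T (stg w b L t f) (stg w b L t g).
Proof.
move=> h k hk; have := agree_node h hk; have hr : k %% b < b by rewrite ltn_mod.
rewrite /stg /=; case: ifP => hc hfg.
  by rewrite h //; congr (addw _ _ _); apply: shf_ext => //; exact: ltnW (tb _).
rewrite (hfg _ hr).1; congr (subw _ _ _); apply: shf_ext => //; first exact: ltnW (tb _).
by move=> i hi; rewrite (hfg _ hi).2.
Qed.

Lemma agree_istg f g : agree T f g -> agree T (istg w b L t f) (istg w b L t g).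
Proof.
move=> h k hk; have := agree_node h hk; have hr : k %% b < b by rewrite ltn_mod.
rewrite /istg /=; case: ifP => hc hfg; first by rewrite h // hfg.
apply: ishf_ext => //; first exact: ltnW (tb _).
by move=> i hi; have [-> ->] := hfg _ hi.
Qed.
End Agree.

Lemma agree_invP w b D n T f g : 0 < b -> n <= D -> 2 ^ D * b %| T -> agree T f g ->
  agree T (invP w b D n f) (invP w b D n g).
Proof.
move=> b0; elim: n f g => [//|n IHn] f g hn hT h /=.
apply: IHn => //; first exact: ltnW.
apply: agree_istg => //; first by rewrite expn_gt0.
  by apply: dvdn_trans hT; rewrite dvdn_mul // -expnS dvdn_exp2l //; lia.
by move=> q; apply: tw_lt.
Qed.

Lemma agree_trans T f g h : agree T f g -> agree T g h -> agree T f h.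
Proof. by move=> h1 h2 k hk; rewrite h1 // h2. Qed.

Section Conv3.
Variables (w : nat) (inp : nat -> nat) (ilim lim M : nat).
Local Notation W := (2 ^ w).
Local Notation triple := (triple w inp ilim lim).
Local Notation wbd := (wbd w).
Hypotheses (M2 : 100 < M) (MW : M ^ 12 < W) (Mlim : M ^ 5 < lim).
Let M1 : 1 < M. Proof. exact: ltn_trans M2. Qed.
Local Notation M_W := (M_W M2 MW).
Local Notation M_lim := (M_lim M2 Mlim).
Ltac okt := okd_tac M1 MW Mlim.
Ltac oks := oks_tac M1 MW Mlim.

Section Loops.
Variables (R mu S : nat).
Let a := mA mu.
Let b := mB mu.
Let D := mD mu.
Let a0 : 0 < a := mA_gt0 mu.
Let b0 : 0 < b := mB_gt0 mu.
Hypotheses (aS : a %| S) (R0 : 0 < S) (SM : 2 * S * b <= M).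

Let S_le : S <= M. Proof. by apply: leq_trans SM; rewrite -mulnA mulnCA leq_pmulr // muln_gt0. Qed.
Let a_le : a <= M. Proof. by apply: leq_trans S_le; apply: dvdn_leq. Qed.
Let D_le : D <= M.
Proof. by apply: leq_trans a_le; rewrite /a /mA /D; case: (mD mu) (ltn0Sn (mu - mu %/ 2)) => // n _; apply: ltn_expl. Qed.
Let b_le : b <= M. Proof. by apply: leq_trans SM; rewrite leq_pmull // muln_gt0. Qed.
Let aE : a = 2 ^ D.-1. Proof. by []. Qed.
Let D0 : 0 < D. Proof. by []. Qed.
Let pow_le j : j < D -> 2 ^ j <= M.
Proof. by move=> hj; apply: leq_trans a_le; rewrite aE leq_exp2l //; lia. Qed.
Let pow_div j : j < D -> a %/ 2 ^ j = 2 ^ (D - j.+1).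
Proof. by move=> hj; rewrite aE -expnB; [congr (_ ^ _); lia|by []|lia]. Qed.
Let pow_dvd j : j < D -> 2 ^ (D - j.+1) %| S.
Proof. by move=> hj; apply: dvdn_trans aS; rewrite aE dvdn_exp2l //; lia. Qed.

Definition hpar s := [/\ rg s cA = a, rg s cB = b & rg s cD = D].

Definition c_fwd_loop :=
  for cd upto !cD in cd' {{ c_stage;; cL ::= !cL / #2;; cE ::= !cE * #2 }}.

Lemma c_fwd_loop_ok s : hpar s -> rg s cS = S -> rg s cL = a -> rg s cE = 1 ->
  wbd (ar s aP) ->
  triple c_fwd_loop s (D * (S * (8 * b + 3 * D + 12) + 5) + 2) (fun s' =>
    agree (2 * S * b) (ar s' aP) (fwdP w b D D (ar s aP)) /\ wbd (ar s' aP)).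
Proof.
move=> [hA hB hD] hS hL hE hP; set P := ar s aP in hP *.
apply: (@t_for _ _ _ _ _ _ _ _ _ D (fun=> S * (8 * b + 3 * D + 12) + 4) _ (fun j s1 =>
  [/\ rg s1 cS = S, rg s1 cL = a %/ 2 ^ j, rg s1 cE = 2 ^ j,
      agree (2 * S * b) (ar s1 aP) (fwdP w b D j P) & wbd (ar s1 aP)])) => //.
- exact: M_W.
- by rewrite /= divn1.
- move=> j s1 hj [h1 h2 h3 h4 h5] fr fa.
  have hp : hypos b j (2 ^ (D - j.+1)) S (setr s1 cd j).
    by split; rewrite /= ?(fr cB isT) //= h2 pow_div.
  apply: (t_seq (c_stage_ok inp ilim M2 MW Mlim b0 _ (pow_dvd hj) SM (pow_le hj) hp) (T2 := 2)).
  + by rewrite expn_gt0.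
  + rewrite -addnA leq_add2r leq_mul2l; apply/orP; right; lia.
  move=> s2 h6 fr2 fa2.
  have e2 : rg s2 cL = 2 ^ (D - j.+1) by rewrite fr2 //= h2 pow_div.
  have e3 : rg s2 cE = 2 ^ j by rewrite fr2.
  have l2 : 2 ^ (D - j.+1) <= M by apply: pow_le; lia.
  have l3 := pow_le hj.
  apply: t_asg; first okt.
  apply: t_asg1 => //; first okt.
  split; rewrite /= ?e2 ?e3.
  + by rewrite fr2.
  + by rewrite -pow_div // -divnMA -expnSr.
  + by rewrite -expnSr.
  + move=> k hk; rewrite h6 hk; refine (agree_stg w b0 _ _ _ h4 hk).
    * by rewrite expn_gt0.
    * by rewrite dvdn_mul // dvdn_mul // pow_dvd.
    * by move=> q; apply: tw_lt.
  + by move=> k; rewrite h6; case: ifP => _; [apply: stg_wbd|apply: h5].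
- by rewrite sum_nat_const card_ord -addnS.
- by move=> s1 [_ _ _ h4 h5] _ _.
Qed.

Definition c_inv_loop :=
  for ck upto !cD in ck' {{
    cd ::= !cD - #1 - !ck;; c_istage;; cL ::= !cL * #2;; cE ::= !cE / #2 }}.

Lemma c_inv_loop_ok s : hpar s -> rg s cS = S -> rg s cL = 1 -> rg s cE = a ->
  wbd (ar s aP) ->
  triple c_inv_loop s (D * (S * (9 * b + 3 * D + 12) + 6) + 2) (fun s' =>
    agree (2 * S * b) (ar s' aP) (invP w b D D (ar s aP)) /\ wbd (ar s' aP)).
Proof.
move=> [hA hB hD] hS hL hE hP; set P := ar s aP in hP *.
apply: (@t_for _ _ _ _ _ _ _ _ _ D (fun=> S * (9 * b + 3 * D + 12) + 5) _ (fun j s1 =>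
  [/\ rg s1 cS = S, rg s1 cL = 2 ^ j, rg s1 cE = a %/ 2 ^ j,
      agree (2 * S * b) (invP w b D (D - j) (ar s1 aP)) (invP w b D D P)
    & wbd (ar s1 aP)])) => //.
- exact: M_W.
- by rewrite /= divn1.
- move=> j s1 hj [h1 h2 h3 h4 h5] fr fa.
  have eD : rg s1 cD = D by rewrite (fr cD isT).
  rewrite addnS; apply: t_asg; first by okt; rewrite eD; lia.
  have hd : D - j.+1 < D by lia.
  have e1 : 2 ^ (D - (D - j.+1).+1) = 2 ^ j by congr (_ ^ _); lia.
  set s1' := setr _ cd _.
  have hp : hypos b (D - j.+1) (2 ^ (D - (D - j.+1).+1)) S s1'.
    split; rewrite /= ?(fr cB isT) //=; first by rewrite eD; lia.
      by rewrite e1.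
    by rewrite h3 pow_div.
  apply: (t_seq (c_istage_ok inp ilim M2 MW Mlim b0 _ (pow_dvd hd) SM (pow_le hd) hp) (T2 := 2)).
  + by rewrite expn_gt0.
  + rewrite -addnA leq_add2r leq_mul2l; apply/orP; right; lia.
  move=> s2 h6 fr2 fa2.
  have e2 : rg s2 cL = 2 ^ j by rewrite fr2.
  have e3 : rg s2 cE = 2 ^ (D - j.+1) by rewrite fr2 //= h3 pow_div.
  have l2 := pow_le hd; have l3 := pow_le hj.
  apply: t_asg; first okt.
  apply: t_asg1 => //; first okt.
  split; rewrite /= ?e2 ?e3.
  + by rewrite fr2.
  + by rewrite -expnSr.
  + by rewrite -pow_div // -divnMA -expnSr.
  + apply: agree_trans h4; rewrite (_ : D - j = (D - j.+1).+1) /=; last by lia.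
    apply: agree_invP => //; first exact: ltnW.
      by rewrite -mA2 dvdn_mul // dvdn_mul.
    by move=> k hk; rewrite h6 hk.
  + by move=> k; rewrite h6; case: ifP => _; [apply: istg_wbd|apply: h5].
- by rewrite sum_nat_const card_ord -addnS.
- by move=> s1 [_ _ _ h4 h5] _ _; rewrite subnn in h4.
Qed.
End Loops.
End Conv3.

(** * From negacyclic products to integer coefficients *)

Section Extract.
Variables (w n kap : nat) (P Z : nat -> nat).
Local Notation W := (2 ^ w).
Hypotheses (w0 : 0 < w) (n0 : 0 < n) (hZ : wbd w Z) (hneg : negaprod w n 1 kap P Z).

(** The ring is instantiated by polynomials over [Z/2^w] modulo [X ^ n + 1], and [z] by the class of
    [X]. The degree bound excludes wrap-around modulo [X ^ n + 1], the bound by [W] excludes it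
    modulo [2 ^ w]. *)
Lemma negaprod_coef dx dy : dx + dy <= n.+1 ->
  (forall k, dx <= k -> k < n -> P k = 0) ->
  (forall k, dy <= k -> k < n -> P (n + k) = 0) ->
  forall k, k < n ->
  kap * \sum_(i < k.+1) P i * P (n + (k - i)) < W ->
  Z k = kap * \sum_(i < k.+1) P i * P (n + (k - i)).
Proof.
move=> dxy hX hY k hk hlt.
have W1 : 1 < W by rewrite -{1}(expn0 2) ltn_exp2l.
move: hneg hZ hlt W1; rewrite /negaprod /wbd; move: W => V hneg' hZ' hlt W1.
pose R := 'Z_V; pose h : {poly R} := ('X^n + 1)%R.
have sh : size h = n.+1 by rewrite size_polyDl ?size_polyXn ?size_poly1.
have mh : mk_monic h = h.
  by rewrite /mk_monic sh ltnS n0 monicE lead_coefDl ?size_polyXn ?size_poly1 //= lead_coefXn eqxx.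
pose T := {poly %/ h}.
have R0 : (V%:R = 0 :> R)%R.
  by apply: val_inj; rewrite /= Zp_nat /= Zp_cast // modnn.
have q0 : in_qpoly h h = 0%R :> T.
  have e := Pdiv.RingMonic.rmodpp (monic_mk_monic h); rewrite mh in e.
  by apply: val_inj; rewrite /= mh e.
pose z : T := in_qpoly h 'X.
have zn : (z ^+ n = -1 :> T)%R.
  have e1 : (z ^+ n + 1 = 0 :> T)%R.
    by rewrite -rmorphXn -(rmorph1 (in_qpoly h)) -rmorphD; exact: q0.
  by apply/eqP; rewrite -addr_eq0 e1.
have T0 : (V%:R = 0 :> T)%R.
  by rewrite -(rmorph_nat (in_qpoly h)) -polyC_natr R0 rmorph0.
pose pc (Q : nat -> nat) c : {poly R} := (\poly_(i < n) (Q (c * n + i)%N)%:R)%R.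
have sbE Q c : sb n z Q c = in_qpoly h (pc Q c) :> T.
  rewrite /sb /evb /pc poly_def rmorph_sum /=; apply: eq_bigr => i _.
  by rewrite -mul_polyC polyC_natr rmorphM rmorph_nat rmorphXn.
have e : in_qpoly h (pc Z 0%N) = in_qpoly h (kap%:R * pc P 0%N * pc P (0 + 1)%N)%R.
  have := hneg' _ z T0 zn 0%N isT; rewrite !sbE => ->.
  by rewrite !rmorphM rmorph_nat.
have s0 : (size (pc P 0) <= dx)%N.
  apply/leq_sizeP => j hj; rewrite coef_poly; case: ifP => // hjn.
  by rewrite mul0n add0n hX.
have s1 : (size (pc P (0 + 1)%N) <= dy)%N.
  apply/leq_sizeP => j hj; rewrite coef_poly; case: ifP => // hjn.
  by rewrite mul1n hY.
have sZ : (size (pc Z 0%N) <= n)%N by apply: size_poly.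
have sM : (size (kap%:R * pc P 0%N * pc P (0 + 1)%N)%R <= n)%N.
  rewrite -mulrA -polyC_natr mul_polyC; apply: leq_trans (size_scale_leq _ _) _.
  by apply: leq_trans (size_polyMleq _ _) _; lia.
have eqp : (pc Z 0%N = kap%:R * pc P 0%N * pc P (0 + 1)%N)%R.
  have r1 : Pdiv.Ring.rmodp (pc Z 0%N) h = pc Z 0%N.
    by apply: Pdiv.CommonRing.rmodp_small; rewrite sh ltnS.
  have r2 : Pdiv.Ring.rmodp (kap%:R * pc P 0%N * pc P (0 + 1)%N)%R h = (kap%:R * pc P 0%N * pc P (0 + 1)%N)%R.
    by apply: Pdiv.CommonRing.rmodp_small; rewrite sh ltnS.
  have := congr1 val e; rewrite /= !mh r1.
  move=> ->; exact: r2.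
have := congr1 (fun p : {poly R} => p`_k)%R eqp.
rewrite -mulrA -polyC_natr mul_polyC coefZ coefM coef_poly hk mul0n add0n.
have -> : (\sum_(j < k.+1) (pc P 0%N)`_j * (pc P (0 + 1)%N)`_(k - j) =
   (\sum_(i < k.+1) P i * P (n + (k - i)))%N%:R :> R)%R.
  rewrite natr_sum; apply: eq_bigr => j _; have hj := ltn_ord j.
  have j1 : (j < n)%N := leq_trans hj hk.
  have j2 : (k - j < n)%N := leq_ltn_trans (leq_subr _ _) hk.
  rewrite !coef_poly j1 j2.
  by rewrite mul0n mul1n natrM.
rewrite -natrM => /(congr1 val); rewrite /= !Zp_nat /= !Zp_cast //.
by rewrite !modn_small.
Qed.
End Extract.

Lemma agree_relay a b R f g : 0 < a -> 0 < b -> agree (R * (a * b)) f g ->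
  agree (R * (2 * (a * b))) (relay a b f) (relay a b g).
Proof.
move=> a0 b0 h k hk; rewrite /relay /=; case: ifP => // hc; apply: h.
set r := k %% (2 * a * b) in hc *.
have hq : k %/ (2 * a * b) < R by rewrite ltn_divLR ?muln_gt0 ?a0 // -mulnA.
have hr : r %% b < b by rewrite ltn_mod.
apply: (@leq_trans ((k %/ (2 * a * b)).+1 * (a * b))); last by rewrite leq_mul2r hq orbT.
rewrite [(k %/ _).+1 * _]mulSnr ltn_add2l; apply: (@leq_trans (a * (r %% b).+1)).
  by rewrite [a * _.+1]mulnS addnC ltn_add2r.
by rewrite leq_mul2l hr orbT.
Qed.

Lemma agree_unrelay w a b R f g : 0 < a -> 0 < b -> agree (R * (2 * (a * b))) f g ->
  agree (R * (a * b)) (unrelay w a b f) (unrelay w a b g).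
Proof.
move=> a0 b0 h k hk; rewrite /unrelay /=; set r := k %% (a * b).
have hr : r < a * b by rewrite ltn_mod muln_gt0 a0.
have hi : r %/ a < b by rewrite ltn_divLR // mulnC.
have hj : r %% a < a by rewrite ltn_mod.
have hq : k %/ (a * b) < R by rewrite ltn_divLR ?muln_gt0 ?a0.
set q := k %/ (a * b) in hq *.
have idx B i : B < 2 * a -> i < b -> (q * (2 * a) + B) * b + i < R * (2 * (a * b)).
  move=> hB hi'; have -> : R * (2 * (a * b)) = R * (2 * a) * b by rewrite !mulnA.
  apply: (@leq_trans ((q * (2 * a) + B).+1 * b)).
    by rewrite [_.+1 * b]mulSnr ltn_add2l.
  rewrite leq_mul2r; apply/orP; right; rewrite -addnS.
  by apply: (@leq_trans (q.+1 * (2 * a))); rewrite ?leq_mul2r ?hq ?orbT //; rewrite [q.+1 * _]mulSnr leq_add2l.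
have idx1 i : i < b -> (q * (2 * a) + a + r %% a) * b + i < R * (2 * (a * b)).
  by move=> hi'; rewrite -[_ + a + _]addnA; apply: idx; rewrite // mul2n -addnn ltn_add2l.
rewrite h; last by apply: idx => //; lia.
congr (addw _ _ _); apply: shf_ext => // i hi'.
by apply: h; apply: idx1.
Qed.

Lemma agree_fwdP w b D n T f g : 0 < b -> n <= D -> 2 ^ D * b %| T -> agree T f g ->
  agree T (fwdP w b D n f) (fwdP w b D n g).
Proof.
move=> b0; elim: n => [//|n IHn] hn hT h /=.
apply: agree_stg => //.
- by rewrite expn_gt0.
- by apply: dvdn_trans hT; rewrite dvdn_mul // -expnS dvdn_exp2l //; lia.
- by move=> q; apply: tw_lt.
- by apply: IHn => //; apply: ltnW.
Qed.

Lemma sb_agree (K : comNzRingType) n (z : K) T f g c : c.+1 * n <= T -> agree T f g ->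
  sb n z f c = sb n z g c.
Proof.
move=> hc h; apply: eq_bigr => i _; rewrite h //.
by apply: leq_trans hc; rewrite [_.+1 * _]mulSnr ltn_add2l.
Qed.

Lemma negaprod_agree w n R kap P P' Z Z' :
  agree (2 * R * n) P P' -> agree (R * n) Z Z' -> negaprod w n R kap P Z ->
  negaprod w n R kap P' Z'.
Proof.
move=> hP hZ h K z W0 zn c hc.
rewrite -(sb_agree z (f := Z) (T := R * n)) ?h //; last by rewrite leq_mul2r hc orbT.
have h2 : c + R < 2 * R by rewrite mul2n -addnn ltn_add2r.
have h3 : c < 2 * R by apply: leq_trans h2; rewrite ltnS leq_addr.
by congr (_ * _ * _)%R; apply: sb_agree hP; rewrite leq_mul2r ?h2 ?h3 orbT.
Qed.

Definition c_fwd0 := cS ::= !cR * (#2 * !cA);; cL ::= !cA;; cE ::= #1;; c_fwd_loop.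
Definition c_inv0 := cS ::= !cR * !cA;; cL ::= #1;; cE ::= !cA;; c_inv_loop.

Definition c_dn := c_par;; c_relay;; c_fwd0;; cR ::= !cR * (#2 * !cA).
Definition c_up := c_par;; cR ::= !cR / (#2 * !cA);; c_inv0;; c_unrelay.

(** Halving brings the parameter to 0 long before [cMU] rounds are over, and the remaining rounds do
    nothing. The parameters are recorded in [aN], from which [c_upl] reads them in reverse order. *)
Definition c_down :=
  for cl upto !cMU in cl' {{
    sto aN$[!cl] ::= !cmu;; If #0 < !cmu {{ c_dn }} Else {{ Skip }};;
    cmu ::= !cmu / #2 }}.

Definition c_upl :=
  for cl upto !cMU in cl' {{
    cmu ::= aN$[!cMU - #1 - !cl];; If #0 < !cmu {{ c_up }} Else {{ Skip }} }}.

Definition c_conv :=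
  cR ::= #1;; cmu ::= !cMU;; c_down;; cK ::= !cR;; c_base;; c_upl.

Section Levels.
Variables (w : nat) (inp : nat -> nat) (ilim lim M : nat).
Local Notation W := (2 ^ w).
Local Notation triple := (triple w inp ilim lim).
Local Notation wbd := (wbd w).
Hypotheses (M2 : 100 < M) (MW : M ^ 12 < W) (Mlim : M ^ 5 < lim).
Let M1 : 1 < M. Proof. exact: ltn_trans M2. Qed.
Local Notation M_W := (M_W M2 MW).
Local Notation M_lim := (M_lim M2 Mlim).
Ltac okt := okd_tac M1 MW Mlim.
Ltac oks := oks_tac M1 MW Mlim.

Definition fwdA mu P := fwdP w (mB mu) (mD mu) (mD mu) (relay (mA mu) (mB mu) P).
Definition invA mu Z := unrelay w (mA mu) (mB mu) (invP w (mB mu) (mD mu) (mD mu) Z).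

Definition lvl_cost mu0 N := 60 * N * mu0.+1 ^ 2.

Lemma mD_le mu mu0 : mu <= mu0 -> 0 < mu -> mD mu <= mu0.+1.
Proof. by move=> h1 h2; rewrite /mD ltnS; apply: leq_trans h1; apply: leq_subr. Qed.

Lemma fwd_cost mu mu0 R N S : 0 < R -> 0 < mu -> mu <= mu0 ->
  N = R * (2 * (2 * 2 ^ mu.+1)) -> S = R * (2 * mA mu) ->
  2 * mu + 12 + (6 * N + 4 + (mD mu * (S * (8 * mB mu + 3 * mD mu + 12) + 5) + 2 + 4))
   <= lvl_cost mu0 N.
Proof.
move=> R0 mp hmu hN hS0; have hD := mD_le hmu mp; set D := mD mu in hD *.
have eN : N = 2 * S * mB mu by rewrite hN hS0 -mAB; ring.
have b2 : 2 <= mB mu by rewrite /mB expnS leq_pmulr // expn_gt0.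
have S0 : 0 < S by rewrite hS0 !muln_gt0 R0 mA_gt0.
have hS : 4 * S <= N by rewrite eN -mulnA mulnCA [4 * S]mulnC leq_mul2l; apply/orP; right; lia.
have e1 : S * (8 * mB mu + 3 * D + 12) <= N * (3 * D + 16).
  rewrite eN in hS *; move: (mB mu) b2 hS => b b2 hS.
  have : S * (3 * D + 12) <= 2 * S * b * (3 * D + 12).
    by rewrite leq_mul2r -mulnA mulnCA leq_pmulr ?orbT // muln_gt0; lia.
  by lia.
have N0 : 0 < N by rewrite eN !muln_gt0 S0 /=; lia.
have e2 : D * (S * (8 * mB mu + 3 * D + 12) + 5) <= mu0.+1 * (N * (3 * mu0.+1 + 21)).
  apply: leq_mul => //; apply: (@leq_trans (N * (3 * D + 16) + N * 5)).
    by apply: leq_add => //; rewrite mulnC leq_pmulr.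
  by rewrite -mulnDr leq_mul2l; apply/orP; right; lia.
rewrite /lvl_cost; move: e2; move: (D * _) => X.
have : 2 * mu + 12 + 4 + 2 + 4 <= N * (2 * mu0.+1 + 22).
  by apply: leq_trans (leq_pmull _ N0); lia.
rewrite [mu0.+1 ^ 2]expnS expn1; have : 0 < mu0.+1 by []; move: (mu0.+1) => m m0 h1 h2.
have h3 : N * m <= N * (m * m) by rewrite leq_mul2l leq_pmulr ?orbT.
have h4 : N <= N * m by rewrite leq_pmulr.
lia.
Qed.

Lemma inv_cost mu mu0 R N S : 0 < R -> 0 < mu -> mu <= mu0 ->
  N = R * (2 * (2 * 2 ^ mu.+1)) -> S = R * mA mu ->
  2 * mu + 12 + (mD mu * (S * (9 * mB mu + 3 * mD mu + 12) + 6) + 2 + 4 +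
   (11 * (R * 2 ^ mu.+1) + 4)) <= lvl_cost mu0 N.
Proof.
move=> R0 mp hmu hN hS0; have hD := mD_le hmu mp; set D := mD mu in hD *.
have eN : N = 4 * S * mB mu by rewrite hN hS0 -mAB; ring.
have b2 : 2 <= mB mu by rewrite /mB expnS leq_pmulr // expn_gt0.
have S0 : 0 < S by rewrite hS0 !muln_gt0 R0 mA_gt0.
have hS : 4 * S <= N by rewrite eN leq_pmulr //; lia.
have e1 : S * (9 * mB mu + 3 * D + 12) <= N * (3 * D + 16).
  rewrite eN in hS *; move: (mB mu) b2 hS => b b2 hS.
  have : S * (3 * D + 12) <= 4 * S * b * (3 * D + 12).
    by rewrite leq_mul2r -mulnA mulnCA leq_pmulr ?orbT // muln_gt0; lia.
  by lia.
have N0 : 0 < N by rewrite eN !muln_gt0 S0 /=; lia.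
have e2 : D * (S * (9 * mB mu + 3 * D + 12) + 6) <= mu0.+1 * (N * (3 * mu0.+1 + 22)).
  apply: leq_mul => //; apply: (@leq_trans (N * (3 * D + 16) + N * 6)).
    by apply: leq_add => //; rewrite mulnC leq_pmulr.
  by rewrite -mulnDr leq_mul2l; apply/orP; right; lia.
rewrite /lvl_cost; move: e2; move: (D * _) => X.
have : 2 * mu + 12 + 4 + 2 + 4 <= N * (2 * mu0.+1 + 22).
  by apply: leq_trans (leq_pmull _ N0); lia.
have : 11 * (R * 2 ^ mu.+1) <= 11 * N by rewrite leq_mul2l hN; lia.
rewrite [mu0.+1 ^ 2]expnS expn1; have : 0 < mu0.+1 by []; move: (mu0.+1) (11 * (R * _)) => m y m0 h0 h1 h2.
have h3 : N * m <= N * (m * m) by rewrite leq_mul2l leq_pmulr ?orbT.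
have h4 : N <= N * m by rewrite leq_pmulr.
lia.
Qed.

Lemma c_dn_ok s mu mu0 R N : 0 < R -> 0 < mu -> mu <= mu0 ->
  N = R * (2 * (2 * 2 ^ mu.+1)) -> N <= M ->
  rg s cmu = mu -> rg s cR = R -> wbd (ar s aP) ->
  triple c_dn s (lvl_cost mu0 N) (fun s' => [/\ rg s' cR = R * 2 ^ mD mu,
    wbd (ar s' aP) & agree N (ar s' aP) (fwdA mu (ar s aP))]).
Proof.
move=> R0 mp hmu hN NM hs hR hP.
have a0 := mA_gt0 mu; have b0 := mB_gt0 mu.
have hNM := NM; rewrite hN in hNM.
have pM : 2 ^ mu.+1 <= M.
  apply: leq_trans hNM; rewrite (_ : R * _ = 4 * R * 2 ^ mu.+1); last by ring.
  by rewrite leq_pmull // muln_gt0 R0.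
apply: t_weak (fwd_cost R0 mp hmu hN erefl) (fun _ h => h); set S := R * (2 * mA mu).
have eN : 2 * S * mB mu = N by rewrite hN -mAB /S; ring.
have S0 : 0 < S by rewrite !muln_gt0 R0.
have SM : S <= M by apply: leq_trans NM; rewrite -eN -mulnA mulnCA leq_pmulr // muln_gt0.
have RM : R <= M by apply: leq_trans SM; rewrite leq_pmulr // muln_gt0.
have aM : mA mu <= M by apply: leq_trans SM; rewrite /S mulnA leq_pmull // muln_gt0 R0.
have c2 : 2 <= M := M1. have c1 : 1 <= M := ltnW M1.
apply: (t_seq (c_par_ok inp ilim M2 MW Mlim hs pM)); first exact: leqnn.
move=> s1 [hB hA hD] fr1 fa1.
have hR1 : rg s1 cR = R by rewrite fr1.
apply: (t_seq (c_relay_ok inp ilim M2 MW Mlim R0 hR1 hA hB hNM) (T2 := mD mu * (S * (8 * mB mu + 3 * mD mu + 12) + 5) + 2 + 4)).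
  by rewrite hN.
move=> s2 [h2 h2'] fr2 fa2.
have hP2 : wbd (ar s2 aP).
  move=> k; have [hk|hk] := ltnP k (R * (2 * (2 * 2 ^ mu.+1))).
    by rewrite h2 //; apply: relay_wbd; rewrite fa1.
  by rewrite h2' // fa1.
have hR2 : rg s2 cR = R by rewrite fr2.
have hA2 : rg s2 cA = mA mu by rewrite fr2.
have hB2 : rg s2 cB = mB mu by rewrite fr2.
have hD2 : rg s2 cD = mD mu by rewrite fr2.
have aS : mA mu %| S by rewrite /S mulnA dvdn_mull.
have SbM : 2 * S * mB mu <= M by rewrite eN.
apply: (@t_seq _ _ _ _ _ _ _ (mD mu * (S * (8 * mB mu + 3 * mD mu + 12) + 5) + 2 + 3) 1 _ _
  (fun s3 => [/\ rg s3 cR = R, rg s3 cA = mA mu, wbd (ar s3 aP) &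
     agree N (ar s3 aP) (fwdA mu (ar s aP))])).
- rewrite addn3; apply: t_asg; first by oks; rewrite ?hR2 ?hA2.
  apply: t_asg; first by oks; rewrite ?hA2.
  apply: t_asg; first by oks.
  set s2' := setr _ cE _.
  apply: t_weak (t_frame (@c_fwd_loop_ok w inp ilim lim M M2 MW Mlim mu S aS S0 SbM s2' _ _ _ _ _)) (leqnn _) _ => //.
  + by rewrite /= hR2 hA2.
  + move=> s3 [[h3 h3'] fr3 fa3]; split=> //; first by rewrite fr3.
      by rewrite fr3.
    rewrite eN in h3; apply: agree_trans h3 _; apply: agree_fwdP => //.
      by rewrite hN -mA2 -mAB; apply/dvdnP; exists (2 * R); ring.
    by rewrite hN -(fa1 aP).
- by rewrite -!addnA.
move=> s3 [k1 k2 k3 k4] fr3 fa3.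
apply: t_asg1 => //; first by oks; rewrite ?k1 ?k2.
by rewrite /= k1 k2 mA2.
Qed.

Lemma c_up_ok s mu mu0 R N : 0 < R -> 0 < mu -> mu <= mu0 ->
  N = R * (2 * (2 * 2 ^ mu.+1)) -> N <= M ->
  rg s cmu = mu -> rg s cR = R * 2 ^ mD mu -> wbd (ar s aP) ->
  triple c_up s (lvl_cost mu0 N) (fun s' => [/\ rg s' cR = R,
    wbd (ar s' aP) & agree (R * 2 ^ mu.+1) (ar s' aP) (invA mu (ar s aP))]).
Proof.
move=> R0 mp hmu hN NM hs hR hP.
have a0 := mA_gt0 mu; have b0 := mB_gt0 mu.
have hNM := NM; rewrite hN in hNM.
have pM : 2 ^ mu.+1 <= M.
  apply: leq_trans hNM; rewrite (_ : R * _ = 4 * R * 2 ^ mu.+1); last by ring.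
  by rewrite leq_pmull // muln_gt0 R0.
apply: t_weak (inv_cost R0 mp hmu hN erefl) (fun _ h => h); set S := R * mA mu.
have eN : 4 * S * mB mu = N by rewrite hN -mAB /S; ring.
have S0 : 0 < S by rewrite !muln_gt0 R0.
have S4M : 4 * S <= M by apply: leq_trans NM; rewrite -eN leq_pmulr.
have SM : S <= M by lia.
have RM : R * 2 ^ mD mu <= M by rewrite -mA2 mulnCA -/S; lia.
have aM : mA mu <= M by apply: leq_trans SM; rewrite leq_pmull.
have c2 : 2 <= M := M1. have c1 : 1 <= M := ltnW M1.
apply: (t_seq (c_par_ok inp ilim M2 MW Mlim hs pM)
  (T2 := mD mu * (S * (9 * mB mu + 3 * mD mu + 12) + 6) + 2 + 4 + (11 * (R * 2 ^ mu.+1) + 4))).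
  exact: leqnn.
move=> s1 [hB hA hD] fr1 fa1.
have hR1 : rg s1 cR = R * 2 ^ mD mu by rewrite fr1.
set X := mD mu * _; have -> : X + 2 + 4 + (11 * (R * 2 ^ mu.+1) + 4) =
  (X + 2 + 3 + (11 * (R * 2 ^ mu.+1) + 4)).+1 by lia.
apply: t_asg; first by oks; rewrite ?hR1 ?hA.
have eR : R * 2 ^ mD mu %/ (2 * mA mu) = R by rewrite mA2 mulnK // expn_gt0.
rewrite /= hR1 hA eR.
have aS : mA mu %| S by rewrite dvdn_mull.
have SbM : 2 * S * mB mu <= M.
  by apply: leq_trans NM; rewrite -eN !leq_mul2r !orbT.
apply: (@t_seq _ _ _ _ _ _ _ (X + 2 + 3) (11 * (R * 2 ^ mu.+1) + 4) _ _
  (fun s3 => [/\ rg s3 cR = R, rg s3 cA = mA mu, rg s3 cB = mB mu, wbd (ar s3 aP) &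
     agree (2 * S * mB mu) (ar s3 aP) (invP w (mB mu) (mD mu) (mD mu) (ar s aP))])).
- rewrite addn3; apply: t_asg.
    by oks; rewrite ?hA //; apply: leq_trans RM; rewrite leq_pmulr ?expn_gt0.
  apply: t_asg; first by oks.
  apply: t_asg; first by oks; rewrite /= hA.
  set s2' := setr _ cE _.
  apply: t_weak (t_frame (@c_inv_loop_ok w inp ilim lim M M2 MW Mlim mu S aS S0 SbM s2' _ _ _ _ _)) (leqnn _) _ => //.
  + by rewrite /= hA.
  + by rewrite /s2' /= fa1.
  + move=> s3 [[h3 h3'] fr3 fa3]; split=> //; rewrite ?fr3 //.
    by rewrite -(fa1 aP).
- by [].
move=> s3 [k1 k2 k3 k4 k5] fr3 fa3.
apply: t_weak (t_frame (c_unrelay_ok inp ilim M2 MW Mlim R0 k1 k2 k3 hNM)) (leqnn _) _.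
move=> s4 [[h4 h4'] fr4 fa4]; split.
- by rewrite fr4.
- move=> k; have [hk|hk] := ltnP k (R * 2 ^ mu.+1).
    by rewrite h4 //; apply: unrelay_wbd.
  by rewrite h4'.
- apply: agree_trans h4 _; rewrite -mAB; apply: agree_unrelay => //.
  by rewrite (_ : R * _ = 2 * S * mB mu) // /S; ring.
Qed.
End Levels.

(** * Depth and memory of the recursion *)

Section Whole.
Variables (w mu0 : nat) (P0 : nat -> nat).

Definition muf l := mu0 %/ 2 ^ l.
Fixpoint Rf l := if l is l'.+1 then
  (if 0 < muf l' then Rf l' * 2 ^ mD (muf l') else Rf l') else 1.
Fixpoint Gf l := if l is l'.+1 then
  (if 0 < muf l' then fwdA w (muf l') (Gf l') else Gf l') else P0.
Definition Sf l := Rf l * 2 ^ (muf l).+1.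
Definition conv_size := 8 * 2 ^ mu0 * mu0.+1.

Lemma mufS l : muf l.+1 = muf l %/ 2.
Proof. by rewrite /muf expnSr divnMA. Qed.

Lemma muf_le l : muf l <= mu0. Proof. exact: leq_div. Qed.

Lemma muf_last : muf mu0 = 0.
Proof. by rewrite /muf divn_small // ltn_expl. Qed.

Lemma Rf_gt0 l : 0 < Rf l.
Proof. by elim: l => // l IHl /=; case: ifP => // _; rewrite muln_gt0 IHl expn_gt0. Qed.

Lemma SfS l : Sf l.+1 = if 0 < muf l then 2 * Sf l else Sf l.
Proof.
rewrite /Sf mufS /=; case: posnP => [->//|hm].
have -> : 2 * (Rf l * 2 ^ (muf l).+1) = Rf l * (2 * mA (muf l)) * mB (muf l).
  by rewrite -mAB; ring.
by rewrite mA2.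
Qed.

Lemma Sf_le l : Sf l <= 2 ^ mu0.+1 * 2 ^ l.
Proof.
elim: l => [|l IHl]; first by rewrite /Sf /muf expn0 divn1 mul1n muln1.
rewrite SfS [2 ^ l.+1]expnS mulnCA; case: ifP => _; first by rewrite leq_mul2l.
by apply: leq_trans IHl _; rewrite leq_pmull.
Qed.

(** The padding doubles the data at each active level, but level [l] is active only if
    [2 ^ l <= mu0]. All doublings together therefore cost at most a factor of order [mu0], which is
    the origin of [conv_size]. *)
Lemma Sf_act l : 0 < muf l -> 4 * Sf l <= conv_size.
Proof.
rewrite /muf divn_gt0 ?expn_gt0 // => h; rewrite /conv_size.
have := Sf_le l; rewrite expnS => h1.
have h2 : 2 * 2 ^ mu0 * 2 ^ l <= 2 * 2 ^ mu0 * mu0 by rewrite leq_mul2l h orbT.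
by move: h1 h2; move: (2 ^ mu0) (2 ^ l) => p q; lia.
Qed.

Lemma Sf_all l : 2 * Sf l <= conv_size.
Proof.
elim: l => [|l IHl].
  rewrite /Sf /muf expn0 divn1 mul1n expnS /conv_size.
  by rewrite mulnA -[X in X <= _]muln1 leq_mul // leq_mul2r; lia.
by rewrite SfS; case: posnP => // /Sf_act; lia.
Qed.

Lemma Rf_le l : Rf l <= conv_size.
Proof.
apply: leq_trans (Sf_all l); rewrite /Sf mulnCA leq_pmulr //.
by rewrite muln_gt0 expn_gt0.
Qed.
End Whole.

Section ConvOk.
Variables (w : nat) (inp : nat -> nat) (ilim lim M : nat).
Local Notation W := (2 ^ w).
Local Notation triple := (triple w inp ilim lim).
Local Notation wbd := (wbd w).
Hypotheses (M2 : 100 < M) (MW : M ^ 12 < W) (Mlim : M ^ 5 < lim).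
Let M1 : 1 < M. Proof. exact: ltn_trans M2. Qed.
Local Notation M_W := (M_W M2 MW).
Local Notation M_lim := (M_lim M2 Mlim).
Ltac okt := okd_tac M1 MW Mlim.
Ltac oks := oks_tac M1 MW Mlim.

Variables (mu0 : nat) (s : st).
Hypotheses (hmu : rg s cMU = mu0) (hs : conv_size mu0 <= M) (hP : wbd (ar s aP)).
Local Notation muf := (muf mu0).
Local Notation Rf := (Rf mu0).
Local Notation Sf := (Sf mu0).
Local Notation Gf := (Gf w mu0 (ar s aP)).
Let LB := lvl_cost mu0 (conv_size mu0).

Let c2 : 2 <= M := M1.
Let c1 : 1 <= M := ltnW M1.
Let mu0M : mu0 <= M.
Proof. by apply: leq_trans hs; apply: leq_trans (leqnSn _) _; rewrite leq_pmull // muln_gt0 expn_gt0. Qed.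
Let N_eq l : Rf l * (2 * (2 * 2 ^ (muf l).+1)) = 4 * Sf l.
Proof. by rewrite /Sf; ring. Qed.
Let lvl_le l : 0 < muf l -> lvl_cost mu0 (4 * Sf l) <= LB.
Proof. by move=> h; rewrite /LB /lvl_cost leq_mul2r leq_mul2l Sf_act ?orbT. Qed.

Lemma c_down_ok s1 : rg s1 cMU = mu0 -> rg s1 cR = 1 -> rg s1 cmu = mu0 ->
  ar s1 aP = ar s aP ->
  triple c_down s1 (mu0 * (LB + 4) + 2) (fun s' =>
    [/\ rg s' cR = Rf mu0, wbd (ar s' aP),
        agree (2 * Sf mu0) (ar s' aP) (Gf mu0)
      & forall i, i < mu0 -> ar s' aN i = muf i]).
Proof.
move=> e1 e2 e3 e4.
apply: (@t_for _ _ _ _ _ _ _ _ _ mu0 (fun=> LB + 3) _ (fun l s2 =>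
  [/\ rg s2 cmu = muf l, rg s2 cR = Rf l, wbd (ar s2 aP),
      agree (2 * Sf l) (ar s2 aP) (Gf l) & forall i, i < l -> ar s2 aN i = muf i])) => //.
- exact: M_W.
- by split; rewrite //= ?e4 // e3 /muf divn1.
- move=> l s2 hl [h1 h2 h3 h4 h5] fr fa.
  have lM : l <= M by apply: leq_trans mu0M; apply: ltnW.
  have hmM : muf l <= M by apply: leq_trans (muf_le _ _) mu0M.
  rewrite addn3; apply: t_sto; [by oks|by []|by apply: M_lim|].
  rewrite /= h1; set s3 := seta _ _ _ _.
  have hN i : i < l.+1 -> ar s3 aN i = muf i.
    rewrite /s3 /= ltnS leq_eqVlt; case: eqP => [->//|_] /= hi; exact: h5.
  apply: (@t_seq _ _ _ _ _ _ _ (LB.+1) 1 _ _ (fun s4 => [/\ rg s4 cmu = muf l,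
     rg s4 cR = Rf l.+1, wbd (ar s4 aP), agree (2 * Sf l.+1) (ar s4 aP) (Gf l.+1) &
     ar s4 aN = ar s3 aN])).
  + apply: t_if; first by oks; rewrite /= h1.
    * rewrite /= h1 => hm; have {}hm : 0 < muf l by case: posnP hm.
      have hN4 := Sf_act hm.
      apply: t_weak (t_frame (@c_dn_ok w inp ilim lim M M2 MW Mlim s3 (muf l) mu0 (Rf l)
         (4 * Sf l) (Rf_gt0 _ _) hm (muf_le _ _) _ _ _ _ _)) (lvl_le hm) _ => //.
      - exact: leq_trans hN4 hs.
      - move=> s4 [[k1 k2 k3] fr4 fa4]; split=> //=.
        + by rewrite fr4.
        + by rewrite hm.
        + rewrite SfS hm mulnA; apply: agree_trans k3 _.
          rewrite /fwdA; apply: agree_fwdP; first exact: mB_gt0; first by [].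
            by rewrite -N_eq -mA2 -mAB; apply/dvdnP; exists (2 * Rf l); ring.
          rewrite (_ : 4 * Sf l = (2 * Rf l) * (2 * (mA (muf l) * mB (muf l)))); last first.
            by rewrite mAB /Sf; ring.
          apply: agree_relay; [exact: mA_gt0|exact: mB_gt0|].
          by rewrite mAB -mulnA.
        + by rewrite fa4.
    * rewrite /= h1 => hm; have {}hm : muf l = 0 by case: posnP hm.
      apply: t_skip; split=> //=; rewrite ?hm //.
      by rewrite SfS hm.
  + by rewrite addn1.
  move=> s4 [k1 k2 k3 k4 k5] fr4 fa4; apply: t_asg1 => //; first by oks; rewrite k1.
  by split; rewrite //= ?k1 ?mufS // k5.
- by rewrite sum_nat_const card_ord; lia.
- by move=> s2 [h1 h2 h3 h4 h5] _ _; split.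
Qed.

Lemma c_upl_ok s1 kap Z0 : rg s1 cMU = mu0 -> rg s1 cR = Rf mu0 ->
  (forall i, i < mu0 -> ar s1 aN i = muf i) ->
  wbd (ar s1 aP) -> ar s1 aP = Z0 -> negaprod w 2 (Rf mu0) kap (Gf mu0) Z0 ->
  triple c_upl s1 (mu0 * (LB + 3) + 2) (fun s' =>
    wbd (ar s' aP) /\
    negaprod w (2 ^ mu0.+1) 1 (kap * Rf mu0) (ar s aP) (ar s' aP)).
Proof.
move=> e1 e2 e3 e4 e5 e6.
(* The invariant [k * Rf l = kap * Rf mu0] tracks the scale: each level on the way up multiplies [k]
   by the factor by which [Rf] shrinks. At the top the scale is thus [Rf mu0], a number already
   known after the way down and saved in [cK]. *)
apply: (@t_for _ _ _ _ _ _ _ _ _ mu0 (fun=> LB + 2) _ (fun i s2 => let l := mu0 - i in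
  [/\ rg s2 cR = Rf l, wbd (ar s2 aP) & exists2 k, k * Rf l = kap * Rf mu0 &
   negaprod w (2 ^ (muf l).+1) (Rf l) k (Gf l) (ar s2 aP)])) => //.
- exact: M_W.
- by rewrite subn0; split=> //; exists kap; rewrite // muf_last /= e5.
- move=> i s2 hi /= [h1 h2 [k hk h3]] fr fa; set l := mu0 - i.+1.
  have el : mu0 - i = l.+1 by rewrite /l; lia.
  rewrite el in h1 hk h3.
  have hl : l < mu0 by rewrite /l; lia.
  have eN : ar s2 aN l = muf l by rewrite fa // e3.
  have iM : i <= M by lia.
  have hmM : muf l <= M by apply: leq_trans (muf_le _ _) mu0M.
  have eMU : rg s2 cMU = mu0 by rewrite (fr cMU isT).
  have el' : mu0 - 1 - i = l by rewrite /l; lia.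
  rewrite addn2; apply: t_asg; first by oks; rewrite /= eMU; lia.
  rewrite /= eMU el' eN.
  apply: t_if; first by oks.
  + rewrite /= => hm; have {}hm : 0 < muf l by case: posnP hm.
    rewrite /= hm in h1 hk h3.
    set s3 := setr _ cmu _.
    apply: t_weak (@c_up_ok w inp ilim lim M M2 MW Mlim s3 (muf l) mu0 (Rf l)
         (4 * Sf l) (Rf_gt0 _ _) hm (muf_le _ _) _ _ _ _ _) (lvl_le hm) _ => //.
    * exact: leq_trans (Sf_act hm) hs.
    move=> s4 [k1 k2 k3]; split=> //.
    exists (k * 2 ^ mD (muf l)); first by rewrite -hk; ring.
    have := @negaprod_level w (muf l %/ 2).+1 (mD (muf l)) (Rf l) k (Gf l) (ar s2 aP) isT _ _ h2.
    rewrite -/(mA (muf l)) -/(mB (muf l)) mAB => H.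
    apply: negaprod_agree (H _ _ _) => //.
    * by move=> j hj; rewrite k3.
    * by rewrite /mD ltnS; have := leq_div (muf l) 2; lia.
    * rewrite /Gf; elim: (l) => [//|l' IH] /=; case: ifP => // _.
      by apply: fwdP_wbd; apply: relay_wbd.
    * by rewrite -/(fwdA w (muf l) (Gf l)) /mB -mufS.
  + rewrite /= => hm; have {}hm : muf l = 0 by case: posnP hm.
    rewrite /= hm /= mufS hm in h1 hk h3.
    by apply: t_skip; split=> //; exists k; rewrite // hm.
- by rewrite sum_nat_const card_ord; lia.
- move=> s2 /=; rewrite subnn => -[_ h2 [k]]; rewrite /= muln1 /muf divn1 => -> h3 _ _.
  by split.
Qed.

Lemma c_conv_ok : triple c_conv s (3 * mu0 * (LB + 4) + 7 * conv_size mu0 + 9) (fun s' =>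
  [/\ rg s' cK = Rf mu0, wbd (ar s' aP) &
    negaprod w (2 ^ mu0.+1) 1 (Rf mu0) (ar s aP) (ar s' aP)]).
Proof.
apply: t_weak (leqnn _) (fun _ h => h).
rewrite (_ : 3 * _ * _ + _ + _ = (mu0 * (LB + 4) + 2 + (7 * conv_size mu0 + 2 +
   (mu0 * (LB + 3) + 2) + (mu0 * (LB + 4) + mu0 + 0)).+1).+2); last by lia.
apply: t_asg; first by oks.
apply: t_asg; first by oks.
set s1 := setr _ cmu _.
apply: (t_seq (@c_down_ok s1 _ _ _ _)) => //.
move=> s2 [h1 h2 h3 h4] fr2 fa2.
have RM : Rf mu0 <= M := leq_trans (Rf_le _ _) hs.
apply: t_asg; first by oks; rewrite h1.
set s3 := setr _ cK _.
have hR3 : rg s3 cR = Rf mu0 by [].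
have SM : 4 * Rf mu0 <= M.
  apply: leq_trans hs; apply: leq_trans (Sf_all mu0 mu0).
  by rewrite /Sf muf_last; lia.
apply: (t_seq (@c_base_ok w inp ilim lim M M2 MW Mlim s3 _ hR3 SM h2)
   (T2 := mu0 * (LB + 3) + 2)).
  by have := Rf_le mu0 mu0; lia.
move=> s4 [k1 k2 k3] fr4 fa4.
have e1 : rg s4 cMU = mu0 by rewrite fr4 //= fr2.
have e2 : rg s4 cR = Rf mu0 by rewrite fr4.
have e3 i : i < mu0 -> ar s4 aN i = muf i by move=> hi; rewrite fa4 //= h4.
apply: t_weak (t_frame (@c_upl_ok s4 1 _ e1 e2 e3 k2 erefl _)) (leqnn _) _.
  apply: negaprod_agree k1 => // k hk.
  by apply: h3; move: hk; rewrite /Sf muf_last; lia.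
move=> s5 [[j1 j2] fr5 fa5]; split=> //; first by rewrite fr5 // fr4.
by rewrite mul1n in j2.
Qed.
End ConvOk.

(** * Generating functions of bounded subset sums *)

Definition bss (c : nat -> nat) s y :=
  exists x : nat -> nat, (forall v, x v <= c v) /\ \sum_(v < s.+1) v * x v = y.

Section Series.
Open Scope ring_scope.
Variables (F : fieldType) (c : nat -> nat) (r : nat -> F).

Definition fac v : {poly F} := \sum_(j < (c v).+1) r v ^+ j *: 'X^(v * j).
Fixpoint gf s : {poly F} := if s is s'.+1 then gf s' * fac s else 1.

(* Coefficients of the logarithmic derivative [X * fac' / fac]. *)
Definition lgd v m : F :=
  if (v %| m)%N && (0 < m)%N then
    v%:R * r v ^+ (m %/ v) * (if ((c v).+1 %| m %/ v)%N then - (c v)%:R else 1)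
  else 0.
Definition lgds s m : F := \sum_(1 <= v < s.+1) lgd v m.

Lemma coef_fac v m : (0 < v)%N ->
  (fac v)`_m = if (v %| m)%N && (m %/ v <= c v)%N then r v ^+ (m %/ v) else 0.
Proof.
move=> v0; rewrite /fac coef_sum.
case: ifP => [/andP[/dvdnP[k ->]]|h].
  rewrite mulnK // => hk; have hk' : (k < (c v).+1)%N by [].
  rewrite (bigD1 (Ordinal hk')) //= coefZ coefXn mulnC eqxx mulr1 big1 ?addr0 // => j hj.
  rewrite coefZ coefXn eqn_pmul2l // (_ : (k == j) = false) ?mulr0 //.
  by apply/negbTE; move: hj; apply: contraNneq => e; apply/eqP/val_inj.
rewrite big1 // => j _; rewrite coefZ coefXn; case: eqP => [e|_]; last by rewrite mulr0.
by move: h; rewrite e dvdn_mulr //= mulKn // -ltnS ltn_ord.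
Qed.

(* Among [c + 1] consecutive exponents exactly one is divisible by [c + 1]. *)
Lemma sum_block C j : (C < j)%N ->
  \sum_(i < C.+1) (if (C.+1 %| (j - i))%N then - C%:R else 1 : F) = 0.
Proof.
move=> hj; pose i0 := (j %% C.+1)%N.
have hi0 : (i0 < C.+1)%N by rewrite ltn_mod.
have hd (i : 'I_C.+1) : (C.+1 %| (j - i))%N = (i == Ordinal hi0).
  have hi := ltn_ord i; rewrite -eqn_mod_dvd; last by lia.
  by rewrite -val_eqE /= eq_sym (modn_small hi).
rewrite (bigD1 (Ordinal hi0)) // hd eqxx.
rewrite (eq_bigr (fun=> 1)) => [|i /negbTE hi]; last by rewrite hd hi.
by rewrite sumr_const cardC1 card_ord /= addNr.
Qed.

Lemma sum_multiples (G : nat -> F) v n : (0 < v)%N ->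
  (forall i, ~~ (v %| i)%N -> G i = 0) ->
  \sum_(i < (n * v).+1) G i = \sum_(j < n.+1) G (j * v)%N.
Proof.
move=> v0 h; rewrite -!(big_mkord xpredT).
rewrite -(big_mkord xpredT (fun j => G (j * v)%N)).
elim: n => [|n IHn]; first by rewrite mul0n !big_nat1 mul0n.
rewrite [RHS]big_nat_recr //= -IHn.
rewrite (@big_cat_nat _ _ _ (n * v).+1) //=; last by rewrite ltnS leq_mul2r leqnSn orbT.
congr (_ + _); rewrite big_nat_recr /=; last by rewrite mulSn; lia.
rewrite big_nat_cond big1 ?add0r // => i /andP[/andP[i1 i2] _]; apply: h.
apply/negP => /dvdnP[k ek]; move: i1 i2; rewrite ek !ltn_mul2r => /andP[_ h1] /andP[_ h2]; lia.
Qed.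

(** Put [q = r v *: 'X^v] and [C = c v]. Then [fac v = (1 - q^(C+1)) / (1 - q)], and [X fac' / fac]
    is [v] times the sum of all [q^k] with [k >= 1], minus [v (C+1)] times the sum of all
    [q^(k(C+1))]; these are the coefficients [lgd]. The identity is verified after multiplication by
    [fac v]. *)
Lemma lgd_fac v m : (0 < v)%N ->
  ('X * (fac v)^`())`_m = \sum_(i < m.+1) lgd v i * (fac v)`_(m - i).
Proof.
move=> v0; rewrite coefXM coef_deriv.
have [->|m0] := posnP m; first by rewrite big_ord1 /lgd ltnn andbF mul0r.
rewrite prednK // coef_fac //.
have [/dvdnP[k em]|ndv] := boolP (v %| m)%N; last first.
  rewrite mul0rn big1 // => i _; rewrite /lgd; case: ifP => [/andP[vi i0]|_]; last by rewrite mul0r.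
  rewrite coef_fac // (_ : (v %| m - i)%N = false) ?mulr0 //.
  by apply: contraNF ndv => h; rewrite -(subnK (ltnSE (ltn_ord i))) dvdn_add.
rewrite em mulnK //=.
have k0 : (0 < k)%N by case: (k) em => //; lia.
rewrite (@sum_multiples (fun i => lgd v i * (fac v)`_(k * v - i)) v k) //; last first.
  by move=> i /negbTE hi; rewrite /lgd hi mul0r.
have e (j : 'I_k.+1) : lgd v (j * v) * (fac v)`_(k * v - j * v) =
   v%:R * r v ^+ k * (if (0 < j)%N && (k - j <= c v)%N then
     if ((c v).+1 %| j)%N then - (c v)%:R else 1 else 0).
  rewrite /lgd dvdn_mull //= -mulnBl coef_fac // dvdn_mull //= !mulnK // muln_gt0 v0 andbT.
  case: (0 < j)%N => /=; last by rewrite mul0r mulr0.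
  case: (k - j <= c v)%N; last by rewrite !mulr0.
  rewrite mulrAC -!mulrA; congr (_ * _); rewrite !mulrA -exprD subnKC //.
  by rewrite -ltnS ltn_ord.
rewrite (eq_bigr _ (fun j _ => e j)) -mulr_sumr.
(* For [k <= c v] the terms with positive index are all 1 and yield the factor [k] of the
   derivative. Beyond that the sum runs over a full block of [c v + 1] consecutive exponents and
   vanishes. *)
have [kc|kc] := leqP k (c v).
  rewrite big_ord_recl /= mul0r_id || rewrite big_ord_recl /= add0r.
  rewrite (eq_bigr (fun=> 1)) => [|j _]; last first.
    rewrite /bump /= leq_subLR (leq_trans kc) ?leq_addl //=.
    rewrite gtnNdvd // add1n ltnS; apply: leq_trans kc; exact: ltn_ord.
  by rewrite sumr_const card_ord -[LHS]mulr_natr natrM; ring.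
rewrite -(big_mkord xpredT (fun j => if (0 < j)%N && (k - j <= c v)%N then
     if ((c v).+1 %| j)%N then - (c v)%:R else 1 else 0)).
rewrite (@big_cat_nat _ _ _ (k - c v)) //=; last by lia.
rewrite big_nat_cond big1 ?add0r; last first.
  move=> j /andP[/andP[_ hj] _]; case: ifP => // /andP[_ h]; lia.
rewrite -{1}(add0n (k - c v)%N) big_addn (_ : (k.+1 - (k - c v) = (c v).+1)%N); last by lia.
rewrite big_mkord (reindex_inj rev_ord_inj) /=.
rewrite (eq_bigr (fun i : 'I_(c v).+1 => if ((c v).+1 %| (k - i))%N then - (c v)%:R else 1 : F)).
  by rewrite sum_block // mulr0 mul0rn.
move=> i _; have hi := ltn_ord i.
rewrite (_ : ((c v).+1 - i.+1 + (k - c v) = k - i)%N); last by lia.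
by rewrite (_ : (0 < k - i)%N && (k - (k - i) <= c v)%N); last by apply/andP; split; lia.
Qed.

(** The power series identity [X P' = h P], coefficient by coefficient: [h] is the logarithmic
    derivative of [P]. Such [h] add under products, which makes the sum [lgds] the right series for
    [gf]. *)
Definition lrel (P : {poly F}) (h : nat -> F) :=
  forall m, ('X * P^`())`_m = \sum_(i < m.+1) h i * P`_(m - i).

Lemma lrel_trunc P h m n : (m <= n)%N -> lrel P h ->
  ('X * P^`())`_m = ((\poly_(i < n.+1) h i) * P)`_m.
Proof.
move=> mn hP; rewrite hP coefM; apply: eq_bigr => i _.
by rewrite coef_poly ltnS (leq_trans _ mn) // -ltnS.
Qed.

Lemma lrelM P Q h g : lrel P h -> lrel Q g -> lrel (P * Q) (fun i => h i + g i).
Proof.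
move=> hP hQ m; rewrite derivM mulrDr coefD.
have -> : 'X * (P^`() * Q) = ('X * P^`()) * Q by rewrite mulrA.
have -> : 'X * (P * Q^`()) = P * ('X * Q^`()) by ring.
have eP : (('X * P^`()) * Q)`_m = ((\poly_(i < m.+1) h i) * (P * Q))`_m.
  rewrite mulrA !coefM; apply: eq_bigr => i _.
  by rewrite (@lrel_trunc _ h _ m) // -ltnS.
have eQ : (P * ('X * Q^`()))`_m = ((\poly_(i < m.+1) g i) * (P * Q))`_m.
  rewrite (_ : \poly_(i < m.+1) g i * (P * Q) = P * (\poly_(i < m.+1) g i * Q)); last by ring.
  rewrite [LHS]coefM [RHS]coefM; apply: eq_bigr => i _.
  by rewrite (@lrel_trunc _ g _ m) // leq_subr.
rewrite eP eQ -coefD -mulrDl coefM; apply: eq_bigr => i _.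
by rewrite coefD !coef_poly ltn_ord.
Qed.

Lemma gf_rec s m :
  m%:R * (gf s)`_m = \sum_(i < m.+1) lgds s i * (gf s)`_(m - i).
Proof.
have h : lrel (gf s) (lgds s).
  elim: s => [|s IHs] /=.
    move=> k; rewrite derivC mulr0 coef0 big1 // => i _.
    by rewrite /lgds big_geq ?mul0r.
  move=> k; have := lrelM IHs (fun k => @lgd_fac s.+1 k isT) k; move=> ->.
  by apply: eq_bigr => i _; congr (_ * _); rewrite /lgds [RHS]big_nat_recr.
rewrite -h coefXM coef_deriv; case: (m) => [|n]; first by rewrite mul0r.
by rewrite /= mulr_natl.
Qed.

Lemma gf0 s : (gf s)`_0 = 1.
Proof.
elim: s => [|s IHs] /=; first by rewrite coefC.
by rewrite coef0M IHs coef_fac // dvdn0 div0n /= expr0 mulr1.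
Qed.

Lemma gfS s y :
  (gf s.+1)`_y = \sum_(j < (c s.+1).+1)
     (if (s.+1 * j <= y)%N then r s.+1 ^+ j * (gf s)`_(y - s.+1 * j) else 0).
Proof.
rewrite /= /fac mulr_sumr coef_sum; apply: eq_bigr => j _.
rewrite -scalerAr coefZ coefMXn; by case: (leqP (s.+1 * j) y) => h; rewrite ?mulr0.
Qed.

(** A nonzero coefficient has a nonzero term in its expansion over the multiplicity of the last
    size, and that term hands down a witness. It holds for all weights, which is why the error is
    one-sided. *)
Lemma gf_sound s y : (gf s)`_y != 0 -> bss c s y.
Proof.
elim: s y => [|s IHs] y.
  rewrite /= coef1; case: (y =P 0%N) => [->|_]; last by rewrite eqxx.
  by move=> _; exists (fun=> 0%N); split=> //; rewrite big_ord1.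
rewrite gfS => h.
have [j hj] : exists j : 'I_(c s.+1).+1, (s.+1 * j <= y)%N && ((gf s)`_(y - s.+1 * j) != 0).
  apply/existsP; apply: contraNT h; rewrite negb_exists => /forallP h.
  apply/eqP; rewrite big1 // => j _; move: (h j); rewrite negb_and.
  by case: ifP => //= _; rewrite negbK => /eqP ->; rewrite mulr0.
case/andP: hj => hj /IHs[x [hx ex]].
exists (fun v => if v == s.+1 then val j else x v); split.
  by move=> v; case: eqP => // ->; rewrite -ltnS ltn_ord.
rewrite big_ord_recr /= eqxx -[RHS](subnK hj) -ex; congr (_ + _)%N.
by apply: eq_bigr => v _; rewrite (_ : (v == s.+1 :> nat) = false) //; apply/eqP; have := ltn_ord v; lia.
Qed.
End Series.

(** * Bookkeeping of the online convolution *)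

Section LowBit.
Definition lb i := 2 ^ logn 2 i.
(** Step [i] multiplies the [lb i] newest coefficients, those just before [i], by the first
    [2 * lb i] of the known factor, and updates the positions [x] in [[i, i + lb i)]. For [x >= i],
    [cov x i] is the last step up to [i] that reached [x]; the terms with index below it are the
    ones accumulated there. *)
Fixpoint cov x i := if i is i'.+1 then (if x < i + lb i then i else cov x i') else 0.

Lemma lb_dvd i : lb i %| i.
Proof. by case: i => [|i]; rewrite ?dvdn0 // pfactor_dvdnn. Qed.

Lemma lb_gt0 i : 0 < lb i. Proof. by rewrite expn_gt0. Qed.

Lemma cov_skip x a d : (forall i, a < i <= a + d -> i + lb i <= x) -> cov x (a + d) = cov x a.
Proof.
elim: d => [|d IHd] h; first by rewrite addn0.
rewrite addnS /= ltnNge h ?IHd //=; last by lia.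
by move=> i hi; apply: h; lia.
Qed.

(** The blocks fit together without overlap: just before step [i], each position it is about to
    update lacks, among the indices below [i], precisely those in [[i - lb i, i)]. The steps
    strictly between [i - lb i] and [i] have smaller lowest bits and end by [i]. *)
Lemma cov_pred x i : 0 < i -> i <= x < i + lb i -> cov x i.-1 = i - lb i.
Proof.
move=> i0 /andP[ix xi]; have hb : lb i <= i by apply: dvdn_leq (lb_dvd i).
have l0 := lb_gt0 i.
rewrite (_ : i.-1 = i - lb i + (lb i).-1); last by lia.
rewrite cov_skip; last first.
  move=> j hj; have j0 : 0 < j by lia.
  have hlt : logn 2 j < logn 2 i.
    rewrite ltnNge; apply/negP => hle.
    have dj : lb i %| j by apply: dvdn_trans (lb_dvd j); apply: dvdn_exp2l.
    have := dvdn_sub (lb_dvd i) dj => /dvdn_leq; lia.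
  have dji : lb j %| i - j.
    by apply: dvdn_sub (lb_dvd j); apply: dvdn_trans (lb_dvd i); apply/dvdn_exp2l/ltnW.
  have := dvdn_leq _ dji; lia.
(* Clearing the lowest bit leaves a number whose lowest bit is at least twice as large, so step
   [i - lb i] did reach [x]. *)
case e: (i - lb i) => [//|j] /=; rewrite -e.
suff -> : x < i - lb i + lb (i - lb i) by [].
have : 2 ^ (logn 2 i).+1 %| i - lb i.
  have /dvdnP[q eq] := lb_dvd i.
  have oq : odd q.
    rewrite -[odd q]negbK -dvdn2; apply/negP => /dvdnP[q' eq'].
    have : 2 ^ (logn 2 i).+1 %| i.
      by rewrite {2}eq eq' -mulnA -expnS dvdn_mull.
    by rewrite pfactor_dvdn // ltnn.
  rewrite {2}eq -{2}(mul1n (lb i)) -mulnBl expnS dvdn_mul //.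
  by rewrite dvdn2 oddB ?oq //; case: (q) oq.
rewrite pfactor_dvdn ?e // -e => h.
have : 2 * lb i <= lb (i - lb i) by rewrite -expnS leq_exp2l.
lia.
Qed.

Lemma cov_self i : 0 < i -> cov i i = i.
Proof. by case: i => //= i _; rewrite -{1}[i.+1]addn0 ltn_add2l lb_gt0. Qed.

End LowBit.

(** * A prime in a short interval, and a harmonic sum *)

Lemma logn_bin p m : prime p -> p ^ logn p 'C(2 * m, m) <= maxn 1 (2 * m).
Proof.
move=> pp; have p1 := prime_gt1 pp.
case: m => [|m]; first by rewrite muln0 bin0 logn1.
set M := m.+1.
have hb : 0 < 'C(2 * M, M) by rewrite bin_gt0; lia.
have e : logn p 'C(2 * M, M) + 2 * logn p M`! = logn p (2 * M)`!.
  rewrite -(@bin_fact (2 * M) M); last by lia.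
  rewrite (_ : 2 * M - M = M); last by lia.
  by rewrite !lognM ?muln_gt0 ?fact_gt0 //; lia.
rewrite !logn_fact // in e.
have [L hL] : {L | p ^ L <= 2 * M < p ^ L.+1}.
  by exists (trunc_log p (2 * M)); apply: trunc_log_bounds => //; lia.
case/andP: hL => hL1 hL2.
apply: leq_trans (leq_trans hL1 (leq_maxr _ _)).
rewrite leq_exp2l //.
have f n k : n <= k -> n <= 2 * M -> \sum_(1 <= i < k.+1) n %/ p ^ i = \sum_(1 <= i < n.+1) n %/ p ^ i.
  move=> nk _; rewrite (@big_cat_nat _ _ _ n.+1) //= [X in _ + X]big_nat_cond [X in _ + X]big1 ?addn0 // => i /andP[/andP[hi _] _].
  by rewrite divn_small //; apply: ltn_trans (ltn_expl i p1).
have e2 : \sum_(1 <= i < M.+1) M %/ p ^ i = \sum_(1 <= i < (2 * M).+1) M %/ p ^ i.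
  by rewrite (f M (2 * M)) //; lia.
rewrite e2 big_distrr /= in e.
(* By the formula for the exponent of [p] in a factorial, each power [p ^ i] contributes at most 1
   to the exponent in the binomial coefficient, and only powers with [i <= L] contribute. *)
have h : \sum_(1 <= i < (2 * M).+1) 2 * M %/ p ^ i <=
   \sum_(1 <= i < (2 * M).+1) (2 * (M %/ p ^ i) + (i <= L)).
  apply: leq_sum => i _; set d := p ^ i.
  have d0 : 0 < d by rewrite expn_gt0; lia.
  case: (leqP i L) => hi.
    rewrite addn1 -ltnS -(ltn_pmul2r d0).
    have h1 := leq_trunc_div (2 * M) d; have h2 := divn_eq M d; have h3 := ltn_pmod M d0.
    apply: leq_ltn_trans h1 _; rewrite {1}h2; move: (M %/ d) => z; rewrite ?mulSn mulnDr mulnA; lia.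
  rewrite divn_small ?leq0n // ; apply: leq_trans hL2 _; by rewrite leq_exp2l.
rewrite big_split /= in h.
have h3 : \sum_(1 <= i < (2 * M).+1) (i <= L : nat) <= L.
  have LM : L <= 2 * M by apply: leq_trans hL1; exact: ltnW (ltn_expl _ p1).
  rewrite (@big_cat_nat _ _ _ L.+1) //= [X in _ + X]big_nat_cond [X in _ + X]big1 ?addn0; last first.
    by move=> i /andP[/andP[hi _] _]; rewrite leqNgt hi.
  apply: leq_trans (_ : \sum_(1 <= i < L.+1) 1 <= L); first by apply: leq_sum => i _; apply: leq_b1.
  by rewrite sum_nat_const_nat; lia.
lia.
Qed.

Lemma bin_ge m : 2 ^ m <= 'C(2 * m, m).
Proof.
elim: m => [//|m IHm].
rewrite (_ : 2 * m.+1 = (2 * m).+2); last by lia.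
have := @leq_bin2l (2 * m) (2 * m).+1 m (leqnSn _); rewrite !binS expnS; move: IHm; lia.
Qed.

(** Otherwise every prime factor of the central binomial coefficient of [m = l * N + 1] is at most
    [N]. Each prime power in it is at most [2 * m <= 2 ^ l], so the coefficient is at most
    [2 ^ (l * N)], contradicting its lower bound [2 ^ m]. *)
Lemma prime_between N l : 2 * (l * N + 1) <= 2 ^ l -> 
  exists2 p, prime p & N < p <= 2 * (l * N + 1).
Proof.
move=> hl; set m := l * N + 1.
have [/hasP[p hp1 hp2]|hno] := boolP (has prime (index_iota N.+1 (2 * m).+1)).
  by exists p => //; move: hp1; rewrite mem_index_iota.
have m0 : 0 < m by rewrite /m addn1.
have b0 : 0 < 'C(2 * m, m) by rewrite bin_gt0; lia.
set b := 'C(2 * m, m) in b0.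
have lb p : prime p -> p ^ logn p b <= 2 ^ l.
  by move=> pp; apply: leq_trans (logn_bin m pp) _; rewrite geq_max expn_gt0.
have hz p : prime p -> N < p -> logn p b = 0.
  move=> pp Np; apply/eqP; rewrite -leqn0 leqNgt; apply/negP => l0.
  have : p <= 2 * m.
    have := logn_bin m pp; rewrite -/b; have := leq_pexp2l (prime_gt0 pp) l0; rewrite expn1; lia.
  move=> hp; move/hasPn: hno => /(_ p); rewrite mem_index_iota Np ltnS hp => /(_ isT).
  by rewrite pp.
have : b <= (2 ^ l) ^ N.
  rewrite -{1}(@partnT b) // (@widen_partn (maxn b N)) ?leq_maxl //.
  rewrite (@big_cat_nat _ _ _ N.+1) //=; last by rewrite ltnS leq_maxr.
  rewrite [X in _ * X]big_nat_cond [X in _ * X]big1 ?muln1; last first.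
    move=> p /andP[/andP[hp _] _]; have [pp|npp] := boolP (prime p); first by rewrite hz.
    by rewrite lognE (negbTE npp).
  rewrite big_ltn // logn0p || rewrite big_ltn //.
  rewrite (_ : 0 ^ logn 0 b = 1) ?mul1n; last by rewrite lognE.
  apply: leq_trans (_ : \prod_(1 <= p < N.+1) 2 ^ l <= _).
    apply: leq_prod => p _; have [pp|npp] := boolP (prime p); first exact: lb.
    by rewrite lognE (negbTE npp) expn_gt0.
  by rewrite prod_nat_const_nat subn1.
have := bin_ge m; rewrite -/b -expnM => h1 h2.
have := leq_trans h1 h2; rewrite leq_exp2l // /m; lia.
Qed.

(** On the dyadic block from [2 ^ k] to [2 ^ k.+1] there are [2 ^ k] quotients, each at most
    [B %/ 2 ^ k], so a block contributes at most [B]. The bound prices the sieve and all loops over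
    multiples. *)
Lemma harmonic B k : \sum_(1 <= i < 2 ^ k) B %/ i <= B * k.
Proof.
elim: k => [|k IHk]; first by rewrite big_geq.
rewrite (@big_cat_nat _ _ _ (2 ^ k)) //= ?expn_gt0 ?leq_exp2l //.
rewrite mulnS addnC leq_add //.
apply: leq_trans (_ : \sum_(2 ^ k <= i < 2 ^ k.+1) B %/ 2 ^ k <= B).
  rewrite big_nat_cond [X in _ <= X]big_nat_cond; apply: leq_sum => i /andP[/andP[hi _] _]; by apply: leq_div2l; rewrite ?expn_gt0.
rewrite sum_nat_const_nat expnS mul2n -addnn addnK mulnC; exact: leq_trunc_div.
Qed.

(** * Sieve, prime and modular inverses *)

Notation sS := 30 (only parsing). Notation sD := 31 (only parsing).
Notation sP := 32 (only parsing). Notation sT := 33 (only parsing).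
Notation sT' := 34 (only parsing). Notation sTau := 35 (only parsing).
Notation sv := 36 (only parsing). Notation sv' := 37 (only parsing).
Notation sr := 38 (only parsing). Notation spw := 39 (only parsing).
Notation sj := 40 (only parsing). Notation sj' := 41 (only parsing).
Notation si := 42 (only parsing). Notation si' := 43 (only parsing).
Notation sq := 44 (only parsing). Notation sk := 45 (only parsing).
Notation sk' := 46 (only parsing). Notation sx := 47 (only parsing).
Notation sB := 48 (only parsing). Notation sy := 49 (only parsing).
Notation sc := 50 (only parsing). Notation slg := 51 (only parsing).

Notation aU := 0 (only parsing). Notation aRND := 1 (only parsing).
Notation aC := 2 (only parsing). Notation aH := 3 (only parsing).
Notation aHs := 4 (only parsing). Notation aF := 5 (only parsing).
Notation aACC := 6 (only parsing). Notation aINV := 7 (only parsing).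
Notation aMK := 8 (only parsing). Notation aY := 13 (only parsing).
Notation aR := 14 (only parsing). Notation aR2 := 15 (only parsing).
Notation aV := 16 (only parsing).

Definition c_sieve :=
  for si upto !sB + #1 in si' {{
    If #1 < !si {{
      for sj upto !sB / !si + #1 in sj' {{
        If #1 < !sj {{ sto aMK$[!si * !sj] ::= #1 }} Else {{ Skip }} }} }}
    Else {{ Skip }} }}.

(** The threshold [4 * D + 8] makes all [i <= D] invertible modulo the prime and lets a trial fail
    with probability at most 1/2. *)
Definition c_prime :=
  sP ::= #2;;
  for sx upto !sB + #1 in sy {{
    If #4 * !sD + #8 < !sx {{
      If aMK$[!sx] == #0 {{ sP ::= !sx }} Else {{ Skip }} }}
    Else {{ Skip }} }}.

Definition c_inv :=
  sto aINV$[#1] ::= #1;;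
  for si upto !sD in si' {{
    sx ::= !si + #2;;
    sto aINV$[!sx] ::= !sP - !sP / !sx * aINV$[!sP %% !sx] %% !sP }}.

Lemma sieve_cost B : \sum_(i < B.+1) ((B %/ i).+1 * 3 + 4).+1 + 2 <= 10 * B.+1 * (up_log 2 B.+1).+1 + 2.
Proof.
have [l hl] : exists l, up_log 2 B.+1 = l by eexists.
rewrite hl leq_add2r.
have hB : B.+1 <= 2 ^ l by rewrite -hl up_logP.
rewrite (eq_bigr (fun i : 'I__ => 3 * (B %/ i) + 8)); last by move=> i _; lia.
rewrite big_split /= sum_nat_const card_ord -big_distrr /= -(big_mkord xpredT (fun i => B %/ i)).
rewrite big_ltn // divn0 add0n.
have h1 : \sum_(1 <= i < B.+1) B %/ i <= B * l.
  by apply: leq_trans (harmonic B l); rewrite [X in _ <= X](@big_cat_nat _ _ _ B.+1) //= leq_addr.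
have h2 : B * l <= B.+1 * l by rewrite leq_mul2r leqnSn orbT.
by rewrite mulnS; move: h1 h2; lia.
Qed.

Section Setup.
Variables (w : nat) (inp : nat -> nat) (ilim lim M : nat).
Local Notation W := (2 ^ w).
Local Notation triple := (triple w inp ilim lim).
Local Notation wbd := (wbd w).
Hypotheses (M2 : 100 < M) (MW : M ^ 12 < W) (Mlim : M ^ 5 < lim).
Let M1 : 1 < M. Proof. exact: ltn_trans M2. Qed.
Local Notation M_W := (M_W M2 MW).
Local Notation M_lim := (M_lim M2 Mlim).
Ltac okt := okd_tac M1 MW Mlim.
Ltac oks := oks_tac M1 MW Mlim.

Lemma t_forc x y e c s N B T (I : nat -> st -> Prop) (Q : st -> Prop) :
  okE w inp ilim lim e s -> eval w inp e s = N -> N <= M ->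
  I 0 (setr s y N) ->
  (forall j s1, j < N -> I j s1 ->
     (forall z, z \notin x :: wv c -> rg s1 z = rg (setr s y N) z) ->
     (forall a, a \notin wa c -> ar s1 a = ar s a) ->
     triple c (setr s1 x j) B (I j.+1)) ->
  N * B.+1 + 2 <= T ->
  (forall s1, I N s1 -> 
     (forall z, z \notin x :: wv c -> rg s1 z = rg (setr s y N) z) ->
     (forall a, a \notin wa c -> ar s1 a = ar s a) -> Q (setr s1 x N)) ->
  triple (For x y e c) s T Q.
Proof.
move=> h1 h2 h3 h4 h5 h6 h7.
apply: (@t_for _ _ _ _ _ _ _ _ _ N (fun=> B) _ I) => //; first exact: M_W.
by rewrite sum_nat_const card_ord.
Qed.

Lemma c_sieve_ok s B : rg s sB = B -> 2 * B + 2 <= M -> (forall k, ar s aMK k = 0) ->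
  triple c_sieve s (10 * B.+1 * (up_log 2 B.+1).+1 + 2) (fun s' =>
    forall k, 1 < k <= B -> (ar s' aMK k == 0) = prime k).
Proof.
move=> hB BM h0.
apply: (@t_for _ _ _ _ _ _ _ _ _ B.+1 (fun i => (B %/ i).+1 * 3 + 4) _
  (fun i s1 => (forall k, 1 < k -> ar s1 aMK k != 0 -> ~~ prime k) /\
     (forall i' j, 1 < i' < i -> 1 < j -> i' * j <= B -> ar s1 aMK (i' * j) != 0))).
- by okt.
- by rewrite /= hB addn1.
- by apply: M_W; lia.
- by split=> [k _|i' j]; rewrite /= ?h0 ?eqxx //; lia.
- move=> i s1 hi [h1 h2] fr fa.
  have eB : rg s1 sB = B by rewrite fr.
  have dB := leq_div B i.
  rewrite addnS; apply: t_if; first by okt.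
  + move=> hc; have i1 : 1 < i by move: hc; rewrite /=; case: (1 < i).
    apply: (@t_forc _ _ _ _ _ (B %/ i).+1 2 _ (fun j s2 =>
       (forall k, 1 < k -> ar s2 aMK k != 0 -> ~~ prime k) /\
       (forall i' j', 1 < i' -> (i' < i) || (i' == i) && (j' < j) -> 1 < j' -> i' * j' <= B -> ar s2 aMK (i' * j') != 0))).
    * by okt; rewrite eB; lia.
    * by rewrite /= eB addn1.
    * by lia.
    * split=> // i' j' k1; rewrite ltn0 andbF orbF => k2 k3 k4; apply: h2 => //; by rewrite k1.
    * move=> j s2 hj [k1 k2] fr2 fa2.
      have ei : rg s2 si = i by rewrite fr2.
      have ij : i * j <= B by apply: leq_trans (leq_trunc_div B i); rewrite mulnC leq_mul2r -ltnS hj orbT.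
      apply: t_if; first by okt.
      - move=> hc2; have j1 : 1 < j by move: hc2; rewrite /=; case: (1 < j).
        apply: t_sto1 => //; first by oks; rewrite ?ei; lia.
          by okt.
          by apply: M_lim; rewrite /= ei; lia.
        split=> [k|i' j' l1 l2 l3 l4] /=; rewrite ei.
          case: (k =P (i * j)%N) => [-> _ _|_ l1 l2]; last exact: k1.
          apply/negP => /primeP[_ /(_ i (dvdn_mulr _ (dvdnn i)))] /orP[/eqP|/eqP e]; first by lia.
          have : i * 1 < i * j by rewrite ltn_pmul2l; lia.
          by lia.
        case: (_ =P (i * j)%N) => // ne; apply: k2 => //; move: l2; case: (ltnP i' i) => //= ii.
        case/andP=> /eqP ei' ; rewrite ltnS leq_eqVlt => /orP[/eqP ej|->]; last by rewrite ei' eqxx.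
        by case: ne; rewrite ei' ej.
      - move=> hc2; have j1 : j <= 1 by move: hc2; rewrite /=; case: ltnP.
        apply: t_skip; split=> // i' j' l1 l2 l3 l4; apply: k2 => //.
        by move: l2; case: (ltnP i' i) => //= ii /andP[-> /=]; lia.
    * by lia.
    * move=> s2 [k1 k2] _ _; split=> // i' j /andP[l1 l2] l3 l4; apply: k2 => //.
      move: l2; rewrite ltnS leq_eqVlt => /orP[/eqP e|->] //; rewrite e ltnn eqxx /= ltnS.
      by rewrite leq_divRL; [rewrite mulnC -e|lia].
  + move=> hc; have i1 : i <= 1 by move: hc; rewrite /=; case: ltnP.
    by apply: t_skip; split=> // i' j hh; apply: h2; lia.
- exact: sieve_cost.
- move=> s1 [h1 h2] _ _ k /andP[k1 kB] /=; apply/idP/idP.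
  + apply: contraLR => np; have /primePn[|[d hd dk]] := np; first by lia.
    have dk' := divnK dk; rewrite -dk' mulnC; apply: h2; [lia| |].
      by move: dk'; case: (k %/ d) => [|[|]] //; lia.
    by rewrite mulnC dk'.
  + by apply: contraLR => /h1; apply.
Qed.

Lemma c_prime_ok s D B : rg s sB = B -> rg s sD = D -> 4 * D + 8 + B + 2 <= M ->
  (forall k, 1 < k <= B -> (ar s aMK k == 0) = prime k) ->
  (exists2 p, prime p & 4 * D + 8 < p <= B) ->
  triple c_prime s (4 * B + 8) (fun s' => prime (rg s' sP) /\ 4 * D + 8 < rg s' sP <= B).
Proof.
move=> hB hD BM hmk [p pp hp].
have -> : 4 * B + 8 = (4 * B + 7).+1 by lia.
apply: t_asg; first by okt.
apply: (@t_forc _ _ _ _ _ B.+1 3 _ (fun x s1 =>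
  (p < x -> prime (rg s1 sP) /\ 4 * D + 8 < rg s1 sP <= B))) => //.
- by oks; rewrite /= ?hB; lia.
- by rewrite /= hB addn1.
- by lia.
- move=> x s1 hx IH fr fa.
  have eD : rg s1 sD = D by rewrite fr.
  apply: t_if; first by oks; rewrite ?eD; lia.
  + move=> hc; have {}hc : 4 * D + 8 < x by move: hc; rewrite /= eD; case: ltnP.
    have em : (ar s1 aMK x == 0) = prime x by rewrite fa // hmk //; lia.
    apply: t_if; first by oks; lia.
    * move=> px; have {}px : (prime x : nat) != 0 by move: px; rewrite /= em.
      apply: t_asg1 => //.
      by move=> _ /=; split; [case: (prime x) px|lia].
    * move=> px; have {}px : (prime x : nat) = 0 by move: px; rewrite /= em.
      apply: t_skip => /= h; apply: IH.
      move: h; rewrite ltnS leq_eqVlt => /orP[/eqP e|//]; by rewrite -e pp in px.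
  + rewrite /= eD => hc; have {}hc : x <= 4 * D + 8 by move: hc; case: ltnP.
    by apply: t_skip => /= h; lia.
- by lia.
- by move=> s1 h _ _ /=; apply: h; lia.
Qed.

(** Since [p = (p %/ x) * x + p %% x], the inverse of [x] is minus [p %/ x] times the inverse of the
    smaller number [p %% x]. All inverses up to [D] thus take linear time. *)
Lemma inv_step p x v : prime p -> 0 < x < p -> v < p ->
  (p %% x) * v %% p = 1 -> x * (p - (p %/ x * v) %% p) %% p = 1.
Proof.
move=> pp /andP[x0 xp] vp h; have p1 := prime_gt1 pp; have p0 : 0 < p by lia.
set k := p %/ x; have hm : k * v %% p < p by rewrite ltn_mod.
have e1 : x * (p - k * v %% p) + x * (k * v) = 0 %[mod p].
  by rewrite -modnDmr -(modnMmr x (k * v)) modnDmr -mulnDr subnK ?modnMl ?mod0n // ltnW.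
have e2 : p %% x * v + x * (k * v) = 0 %[mod p].
  by rewrite mulnA (mulnC x) -mulnDl addnC -divn_eq modnMr mod0n.
move: e1; rewrite -e2 => /eqP; rewrite eqn_modDr => /eqP ->; exact: h.
Qed.

Lemma c_inv_ok s D p : rg s sD = D -> rg s sP = p -> prime p -> D + 2 < p -> p <= M ->
  triple c_inv s (3 * D + 3) (fun s' =>
    forall i, 0 < i <= D -> ar s' aINV i < p /\ i * ar s' aINV i %% p = 1).
Proof.
move=> hD hp pp Dp pM; have p1 := prime_gt1 pp.
rewrite addnS; apply: t_sto; try by okt.
  by apply: M_lim; rewrite /=; lia.
apply: (@t_forc _ _ _ _ _ D 2 _ (fun j s1 => forall i, 0 < i <= j.+1 ->
  ar s1 aINV i < p /\ i * ar s1 aINV i %% p = 1)) => //.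
- by lia.
- by move=> i hi /=; have -> : i = 1 by [lia]; rewrite /= mul1n modn_small.
- move=> j s1 hj IH fr fa.
  have ep : rg s1 sP = p by rewrite fr.
  have pj0 : 0 < p %% (j + 2).
    rewrite lt0n; apply/negP => h; have := dvdn_leq _ h.
    by move: pp => /primeP[_ /(_ _ h)]; lia.
  have pj1 : p %% (j + 2) < j + 2 by rewrite ltn_mod; lia.
  have [|i1 i2] := IH (p %% (j + 2)); first by lia.
  apply: t_asg; first by oks; lia.
  apply: t_sto1; [by oks; lia| | | by [] |].
  + by oks; rewrite ?ep ?ltnS //= ; try lia; exact: ltnW (ltn_pmod _ _).
  + by apply: M_lim; rewrite /=; lia.
  move=> i hi /=; rewrite ep; case: eqP => [->|ne]; last by apply: IH; lia.
  have hi2 : (j + 2) * (p - (p %/ (j + 2) * ar s1 aINV (p %% (j + 2))) %% p) %% p = 1.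
    by apply: inv_step => //; lia.
  split=> //; have hle := leq_subr (p %/ (j + 2) * ar s1 aINV (p %% (j + 2)) %% p) p.
  by rewrite ltn_neqAle hle andbT; apply/negP => /eqP h; rewrite h modnMl in hi2.
- by lia.
- by move=> s1 h _ _ /= i hi; apply: h; lia.
Qed.

End Setup.

(* bits of the lowest set bit *)
Definition c_lowbit :=
  sq ::= #1;; sk ::= #0;;
  for sx upto !slg in sy {{
    If !si %% (#2 * !sq) == #0 {{ sq ::= #2 * !sq;; sk ::= !sk + #1 }} Else {{ Skip }} }}.

(** The factors have lengths [Q] and [2 * Q]; padded to [4 * Q] their negacyclic product equals the
    ordinary one. Entries of the known factor beyond [D] are set to 0. *)
Definition c_fill :=
  for sj upto #4 * !sq in sj' {{
    If !sj < !sq {{ sto aP$[!sj] ::= aF$[!si - !sq + !sj] }}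
    Else {{ sto aP$[!sj] ::= #0 }};;
    If !sj < #2 * !sq {{
      If !sj < !sD + #1 {{ sto aP$[#4 * !sq + !sj] ::= aHs$[!sj] }}
      Else {{ sto aP$[#4 * !sq + !sj] ::= #0 }} }}
    Else {{ sto aP$[#4 * !sq + !sj] ::= #0 }} }}.

(** Coefficient [Q + j] of the block product pairs index [i - Q + a] with index [Q + j - a], which
    add up to [i + j]. The division by [cK] removes the scale of the transform exactly. *)
Definition c_acc :=
  for sj upto !sq in sj' {{
    If !si + !sj < !sD + #1 {{
      sto aACC$[!si + !sj] ::= (aACC$[!si + !sj] + aP$[!sq + !sj] / !cK) %% !sP }}
    Else {{ Skip }} }}.

Definition c_step :=
  si ::= !si + #1;; c_lowbit;; c_fill;; cMU ::= !sk + #1;; c_conv;; c_acc;;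
  sto aF$[!si] ::= aACC$[!si] * aINV$[!si] %% !sP.

(** At most [mu] levels, each of cost [conv_size mu * mu.+1 ^ 2] up to a constant, with
    [conv_size mu] of order [2 ^ mu * mu.+1], give the fourth power. *)
Lemma conv_cost_le mu L : mu <= L ->
  3 * mu * (lvl_cost mu (conv_size mu) + 4) + 7 * conv_size mu + 9 <= 2000 * 2 ^ mu * L.+1 ^ 4.
Proof.
move=> h; rewrite /lvl_cost /conv_size.
have h0 : 0 < 2 ^ mu by rewrite expn_gt0.
apply: (@leq_trans (2000 * 2 ^ mu * mu.+1 ^ 4)); last by rewrite leq_mul2l leq_exp2r // ltnS h orbT.
move: (2 ^ mu) h0 => Z Z0.
rewrite !expnS expn0 muln1; move: {L h} mu => m.
have -> : 3 * m * (60 * (8 * Z * m.+1) * (m.+1 * m.+1) + 4) =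
   1440 * Z * (m * (m.+1 * (m.+1 * m.+1))) + 12 * m by ring.
have h1 : m * (m.+1 * (m.+1 * m.+1)) <= m.+1 * (m.+1 * (m.+1 * m.+1)) by rewrite leq_mul2r leqnSn orbT.
have h2 : m.+1 <= m.+1 * (m.+1 * (m.+1 * m.+1)) by rewrite leq_pmulr.
set X := m.+1 * (m.+1 * (m.+1 * m.+1)) in h1 h2 *.
have h3 : 1440 * Z * (m * (m.+1 * (m.+1 * m.+1))) <= 1440 * Z * X by rewrite leq_mul2l h1 orbT.
have h4 : m.+1 <= Z * X by apply: leq_trans h2 _; rewrite leq_pmull.
have h5 : 7 * (8 * Z * m.+1) <= 56 * (Z * X) by rewrite -!mulnA mulnA (_ : 7 * 8 = 56) // leq_mul2l leq_mul2l h2 !orbT.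
have h6 : 1 <= Z * X by apply: leq_trans h4.
rewrite -!mulnA in h3 h5 *; lia.
Qed.


Lemma sum_if_lt n Q c : \sum_(a < n) (if a < Q then c else 0) = minn n Q * c.
Proof.
elim: n => [|n IHn]; first by rewrite big_ord0 min0n.
by rewrite big_ord_recr IHn /=; case: ltnP => h; [rewrite -mulSnr|rewrite addn0]; congr (_ * _); lia.
Qed.

Lemma cov_le x i : cov x i <= i.
Proof. by elim: i => //= i IH; case: ifP => // _; apply: leq_trans IH _. Qed.

Lemma natr_Fp_inj p m n : prime p -> m < p -> n < p -> (m%:R = n%:R :> 'F_p)%R -> m = n.
Proof.
move=> pp hm hn /(congr1 val); rewrite /= !val_Fp_nat // !modn_small //.
Qed.

(** * One step of the online convolution *)

Section Step.
Variables (w : nat) (inp : nat -> nat) (ilim lim M : nat).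
Local Notation W := (2 ^ w).
Local Notation triple := (triple w inp ilim lim).
Local Notation wbd := (wbd w).
Hypotheses (M2 : 100 < M) (MW : M ^ 12 < W) (Mlim : M ^ 5 < lim).
Let M1 : 1 < M. Proof. exact: ltn_trans M2. Qed.
Local Notation M_W := (M_W M2 MW).
Local Notation M_lim := (M_lim M2 Mlim).
Local Notation t_forc := (t_forc M2 MW).
Ltac okt := okd_tac M1 MW Mlim.
Ltac oks := oks_tac M1 MW Mlim.

Lemma c_lowbit_ok s i L : rg s si = i -> 0 < i -> i < 2 ^ L -> rg s slg = L -> 4 * i <= M -> L <= M ->
  triple c_lowbit s (4 * L + 4) (fun s' => rg s' sk = logn 2 i /\ rg s' sq = lb i).
Proof.
move=> hi i0 iL hL iM LM.
have -> : 4 * L + 4 = (4 * L + 2).+2 by lia.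
apply: t_asg; first by okt.
apply: t_asg; first by okt.
have hl : logn 2 i <= L.
  by rewrite -(leq_exp2l (m := 2)) //; apply: leq_trans (ltnW iL); apply: dvdn_leq (lb_dvd i).
apply: (t_forc (N := L) (B := 3) (I := fun x s1 =>
  rg s1 sk = minn x (logn 2 i) /\ rg s1 sq = 2 ^ minn x (logn 2 i))) => //.
- by rewrite min0n.
- move=> x s1 hx [e1 e2] fr fa; set l := logn 2 i in hl e1 e2 *.
  have ei : rg s1 si = i by rewrite fr.
  have hq : 2 ^ minn x l <= i.
    by apply: leq_trans (dvdn_leq i0 (lb_dvd i)); rewrite leq_exp2l // geq_minr.
  have hm : minn x l <= L by apply: leq_trans (geq_minr _ _) hl.
  apply: t_if; first by oks; lia.
  + move=> hc; have {}hc : 2 ^ (minn x l).+1 %| i.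
      by move: hc; rewrite /= ei e2 -expnS /dvdn; case: (i %% _ == 0).
    rewrite pfactor_dvdn // -/l in hc.
    have hxl : x < l by lia.
    apply: t_asg; first by oks; lia.
    apply: t_asg1 => //; first by oks; lia.
    by rewrite /= e1 e2 addn1 -expnS; have -> : minn x.+1 l = (minn x l).+1 by [lia].
  + move=> hc; have {}hc : ~~ (2 ^ (minn x l).+1 %| i).
      by move: hc; rewrite /= ei e2 -expnS /dvdn; case: (i %% _ == 0).
    rewrite pfactor_dvdn // -/l in hc.
    by apply: t_skip => /=; rewrite e1 e2; have -> : minn x.+1 l = minn x l by [lia].
- by lia.
- by move=> s1 [e1 e2] _ _ /=; rewrite e1 e2 /lb; have -> : minn L (logn 2 i) = logn 2 i by [lia].
Qed.

Lemma c_fill_ok s i Q D : rg s si = i -> rg s sq = Q -> rg s sD = D -> 0 < Q <= i -> i <= D -> 8 * D + 8 <= M ->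
  (forall k, k <= D -> ar s aF k <= M /\ ar s aHs k <= M) ->
  triple c_fill s (28 * Q + 2) (fun s' => forall k,
    ar s' aP k = if k < 4 * Q then (if k < Q then ar s aF (i - Q + k) else 0)
                 else if k < 8 * Q then (if (k - 4 * Q < 2 * Q) && (k - 4 * Q <= D) then ar s aHs (k - 4 * Q) else 0)
                 else ar s aP k).
Proof.
move=> hi hq hD hQ iD DM hb.
apply: (t_forc (N := 4 * Q) (B := 6) (I := fun j s1 => forall k,
    ar s1 aP k = if k < 4 * Q then (if k < j then if k < Q then ar s aF (i - Q + k) else 0 else ar s aP k)
                 else if k < 4 * Q + j then (if (k - 4 * Q < 2 * Q) && (k - 4 * Q <= D) then ar s aHs (k - 4 * Q) else 0)
                 else ar s aP k)).
- by oks; lia.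
- by rewrite /= hq.
- by lia.
- by move=> k /=; rewrite addn0; case: (k < 4 * Q).
- move=> j s1 hj IH fr fa.
  have ei : rg s1 si = i by rewrite fr.
  have eq : rg s1 sq = Q by rewrite fr.
  have eD : rg s1 sD = D by rewrite fr.
  have eF k : ar s1 aF k = ar s aF k by rewrite fa.
  have eH k : ar s1 aHs k = ar s aHs k by rewrite fa.
  have lM k : k <= M -> k < lim by move=> h; apply: M_lim; lia.
  apply: (t_seq (T1 := 2) (T2 := 4) (Q1 := fun s2 => forall k, ar s2 aP k =
     if k == j then (if j < Q then ar s aF (i - Q + j) else 0) else ar s1 aP k)) => //.
    apply: t_if; first by oks; lia.
    + move=> hc; have {}hc : j < Q by move: hc; rewrite /= eq; case: ltnP.
      apply: t_sto1 => //; first by oks; lia.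
        by apply: lM => /=; lia.
      by move=> k /=; rewrite ei eq eF hc.
    + move=> hc; have {}hc : Q <= j by move: hc; rewrite /= eq; case: ltnP.
      apply: t_sto1 => //; first by oks; lia.
        by apply: lM => /=; lia.
      by move=> k /=; rewrite ltnNge hc.
  move=> s2 h2 fr2 fa2.
  have ej : rg s2 sj = j by rewrite fr2.
  rewrite /= in fr2; have {}ei : rg s2 si = i by rewrite fr2.
  have {}eq : rg s2 sq = Q by rewrite fr2.
  have {}eD : rg s2 sD = D by rewrite fr2.
  have {}eH k : ar s2 aHs k = ar s aHs k by rewrite fa2 //= eH.
  have fin s3 v : (forall k, ar s3 aP k = if k == 4 * Q + j then v else ar s2 aP k) ->
     v = (if (j < 2 * Q) && (j <= D) then ar s aHs j else 0) ->
     forall k, ar s3 aP k = (if k < 4 * Q then (if k < j.+1 then if k < Q then ar s aF (i - Q + k) else 0 else ar s aP k)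
                 else if k < 4 * Q + j.+1 then (if (k - 4 * Q < 2 * Q) && (k - 4 * Q <= D) then ar s aHs (k - 4 * Q) else 0)
                 else ar s aP k).
    move=> h3 ev k; rewrite h3 h2 IH addnS !ltnS.
    case: (k =P 4 * Q + j) => [->|ne1].
      by rewrite ltnNge leq_addr /= leqnn addKn -ev.
    case: (k =P j) => [->|ne2]; first by rewrite hj leqnn.
    by rewrite (leq_eqVlt k (4 * Q + j)) (leq_eqVlt k j) (introF eqP ne1) (introF eqP ne2).
  have o1 : okE w inp ilim lim (#4 * !sq + !sj)%X s2 by oks; lia.
  have o2 : 4 * Q + j < lim by apply: lM; lia.
  apply: t_if; first by oks; lia.
  + move=> hc; have {}hc : j < 2 * Q by move: hc; rewrite /= eq ej; case: ltnP.
    apply: t_if; first by oks; lia.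
    * move=> hc2; have {}hc2 : j <= D by move: hc2; rewrite /= eD ej addn1 ltnS; case: leqP.
      apply: t_sto1; [exact: o1|by oks; lia|by rewrite /= eq ej|by []|].
      by apply: (fin _ (ar s aHs j)) => [k /=|]; rewrite ?eq ?ej ?eH // hc hc2.
    * move=> hc2; have {}hc2 : D < j by move: hc2; rewrite /= eD ej addn1 ltnS; case: leqP.
      apply: t_sto1; [exact: o1|by oks|by rewrite /= eq ej|by []|].
      by apply: (fin _ 0) => [k /=|]; rewrite ?eq ?ej // [j <= D]leqNgt hc2 andbF.
  + move=> hc; have {}hc : 2 * Q <= j by move: hc; rewrite /= eq ej; case: ltnP.
    apply: t_sto1; [exact: o1|by oks|by rewrite /= eq ej|by []|].
    by apply: (fin _ 0) => [k /=|]; rewrite ?eq ?ej // ltnNge hc.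
- by lia.
- move=> s1 h _ _ k /=; rewrite h; case: ltnP => // hk; rewrite (_ : 4 * Q + 4 * Q = 8 * Q) //; lia.
Qed.

Lemma c_acc_ok s i Q D p K : rg s si = i -> rg s sq = Q -> rg s sD = D -> rg s sP = p -> rg s cK = K ->
  0 < p -> 0 < Q <= i -> i <= D -> 8 * D + 8 <= M ->
  (forall k, k <= D -> ar s aACC k <= M) -> (forall k, k < Q -> ar s aP (Q + k) <= M) -> p <= M ->
  triple c_acc s (4 * Q + 2) (fun s' => forall k,
    ar s' aACC k = if (i <= k < i + Q) && (k <= D) then (ar s aACC k + ar s aP (Q + (k - i)) %/ K) %% p
                   else ar s aACC k).
Proof.
move=> hi hq hD hp hK p0 hQ iD DM hb hP pM.
apply: (t_forc (N := Q) (B := 2) (I := fun j s1 => forall k, ar s1 aACC k =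
   if (i <= k < i + j) && (k <= D) then (ar s aACC k + ar s aP (Q + (k - i)) %/ K) %% p
                   else ar s aACC k)) => //.
- by lia.
- by move=> k /=; rewrite addn0; case: leqP => //= h; rewrite ltnNge h.
- move=> j s1 hj IH fr fa.
  have ei : rg s1 si = i by rewrite fr.
  have eq : rg s1 sq = Q by rewrite fr.
  have eD : rg s1 sD = D by rewrite fr.
  have ep : rg s1 sP = p by rewrite fr.
  have eK : rg s1 cK = K by rewrite fr.
  have eP k : ar s1 aP k = ar s aP k by rewrite fa.
  apply: t_if; first by oks; lia.
  + move=> hc; have {}hc : i + j <= D by move: hc; rewrite /= ei eD addn1 ltnS; case: leqP.
    have ea : ar s1 aACC (i + j) = ar s aACC (i + j) by rewrite IH ltnn andbF.
    have := hb _ hc; have := hP _ hj => b1 b2.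
    apply: t_sto1 => //; first by oks; lia.
    * by oks; rewrite ?ei ?eq ?ea ?eP ?eK //; lia.
    * by apply: M_lim; rewrite /= ei; lia.
    move=> k /=; rewrite ei eq ea eP ep eK addnS ltnS.
    case: (k =P i + j) => [->|ne]; first by rewrite leq_addr leqnn hc /= addKn.
    by rewrite IH (leq_eqVlt k (i + j)) (introF eqP ne).
  + move=> hc; have {}hc : D < i + j by move: hc; rewrite /= ei eD addn1 ltnS; case: leqP.
    apply: t_skip => k /=; rewrite IH.
    by have -> : (i <= k < i + j.+1) && (k <= D) = (i <= k < i + j) && (k <= D) by [lia].
- by lia.
Qed.


(** The size condition involves [conv_size mu] because the scale [K] returned by the transform is at
    most that large, and the scaled coefficient must still fit. *)
Lemma c_mul_ok s mu dx dy : rg s cMU = mu -> conv_size mu <= M -> wbd (ar s aP) ->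
  dx + dy <= (2 ^ mu.+1).+1 ->
  (forall k, dx <= k -> k < 2 ^ mu.+1 -> ar s aP k = 0) ->
  (forall k, dy <= k -> k < 2 ^ mu.+1 -> ar s aP (2 ^ mu.+1 + k) = 0) ->
  (forall k, k < 2 ^ mu.+1 ->
     conv_size mu * \sum_(i < k.+1) ar s aP i * ar s aP (2 ^ mu.+1 + (k - i)) <= M) ->
  triple c_conv s (2000 * 2 ^ mu * mu.+1 ^ 4) (fun s' => exists2 K, 0 < K <= M &
    [/\ rg s' cK = K, wbd (ar s' aP) & forall k, k < 2 ^ mu.+1 ->
     ar s' aP k = K * \sum_(i < k.+1) ar s aP i * ar s aP (2 ^ mu.+1 + (k - i)) /\ ar s' aP k <= M]).
Proof.
move=> hmu hs hw hd hx hy hb.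
have H := @c_conv_ok w inp ilim lim M M2 MW Mlim mu s hmu hs hw.
have h2 := conv_cost_le (leqnn mu).
apply: (t_weak H h2).
move=> s' [eK w' hneg].
exists (Rf mu mu); first by rewrite Rf_gt0 (leq_trans (Rf_le _ _) hs).
split=> // k hk.
have b1 : Rf mu mu * \sum_(i < k.+1) ar s aP i * ar s aP (2 ^ mu.+1 + (k - i)) <= M.
  by apply: leq_trans (hb k hk); rewrite leq_mul2r Rf_le orbT.
have w0 : 0 < w by move: MW; case: (w) => //; rewrite expn0 ltnS leqn0 expn_eq0 => /andP[/eqP]; lia.
suff -> : ar s' aP k = Rf mu mu * \sum_(i < k.+1) ar s aP i * ar s aP (2 ^ mu.+1 + (k - i)) by [].
apply: (@negaprod_coef w (2 ^ mu.+1) (Rf mu mu) (ar s aP) (ar s' aP) w0 _ w' hneg dx dy hd hx hy k hk).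
  by rewrite expn_gt0.
exact: M_W.
Qed.

(* Online convolution: after step [i] the accumulator at [k > i] holds the terms with index below [cov k i]. *)
Lemma c_step_ok s i D p L (h : nat -> 'F_p) :
  rg s si = i -> rg s sD = D -> rg s sP = p -> rg s slg = L ->
  i < D -> D < 2 ^ L -> prime p -> 
  8 * D + 8 <= M -> L <= M -> p <= M -> 16 * 2 ^ L * L.+2 * (D.+1 * (p * p)) <= M ->
  wbd (ar s aP) ->
  (forall k, k <= D -> ar s aHs k < p /\ ((ar s aHs k)%:R)%R = h k) ->
  (forall k, k <= i -> ar s aF k < p) -> (forall k, k <= D -> ar s aF k <= M) ->
  (forall k, 0 < k <= D -> ar s aINV k < p /\ k * ar s aINV k %% p = 1) ->
  (forall k, k <= D -> ar s aACC k < p) ->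
  (forall k, i < k <= D -> ((ar s aACC k)%:R = \sum_(a < cov k i) (ar s aF a)%:R * h (k - a)%N)%R) ->
  triple c_step s (4040 * lb i.+1 * L.+2 ^ 4 + 4 * L + 20) (fun s' =>
    [/\ rg s' si = i.+1, wbd (ar s' aP), 
       (forall k, k != i.+1 -> ar s' aF k = ar s aF k) /\
       (ar s' aF i.+1 < p /\ (i.+1%:R * (ar s' aF i.+1)%:R = \sum_(a < i.+1) (ar s aF a)%:R * h (i.+1 - a)%N)%R),
      (forall k, k <= D -> ar s' aACC k < p) &
      (forall k, i.+1 < k <= D -> ((ar s' aACC k)%:R = \sum_(a < cov k i.+1) (ar s' aF a)%:R * h (k - a)%N)%R)]).
Proof.
move=> hi hD hp hL iD DL pp DM LL pM PM hw hH hF hFM hI hA hC.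
have p1 := prime_gt1 pp; have p0 : 0 < p by lia.
have c1 : 1 <= M by lia.
set Q := lb i.+1; set l := logn 2 i.+1.
have eQ : Q = 2 ^ l by [].
have Q0 : 0 < Q by apply: lb_gt0.
have Qi : Q <= i.+1 by apply: dvdn_leq (lb_dvd _).
have lL : l < L by rewrite -(ltn_exp2l (m := 2)) // -eQ; apply: leq_ltn_trans DL; apply: leq_trans Qi iD.
have cs : conv_size l.+1 <= 16 * 2 ^ L * L.+2.
  rewrite /conv_size expnS mulnA; apply: leq_mul; last by lia.
  by rewrite (_ : 8 * 2 = 16) // leq_mul2l leq_exp2l // ltnW.
have pos : 0 < D.+1 * (p * p) by rewrite !muln_gt0 p0.
have cs' : conv_size l.+1 <= M by apply: leq_trans cs _; apply: leq_trans PM; rewrite leq_pmulr.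
have hL4 : 0 < L.+2 ^ 4 by rewrite expn_gt0.
have T1 : (4 * L + 4) + ((28 * Q + 2) + (4000 * Q * L.+2 ^ 4 + ((4 * Q + 2) + 1)).+1) <= 4040 * Q * L.+2 ^ 4 + 4 * L + 19.
  have : Q <= Q * L.+2 ^ 4 by rewrite leq_pmulr.
  by rewrite -!mulnA; move: (Q * L.+2 ^ 4) => z; lia.
apply: (@t_weak _ _ _ _ _ _ ((4 * L + 4) + ((28 * Q + 2) + (4000 * Q * L.+2 ^ 4 + ((4 * Q + 2) + 1)).+1)).+1); last 2 first.
- by move: T1; lia.
- by move=> s' hh; exact: hh.
apply: t_asg; first by oks; lia.
set s0 := setr s si _.
have e0 : rg s0 si = i.+1 by rewrite /= hi addn1.
apply: (t_seq (c_lowbit_ok (s := s0) (i := i.+1) (L := L) _ _ _ _ _ _)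
   (T2 := (28 * Q + 2) + (4000 * Q * L.+2 ^ 4 + ((4 * Q + 2) + 1)).+1)) => //; try lia.
move=> s1 [ek eq] fr fa; rewrite -/l -/Q in ek eq.
apply: (t_seq (c_fill_ok (s := s1) (i := i.+1) (Q := Q) (D := D) _ _ _ _ _ _ _)
   (T2 := (4000 * Q * L.+2 ^ 4 + ((4 * Q + 2) + 1)).+1)) => //; try lia.
- by rewrite fr.
- by rewrite fr.
- move=> k hk; rewrite !fa // /s0 /=; split; last by have [] := hH _ hk; lia.
  exact: hFM.
move=> s2 hP2 fr2 fa2.
apply: t_asg; first by oks; rewrite fr2 //= ek; lia.
set s3 := setr s2 cMU _.
have e3 : rg s3 cMU = l.+1 by rewrite /= fr2 //= ek addn1.
have eP3 k : ar s3 aP k = if k < 4 * Q then (if k < Q then ar s aF (i.+1 - Q + k) else 0)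
     else if k < 8 * Q then (if (k - 4 * Q < 2 * Q) && (k - 4 * Q <= D) then ar s aHs (k - 4 * Q) else 0)
     else ar s aP k.
  by rewrite /= hP2 !fa.
have pW v : v < p -> v < W by move=> hv; apply: M_W; lia.
have w3 : wbd (ar s3 aP).
  move=> k; rewrite eP3; case: ifP => h1.
    case: ifP => h2; last by apply: pW.
    by apply/pW/hF; lia.
  case: ifP => h2; last exact: hw.
  case: ifP => [/andP[_ h3]|_]; last by apply: pW.
  by apply: pW; have [] := hH _ h3.
have n4 : 2 ^ l.+2 = 4 * Q by rewrite eQ !expnS mulnA.
have coef k : k < 4 * Q -> \sum_(a < k.+1) ar s3 aP a * ar s3 aP (4 * Q + (k - a)) =
   \sum_(a < k.+1) (if a < Q then ar s aF (i.+1 - Q + a) * (if (k - a < 2 * Q) && (k - a <= D) then ar s aHs (k - a) else 0) else 0).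
  move=> hk; apply: eq_bigr => a _; have ha := ltn_ord a; rewrite !eP3.
  rewrite (_ : a < 4 * Q); last by lia.
  rewrite (_ : (4 * Q + (k - a) < 4 * Q) = false); last by lia.
  rewrite (_ : 4 * Q + (k - a) < 8 * Q); last by lia.
  by rewrite addKn; case: ifP => // _; rewrite mul0n.
have coefM k : k < 4 * Q -> \sum_(a < k.+1) ar s3 aP a * ar s3 aP (4 * Q + (k - a)) <= D.+1 * (p * p).
  move=> hk; rewrite coef //.
  apply: (@leq_trans (\sum_(a < k.+1) (if a < Q then p * p else 0))).
    apply: leq_sum => a _; case: ifP => // ha; apply: leq_mul; first by apply/ltnW/hF; lia.
    by case: ifP => [/andP[_ h3]|//]; apply: ltnW; have [] := hH _ h3.
  by rewrite sum_if_lt leq_mul2r; apply/orP; right; lia.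
apply: (t_seq (T2 := (4 * Q + 2) + 1) (c_mul_ok (s := s3) (mu := l.+1) (dx := Q) (dy := 2 * Q) e3 cs' w3 _ _ _ _)); rewrite ?n4.
- by lia.
- by move=> k h1 h2; rewrite eP3 h2 ltnNge h1.
- move=> k h1 h2; rewrite eP3 (_ : (4 * Q + k < 4 * Q) = false); last by lia.
  by rewrite (_ : 4 * Q + k < 8 * Q) ?addKn; [rewrite ltnNge h1|lia].
- move=> k hk; apply: leq_trans PM; apply: leq_mul => //; exact: coefM.
- rewrite leq_add2r (_ : 2000 * 2 ^ l.+1 = 4000 * Q); last by rewrite eQ expnS; lia.
  by rewrite leq_mul2l leq_exp2r //; apply/orP; right; lia.
move=> s4 [K /andP[K0 KM] [eK w4 hZ]] fr4 fa4.
have rs x : x \notin wv c_conv -> x \notin [:: cMU; sj; sj'; sx; sy; sq; sk; si] -> rg s4 x = rg s x.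
  move=> h1 h2; rewrite fr4 //=; move: h2; rewrite !inE !negb_or => /and4P[/negbTE-> n1 n2 /and5P[n3 n4' n5 n6 n7]].
  rewrite fr2 ?inE ?negb_or ?n1 ?n2 //= fr //= ?(negbTE n7) // !inE !negb_or.
  by rewrite n3 n4' n5 n6.
have conv d : d < Q -> i.+1 + d <= D -> ar s4 aP (Q + d) = K * \sum_(a < Q) ar s aF (i.+1 - Q + a) * ar s aHs (Q + d - a).
  move=> hd hd2; have [-> _] := hZ (Q + d) ltac:(lia); rewrite coef; last by lia.
  congr (_ * _).
  rewrite -(big_mkord xpredT (fun a => if a < Q then ar s aF (i.+1 - Q + a) * (if (Q + d - a < 2 * Q) && (Q + d - a <= D) then ar s aHs (Q + d - a) else 0) else 0)).
  rewrite (@big_cat_nat _ _ _ Q) //=; last by lia.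
  rewrite [X in _ + X]big_nat_cond [X in _ + X]big1 ?addn0; last first.
    by move=> a /andP[/andP[h1 _] _]; rewrite ltnNge h1.
  rewrite big_mkord; apply: eq_bigr => a _; have ha := ltn_ord a.
  by rewrite ha (_ : (_ < _) && _) //; apply/andP; split; lia.
apply: (t_seq (T2 := 1) (c_acc_ok (s := s4) (i := i.+1) (Q := Q) (D := D) (p := p) (K := K) _ _ _ _ _ _ _ _ _ _ _ _)) => //; try lia.
- by rewrite fr4 //= fr2 //= fr.
- by rewrite fr4 //= fr2.
- by rewrite rs.
- by rewrite rs.
- by move=> k hk; rewrite fa4 //= fa2 //= fa //=; have := hA _ hk; lia.
- by move=> k hk; have [] := hZ (Q + k) ltac:(lia).
move=> s5 hacc fr5 fa5.
have hA4 k : ar s4 aACC k = ar s aACC k by rewrite fa4 //= fa2 //= fa.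
have hF5 k : ar s5 aF k = ar s aF k by rewrite fa5 //= fa4 //= fa2 //= fa.
have castm m : ((m %% p)%N%:R = m%:R :> 'F_p)%R by apply: Fp_nat_mod.
have A5 k : k <= D -> ar s5 aACC k < p.
  by move=> hk; rewrite hacc; case: ifP => _; [rewrite ltn_mod|rewrite hA4; apply: hA].
have C5 k : i < k <= D -> ((ar s5 aACC k)%:R = \sum_(a < cov k i.+1) (ar s aF a)%:R * h (k - a)%N :> 'F_p)%R.
  move=> hk; have ik : i.+1 <= k by lia.
  have eC : cov k i.+1 = if k < i.+1 + lb i.+1 then i.+1 else cov k i by [].
  rewrite eC.
  rewrite hacc; have -> : k <= D by lia.
  rewrite ik andbT /=; case: ifP => hkQ; last first.
    have {}hkQ : (k < i.+1 + lb i.+1) = false by rewrite -/Q.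
    by rewrite hA4 (hC k hk) ?hkQ.
  have hkQ' : k < i.+1 + lb i.+1 by rewrite -/Q.
  rewrite ?hkQ' castm natrD hA4 (hC k hk).
  (* The terms accumulated earlier end at [i.+1 - Q], and the [Q] terms of the current block product
     complete the prefix. *)
  rewrite (@cov_pred k i.+1) ?ik ?hkQ' // conv; [|lia|lia].
  rewrite mulKn // -(big_mkord xpredT (fun a => (ar s aF a)%:R * h (k - a)%N)%R).
  rewrite -[RHS](big_mkord xpredT (fun a => (ar s aF a)%:R * h (k - a)%N)%R) -/Q.
  rewrite [RHS](@big_cat_nat _ _ _ (i.+1 - Q)) //=; last by apply: leq_subr.
  congr (_ + _)%R; rewrite -{2}(add0n (i.+1 - Q)) big_addn subKn // big_mkord natr_sum.
  apply: eq_bigr => a _; have ha := ltn_ord a; rewrite natrM addnC; congr (_ * _)%R.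
  have [_ ->] := hH (Q + (k - i.+1) - a) ltac:(lia); congr h; lia.
have ei5 : rg s5 si = i.+1 by rewrite fr5 //= fr4 //= fr2 //= fr.
have ep5 : rg s5 sP = p by rewrite fr5 //= rs.
have hI5 k : ar s5 aINV k = ar s aINV k by rewrite fa5 //= fa4 //= fa2 //= fa.
have [iv1 iv2] := hI i.+1 ltac:(lia).
have a5 := A5 i.+1 iD.
apply: t_sto1; [by oks|by oks; rewrite ?ei5 ?hI5; lia|by apply: M_lim; rewrite /= ei5; lia|by []|].
rewrite /= ei5 ep5 hI5; split.
- by [].
- by move=> k; rewrite /= fa5.
- split; first by move=> k /negbTE -> /=; rewrite hF5.
  rewrite eqxx ltn_mod; split=> //.
  rewrite castm natrM mulrCA -natrM -(castm (i.+1 * _)) iv2 mulr1 C5 ?ltnSn //.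
  by rewrite cov_self.
- by move=> k hk; apply: A5.
- move=> k hk; rewrite C5; last by lia.
  apply: eq_bigr => a _; have ha := leq_trans (ltn_ord a) (cov_le k i.+1).
  by rewrite (_ : (nat_of_ord a == i.+1) = false) ?hF5 //; apply/negbTE; rewrite neq_ltn ha.
Qed.
End Step.

(** * One randomized trial and its repetition *)

Definition c_zero :=
  for sx upto !sD + #1 in sy {{
    sto aHs$[!sx] ::= #0;; sto aACC$[!sx] ::= #0;; sto aF$[!sx] ::= #0 }}.

(** Only the multiples of one size are visited, so all sizes together cost a harmonic sum. The
    variable [sc] holds the multiplicity plus one; where it divides the exponent the weight is minus
    the multiplicity, represented as [sP] minus its residue. *)
Definition c_hrow :=
  for sj upto !sD / (!sv + #1) in sj' {{
    spw ::= !spw * !sr %% !sP;;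
    sx ::= (!sv + #1) * (!sj + #1);;
    If (!sj + #1) %% !sc == #0 {{ sy ::= !sP - (!sc - #1) %% !sP }} Else {{ sy ::= #1 }};;
    sto aHs$[!sx] ::= (aHs$[!sx] + (!sv + #1) * !spw * !sy) %% !sP }}.

(** A drawn word may be as large as the word size permits, beyond the bound [M] of checked
    expressions, so its reduction modulo [sP] is a [Wrap] operation. *)
Definition c_h :=
  for sv upto !sS in sv' {{
    sx ::= !sTau * (!sS + #1) + (!sv + #1);;
    sr ::= Wrap Mod (aRND$[!sx]) (!sP);;
    spw ::= #1;; sc ::= aC$[!sv + #1] + #1;;
    c_hrow }}.

Definition c_trial :=
  c_zero;; c_h;; sto aF$[#0] ::= #1;; si ::= #0;;
  for 52 upto !sD in 53 {{ c_step }};;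
  for sx upto !sD + #1 in sy {{
    If aF$[!sx] == #0 {{ Skip }} Else {{ sto aH$[!sx] ::= #1 }} }}.

Definition c_ss :=
  for sx upto !sD + #1 in sy {{ sto aH$[!sx] ::= #0 }};;
  for sTau upto !sT in sT' {{ c_trial }}.

(** [lb i] is at most the sum of the powers of two dividing [i], and [2 ^ k] divides [D %/ 2 ^ k] of
    the numbers up to [D], so each of the [L] powers contributes at most [D]. Hence the block
    products of the online convolution have total length [O(D * L)]. *)
Lemma sum_lb D L : D < 2 ^ L -> \sum_(i < D) lb i.+1 <= D * L.
Proof.
move=> DL.
apply: (@leq_trans (\sum_(i < D) \sum_(k < L) 2 ^ k * (2 ^ k %| i.+1))).
  apply: leq_sum => i _; have hi := ltn_ord i.
  have lL : logn 2 i.+1 < L.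
    by rewrite -(ltn_exp2l (m := 2)) //; apply: leq_ltn_trans DL; apply: leq_trans (dvdn_leq _ (lb_dvd i.+1)) hi.
  by rewrite (bigD1 (Ordinal lL)) //= lb_dvd muln1 leq_addr.
rewrite exchange_big /= mulnC -[X in _ <= X * _]card_ord -sum_nat_const.
apply: leq_sum => k _; rewrite -big_distrr /= mulnC.
apply: leq_trans (leq_trunc_div D (2 ^ k)).
by rewrite leq_mul2r divn_count_dvd big_add1 /= big_mkord leqnn orbT.
Qed.

(** Trial [tau] reads its own [S.+1] words, disjoint from those of the other trials. *)
Definition hit p (C RND : nat -> nat) S tau y : bool :=
  ((gf C (fun v => (RND (tau * S.+1 + v)%N)%:R : 'F_p) S)`_y != 0)%R.

Section Trial.
Variables (w : nat) (inp : nat -> nat) (ilim lim M : nat).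
Local Notation W := (2 ^ w).
Local Notation triple := (triple w inp ilim lim).
Local Notation wbd := (wbd w).
Hypotheses (M2 : 100 < M) (MW : M ^ 12 < W) (Mlim : M ^ 5 < lim).
Let M1 : 1 < M. Proof. exact: ltn_trans M2. Qed.
Let c1 : 1 <= M. Proof. exact: ltnW M1. Qed.
Local Notation M_W := (M_W M2 MW).
Local Notation M_lim := (M_lim M2 Mlim).
Local Notation t_forc := (t_forc M2 MW).
Ltac okt := okd_tac M1 MW Mlim.
Ltac oks := oks_tac M1 MW Mlim.

Lemma c_zero_ok s D : rg s sD = D -> D < M ->
  triple c_zero s (4 * D + 6) (fun s' => forall k, k <= D ->
    [/\ ar s' aHs k = 0, ar s' aACC k = 0 & ar s' aF k = 0]).
Proof.
move=> hD DM.
apply: (t_forc (N := D.+1) (B := 3) (I := fun j s1 => forall k, k < j ->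
    [/\ ar s1 aHs k = 0, ar s1 aACC k = 0 & ar s1 aF k = 0])) => //.
- by oks; rewrite hD ltnW.
- by rewrite /= hD addn1.
- move=> j s1 hj IH fr fa.
  have lj : j < lim by apply: M_lim; lia.
  do 2 (apply: t_sto; [by oks|by oks|by []|]).
  apply: t_sto1; [by oks|by oks|by []|by []|].
  move=> k; rewrite ltnS leq_eqVlt => /orP[/eqP->|/IH[h1 h2 h3]] /=.
    by rewrite !eqxx.
  by rewrite h1 h2 h3 !if_same.
- by lia.
Qed.

Section Row.
Variables (p : nat) (c : nat -> nat) (r : nat -> 'F_p).
Hypothesis pp : prime p.
Let castm m : ((m %% p)%N%:R = m%:R :> 'F_p)%R. Proof. exact: Fp_nat_mod. Qed.
Let castp : (p%:R = 0 :> 'F_p)%R. Proof. by rewrite -castm modnn. Qed.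

Lemma c_hrow_ok s D v : rg s sD = D -> rg s sv = v -> rg s sP = p -> D + v + 2 <= M -> p <= M -> c v.+1 < M ->
  rg s sr < p -> ((rg s sr)%:R)%R = r v.+1 -> rg s sc = (c v.+1).+1 -> rg s spw = 1 ->
  (forall k, k <= D -> ar s aHs k < p) ->
  triple c_hrow s (6 * (D %/ v.+1) + 2) (fun s' => forall k, k <= D ->
    ar s' aHs k < p /\ ((ar s' aHs k)%:R = (ar s aHs k)%:R + lgd c r v.+1 k)%R).
Proof.
move=> hD hv hp DM pM cM hr hrr hc hw hH.
have p1 := prime_gt1 pp; have p0 : 0 < p by lia.
apply: (t_forc (N := D %/ v.+1) (B := 5) (I := fun j s1 => 
  [/\ rg s1 spw <= M, ((rg s1 spw)%:R = r v.+1 ^+ j)%R &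
   forall k, k <= D -> ar s1 aHs k < p /\ ((ar s1 aHs k)%:R = (ar s aHs k)%:R +
     if (k <= v.+1 * j)%N then lgd c r v.+1 k else 0)%R])).
- by oks; lia.
- by rewrite /= hD hv addn1.
- by have := leq_div D v.+1; lia.
- split; rewrite /= ?hw // => k hk; split; first exact: hH.
  rewrite muln0 leqn0; case: eqP => [->|_]; last by rewrite addr0.
  by rewrite /lgd ltnn andbF addr0.
- move=> j s1 hj [h1 h2 h3] fr fa.
  have vj : v.+1 * j.+1 <= D by apply: leq_trans (leq_trunc_div D v.+1); rewrite mulnC leq_mul2r hj orbT.
  have ej : j.+1 <= D by apply: leq_trans vj; rewrite leq_pmull.
  have e1 : rg s1 sv = v by rewrite fr.
  have e2 : rg s1 sP = p by rewrite fr.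
  have e3 : rg s1 sr = rg s sr by rewrite fr.
  have e4 : rg s1 sc = (c v.+1).+1 by rewrite fr.
  apply: t_asg; first by oks; lia.
  apply: t_asg; first by oks; lia.
  set s2 := setr _ sx _.
  have x2 : rg s2 sx = v.+1 * j.+1 by rewrite /= e1 !addn1.
  have w2 : rg s2 spw = rg s1 spw * rg s sr %% p by rewrite /= e2 e3.
  have w2' : rg s2 spw < p by rewrite w2 ltn_mod.
  have p2 : rg s2 sP = p by [].
  have v2 : rg s2 sv = v by [].
  have j2 : rg s2 sj = j by [].
  have c2 : rg s2 sc = (c v.+1).+1 by [].
  have a2 k : ar s2 aHs k = ar s1 aHs k by [].
  move: s2 x2 w2 w2' p2 v2 j2 c2 a2 => s2 x2 w2 w2' p2 v2 j2 c2 a2.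
  apply: (t_seq (T1 := 2) (T2 := 1) (Q1 := fun s3 => rg s3 sy <= M /\
    ((rg s3 sy)%:R = (if ((c v.+1).+1 %| j.+1)%N then - (c v.+1)%:R else 1) :> 'F_p)%R)) => //.
    apply: t_if; first by oks; rewrite ?c2; lia.
    + move=> hc1; have {}hc1 : (c v.+1).+1 %| j.+1.
        by move: hc1; rewrite /= j2 c2 addn1 /dvdn; case: (j.+1 %% _ == 0).
      apply: t_asg1 => //.
        by oks; rewrite ?p2 ?c2 ?subn1 //=; try lia; apply: ltnW; rewrite ltn_mod.
      rewrite /= p2 c2 subn1 /=; split; first by apply: leq_trans (leq_subr _ _) pM.
      rewrite hc1 natrB; last by apply: ltnW; rewrite ltn_mod.
      by rewrite castp castm sub0r.
    + move=> hc1; have {}hc1 : ((c v.+1).+1 %| j.+1) = false.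
        by move: hc1; rewrite /= j2 c2 addn1 /dvdn; case: (j.+1 %% _ == 0).
      by apply: t_asg1; [oks|by []|split=> //; rewrite hc1].
  move=> s3 [y1 y2] fr3 fa3.
  have x3 : rg s3 sx = v.+1 * j.+1 by rewrite fr3.
  have w3 : rg s3 spw = rg s2 spw by rewrite fr3.
  have p3 : rg s3 sP = p by rewrite fr3.
  have v3 : rg s3 sv = v by rewrite fr3.
  have a3 k : ar s3 aHs k = ar s1 aHs k by rewrite fa3.
  have [b1 b2] := h3 _ vj.
  apply: t_sto1; [by oks; lia| | by apply: M_lim; rewrite /= x3; lia|by []|].
    by oks; rewrite ?x3 ?a3; lia.
  rewrite /= w3; split; first by lia.
    by rewrite w2 castm natrM h2 hrr exprSr.
  move=> k hk; rewrite /= ?x3 ?v3 ?p3 ?w3 ?a3; case: (k =P v.+1 * j.+1) => [->|ne].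
    split; first by rewrite ltn_mod.
    rewrite castm natrD b2 leqnn (_ : (v.+1 * j.+1 <= v.+1 * j) = false) ?addr0; last first.
      by rewrite leq_pmul2l // ltnn.
    congr (_ + _)%R; rewrite /lgd dvdn_mulr // mulKn //= ?muln_gt0 /= !natrM addn1 y2 w2 castm natrM h2 hrr exprSr.
    by rewrite !mulrA.
  have [d1 d2] := h3 k hk; split=> //; rewrite d2; congr (_ + _)%R.
  case: leqP => hkj; first by rewrite (leq_trans hkj) // leq_mul2l leqnSn orbT.
  case: leqP => // hkj2; rewrite /lgd; case: ifP => // /andP[/dvdnP[q eq] _].
  by move: hkj hkj2 ne; rewrite eq (mulnC q) ltn_pmul2l // leq_pmul2l // => l1 l2 []; congr (_ * _); lia.
- by lia.
- move=> s1 [h1 h2 h3] _ _ k hk; have [d1 d2] := h3 k hk; split=> //; rewrite [LHS]d2; congr (_ + _)%R.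
  case: leqP => // hkj; rewrite /lgd; case: ifP => // /andP[/dvdnP[q eq] k0].
  by move: hkj; rewrite eq (mulnC q) ltn_pmul2l // ltnNge leq_divRL // -eq hk.
Qed.

Lemma c_h_ok s D S tau L : rg s sD = D -> rg s sS = S -> rg s sP = p -> rg s sTau = tau ->
   S <= D -> D + D + 2 <= M -> p <= M -> tau <= M -> D < 2 ^ L ->
  (forall v, c v < M) -> (forall v, v <= S -> ar s aC v = c v) ->
  (forall v, v <= S -> ((ar s aRND (tau * S.+1 + v))%:R)%R = r v) ->
  (forall k, k <= D -> ar s aHs k = 0) ->
  triple c_h s (6 * D * L + 8 * D + 2) (fun s' => forall k, k <= D ->
    ar s' aHs k < p /\ ((ar s' aHs k)%:R = lgds c r S k)%R).
Proof.
move=> hD hS hp ht SD DM pM tM DL cM hC hR h0.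
have p1 := prime_gt1 pp; have p0 : 0 < p by lia.
apply: (@t_for _ _ _ _ _ _ _ _ _ S (fun v => 6 * (D %/ v.+1) + 6) _ (fun v s1 => forall k, k <= D ->
    ar s1 aHs k < p /\ ((ar s1 aHs k)%:R = lgds c r v k)%R)) => //.
- by apply: M_W; lia.
- by move=> k hk /=; rewrite h0 // /lgds big_geq.
- move=> v s1 hv IH fr fa.
  have e1 : rg s1 sTau = tau by rewrite fr.
  have e2 : rg s1 sS = S by rewrite fr.
  have e3 : rg s1 sP = p by rewrite fr.
  have e4 : rg s1 sD = D by rewrite fr.
  have a1 k : ar s1 aC k = ar s aC k by rewrite fa.
  have a2 k : ar s1 aRND k = ar s aRND k by rewrite fa.
  have ic : tau * (S + 1) + (v + 1) = tau * S.+1 + v.+1 by rewrite !addn1.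
  have -> : 6 * (D %/ v.+1) + 6 = (6 * (D %/ v.+1) + 2).+4 by lia.
  apply: t_asg; first by oks; lia.
  set s2 := setr _ sx _.
  have x2 : rg s2 sx = tau * S.+1 + v.+1 by rewrite /= e1 e2 ic.
  (* The index of a random word can exceed [M], so the degree count does not cover this access and
     the array bound is checked by hand. *)
  have hlim : tau * S.+1 + v.+1 < lim.
    apply: leq_ltn_trans Mlim; apply: (@leq_trans (M * M)).
      have : tau * S.+1 <= M * S.+1 by rewrite leq_mul2r tM orbT.
      have : M * (S.+1 + 1) <= M * M by rewrite leq_mul2l; apply/orP; right; lia.
      by rewrite mulnDr muln1; lia.
    by rewrite -[M * M]/(M ^ 2) leq_exp2l.
  apply: t_asg; first by rewrite /= e1 e2 ic hlim.
  apply: t_asg; first by oks.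
  apply: t_asg.
    by oks; rewrite ?a1 ?addn1 ?hC //; try lia; apply: ltnW.
  apply: t_weak (c_hrow_ok (D := D) (v := v) _ _ _ _ _ _ _ _ _ _ _) (leqnn _) _ => //; try lia.
  + by rewrite /= e1 e2 ic e3 ltn_mod.
  + by rewrite /= e1 e2 ic e3 castm a2 hR.
  + by rewrite /= addn1 a1 hC ?addn1.
  + by move=> k /= /IH[].
  move=> s3 h3 k hk; have [d1 d2] := h3 k hk; split=> //; rewrite d2 /=.
  by have [_ ->] := IH k hk; rewrite /lgds [RHS]big_nat_recr.
- have hh : \sum_(i < S) D %/ i.+1 <= D * L.
    apply: leq_trans (harmonic D L).
    rewrite -(big_mkord xpredT (fun i => D %/ i.+1)) -(big_add1 _ _ 0 S.+1 xpredT (fun i => D %/ i)).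
    rewrite [X in _ <= X](@big_cat_nat _ _ _ S.+1) //= ?leq_addr //; lia.
  rewrite (eq_bigr (fun i : 'I_S => 6 * (D %/ i.+1) + 7)); last by move=> i _; lia.
  rewrite big_split /= sum_nat_const card_ord -big_distrr /= -[6 * D * L]mulnA.
  by move: hh; move: (\sum_(i < S) D %/ i.+1) (D * L) => X Y hh; lia.
Qed.

(* Dividing the recurrence by [i] is legitimate because [i <= D < p]. *)
Lemma gf_unique S (f : nat -> 'F_p) i : 0 < i < p ->
  (forall a, a < i -> (f a = (gf c r S)`_a)%R) ->
  (i%:R * f i = \sum_(a < i) f a * lgds c r S (i - a)%N)%R -> (f i = (gf c r S)`_i)%R.
Proof.
move=> /andP[i0 ip] hf he.
have ne : (i%:R != 0 :> 'F_p)%R.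
  apply/negP => /eqP h; have : i = 0 by apply: (@natr_Fp_inj p) => //; lia.
  by lia.
apply: (mulfI ne); rewrite he gf_rec big_ord_recl.
rewrite [X in (X * _)%R](_ : _ = 0%R); last first.
  by rewrite /lgds big1 // => v _; rewrite /lgd andbF.
rewrite mul0r add0r (reindex_inj rev_ord_inj) /=; apply: eq_bigr => a _.
have ha := ltn_ord a; rewrite hf; last by lia.
rewrite /bump /= add1n mulrC; congr (lgds _ _ _ _ * _`_ _)%R; lia.
Qed.
End Row.

Lemma c_online_ok s D S p L (c : nat -> nat) (r : nat -> 'F_p) :
  rg s sD = D -> rg s sP = p -> rg s slg = L -> rg s si = 0 ->
  D < 2 ^ L -> prime p -> D < p -> 
  8 * D + 8 <= M -> L <= M -> p <= M -> 16 * 2 ^ L * L.+2 * (D.+1 * (p * p)) <= M ->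
  wbd (ar s aP) ->
  (forall k, k <= D -> ar s aHs k < p /\ ((ar s aHs k)%:R = lgds c r S k)%R) ->
  (forall k, 0 < k <= D -> ar s aINV k < p /\ k * ar s aINV k %% p = 1) ->
  (forall k, k <= D -> ar s aACC k = 0) ->
  (forall k, k <= D -> ar s aF k = (k == 0)) ->
  triple (For 52 53 (!sD)%X c_step) s (4100 * D * L.+2 ^ 5 + 2) (fun s' => wbd (ar s' aP) /\
    forall k, k <= D -> ar s' aF k < p /\ ((ar s' aF k)%:R = (gf c r S)`_k)%R).
Proof.
move=> hD hp hL hi DL pp Dp DM LL pM PM hw hH hI hA hF.
have p1 := prime_gt1 pp; have p0 : 0 < p by lia.
apply: (@t_for _ _ _ _ _ _ _ _ _ D (fun i => 4040 * lb i.+1 * L.+2 ^ 4 + 4 * L + 20) _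
  (fun i s1 => [/\ rg s1 si = i, wbd (ar s1 aP), 
     [/\ forall k, k <= D -> ar s1 aF k <= M, forall k, k <= i -> ar s1 aF k < p &
     forall k, k <= i -> ((ar s1 aF k)%:R = (gf c r S)`_k)%R],
     forall k, k <= D -> ar s1 aACC k < p &
     forall k, i < k <= D -> ((ar s1 aACC k)%:R = \sum_(a < cov k i) (ar s1 aF a)%:R * lgds c r S (k - a)%N)%R])).
- by oks.
- by rewrite /= hD.
- by apply: M_W; lia.
- split=> //.
  + split=> k hk /=; first by rewrite hF //; case: eqP.
      by rewrite hF; [case: eqP; lia|lia].
    by move: hk; rewrite leqn0 => /eqP ->; rewrite hF // gf0.
  + by move=> k hk /=; rewrite hA.
  + by move=> k hk /=; rewrite hA ?big_ord0 //; lia.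
- move=> i s1 iD [h1 h2 [h3 h4 h5] h6 h7] fr fa.
  have e1 : rg s1 sD = D by rewrite fr.
  have e2 : rg s1 sP = p by rewrite fr.
  have e3 : rg s1 slg = L by rewrite fr.
  apply: t_weak (@c_step_ok w inp ilim lim M M2 MW Mlim (setr s1 52 i) i D p L (lgds c r S) _ _ _ _ _ _ _ _ _ _ _ _ _ _ _ _ _ _) (leqnn _) _ => //.
  + by move=> k hk /=; rewrite fa //; apply: hH.
  + by move=> k hk /=; rewrite fa //; apply: hI.
  move=> s2 [k1 k2 [k3 [k4 k5]] k6 k7].
  have eF k : k <= i -> ar s2 aF k = ar s1 aF k by move=> hk; rewrite k3 //; apply/eqP; lia.
  split=> //; split.
  + by move=> k hk; case: (k =P i.+1) => [->|/eqP ne]; [lia|rewrite k3 //; apply: h3].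
  + by move=> k; rewrite leq_eqVlt ltnS => /orP[/eqP->|hk]; [exact: k4|rewrite eF //; exact: h4].
  + move=> k; rewrite leq_eqVlt ltnS => /orP[/eqP->|hk]; last by rewrite eF //; apply: h5.
    apply: (@gf_unique p c r pp S (fun a => (ar s2 aF a)%:R)%R i.+1) => [|a|]; first by lia.
      by rewrite ltnS => ha; rewrite eF //; apply: h5.
    rewrite [LHS]k5; apply: eq_bigr => a _; rewrite eF //; exact: ltnSE (ltn_ord a).
- have hh := sum_lb DL; rewrite (eq_bigr (fun i : 'I_D => 4040 * L.+2 ^ 4 * lb i.+1 + (4 * L + 21))); last by move=> i _; rewrite mulnAC; lia.
  rewrite big_split /= sum_nat_const card_ord -big_distrr /=.
  rewrite leq_add2r; set X := L.+2 ^ 4.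
  have X0 : 0 < X by rewrite expn_gt0.
  apply: (@leq_trans (4040 * X * (D * L) + D * (21 * L.+2 * X))).
    apply: leq_add; first by rewrite leq_mul2l hh orbT.
    rewrite leq_mul2l; apply/orP; right; apply: (@leq_trans (21 * L.+2)); first by lia.
    by rewrite leq_pmulr.
  rewrite expnSr -/X.
  have : D * L * X <= D * L.+2 * X by rewrite leq_mul2r leq_mul2l leqW ?orbT //; lia.
  rewrite (_ : 4040 * X * (D * L) = 4040 * (D * L * X)); last by ring.
  rewrite (_ : D * (21 * L.+2 * X) = 21 * (D * L.+2 * X)); last by ring.
  rewrite (_ : 4100 * D * (X * L.+2) = 4100 * (D * L.+2 * X)); last by ring.
  lia.
- by move=> s1 [h1 h2 [h3 h4 h5] h6 h7] _ _; split=> // k hk; split; [apply: h4|apply: h5].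
Qed.

Lemma c_ss_ok s D S p L T (c : nat -> nat) :
  rg s sD = D -> rg s sS = S -> rg s sP = p -> rg s slg = L -> rg s sT = T ->
  D < 2 ^ L -> prime p -> D < p -> S <= D ->
  8 * D + 8 <= M -> L <= M -> p <= M -> T <= M -> 16 * 2 ^ L * L.+2 * (D.+1 * (p * p)) <= M ->
  wbd (ar s aP) ->
  (forall v, v <= S -> ar s aC v = c v) -> (forall v, c v < M) ->
  (forall k, 0 < k <= D -> ar s aINV k < p /\ k * ar s aINV k %% p = 1) ->
  triple c_ss s (T * (5000 * D.+1 * L.+2 ^ 5) + 2 * D + 10) (fun s' => wbd (ar s' aP) /\
    forall y, y <= D -> ar s' aH y = has (fun tau => hit p c (ar s aRND) S tau y) (iota 0 T)).
Proof.
move=> hD hS hp hL hT DL pp Dp SD DM LL pM TM PM hw hC cM hI.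
have p1 := prime_gt1 pp; have p0 : 0 < p by lia.
apply: (t_seq (T1 := 2 * D + 4) (T2 := T * (5000 * D.+1 * L.+2 ^ 5) + 2)
   (Q1 := fun s1 => forall k, k <= D -> ar s1 aH k = 0)).
- apply: (t_forc (N := D.+1) (B := 1) (I := fun j s1 => forall k, k < j -> ar s1 aH k = 0)) => //.
  + by oks; lia.
  + by rewrite /= hD addn1.
  + by lia.
  + move=> j s1 hj IH fr fa; apply: t_sto1; [by oks|by oks|by apply: M_lim; rewrite /=; lia|by []|].
    by move=> k; rewrite ltnS leq_eqVlt => /orP[/eqP->|/IH h] /=; rewrite ?eqxx // h if_same.
  + by lia.
- by lia.
move=> s1 h0 fr0 fa0.
have posX : 0 < L.+2 ^ 5 by rewrite expn_gt0.
apply: (@t_for _ _ _ _ _ _ _ _ _ T (fun=> 5000 * D.+1 * L.+2 ^ 5 - 1) _ (fun tau s2 =>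
  wbd (ar s2 aP) /\ forall y, y <= D -> ar s2 aH y = has (fun tau => hit p c (ar s aRND) S tau y) (iota 0 tau))).
- by oks.
- by rewrite /= fr0.
- by apply: M_W.
- by rewrite /= fa0.
- move=> tau s2 ht [w2 h2] fr fa.
  have eR x : x \in [:: sD; sS; sP; slg] -> rg s2 x = rg s x.
    by rewrite !inE => /or4P[] /eqP ->; rewrite fr //= fr0.
  have [e1 e2 e3 e4] : [/\ rg s2 sD = D, rg s2 sS = S, rg s2 sP = p & rg s2 slg = L].
    by rewrite !eR // !inE.
  have eC k : ar s2 aC k = ar s aC k by rewrite fa // fa0.
  have eI k : ar s2 aINV k = ar s aINV k by rewrite fa // fa0.
  have eN k : ar s2 aRND k = ar s aRND k by rewrite fa // fa0.
  pose r v : 'F_p := ((ar s aRND (tau * S.+1 + v)%N)%:R)%R.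
  apply: (@t_weak _ _ _ _ _ _ ((4 * D + 6) + ((6 * D * L + 8 * D + 2) + ((4100 * D * L.+2 ^ 5 + 2) + (4 * D + 6)).+2)) (fun s' =>
    wbd (ar s' aP) /\ forall y, y <= D -> ar s' aH y = if hit p c (ar s aRND) S tau y then 1 else ar s2 aH y)); first last.
  + move=> s' [w' h']; split=> // y hy; rewrite h' // h2 // -{1}[tau.+1]addn1 iotaD has_cat /= orbF.
    by case: (hit _ _ _ _ _ _); rewrite ?orbT ?orbF.
  + have : L.+2 <= L.+2 ^ 5 by rewrite -{1}[L.+2]expn1 leq_exp2l.
    move: (L.+2 ^ 5) posX => X X0 LX.
    have h1 : D * L + D + D <= D * X by rewrite -addnA addnn -muln2 -mulnDr addn2 leq_mul2l LX orbT.
    rewrite -[6 * D * L]mulnA -[4100 * D * X]mulnA -[5000 * D.+1 * X]mulnA [D.+1 * X]mulSn.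
    by move: (D * L) (D * X) h1 X0 => a b; clear; lia.
  apply: (t_seq (T2 := (6 * D * L + 8 * D + 2) + ((4100 * D * L.+2 ^ 5 + 2) + (4 * D + 6)).+2) (c_zero_ok (s := setr s2 sTau tau) (D := D) e1 _)) => //; first by lia.
  move=> s3 h3 fr3 fa3.
  apply: (t_seq (T2 := ((4100 * D * L.+2 ^ 5 + 2) + (4 * D + 6)).+2)
    (@c_h_ok p c r pp s3 D S tau L _ _ _ _ _ _ _ _ _ _ _ _ _)) => //; try lia.
  + by rewrite fr3.
  + by rewrite fr3.
  + by rewrite fr3.
  + by rewrite fr3.
  + by move=> v hv; rewrite fa3 //= eC hC.
  + by move=> v hv; rewrite fa3 //= eN.
  + by move=> k hk; have [] := h3 _ hk.
  move=> s4 h4 fr4 fa4.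
  apply: t_sto; [by oks|by oks|by apply: M_lim|].
  apply: t_asg; first by oks.
  set s5 := setr _ si _.
  have eS5 k : ar s5 aF k = if k == 0 then 1 else ar s3 aF k by rewrite /= -fa4.
  apply: (t_seq (T2 := 4 * D + 6) (@c_online_ok s5 D S p L c r _ _ _ _ _ _ _ _ _ _ _ _ _ _ _ _)) => //; try lia.
  + by rewrite /= fr4 //= fr3.
  + by rewrite /= fr4 //= fr3.
  + by rewrite /= fr4 //= fr3.
  + by rewrite /= fa4 //= fa3.
  + by move=> k hk; rewrite /= fa4 //= fa3 //= eI; apply: hI.
  + by move=> k hk; rewrite /= fa4 //; have [] := h3 _ hk.
  + by move=> k hk; rewrite eS5; case: eqP => // _; have [] := h3 _ hk.
  move=> s6 [w6 h6] fr6 fa6.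
  have eH6 y : ar s6 aH y = ar s2 aH y by rewrite fa6 //= fa4 //= fa3.
  apply: (t_forc (N := D.+1) (B := 2) (I := fun j s7 => wbd (ar s7 aP) /\ forall y,
     ar s7 aH y = if (y < j) && hit p c (ar s aRND) S tau y then 1 else ar s2 aH y)).
  + by oks; rewrite fr6 //= fr4 //= fr3 //=; lia.
  + by rewrite /= fr6 //= fr4 //= fr3 //= e1 addn1.
  + by lia.
  + by split=> // y; rewrite /= eH6.
  + move=> j s7 hj [w7 IH] fr7 fa7.
    have [f1 f2] := h6 j hj.
    have eh : (ar s7 aF j == 0) = ~~ hit p c (ar s aRND) S tau j.
      rewrite fa7 // /hit negbK -f2; apply/eqP/eqP => [->//|] h.
      by apply: (@natr_Fp_inj p) => //; rewrite h.
    apply: t_if; first by oks; lia.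
    * rewrite [eval _ _ _ _]/= eh => hc; apply: t_skip; split=> // y; rewrite /= IH ltnS (leq_eqVlt y j).
      case: (y =P j) => [->|//]; rewrite ltnn /=.
      by case: (hit _ _ _ _ _ _) hc.
    * rewrite [eval _ _ _ _]/= eh => hc; apply: t_sto1; [by oks|by oks|by apply: M_lim; rewrite /=; lia|by []|].
      split=> // y; rewrite /= IH ltnS (leq_eqVlt y j).
      case: (y =P j) => [->|//]; rewrite /=.
      by case: (hit _ _ _ _ _ _) hc.
  + by lia.
  + by move=> s7 [w7 h7] _ _; split=> // y hy /=; rewrite h7 ltnS hy.
- by rewrite sum_nat_const card_ord subnS subn0 prednK // !muln_gt0.
- by [].
Qed.
End Trial.

(** * Additive combinatorics of dense multisets *)

Section SubLists.

Definition sub (l : seq nat) y := exists l1 l2, perm_eq l (l1 ++ l2) /\ sumn l1 = y.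

Lemma sub_perm l l' y : perm_eq l l' -> sub l y -> sub l' y.
Proof.
by move=> h [l1 [l2 [p e]]]; exists l1, l2; split=> //; rewrite -(permPl h).
Qed.

Lemma sub0 l : sub l 0.
Proof. by exists [::], l. Qed.

Lemma sub_cat l l' y y' : sub l y -> sub l' y' -> sub (l ++ l') (y + y').
Proof.
move=> [l1 [l2 [p e]]] [k1 [k2 [p' e']]]; exists (l1 ++ k1), (l2 ++ k2).
split; last by rewrite sumn_cat e e'.
by rewrite (perm_trans (perm_cat p p')) // -!catA perm_cat2l perm_catCA.
Qed.

Lemma sub_all l : sub l (sumn l).
Proof. by exists l, [::]; rewrite cats0. Qed.

Lemma sub_catl l l' y : sub l y -> sub (l ++ l') y.
Proof. by move=> h; rewrite -[y]addn0; apply: sub_cat (sub0 _). Qed.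

Lemma sub_cons x l y : sub (x :: l) y -> sub l y \/ exists2 z, y = x + z & sub l z.
Proof.
move=> [l1 [l2 [p e]]].
have : x \in l1 ++ l2 by rewrite -(perm_mem p) mem_head.
rewrite mem_cat => /orP[h|h].
  right; exists (sumn (rem x l1)).
    by rewrite -e (perm_sumn (perm_to_rem h)).
  exists (rem x l1), l2; split=> //.
  by rewrite -(perm_cons x) (perm_trans p) // -cat_cons perm_cat2r perm_to_rem.
left; exists l1, (rem x l2); split=> //.
rewrite -(perm_cons x) (perm_trans p) //.
rewrite (perm_trans (y := l1 ++ x :: rem x l2)) ?perm_cat2l ?perm_to_rem //.
by rewrite perm_catC /= perm_cons perm_catC.
Qed.

(** A pair [(a, e)] stands for the two items [a] and [a + e]. Taking exactly one of them contributes
    [a] for certain and [e] by choice, so a set of pairs acts like a fixed base plus the small items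
    [e]. *)
Definition items (P : seq (nat * nat)) := flatten [seq [:: p.1; p.1 + p.2] | p <- P].

Lemma sub_items P R y : sub ([seq p.2 | p <- P] ++ R) y ->
  sub (items P ++ R) (sumn [seq p.1 | p <- P] + y).
Proof.
elim: P y => [//|[a e] P IH] y /= /sub_cons[/IH h|[z -> /IH h]].
  by have := sub_cat (sub_catl [:: a + e] (sub_all [:: a])) h; rewrite /= addn0 addnA.
have := sub_cat (sub_catl [:: a] (sub_all [:: a + e])) h; rewrite /= addn0.
rewrite (_ : a + e + _ = a + sumn [seq p.1 | p <- P] + (e + z)); last by lia.
by apply: sub_perm; apply/permP => p /=; rewrite addnCA.
Qed.

Lemma sumn_items P : sumn (items P) = 2 * sumn [seq p.1 | p <- P] + sumn [seq p.2 | p <- P].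
Proof. by elim: P => //= -[a e] P /= ->; lia. Qed.

Lemma size_items P : size (items P) = 2 * size P.
Proof. by elim: P => //= p P ->; lia. Qed.

Lemma items_cat P Q : items (P ++ Q) = items P ++ items Q.
Proof. by rewrite /items map_cat flatten_cat. Qed.

Lemma items_perm P Q : perm_eq P Q -> perm_eq (items P) (items Q).
Proof. by move=> h; apply/perm_flatten/perm_map. Qed.

Lemma sumn_le_mul l B : (forall x, x \in l -> x <= B) -> sumn l <= size l * B.
Proof.
elim: l => //= x l IH h; rewrite mulSn leq_add ?IH ?h ?mem_head // => y hy.
by apply: h; rewrite inE hy orbT.
Qed.

Section ZeroSum.
Variables (T : eqType) (f : T -> nat) (d : nat).
Hypothesis d0 : 0 < d.

(* Two of the [d + 1] prefix sums agree modulo [d]. *)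
Lemma zero_seg (l : seq T) : d <= size l -> exists z r,
  [/\ perm_eq l (z ++ r), 0 < size z <= d & d %| sumn (map f z)].
Proof.
move=> hl; pose pre i := sumn (map f (take i l)).
pose g (i : 'I_d.+1) : 'I_d := Ordinal (ltn_pmod (pre i) d0).
have : ~~ injectiveb g.
  apply/negP => /injectiveP /leq_card; by rewrite !card_ord ltnn.
case/injectivePn => i [j ne e].
wlog ij : i j ne e / i < j.
  move=> H; case: (ltngtP i j) => h; [exact: (H i j)|by apply: (H j i); rewrite // eq_sym|].
  by move: ne; rewrite (val_inj h) eqxx.
have jd : j <= d by rewrite -ltnS.
exists (drop i (take j l)), (take i l ++ drop j l).
have e1 : take j l = take i l ++ drop i (take j l).
  by rewrite -{1}(cat_take_drop i (take j l)) take_takel // ltnW.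
split.
- by rewrite -{1}(cat_take_drop j l) {1}e1 -catA perm_catCA.
- by rewrite size_drop size_takel ?subn_gt0 ?ij //=; lia.
have e2 : pre j = pre i + sumn (map f (drop i (take j l))).
  by rewrite /pre {1}e1 map_cat sumn_cat.
by move/eqP: (congr1 val e) => /=; rewrite e2 -{1}[pre i]addn0 eqn_modDl mod0n eq_sym.
Qed.

(** Zero-sum segments are split off as long as [d] elements remain. This serves to make the base sum
    of a set of pairs divisible by [d], and to shrink a witness for a residue to fewer than [d]
    items. *)
Lemma zero_part (l : seq T) : exists z r,
  [/\ perm_eq l (z ++ r), size r < d & d %| sumn (map f z)].
Proof.
have [n] := ubnP (size l); elim: n l => // n IH l hn.
have [h|h] := ltnP (size l) d; first by exists [::], l.
have [z [r [p1 /andP[p2 _] p3]]] := zero_seg h.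
have e := perm_size p1; rewrite size_cat in e.
have [|z' [r' [q1 q2 q3]]] := IH r; first by lia.
exists (z ++ z'), r'; split=> //.
  by rewrite (perm_trans p1) // -catA perm_cat2l.
by rewrite map_cat sumn_cat dvdn_add.
Qed.
End ZeroSum.

Definition ap d E l := forall k, k * d <= E -> sub l (k * d).

(** Segments of at most [d] items whose sum is divisible by [d] are appended one at a time. Such a
    sum is at most [d * B <= E + d], so the shifted copy of the progression joins the old one
    without a gap. Fewer than [d] items are left over, which costs [d * B]. *)
Lemma ap_ext d E B l Q : 0 < d -> (forall x, x \in Q -> x <= B) -> d * B <= E + d ->
  ap d E l -> ap d (E + sumn Q - d * B) (l ++ Q).
Proof.
move=> d0; have [n] := ubnP (size Q); elim: n E l Q => // n IH E l Q hn hB hE hl.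
have [h|h] := ltnP (size Q) d.
  move=> k hk; apply: sub_catl; apply: hl; apply: leq_trans hk _.
  have : sumn Q <= d * B.
    by apply: leq_trans (sumn_le_mul hB) _; rewrite leq_mul2r ltnW ?orbT.
  by lia.
have [z [r [p1 /andP[p2 p2'] p3]]] := @zero_seg nat id d d0 Q h.
rewrite map_id in p3.
have zB : sumn z <= d * B.
  apply: (@leq_trans (size z * B)); last by rewrite leq_mul2r p2' orbT.
  apply: sumn_le_mul; by move=> x hx; apply: hB; rewrite (perm_mem p1) mem_cat hx.
have e := perm_size p1; rewrite size_cat in e.
have hlz : ap d (E + sumn z) (l ++ z).
  move=> k hk; have [k1|k1] := leqP (k * d) E; first by apply/sub_catl/hl.
  have /dvdnP[m em] := p3.
  have mk : m <= k.
    have : m * d < k.+1 * d by rewrite -em mulSn; lia.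
    by rewrite ltn_mul2r => /andP[_]; rewrite ltnS.
  rewrite -(subnK mk) mulnDl -em; apply: sub_cat (sub_all z).
  by apply: hl; rewrite mulnBl -em; lia.
have hf : ap d (E + sumn z + sumn r - d * B) ((l ++ z) ++ r).
  apply: IH hlz; [| |by lia].
    by rewrite -ltnS (leq_trans _ hn) // ltnS e -[X in X < _]add0n ltn_add2r.
  by move=> x hx; apply: hB; rewrite (perm_mem p1) mem_cat hx orbT.
move=> k hk; apply: (@sub_perm ((l ++ z) ++ r)).
  by rewrite -catA perm_cat2l perm_sym.
by apply: hf; move: hk; rewrite (perm_sumn p1) sumn_cat addnA.
Qed.
End SubLists.

(** * Disjoint pairs of items with prescribed differences *)

Section Pairs.

(** The pair of [v %/ b] and [v %% h] takes at most [(s %/ b).+1 * h] values. Two sizes with the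
    same code lie in one interval of length [b] and are congruent modulo [h], so they differ by a
    positive multiple of [h] below [b]. *)
Lemma code_pair (X : seq nat) (s h b : nat) : uniq X -> (forall x, x \in X -> x <= s) ->
  0 < h -> 0 < b -> (s %/ b).+1 * h < size X ->
  exists a e, [/\ a \in X, a + e \in X & h <= e < b].
Proof.
move=> uX hX h0 b0 hs.
pose c v := v %/ b * h + v %% h.
have : ~~ uniq (map c X).
  apply/negP => u; have : {subset map c X <= iota 0 ((s %/ b).+1 * h)}.
    move=> y /mapP[x /hX hx ->]; rewrite mem_iota /= add0n /c mulSn addnC.
    have : x %/ b * h <= s %/ b * h by rewrite leq_mul2r leq_div2r ?orbT.
    have := ltn_pmod x h0; lia.
  move/(uniq_leq_size u); rewrite size_map size_iota; lia.
move=> nu.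
have [x [y [hx hy xy e]]] : exists x y, [/\ x \in X, y \in X, x < y & c x = c y].
  have : ~ {in X &, injective c} by move=> inj; move: nu; rewrite map_inj_in_uniq // uX.
  move=> ni; apply: contrapT => ne; apply: ni => x y hx hy e.
  case: (ltngtP x y) => // l; case: ne; [by exists x, y|by exists y, x; rewrite e].
have e1 : x %/ b = y %/ b.
  move: (congr1 (fun z => z %/ h) e); rewrite /c !divnMDl // !(divn_small (ltn_pmod _ h0)); lia.
have e2 : x = y %[mod h].
  by move: (congr1 (fun z => z %% h) e); rewrite /c !modnMDl !modn_mod.
exists x, (y - x); rewrite subnKC; last exact: ltnW.
split=> //; apply/andP; split.
  have : h %| y - x by rewrite -eqn_mod_dvd ?(ltnW xy) //; apply/eqP.
  by move/dvdn_leq; rewrite subn_gt0; apply.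
move: (divn_eq y b) (divn_eq x b) (ltn_pmod y b0); rewrite e1.
by move: (y %/ b * b) (y %% b) (x %% b) => A B C -> -> hB; move: hB; clear; lia.
Qed.

Lemma code_pairs (X : seq nat) (s h b N : nat) : uniq X -> (forall x, x \in X -> x <= s) ->
  0 < h -> 0 < b -> (s %/ b).+1 * h + 2 * N < size X ->
  exists P Z, [/\ size P = N, perm_eq X (items P ++ Z) & forall p, p \in P -> h <= p.2 < b].
Proof.
move=> + + h0 b0; elim: N X => [|N IH] X uX hX hs; first by exists [::], X.
have [|a [e [ha hb he]]] := code_pair uX hX h0 b0; first by lia.
have ne : a + e != a by apply/eqP; lia.
have hb' : a + e \in rem a X by rewrite mem_rem_uniq // inE ne.
have p1 : perm_eq X (a :: a + e :: rem (a + e) (rem a X)).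
  by rewrite (perm_trans (perm_to_rem ha)) // perm_cons perm_to_rem.
have u2 : uniq (a :: a + e :: rem (a + e) (rem a X)) by rewrite -(perm_uniq p1).
have e1 := perm_size p1; rewrite /= in e1.
have [| | |P [Z [q1 q2 q3]]] := IH (rem (a + e) (rem a X)).
- by move: u2 => /= /and3P[].
- by move=> x hx; apply: hX; rewrite (perm_mem p1) !inE hx !orbT.
- by lia.
exists ((a, e) :: P), Z; split=> /=.
- by rewrite q1.
- by rewrite (perm_trans p1) // !perm_cons.
- by move=> p; rewrite inE => /orP[/eqP->|/q3].
Qed.

Definition pc (d : nat) (Z : seq nat) := count (fun v => v + d \in Z) Z.

(** An element belongs to at most two counted pairs, once as lower and once as upper end. Extracting
    a disjoint pair therefore destroys at most 4 pairs. *)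
Lemma pc_rem d z Z : uniq Z -> z \in Z -> pc d Z <= pc d (rem z Z) + 2.
Proof.
move=> uZ hz; rewrite /pc.
have p := perm_to_rem hz.
rewrite (permP p) /=.
have h : count (fun v => v + d \in Z) (rem z Z) <= count (fun v => v + d \in rem z Z) (rem z Z) + 1.
  apply: leq_trans (_ : count (predU (fun v => v + d \in rem z Z) (pred1 (z - d))) (rem z Z) <= _).
    apply: sub_count => v /= hv; have [e|/eqP ne] := v + d =P z; first by rewrite -e addnK eqxx orbT.
    by rewrite mem_rem_uniq // inE ne hv.
  apply: leq_trans (leq_addr (count (predI (fun v => v + d \in rem z Z) (pred1 (z - d))) (rem z Z)) _) _.
  by rewrite count_predUI leq_add2l count_uniq_mem ?rem_uniq // leq_b1.
by rewrite addnC; apply: leq_trans (leq_add h (leq_b1 _)) _; rewrite -addnA.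
Qed.

Lemma pc_pairs d N Z : uniq Z -> 0 < d -> 4 * N <= pc d Z ->
  exists P R, [/\ size P = N, perm_eq Z (items P ++ R) & forall p, p \in P -> p.2 = d].
Proof.
elim: N Z => [|N IH] Z uZ d0 hp; first by exists [::], Z.
have : has (fun v => v + d \in Z) Z by rewrite has_count -/(pc d Z); lia.
case/hasP => a ha hb.
have ne : a + d != a by apply/eqP; lia.
have hb' : a + d \in rem a Z by rewrite mem_rem_uniq // inE ne.
have p1 : perm_eq Z (a :: a + d :: rem (a + d) (rem a Z)).
  by rewrite (perm_trans (perm_to_rem ha)) // perm_cons perm_to_rem.
have u1 := rem_uniq a uZ.
have h1 := pc_rem d uZ ha; have h2 := pc_rem d u1 hb'.
have [| | |P [R [q1 q2 q3]]] := IH (rem (a + d) (rem a Z)) => //.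
- exact: rem_uniq.
- by lia.
exists ((a, d) :: P), R; split=> /=.
- by rewrite q1.
- by rewrite (perm_trans p1) // !perm_cons.
- by move=> p; rewrite inE => /orP[/eqP->|/q3].
Qed.

Lemma pc_filter d Z Y : uniq Z -> pc d Z <= pc d [seq v <- Z | v \notin Y] + 2 * size Y.
Proof.
elim: Y => [|y Y IH] uZ /=.
  by rewrite (eq_filter (a2 := predT)) ?filter_predT; [lia|].
apply: leq_trans (IH uZ) _; rewrite mulnS addnA leq_add2r.
set F := [seq v <- Z | v \notin Y].
have -> : [seq v <- Z | v \notin y :: Y] = rem y F.
  by rewrite rem_filter ?filter_uniq // -filter_predI; apply: eq_filter => v /=; rewrite inE negb_or.
have [hy|hy] := boolP (y \in F); first by apply: pc_rem => //; apply: filter_uniq.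
by rewrite rem_id // leq_addr.
Qed.

(** Coding with [h = 1] and [b = q.+1] gives [10 * q ^ 2] disjoint pairs with differences between 1
    and [q], because [s %/ q.+1 <= q ^ 2]. Some difference then occurs at least [10 * q] times. *)
Lemma exists_delta (X : seq nat) s q : uniq X -> (forall x, x \in X -> x <= s) ->
  0 < q -> s <= q ^ 3 -> 22 * q ^ 2 + 2 < size X -> exists2 d, 0 < d <= q & 10 * q <= pc d X.
Proof.
move=> uX hX q0 sq hs.
have hd : s %/ q.+1 <= q ^ 2.
  have : s %/ q.+1 <= s %/ q by apply: leq_div2l.
  have : s %/ q <= q ^ 3 %/ q by apply: leq_div2r.
  by rewrite expnSr mulnK // => h2 h1; apply: leq_trans h1 h2.
have [| | |P [Z [p1 p2 p3]]] := @code_pairs X s 1 q.+1 (10 * q ^ 2) uX hX => //; first by lia.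
apply: contrapT => hno.
have hc d : 0 < d <= q -> count (fun p => p.2 == d) P < 10 * q.
  move=> hd'; rewrite ltnNge; apply/negP => hh; apply: hno; exists d => //.
  apply: leq_trans hh _.
  have u : uniq (items P) by move: uX; rewrite (perm_uniq p2) cat_uniq => /andP[].
  have sb : {subset items P <= X} by move=> x hx; rewrite (perm_mem p2) mem_cat hx.
  rewrite /pc -!size_filter.
  have -> : size [seq p <- P | p.2 == d] = size [seq p.1 | p <- P & p.2 == d] by rewrite size_map.
  apply: uniq_leq_size.
    have us : subseq [seq p.1 | p <- P & p.2 == d] (items P).
      elim: (P) => // -[a e] P' IH.
      have -> : [seq p.1 | p <- (a, e) :: P' & p.2 == d] = (if e == d then [:: a] else [::]) ++ [seq p.1 | p <- P' & p.2 == d].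
        by rewrite /=; case: ifP.
      apply: (@cat_subseq _ _ _ [:: a; a + e] (items P')) => //.
      by case: ifP => _; rewrite ?sub0seq // sub1seq mem_head.
    exact: subseq_uniq us u.
  move=> x /mapP[[a e]]; rewrite mem_filter /= => /andP[/eqP -> hae] ->.
  have hin y : y \in [:: a; a + d] -> y \in X.
    move=> hy; apply/sb/flattenP; exists [:: a; a + d] => //; by apply/mapP; exists (a, d) => //; move: hae => ->.
  by rewrite mem_filter !hin ?inE ?eqxx ?orbT.
have : size P <= \sum_(1 <= d < q.+1) count (fun p => p.2 == d) P.
  have : forall p, p \in P -> 0 < p.2 < q.+1 by move=> p /p3.
  elim: (P) => [//|p P' IH] h /=; rewrite big_split /=.
  have hp := h p (mem_head _ _).
  rewrite -add1n leq_add //; last by apply: IH => p' hp'; apply: h; rewrite inE hp' orbT.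
  by rewrite (bigD1_seq p.2) ?iota_uniq ?mem_index_iota //= eqxx leq_addr.
have : \sum_(1 <= d < q.+1) count (fun p => p.2 == d) P <= \sum_(1 <= d < q.+1) (10 * q - 1).
  rewrite big_nat_cond [X in _ <= X]big_nat_cond; apply: leq_sum => d /andP[hd' _].
  have := hc d hd'; lia.
rewrite sum_nat_const_nat subn1 /= p1 => h1 h2.
have := leq_trans h2 h1; rewrite (_ : q * (10 * q - 1) = 10 * q ^ 2 - q); last first.
  by rewrite mulnBr muln1 -mulnn mulnCA.
have : q <= q ^ 2 by rewrite -mulnn leq_pmulr.
lia.
Qed.
End Pairs.

(** * Targets far from both ends *)

Section Dense.
Variables (s q lg d : nat) (X : seq nat) (Y : seq nat).
Hypotheses (q0 : 0 < q) (sq : s <= q ^ 3) (d0 : 0 < d <= q) (uX : uniq X)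
  (X0 : forall x, x \in X -> x <= s) (hd : 10 * q <= pc d X) (hX : 16 * q ^ 2 * (lg + 3) <= size X)
  (hY : size Y < d).

(* [X] minus [Y] splits into pairs differing by small amounts; at scale [2^j] the differences lie in [2^j, 2^j q]. *)
Lemma pairs_scale j : (0 < j -> 2 ^ j.-1 <= q ^ 2) -> j <= lg ->
  exists P Z, [/\ perm_eq [seq v <- X | v \notin Y] (items P ++ Z),
    size P <= 2 * q + j * (3 * q ^ 2 + q),
    d %| sumn [seq p.1 | p <- P] & ap d (2 ^ j * (q * d)) [seq p.2 | p <- P]].
Proof.
have [dp dq] := andP d0.
elim: j => [|j IH] hj jl.
  have uX' : uniq [seq v <- X | v \notin Y] by apply: filter_uniq.
  (* Excluding the fewer than [d <= q] sizes in [Y] destroys at most [2 * q] of the [10 * q] pairs;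
     the remaining [8 * q] contain [2 * q] disjoint ones. *)
  have h : 4 * (2 * q) <= pc d [seq v <- X | v \notin Y].
    by move: (pc_filter d Y uX) hd hY dq; move: (pc d X) (pc d _) (size Y); clear; lia.
  have [P [Z [p1 p2 p3]]] := pc_pairs uX' dp h.
  have [A [B [a1 a2 a3]]] := @zero_part _ (fun p : nat * nat => p.1) d dp P.
  exists A, (items B ++ Z); have sA : 2 * q = @size (nat * nat) A + @size (nat * nat) B by rewrite -p1 (perm_size a1) size_cat.
  have {}a2 : @size (nat * nat) B < d := a2.
  split=> //.
  - by rewrite (perm_trans p2) // catA perm_cat2r -items_cat items_perm.
  - by rewrite mul0n addn0 sA leq_addr.
  - have hA : all (fun p => p.2 == d) A.
      by apply/allP => p hp; rewrite p3 // (perm_mem a1) mem_cat hp.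
    have -> : [seq p.2 | p <- A] = nseq (size A) d.
      by elim: (A) hA => //= p A' IH /andP[/eqP -> /IH ->].
    move=> k; rewrite mul1n leq_pmul2r // => kq.
    exists (nseq k d), (nseq (size A - k) d); split; last by rewrite sumn_nseq mulnC.
    have kA : k <= @size (nat * nat) A by move: sA a2 dq kq; clear; lia.
    by rewrite -nseqD subnKC.
have hj' : 2 ^ j <= q ^ 2 by apply: (hj isT).
have [| |P [Z [p1 p2 p3 p4]]] := IH; [|lia|].
  by move=> j0; apply: leq_trans hj'; rewrite leq_exp2l // leq_pred.
have q2 : 0 < q ^ 2 by rewrite expn_gt0 q0.
have qq : q <= q ^ 2 by rewrite -mulnn leq_pmulr.
have uZ : uniq Z.
  have : uniq (items P ++ Z) by rewrite -(perm_uniq p1) filter_uniq.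
  by rewrite cat_uniq => /and3P[].
have sZ : forall x, x \in Z -> x <= s.
  move=> x hx; apply: X0; have : x \in [seq v <- X | v \notin Y] by rewrite (perm_mem p1) mem_cat hx orbT.
  by rewrite mem_filter => /andP[].
have hZ : size X <= size Y + (2 * size P + size Z).
  have e : size [seq v <- X | v \notin Y] = 2 * size P + size Z by rewrite (perm_size p1) size_cat size_items.
  rewrite -e.
  rewrite -(count_predC (fun v => v \in Y) X) -!size_filter leq_add2r.
  apply: uniq_leq_size; first exact: filter_uniq.
  by move=> x; rewrite mem_filter => /andP[].
(* The summand [q] pays for the fewer than [d] pairs that are dropped to make the first components
   add up to a multiple of [d]. *)
set N := 3 * q ^ 2 + q.
have hb : (s %/ (2 ^ j * q).+1).+1 * 2 ^ j <= 2 * q ^ 2.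
  have l1 : s %/ (2 ^ j * q).+1 <= q ^ 3 %/ (2 ^ j * q).
    apply: leq_trans (leq_div2r _ sq); apply: leq_div2l => //; by rewrite muln_gt0 expn_gt0.
  have l2 : q ^ 3 %/ (2 ^ j * q) * 2 ^ j <= q ^ 2.
    by rewrite expnSr divnMr //; exact: leq_trunc_div.
  have l3 : s %/ (2 ^ j * q).+1 * 2 ^ j <= q ^ 2 by apply: leq_trans l2; rewrite leq_mul2r l1 orbT.
  by rewrite mulSn mul2n -addnn leq_add.
have hsz : (s %/ (2 ^ j * q).+1).+1 * 2 ^ j + 2 * N < size Z.
  have h1 : j * (3 * q ^ 2 + q) <= j * (4 * q ^ 2) by rewrite leq_mul2l; apply/orP; right; lia.
  have h2 : 16 * q ^ 2 * (j.+1 + 3) <= 16 * q ^ 2 * (lg + 3) by rewrite leq_mul2l; apply/orP; right; lia.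
  have h3 : 16 * q ^ 2 * (j.+1 + 3) = 4 * (j * (4 * q ^ 2)) + 64 * q ^ 2 by ring.
  have hX' := leq_trans h2 hX; rewrite h3 in hX'.
  move: hb hZ p2 hX' hY dq qq h1 q2; rewrite /N.
  move: (_.+1 * 2 ^ j) (j * (3 * q ^ 2 + q)) (j * (4 * q ^ 2)) (q ^ 2) (size X) (size Y) (size P) (size Z).
  by clear; lia.
have [| |Q [Z' [r1 r2 r3]]] := code_pairs uZ sZ _ _ hsz => //; first by rewrite expn_gt0.
have [A [B [a1 a2 a3]]] := @zero_part _ (fun p : nat * nat => p.1) d dp Q.
have sA : N = @size (nat * nat) A + @size (nat * nat) B by rewrite -r1 (perm_size a1) size_cat.
have {}a2 : @size (nat * nat) B < d := a2.
exists (P ++ A), (items B ++ Z'); split.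
- rewrite (perm_trans p1) // items_cat -catA perm_cat2l (perm_trans r2) // catA perm_cat2r.
  by rewrite -items_cat items_perm.
- by rewrite size_cat mulSn -/N; lia.
- by rewrite map_cat sumn_cat dvdn_add.
rewrite map_cat => k hk.
have hA p : p \in A -> 2 ^ j <= p.2 <= 2 ^ j * q.
  by move=> hp; rewrite -ltnS; apply: r3; rewrite (perm_mem a1) mem_cat hp.
have hext := @ap_ext d (2 ^ j * (q * d)) (2 ^ j * q) _ [seq p.2 | p <- A] dp _ _ p4.
apply: hext.
- by move=> x /mapP[p /hA /andP[_ h] ->].
- by rewrite (_ : d * _ = 2 ^ j * (q * d)) ?leq_addr //; ring.
apply: leq_trans hk _.
(* At least [3 * q ^ 2] pairs with differences at least [2 ^ j] remain, while [ap_ext] loses only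
   [q * d * 2 ^ j <= q ^ 2 * 2 ^ j]. The gain exceeds the current length [2 ^ j * (q * d)], so the
   progression doubles. *)
have sumA : size A * 2 ^ j <= sumn [seq p.2 | p <- A].
  elim: (A) hA => //= p A' IH' h; rewrite mulSn leq_add //.
    by have /andP[] := h p (mem_head _ _).
  by apply: IH' => x hx; apply: h; rewrite inE hx orbT.
have h40 : 3 * q ^ 2 <= @size (nat * nat) A by move: sA a2 dq; rewrite /N; clear; lia.
have h4 : 3 * q ^ 2 * 2 ^ j <= size A * 2 ^ j by rewrite leq_mul2r; apply/orP; right; exact: h40.
have h5 : q * d <= q ^ 2 by rewrite -mulnn leq_mul2l dq orbT.
have h6 : q * d * 2 ^ j <= q ^ 2 * 2 ^ j by rewrite leq_mul2r h5 orbT.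
rewrite (_ : d * (2 ^ j * q) = q * d * 2 ^ j); last by ring.
rewrite expnS (_ : 2 * 2 ^ j * (q * d) = 2 * (q * d * 2 ^ j)); last by ring.
rewrite (_ : 2 ^ j * (q * d) = q * d * 2 ^ j); last by ring.
rewrite -mulnA in h4; move: (q * d * 2 ^ j) (q ^ 2 * 2 ^ j) (size A * 2 ^ j) (sumn _) h4 h6 sumA => a b c e; clear; lia.
Qed.
End Dense.

Lemma uniq_sub_perm (A B : seq nat) : uniq A -> {subset A <= B} -> exists C, perm_eq B (A ++ C).
Proof.
elim: A B => [|a A IH] B /=; first by exists B.
move=> /andP[na uA] h.
have [x hx|C hC] := IH (rem a B) uA.
  have : x \in B by apply: h; rewrite inE hx orbT.
  have : x != a by apply: contraNneq na => <-.
  have ha : a \in B by apply: h; rewrite mem_head.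
  by rewrite (perm_mem (perm_to_rem ha)) inE => /negbTE ->.
exists C; rewrite (perm_trans (perm_to_rem (h a (mem_head _ _)))) // perm_cons //.
Qed.

(* [I] is the multiset of items, [X] its set of sizes. *)
Lemma dense_reach s q lg d (X I : seq nat) t y :
  0 < q -> 0 < s -> s <= q ^ 3 -> s < 2 ^ lg -> 0 < d <= q -> uniq X -> {subset X <= I} ->
  (forall x, x \in I -> x <= s) ->
  10 * q <= pc d X -> 16 * q ^ 2 * (lg + 3) <= size X ->
  2 * s * (16 * q ^ 2 * (lg + 3)) <= t -> t + 2 * s * (16 * q ^ 2 * (lg + 3)) <= sumn I ->
  sub I y -> y = t %[mod d] -> sub I t.
Proof.
move=> q0 s0 sq slg hd uX XI Is hpc hX ht1 ht2 [l1 [l2 [pI ey]]] yt.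
have [dp dq] := andP hd.
(* Only the residue of the given witness matters. Removing zero-sum parts leaves [Y] with fewer than
   [d] items, few enough to be kept apart from the pairs. *)
have [z [Y [pz sY dz]]] := @zero_part _ (fun v : nat => v) d dp l1.
rewrite map_id in dz.
have pI2 : perm_eq I (Y ++ (z ++ l2)).
  rewrite (perm_trans pI) // (perm_trans (y := (z ++ Y) ++ l2)) ?perm_cat2r //.
  by rewrite catA perm_cat2r perm_catC.
have Yt : sumn Y = t %[mod d].
  by rewrite -yt -ey (perm_sumn pz) sumn_cat -modnDml (eqP dz) add0n.
(* [J] is the first scale at which the progression is so long that items of any size up to [s] can
   extend it. Its minimality gives the bound on [2 ^ J.-1] required by [pairs_scale]. *)
have [J [J1 J2 J3]] : exists J, [/\ s <= 2 ^ J * q, J <= lg & 0 < J -> 2 ^ J.-1 <= q ^ 2].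
  have ex : exists j, s <= 2 ^ j * q by exists lg; apply: leq_trans (ltnW slg) _; rewrite leq_pmulr.
  exists (ex_minn ex); case: ex_minnP => m hm hmin; split=> //.
    by apply: hmin; apply: leq_trans (ltnW slg) _; rewrite leq_pmulr.
  move=> m0; rewrite leqNgt; apply/negP => h.
  have : m <= m.-1.
    by apply: hmin; apply: leq_trans sq _; rewrite expnSr leq_mul2r (ltnW h) orbT.
  lia.
have X0 x : x \in X -> x <= s by move=> /XI /Is.
have [P [Z [p1 p2 p3 p4]]] := pairs_scale q0 sq hd uX X0 hpc hX sY J3 J2.
set X' := [seq v <- X | v \notin Y] in p1.
have uX' : uniq X' by apply: filter_uniq.
have [C hC] : exists C, perm_eq (z ++ l2) (X' ++ C).
  apply: uniq_sub_perm => // x; rewrite mem_filter => /andP[nY /XI].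
  by rewrite (perm_mem pI2) mem_cat (negbTE nY).
set R := Z ++ C.
have pI3 : perm_eq I (Y ++ (items P ++ R)).
  rewrite (perm_trans pI2) // perm_cat2l (perm_trans hC) // catA perm_cat2r //.
set L := sumn [seq p.1 | p <- P]; set E := sumn [seq p.2 | p <- P].
have Rs x : x \in R -> x <= s by move=> hx; apply: Is; rewrite (perm_mem pI3) mem_cat; apply/orP; right; rewrite mem_cat hx orbT.
have Ys : sumn Y <= q * s.
  apply: leq_trans (sumn_le_mul (B := s) _) _; last by rewrite leq_mul2r; apply/orP; right; lia.
  by move=> x hx; apply: Is; rewrite (perm_mem pI3) mem_cat hx.
have q2 : 0 < q ^ 2 by rewrite expn_gt0 q0.
have qq : q <= q ^ 2 by rewrite -mulnn leq_pmulr.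
have Ps : 2 * L + E <= 2 * (2 * q + lg * (4 * q ^ 2)) * s.
  rewrite -sumn_items; apply: leq_trans (sumn_le_mul (B := s) _) _.
    by move=> x hx; apply: Is; rewrite (perm_mem pI3) mem_cat; apply/orP; right; rewrite mem_cat hx.
  rewrite leq_mul2r size_items leq_mul2l; apply/orP; right => /=.
  apply: leq_trans p2 _; rewrite leq_add2l; apply: leq_mul => //; lia.
have tot : sumn I = sumn Y + (2 * L + E + sumn R).
  by rewrite (perm_sumn pI3) !sumn_cat sumn_items.
have big : 2 * (2 * q + lg * (4 * q ^ 2)) * s + 2 * (q * s) <= 2 * s * (16 * q ^ 2 * (lg + 3)).
  rewrite (_ : 2 * (2 * q + lg * (4 * q ^ 2)) * s + 2 * (q * s) = s * (6 * q + 8 * (lg * q ^ 2))); last by ring.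
  rewrite (_ : 2 * s * (16 * q ^ 2 * (lg + 3)) = s * (32 * (lg * q ^ 2) + 96 * q ^ 2)); last by ring.
  rewrite leq_mul2l; apply/orP; right; lia.
have hap := @ap_ext d (2 ^ J * (q * d)) s [seq p.2 | p <- P] R dp Rs _ p4.
have sd : d * s <= q * s by rewrite leq_mul2r dq orbT.
have hEd : d * s <= 2 ^ J * (q * d).
  by rewrite mulnA [_ * d]mulnC leq_mul2l J1 orbT.
have tge : sumn Y + L <= t.
  move: (leq_trans big ht1) Ps Ys; move: (2 * (2 * q + lg * (4 * q ^ 2)) * s) (q * s) (sumn Y).
  by generalize L E; clear; lia.
(* The items of [Y] and one item of each pair form a base below [t] in the residue class of [t];
   what is missing is a multiple of [d], to be supplied by the differences and the remaining
   items. *)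
have /dvdnP[k ek] : d %| t - (sumn Y + L).
  rewrite -eqn_mod_dvd // eq_sym; apply/eqP.
  by rewrite -modnDmr (eqP p3) addn0.
have hs : sub ([seq p.2 | p <- P] ++ R) (k * d).
  apply: hap; first by apply: leq_trans hEd _; apply: leq_addr.
  rewrite -ek; move: big Ps Ys ht2 sd tge; rewrite tot.
  move: (2 * (2 * q + lg * (4 * q ^ 2)) * s) (q * s) (sumn Y) (sumn R) (d * s) (2 ^ J * (q * d)) (2 * s * _).
  by generalize L E; clear; lia.
have := sub_cat (sub_all Y) (sub_items hs).
rewrite -ek -/L (_ : sumn Y + (L + _) = t); last by move: tge; generalize L (sumn Y); clear; lia.
by apply: sub_perm; rewrite perm_sym.
Qed.

(** * Proximity and binary levels *)

Section Multiset.
Variable U : nat -> nat.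

Definition msi s := flatten [seq nseq (U v) v | v <- iota 1 s].

Lemma msiS s : msi s.+1 = msi s ++ nseq (U s.+1) s.+1.
Proof. by rewrite /msi -{1}[s.+1]addn1 iotaD map_cat flatten_cat /= cats0 add1n. Qed.

Lemma sumn_msi s : sumn (msi s) = \sum_(v < s.+1) v * U v.
Proof.
elim: s => [|s IH]; first by rewrite big_ord1.
by rewrite msiS sumn_cat sumn_nseq IH [RHS]big_ord_recr.
Qed.

Lemma mem_msi s v : (v \in msi s) = (0 < v <= s) && (0 < U v).
Proof.
elim: s => [|s IH]; first by case: v.
rewrite msiS mem_cat IH mem_nseq (leq_eqVlt v s.+1) ltnS.
by case: eqP => [->|_] /=; [rewrite ltnn ?andbF /= ?andbT|rewrite ?andbF ?orbF].
Qed.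

Lemma count_msi s v : count_mem v (msi s) <= U v.
Proof.
have -> : count_mem v (msi s) = if 0 < v <= s then U v else 0; last by case: ifP.
elim: s => [|s IH]; first by case: v.
rewrite msiS count_cat IH count_nseq /= (leq_eqVlt v s.+1) ltnS.
case: (v =P s.+1) => [->|/eqP ne]; first by rewrite ltnn eqxx mul1n.
by rewrite eq_sym (negbTE ne) addn0.
Qed.

Lemma sumn_count s l : (forall x, x \in l -> x <= s) -> sumn l = \sum_(v < s.+1) v * count_mem (val v) l.
Proof.
elim: l => [|x l IH] h /=; first by rewrite big1 // => v _; rewrite muln0.
have hx : x < s.+1 by apply: h; rewrite mem_head.
rewrite IH; last by move=> y hy; apply: h; rewrite inE hy orbT.
under [RHS]eq_bigr do rewrite mulnDr.
rewrite big_split /=; congr (_ + _).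
rewrite (bigD1 (Ordinal hx)) //= eqxx muln1 big1 ?addn0 // => v hv.
by rewrite eq_sym (_ : (v == x :> nat) = false) ?muln0 //; apply: contraNF hv => /eqP e; apply/eqP/val_inj.
Qed.

Lemma bss_sub s t : bss U s t <-> sub (msi s) t.
Proof.
split=> [[x [hx <-]]|[l1 [l2 [p e]]]].
  elim: s => [|s IH]; first by rewrite big_ord1; apply: sub0.
  rewrite big_ord_recr msiS; apply: sub_cat => //.
  exists (nseq (x s.+1) s.+1), (nseq (U s.+1 - x s.+1) s.+1).
  by rewrite -nseqD subnKC // sumn_nseq.
exists (fun v => count_mem v l1); split.
  move=> v; apply: leq_trans (count_msi s v).
  by rewrite (permP p) count_cat leq_addr.
rewrite -sumn_count // => x hx.
have : x \in msi s by rewrite (perm_mem p) mem_cat hx.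
by rewrite mem_msi => /andP[/andP[]].
Qed.

Lemma bss_compl s t : t <= \sum_(v < s.+1) v * U v ->
  bss U s (\sum_(v < s.+1) v * U v - t) -> bss U s t.
Proof.
move=> ht [x [hx ex]]; exists (fun v => U v - x v); split; first by move=> v; apply: leq_subr.
have : \sum_(v < s.+1) v * (U v - x v) + \sum_(v < s.+1) v * x v = \sum_(v < s.+1) v * U v.
  by rewrite -big_split; apply: eq_bigr => v _; rewrite /= -mulnDr subnK.
by rewrite ex; lia.
Qed.

Lemma bss_le s t : bss U s t -> t <= \sum_(v < s.+1) v * U v.
Proof. by move=> [x [hx <-]]; apply: leq_sum => v _; rewrite leq_mul2l hx orbT. Qed.
End Multiset.

Section Proximity.
Variables (s d t : nat) (U p : nat -> nat).
Hypotheses (hp : forall v, p v <= U v) (hd : \sum_(v < s.+1) v * p v + d = t) (ds : d < s).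
Let KK := s ^ 3 + s.

Lemma sum_upd (f : nat -> nat -> nat) (x : nat -> nat) a z (F := fun y : nat -> nat => \sum_(v < s.+1) f v (y v)) :
  a <= s -> F (fun v => if v == a then z else x v) + f a (x a) = F x + f a z.
Proof.
move=> ha; have ha' : a < s.+1 by [].
have E (y : nat -> nat) : F y = f a (y a) + \sum_(v < s.+1 | v != Ordinal ha') f v (y v).
  by rewrite /F (bigD1 (Ordinal ha')).
rewrite !E eqxx.
have -> : \sum_(v < s.+1 | v != Ordinal ha') f v (if v == a :> nat then z else x v) =
   \sum_(v < s.+1 | v != Ordinal ha') f v (x v).
  apply: eq_bigr => v hv; rewrite (_ : (v == a :> nat) = false) //.
  by apply: contraNF hv => /eqP e; apply/eqP/val_inj.
by ring.
Qed.

(** If [x] exceeds [p] at [a] by at least [b] copies and falls short at [b] by at least [a],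
    replacing [b] copies of [a] by [a] copies of [b] keeps the sum and moves [x] towards [p]. Once
    no exchange is possible, a deviation beyond [s] at one size forces every opposite deviation
    below [s]; those weigh at most [s ^ 3], and by balance the large one weighs at most [s ^ 3] plus
    the gap [d < s]. *)
Lemma proximity : bss U s t -> exists x, [/\ forall v, x v <= U v, \sum_(v < s.+1) v * x v = t
   & forall v, 0 < v <= s -> x v <= p v + KK /\ p v <= x v + KK].
Proof.
case=> x [hx ex].
pose mu (x : nat -> nat) := \sum_(v < s.+1) ((x v - p v) + (p v - x v)).
have [m] := ubnP (mu x); elim: m x hx ex => // m IH x hx ex hm.
have [[a [b [ha hb xa xb]]]|no] := pselect (exists a b, [/\ 0 < a <= s, 0 < b <= s, p a + b <= x a & x b + a <= p b]).
  have ab : a != b by apply/eqP => e; subst b; lia.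
  pose x1 v := if v == a then x a - b else x v.
  pose x2 v := if v == b then x b + a else x1 v.
  have xb1 : x1 b = x b by rewrite /x1 eq_sym (negbTE ab).
  have e1 : \sum_(v < s.+1) v * x1 v + a * x a = \sum_(v < s.+1) v * x v + a * (x a - b).
    by apply: (@sum_upd (fun v z => v * z) x a (x a - b)); lia.
  have e2 : \sum_(v < s.+1) v * x2 v + b * x b = \sum_(v < s.+1) v * x1 v + b * (x b + a).
    by rewrite -{1}xb1; apply: (@sum_upd (fun v z => v * z) x1 b (x b + a)); lia.
  have m1 : mu x1 + (x a - p a + (p a - x a)) = mu x + (x a - b - p a + (p a - (x a - b))).
    by apply: (@sum_upd (fun v z => (z - p v) + (p v - z)) x a (x a - b)); lia.
  have m2 : mu x2 + (x b - p b + (p b - x b)) = mu x1 + (x b + a - p b + (p b - (x b + a))).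
    by rewrite -{1 2}xb1; apply: (@sum_upd (fun v z => (z - p v) + (p v - z)) x1 b (x b + a)); lia.
  apply: (IH x2).
  - move=> v; rewrite /x2 /x1; case: eqP => [->|_]; first by apply: leq_trans xb _.
    by case: eqP => [->|_] //; apply: leq_trans (leq_subr _ _) _.
  - have h1 : b <= x a by lia.
    have h2 : a * (x a - b) + a * b = a * x a by rewrite -mulnDr subnK.
    have h3 : b * (x b + a) = b * x b + a * b by rewrite mulnDr mulnC (mulnC a).
    by move: e1 e2 h2 h3; rewrite ex; generalize (a * b) (a * x a) (a * (x a - b)) (b * x b) (b * (x b + a)); lia.
  - by move: hm m1 m2; generalize (mu x) (mu x1) (mu x2); lia.
exists x; split=> //.
have bal : \sum_(v < s.+1) v * (x v - p v) = d + \sum_(v < s.+1) v * (p v - x v).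
  have : \sum_(v < s.+1) v * (x v - p v) + \sum_(v < s.+1) v * p v =
         \sum_(v < s.+1) v * (p v - x v) + \sum_(v < s.+1) v * x v.
    by rewrite -!big_split; apply: eq_bigr => v _; rewrite /= -!mulnDr; congr (_ * _); lia.
  rewrite ex -hd; lia.
have cube (f : nat -> nat) : (forall v, 0 < v <= s -> f v <= s) -> \sum_(v < s.+1) v * f v <= s ^ 3.
  move=> hf; rewrite big_ord_recl mul0n add0n.
  apply: (@leq_trans (\sum_(v < s) s * s)).
    by apply: leq_sum => v _; rewrite lift0; have hv := ltn_ord v; apply: leq_mul; [|apply: hf].
  by rewrite sum_nat_const card_ord !expnS expn0 muln1.
have one (f : nat -> nat) v : 0 < v <= s -> f v <= \sum_(v < s.+1) v * f v.
  move=> hv; have hv' : v < s.+1 by lia.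
  rewrite (bigD1 (Ordinal hv')) //=; apply: leq_trans (leq_addr _ _).
  by rewrite leq_pmull; lia.
move=> v hv; split; rewrite leqNgt; apply/negP => hk.
- have h1 := cube (fun v => p v - x v).
  have h2 := one (fun v => x v - p v) v hv.
  have : \sum_(v < s.+1) v * (p v - x v) <= s ^ 3.
    apply: h1 => b hb; rewrite leqNgt; apply/negP => hh; apply: no.
    by exists v, b; split=> //; rewrite /KK in hk; lia.
  by rewrite /KK in hk; move: h2; rewrite bal; lia.
- have h1 := cube (fun v => x v - p v).
  have h2 := one (fun v => p v - x v) v hv.
  have : \sum_(v < s.+1) v * (x v - p v) <= s ^ 3.
    apply: h1 => a ha; rewrite leqNgt; apply/negP => hh; apply: no.
    by exists a, v; split=> //; rewrite /KK in hk; lia.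
  by rewrite /KK in hk; rewrite bal; lia.
Qed.

Let b v := p v - KK.
(** By proximity some solution stays within [KK] of [p]. The [p v - KK] lowest copies are then
    fixed, and at most [2 * KK] further ones are left to choose. *)
Definition resU KK v := minn (U v) (p v + KK) - (p v - KK).

Lemma bss_res : bss U s t <-> bss (resU KK) s (t - \sum_(v < s.+1) v * b v).
Proof.
have bp : \sum_(v < s.+1) v * b v <= t.
  by rewrite -hd; apply: leq_trans (leq_addr _ _); apply: leq_sum => v _; rewrite leq_mul2l leq_subr orbT.
have bm v : b v <= minn (U v) (p v + KK) by have := hp v; rewrite /b; lia.
split.
  move=> /proximity[x [h1 h2 h3]].
  exists (fun v => if 0 < v <= s then x v - b v else 0); split.
    by move=> v; case: ifP => // hv; have [a1 a2] := h3 v hv; have := h1 v; rewrite /resU -/(b v) /b; lia.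
  have : \sum_(v < s.+1) v * (if 0 < v <= s then x v - b v else 0) + \sum_(v < s.+1) v * b v = t.
    rewrite -h2 -big_split; apply: eq_bigr => v _ /=.
    have [->|v0] := posnP v; first by rewrite !mul0n.
    rewrite (ltnSE (ltn_ord v)) /= -mulnDr subnK //.
    by have [] := h3 v; rewrite ?v0 ?(ltnSE (ltn_ord v)) // /b; lia.
  lia.
case=> x [h1 h2]; exists (fun v => x v + b v); split.
  by move=> v; have := h1 v; have := bm v; have := hp v; rewrite /resU -/(b v); lia.
under eq_bigr do rewrite mulnDr.
by rewrite big_split /= h2 subnK.
Qed.
End Proximity.

(** * Binary levels and carries *)

Section Digits.
Variables (s t K W : nat) (U : nat -> nat).

(** Binary expansion of [U v] with the digits 1 and 2 in place of 0 and 1. As the digit is positive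
    wherever anything is left, every [x <= uk k v] is [z + 2 * x'] with [z <= dig k v] and
    [x' <= uk k.+1 v]; a digit 0 would lose the odd [x]. *)
Definition uk k v := ((U v).+1 %/ 2 ^ k).-1.
Definition dig k v := uk k v - 2 * uk k.+1 v.

Lemma dig_le k v : [/\ 2 * uk k.+1 v <= uk k v, dig k v <= 2, uk k v = 0 -> dig k v = 0 &
   0 < uk k v -> 0 < dig k v].
Proof.
rewrite /dig /uk expnSr divnMA; set f := _ %/ 2 ^ k.
have := divn_eq f 2; have := ltn_pmod f (isT : 0 < 2); move: (f %/ 2) (f %% 2) => a b hb e.
by split; lia.
Qed.

Lemma dig_join k v z x : z <= dig k v -> x <= uk k.+1 v -> z + 2 * x <= uk k v.
Proof. by have [h _ _ _] := dig_le k v; rewrite /dig; lia. Qed.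

Fixpoint xk (x : nat -> nat) k v := if k is k'.+1 then minn (uk k v) (xk x k' v %/ 2) else x v.

Lemma xk_le x k v : (forall v, x v <= U v) -> xk x k v <= uk k v.
Proof.
move=> hx; case: k => [|k] /=; last by rewrite geq_minl.
by rewrite /uk divn1.
Qed.

Definition zw x k v := xk x k v - 2 * xk x k.+1 v.

Lemma zk_split x k v : (forall v, x v <= U v) -> xk x k v = zw x k v + 2 * xk x k.+1 v /\ zw x k v <= dig k v.
Proof.
move=> hx; have := xk_le k v hx; rewrite /zw /=.
have [h1 h2 h3 h4] := dig_le k v; rewrite /dig in h2 h3 h4 *.
have := divn_eq (xk x k v) 2; have := ltn_pmod (xk x k v) (isT : 0 < 2).
by move: (xk x k v %/ 2) (xk x k v %% 2) (xk x k v) (uk k.+1 v) (uk k v) h1 h2 h3 h4; clear; lia.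
Qed.

(** At level [k], [y] is the part of [t %/ 2 ^ k] not covered by the levels from [k] upwards. Levels
    are treated from [K], where nothing of [t] is visible, down to 0, where nothing may be
    missing. *)
Inductive carry : nat -> nat -> Prop :=
  | carryK : carry K 0
  | carryS k y y' h : k < K -> y <= W -> carry k.+1 y' -> h <= W -> bss (dig k) s h ->
      y + h = t %/ 2 ^ k %% 2 + 2 * y' -> carry k y.

Hypotheses (tK : t < 2 ^ K) (UK : forall v, (U v).+1 < 2 ^ K)
  (hW : \sum_(v < s.+1) v * (2 * (0 < U v)) <= W).

Let Tk k := t %/ 2 ^ k.
Let TkS k : Tk k = Tk k %% 2 + 2 * Tk k.+1.
Proof. by rewrite /Tk expnSr divnMA mulnC addnC -divn_eq. Qed.

Lemma carry_sound k y : carry k y -> exists S, bss (uk k) s S /\ S + y = Tk k.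
Proof.
elim=> {k y} [|k y y' h kK yW _ [S [[x [hx ex]] eS]] hW' [z [hz ez]] e].
  exists 0; split; last by rewrite /Tk divn_small.
  by exists (fun=> 0); split=> //; rewrite big1 // => v _; rewrite muln0.
exists (h + 2 * S); split; last by rewrite TkS -eS -/(Tk k) in e *; lia.
exists (fun v => z v + 2 * x v); split; first by move=> v; apply: dig_join.
rewrite -ez -ex big_distrr -big_split; apply: eq_bigr => v _ /=; ring.
Qed.

Lemma carry_complete : bss U s t -> carry 0 0.
Proof.
case=> x [hx ex].
pose S k := \sum_(v < s.+1) v * xk x k v; pose h k := \sum_(v < s.+1) v * zw x k v.
have SS k : S k = h k + 2 * S k.+1.
  rewrite /S /h big_distrr -big_split; apply: eq_bigr => v _ /=.
  by have [{1}-> _] := zk_split k v hx; ring.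
have hk k : h k <= W.
  apply: leq_trans hW; apply: leq_sum => v _; rewrite leq_mul2l; apply/orP; right.
  have [_ l1] := zk_split k v hx; have [_ l2 l3 _] := dig_le k v.
  have [u0|//] := posnP (U v); last by lia.
  have : uk k v = 0 by rewrite /uk u0; case: (1 %/ 2 ^ k) (leq_div 1 (2 ^ k)) => [|[]].
  lia.
(* Passing from [k] to [k.+1] turns the deficit [y] into [(y + h - bit) / 2]. Starting from deficit
   0, the bound [W] on the level sums [h] bounds every deficit. *)
have bnd k : S k <= Tk k /\ Tk k - S k <= W.
  elim: k => [|k [h1 h2]]; first by rewrite /S /Tk /= ex divn1 leqnn subnn.
  have := SS k; have := TkS k; have := hk k; have := ltn_pmod (Tk k) (isT : 0 < 2); lia.
have SK : S K = 0.
  rewrite /S big1 // => v _; apply/eqP; rewrite muln_eq0; apply/orP; right.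
  by rewrite -leqn0; apply: leq_trans (xk_le K v hx) _; rewrite /uk divn_small.
suff H j : j <= K -> carry (K - j) (Tk (K - j) - S (K - j)).
  by have := H K (leqnn K); rewrite subnn /S /Tk /= ex divn1 subnn.
elim: j => [|j IH] jK.
  by rewrite subn0 SK subn0 /Tk divn_small //; apply: carryK.
have := IH (ltnW jK); have -> : K - j = (K - j.+1).+1 by lia.
have kK : K - j.+1 < K by lia.
move: (K - j.+1) kK => k kK.
move=> hc; have [b1 b2] := bnd k; have [b3 b4] := bnd k.+1.
apply: (carryS kK b2 hc (hk k)).
  by exists (zw x k); split=> // v; have [] := zk_split k v hx.
by have := SS k; have := TkS k; rewrite -/(Tk k); lia.
Qed.

Lemma carryP : carry 0 0 <-> bss U s t.
Proof.
split; last exact: carry_complete.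
move=> /carry_sound[S [h e]]; move: h; rewrite addn0 /Tk divn1 in e; rewrite e.
by case=> x [hx ex]; exists x; split=> // v; have := hx v; rewrite /uk divn1.
Qed.
End Digits.

(** * The program for few distinct sizes *)

Notation zt := 60 (only parsing). Notation zSig := 61 (only parsing).
Notation zq := 62 (only parsing). Notation zlg := 63 (only parsing).
Notation zans := 64 (only parsing). Notation zdl := 65 (only parsing).
Notation zcnt := 66 (only parsing). Notation za := 67 (only parsing).
Notation za' := 68 (only parsing). Notation zb := 69 (only parsing).
Notation zb' := 70 (only parsing). Notation zx := 71 (only parsing).
Notation zx' := 72 (only parsing). Notation zm := 73 (only parsing).
Notation zrem := 74 (only parsing). Notation ztp := 75 (only parsing).
Notation zK := 76 (only parsing). Notation zk := 77 (only parsing).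
Notation zpw := 78 (only parsing). Notation zn := 79 (only parsing).
Notation zbit := 80 (only parsing). Notation zkk := 81 (only parsing).

Definition c_reduce :=
  zrem ::= !zt;; ztp ::= !zt;; zkk ::= !sS * !sS * !sS + !sS;;
  for za upto !sS in za' {{
    zm ::= !zrem / (!za + #1);;
    If aU$[!za + #1] < !zm {{ zm ::= aU$[!za + #1] }} Else {{ Skip }};;
    zrem ::= !zrem - (!za + #1) * !zm;;
    If !zm < !zkk {{ zb ::= #0 }} Else {{ zb ::= !zm - !zkk }};;
    zx ::= !zm + !zkk;;
    If aU$[!za + #1] < !zx {{ zx ::= aU$[!za + #1] }} Else {{ Skip }};;
    sto aV$[!za + #1] ::= !zx - !zb;;
    ztp ::= !ztp - (!za + #1) * !zb }}.

Section Greedy.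
Variables (t : nat) (U : nat -> nat).
Fixpoint rm v := if v is v'.+1 then rm v' - v * minn (U v) (rm v' %/ v) else t.
Definition gp v := minn (U v) (rm v.-1 %/ v).

Lemma rmS v : rm v = rm v.+1 + v.+1 * gp v.+1.
Proof.
rewrite /gp /= subnK //; apply: leq_trans (leq_trunc_div (rm v) v.+1).
by rewrite mulnC leq_mul2r geq_minr orbT.
Qed.

Arguments rm : simpl never.
Arguments gp : simpl never.

Lemma gp_sum s : \sum_(v < s.+1) v * gp v + rm s = t.
Proof.
elim: s => [|s IH]; first by rewrite big_ord1.
by rewrite big_ord_recr -[nat_of_ord ord_max]/(s.+1) -addnA (addnC (s.+1 * _)) -rmS IH.
Qed.

Lemma rm_le v v' : v <= v' -> rm v' <= rm v.
Proof.
elim: v' => [|v' IH]; first by rewrite leqn0 => /eqP->.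
by rewrite leq_eqVlt => /orP[/eqP->//|/IH h]; apply: leq_trans h; apply: leq_subr.
Qed.

(** If some size is not exhausted, what is left after it is less than that size. If all are
    exhausted, the bound on [t] leaves nothing. *)
Lemma rm_lt s : 0 < s -> t <= \sum_(v < s.+1) v * U v -> rm s < s.
Proof.
move=> s0 ht.
have [/hasP[v]|/hasPn h] := boolP (has (fun v => gp v.+1 < U v.+1) (iota 0 s)).
  rewrite mem_iota add0n => /andP[_ vs] hv.
  apply: (@leq_trans v.+1) => //; rewrite ltnS; apply: leq_trans (rm_le vs) _.
  have e : gp v.+1 = rm v %/ v.+1 by move: hv; rewrite /gp /minn -[v.+1.-1]/v; case: (ltnP (U v.+1) (rm v %/ v.+1)) => //; rewrite ltnn.
  have := rmS v; have := divn_eq (rm v) v.+1; have := ltn_pmod (rm v) (ltn0Sn v).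
  by rewrite e mulnC; lia.
have := gp_sum s; suff -> : \sum_(v < s.+1) v * gp v = \sum_(v < s.+1) v * U v by lia.
apply: eq_bigr => -[[|v] hv] _ //; congr (_ * _); apply/eqP; rewrite eqn_leq geq_minl leqNgt.
by apply: (h v); rewrite mem_iota.
Qed.

Lemma rem_pre_le s : \sum_(v < s.+1) v * (gp v - (s ^ 3 + s)) <= t.
Proof.
rewrite -(gp_sum s); apply: leq_trans (leq_addr _ _).
by apply: leq_sum => v _; rewrite leq_mul2l leq_subr orbT.
Qed.
End Greedy.

Definition c_digits :=
  for za upto !sS + #1 in za' {{
    zm ::= (aV$[!za] + #1) / !zpw;; zm ::= !zm - (#0 < !zm);;
    zx ::= (aV$[!za] + #1) / (!zpw * #2);; zx ::= !zx - (#0 < !zx);;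
    sto aC$[!za] ::= !zm - #2 * !zx }}.

(** [aH] is stored reversed, at [D - h], which turns a difference into a sum: the product
    coefficient at [y + D] counts the solutions of [y + h = bit + 2 * y']. *)
Definition c_load :=
  for zx upto #2 * !zn in zx' {{ sto aP$[!zx] ::= #0 }};;
  for zx upto !sD + #1 in zx' {{
    If aY$[!zx] == #0 {{ Skip }} Else {{ sto aP$[!zbit + #2 * !zx] ::= #1 }};;
    If aH$[!zx] == #0 {{ Skip }} Else {{ sto aP$[!zn + (!sD - !zx)] ::= #1 }} }}.

Definition c_level :=
  zk ::= !zK - #1 - !zb;; c_pow zpw zk;; c_digits;; c_ss;;
  zbit ::= (!ztp / !zpw) %% #2;; c_load;; cMU ::= !slg + #1;; c_conv;;
  for zx upto !sD + #1 in zx' {{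
    If aP$[!zx + !sD] == #0 {{ sto aY$[!zx] ::= #0 }} Else {{ sto aY$[!zx] ::= #1 }} }}.

Definition c_sparse :=
  c_reduce;; zK ::= #5 * !zlg + #3;;
  cx ::= !slg + #2;; c_pow zn cx;;
  for zx upto !sD + #1 in zx' {{ sto aY$[!zx] ::= #0 }};;
  sto aY$[#0] ::= #1;;
  for zb upto !zK in zb' {{ c_level }};;
  zans ::= aY$[#0].

Section Sparse.
Variables (w : nat) (inp : nat -> nat) (ilim lim M : nat).
Local Notation W := (2 ^ w).
Local Notation triple := (triple w inp ilim lim).
Local Notation wbd := (wbd w).
Hypotheses (M2 : 100 < M) (MW : M ^ 12 < W) (Mlim : M ^ 5 < lim).
Let M1 : 1 < M. Proof. exact: ltn_trans M2. Qed.
Let c1 : 1 <= M. Proof. exact: ltnW M1. Qed.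
Let c2 : 2 <= M. Proof. exact: M1. Qed.
Local Notation M_W := (M_W M2 MW).
Local Notation M_lim := (M_lim M2 Mlim).
Local Notation t_forc := (t_forc M2 MW).
Ltac okt := okd_tac M1 MW Mlim.
Ltac oks := oks_tac M1 MW Mlim.

Lemma c_reduce_ok s S t (U : nat -> nat) : rg s sS = S -> rg s zt = t ->
  S < M -> t <= M -> S ^ 3 + S <= M -> (forall v, v <= S -> ar s aU v = U v /\ U v <= M) ->
  triple c_reduce s (12 * S + 5) (fun s' =>
    (forall v, 0 < v <= S -> ar s' aV v = resU U (gp t U) (S ^ 3 + S) v) /\ ar s' aV 0 = ar s aV 0 /\
    rg s' ztp = t - \sum_(v < S.+1) v * (gp t U v - (S ^ 3 + S))).
Proof.
move=> hS ht SM tM KM hU.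
have -> : 12 * S + 5 = (12 * S + 2).+3 by lia.
apply: t_asg; first by oks.
apply: t_asg; first by oks.
apply: t_asg; first by oks; rewrite hS ltnW.
set s0 := setr _ zkk _.
have ekk : rg s0 zkk = S ^ 3 + S by rewrite /= hS !expnS expn0 muln1 mulnA.
have [er et eS] : [/\ rg s0 zrem = t, rg s0 ztp = t & rg s0 sS = S] by [].
have eU v : ar s0 aU v = ar s aU v by [].
have eV v : ar s0 aV v = ar s aV v by [].
move: s0 ekk er et eS eU eV => s0 ekk er et eS eU eV.
pose KK := S ^ 3 + S.
have {}KM : KK <= M := KM.
pose tp v := t - \sum_(u < v.+1) u * (gp t U u - KK).
have tpS v : v < S -> tp v = tp v.+1 + v.+1 * (gp t U v.+1 - KK).
  move=> hv; pose G u := u * (gp t U u - KK).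
  have e : \sum_(u < v.+2) G u = \sum_(u < v.+1) G u + G v.+1 := big_ord_recr _ _.
  rewrite -[v.+1 * _]/(G v.+1) /tp -/G e.
  suff : \sum_(u < v.+2) G u <= t.
    by rewrite e; move: (\sum_(u < v.+1) G u) (G v.+1) => x y; lia.
  apply: leq_trans (rem_pre_le t U S).
  rewrite -(big_mkord xpredT (fun u => u * (gp t U u - KK))) -[X in _ <= X](big_mkord xpredT (fun u => u * (gp t U u - KK))).
  by rewrite [X in _ <= X](@big_cat_nat _ _ _ v.+2) //= ?leq_addr // ltnS.
apply: (t_forc (N := S) (B := 11) (I := fun v s1 =>
   [/\ rg s1 zrem = rm t U v, rg s1 ztp = tp v, ar s1 aV 0 = ar s aV 0 &
     forall u, 0 < u <= v -> ar s1 aV u = resU U (gp t U) KK u])).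
- by oks.
- by rewrite /= eS.
- exact: ltnW.
- split; rewrite ?[rg _ _]/=; [by rewrite er|by rewrite et /tp big_ord1 mul0n subn0|exact: eV|].
  by move=> [|u]; rewrite ?ltn0 ?andbF.
- move=> v s1 hv [e1 e2 e3 e4] fr fa.
  have ek : rg s1 zkk = KK by rewrite fr.
  have [hu1 hu2] := hU v.+1 hv.
  have eu : ar s1 aU v.+1 = U v.+1 by rewrite fa // eU.
  have rM u : rm t U u <= M by apply: leq_trans tM; apply: (@rm_le t U 0).
  have tpM u : tp u <= M by apply: leq_trans tM; apply: leq_subr.
  have eg : gp t U v.+1 = minn (U v.+1) (rm t U v %/ v.+1) by [].
  have gM : gp t U v.+1 <= M by apply: leq_trans hu2; apply: geq_minl.
  have lv : v.+1 < lim by apply: M_lim; lia.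
  apply: t_asg; first by oks; rewrite ?e1; try exact: rM; lia.
  set s2 := setr _ zm _.
  have d2 : rg s2 zm = rm t U v %/ v.+1 by rewrite /= e1 addn1.
  have [i1 i2 i3 i4] : [/\ rg s2 zrem = rm t U v, rg s2 ztp = tp v, rg s2 zkk = KK & rg s2 za = v] by [].
  have a2 a u : ar s2 a u = ar s1 a u by [].
  move: s2 d2 i1 i2 i3 i4 a2 => s2 d2 i1 i2 i3 i4 a2.
  have dM : rm t U v %/ v.+1 <= M by apply: leq_trans (leq_div _ _) (rM v).
  apply: (t_seq (T1 := 2) (T2 := 8) (Q1 := fun s3 => rg s3 zm = gp t U v.+1)) => //.
    apply: t_if.
      by oks; rewrite ?i4 ?addn1 ?a2 ?eu ?d2 //; lia.
    + rewrite [eval _ _ _ _]/= i4 addn1 a2 eu d2 => hc; apply: t_asg1; [by oks; rewrite ?i4 ?addn1 //; lia|by []|].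
      by rewrite [rg _ _]/= i4 addn1 a2 eu eg; move: hc; case: ltnP => //; lia.
    + rewrite [eval _ _ _ _]/= i4 addn1 a2 eu d2 => hc; apply: t_skip.
      by rewrite d2 eg; move: hc; case: ltnP => //; lia.
  move=> s3 d3 fr3 fa3.
  have [k1 k2 k3 k4] : [/\ rg s3 zrem = rm t U v, rg s3 ztp = tp v, rg s3 zkk = KK & rg s3 za = v].
    by rewrite !fr3.
  have a3 a u : ar s3 a u = ar s1 a u by rewrite fa3.
  move: s3 d3 k1 k2 k3 k4 a3 {fr3 fa3} => s3 d3 k1 k2 k3 k4 a3.
  have hr := rmS t U v.
  apply: t_asg; first by oks; rewrite ?k1 ?k4 ?d3 ?addn1 //; try exact: rM; lia.
  set s4 := setr _ zrem _.
  have d4 : rg s4 zrem = rm t U v.+1 by move: hr; rewrite /s4 [rg _ _]/= k1 k4 d3 addn1; generalize (rm t U v) (rm t U v.+1) (v.+1 * gp t U v.+1); clear; lia.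
  have [j1 j2 j3 j4] : [/\ rg s4 zm = gp t U v.+1, rg s4 ztp = tp v, rg s4 zkk = KK & rg s4 za = v] by [].
  have a4 a u : ar s4 a u = ar s1 a u by exact: a3.
  move: s4 d4 j1 j2 j3 j4 a4 => s4 d4 j1 j2 j3 j4 a4.
  apply: (t_seq (T1 := 2) (T2 := 5) (Q1 := fun s5 => rg s5 zb = gp t U v.+1 - KK)) => //.
    apply: t_if; first by oks; lia.
    + rewrite [eval _ _ _ _]/= j1 j3 => hc; apply: t_asg1; [by oks|by []|].
      by rewrite [rg _ _]/=; move: hc; case: ltnP => //; lia.
    + rewrite [eval _ _ _ _]/= j1 j3 => hc.
      have hc' : KK <= gp t U v.+1 by move: hc; case: ltnP.
      by apply: t_asg1; [oks; lia|by []|rewrite /= j1 j3].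
  move=> s5 d5 fr5 fa5.
  have [l1 l2 l3 l4] : [/\ rg s5 zrem = rm t U v.+1, rg s5 ztp = tp v, rg s5 zkk = KK & rg s5 za = v].
    by rewrite !fr5.
  have l5 : rg s5 zm = gp t U v.+1 by rewrite fr5.
  have a5 a u : ar s5 a u = ar s1 a u by rewrite fa5.
  move: s5 d5 l1 l2 l3 l4 l5 a5 {fr5 fa5} => s5 d5 l1 l2 l3 l4 l5 a5.
  apply: t_asg; first by oks; lia.
  set s6 := setr _ zx _.
  have d6 : rg s6 zx = gp t U v.+1 + KK by rewrite /= l5 l3.
  have [m1 m2 m3 m4] : [/\ rg s6 zrem = rm t U v.+1, rg s6 ztp = tp v, rg s6 zb = gp t U v.+1 - KK & rg s6 za = v] by [].
  have a6 a u : ar s6 a u = ar s1 a u by exact: a5.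
  move: s6 d6 m1 m2 m3 m4 a6 => s6 d6 m1 m2 m3 m4 a6.
  apply: (t_seq (T1 := 2) (T2 := 2) (Q1 := fun s7 => rg s7 zx = minn (U v.+1) (gp t U v.+1 + KK))) => //.
    apply: t_if; first by oks; rewrite ?m4; lia.
    + rewrite [eval _ _ _ _]/= m4 addn1 a6 eu d6 => hc; apply: t_asg1; [by oks; rewrite ?m4; lia|by []|].
      by rewrite [rg _ _]/= m4 addn1 a6 eu; move: hc; case: ltnP => //; lia.
    + rewrite [eval _ _ _ _]/= m4 addn1 a6 eu d6 => hc; apply: t_skip.
      by rewrite d6; move: hc; case: ltnP => //; lia.
  move=> s7 d7 fr7 fa7.
  have [n1 n2 n3 n4] : [/\ rg s7 zrem = rm t U v.+1, rg s7 ztp = tp v, rg s7 zb = gp t U v.+1 - KK & rg s7 za = v].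
    by rewrite !fr7.
  have a7 a u : ar s7 a u = ar s1 a u by rewrite fa7.
  have mM : minn (U v.+1) (gp t U v.+1 + KK) <= M by apply: leq_trans (geq_minl _ _) hu2.
  have gU : gp t U v.+1 <= U v.+1 by apply: geq_minl.
  have tpv := tpS v hv.
  apply: t_sto; [by oks; lia|by oks; rewrite ?d7 ?n3 //; lia|by rewrite /= n4 addn1|].
  apply: t_asg1 => //; first by oks; rewrite ?n2 ?n3 ?n4 ?addn1 //; try lia; exact: tpM.
  split.
  + by rewrite /= n1.
  + by rewrite /= n2 n4 n3 addn1 tpv addnK.
  + by rewrite /= n4 addn1 a7 e3.
  + move=> u hu; rewrite /= n4 addn1 a7 d7 n3; case: (u =P v.+1) => [->|ne]; first by [].
    by apply: e4; lia.
- by lia.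
- by move=> s1 [e1 e2 e3 e4] _ _; split.
Qed.

Lemma c_digits_ok s S k (V : nat -> nat) : rg s sS = S -> rg s zpw = 2 ^ k -> 2 ^ k <= M -> S < M ->
  (forall v, v <= S -> ar s aV v = V v /\ V v < M) ->
  triple c_digits s (6 * S + 8) (fun s' => forall v, v <= S -> ar s' aC v = dig V k v).
Proof.
move=> hS hpw pM SM hV.
apply: (t_forc (N := S.+1) (B := 5) (I := fun v s1 => forall u, u < v -> ar s1 aC u = dig V k u)) => //.
- by oks; rewrite hS ltnW.
- by rewrite /= hS addn1.
- move=> v s1 hv IH fr fa.
  have [v1 v2] := hV v hv.
  have ev : ar s1 aV v = V v by rewrite fa.
  have ep : rg s1 zpw = 2 ^ k by rewrite fr.
  have vM : v < M by apply: leq_trans hv SM.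
  have pr x : x - (0 < x) = x.-1 by case: x => // x; rewrite /= subn1.
  have hle : (0 < (V v).+1 %/ 2 ^ k) <= (V v).+1 %/ 2 ^ k by case: posnP.
  have hle2 : (0 < (V v).+1 %/ 2 ^ k.+1) <= (V v).+1 %/ 2 ^ k.+1 by case: posnP.
  have dM1 : (V v).+1 %/ 2 ^ k <= M by apply: leq_trans (leq_div _ _) v2.
  have dM2 : (V v).+1 %/ 2 ^ k.+1 <= M by apply: leq_trans (leq_div _ _) v2.
  have uM : uk V k v <= M by apply: leq_trans (leq_pred _) dM1.
  have [h1 _ _ _] := dig_le V k v.
  apply: t_asg; first by oks; rewrite ?ev; lia.
  apply: t_asg; first by oks; rewrite ?ev ?ep ?addn1 //.
  apply: t_asg; first by oks; rewrite ?ev ?ep; lia.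
  apply: t_asg; first by oks; rewrite ?ev ?ep ?addn1 -?expnSr //.
  apply: t_sto1; [by oks; lia| |by apply: M_lim; rewrite /=; lia|by []|].
    oks; rewrite ?ev ?ep ?addn1 -?expnSr ?pr //.
      by apply: leq_trans (leq_pred _) dM2.
  move=> u; rewrite ltnS leq_eqVlt => /orP[/eqP->|hu] /=.
    by rewrite eqxx ev ep !addn1 -expnSr !pr.
  by rewrite (_ : (u == v) = false) ?IH //; apply/eqP; lia.
- by lia.
Qed.

Lemma c_load_ok s D n bit : rg s sD = D -> rg s zn = n -> rg s zbit = bit -> bit < 2 ->
  4 * D.+1 <= n -> 2 * n <= M ->
  triple c_load s (4 * n + 5 * D + 10) (fun s' => forall k,
    ar s' aP k = if k < n then nat_of_bool ((k %% 2 == bit) && (k %/ 2 <= D) && (ar s aY (k %/ 2) != 0))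
                 else if k < 2 * n then nat_of_bool ((k - n <= D) && (ar s aH (D - (k - n)) != 0)) else ar s aP k).
Proof.
move=> hD hn hb b2 nD nM.
apply: (t_seq (T1 := 4 * n + 2) (T2 := 5 * D + 8) (Q1 := fun s1 => forall k, ar s1 aP k = if k < 2 * n then 0 else ar s aP k)).
- apply: (t_forc (N := 2 * n) (B := 1) (I := fun j s1 => forall k, ar s1 aP k = if k < j then 0 else ar s aP k)) => //.
  + by oks; rewrite hn; lia.
  + by rewrite /= hn.
  + move=> j s1 hj IH fr fa; apply: t_sto1; [by oks|by oks|by apply: M_lim; rewrite /=; lia|by []|].
    by move=> k /=; rewrite ltnS (leq_eqVlt k j) IH; case: (k == j).
  + by lia.
- by lia.
move=> s1 h1 fr1 fa1.
apply: (t_forc (N := D.+1) (B := 4) (I := fun j s2 => forall k,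
    ar s2 aP k = if k < n then nat_of_bool ((k %% 2 == bit) && (k %/ 2 < j) && (ar s aY (k %/ 2) != 0))
                 else if k < 2 * n then nat_of_bool ((k - n <= D) && (D - (k - n) < j) && (ar s aH (D - (k - n)) != 0)) else ar s aP k)).
- by oks; rewrite fr1 // hD; lia.
- by rewrite /= fr1 // hD addn1.
- by lia.
- move=> k; rewrite h1 !ltn0 !andbF /=; case: (ltnP k n) => hk; last by [].
  by rewrite (_ : k < 2 * n) //; lia.
- move=> j s2 hj IH fr fa.
  have eD : rg s2 sD = D by rewrite fr //= fr1.
  have en : rg s2 zn = n by rewrite fr //= fr1.
  have eb : rg s2 zbit = bit by rewrite fr //= fr1.
  have eY : ar s2 aY j = ar s aY j by rewrite fa // fa1.
  have eH : ar s2 aH j = ar s aH j by rewrite fa // fa1.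
  have key k : (k %% 2 == bit) && (k %/ 2 == j) = (k == bit + 2 * j).
    apply/idP/eqP => [/andP[/eqP e1 /eqP e2]|->]; first by rewrite (divn_eq k 2) e1 e2; lia.
    by rewrite addnC mulnC modnMDl modn_small // divnMDl // divn_small // addn0 !eqxx.
  have key2 k : n <= k -> (k - n <= D) && (D - (k - n) == j) = (k == n + (D - j)).
    by move=> hk; apply/idP/eqP; lia.
  apply: (t_seq (T1 := 2) (T2 := 2) (Q1 := fun s3 => forall k,
    ar s3 aP k = if k < n then nat_of_bool ((k %% 2 == bit) && (k %/ 2 < j.+1) && (ar s aY (k %/ 2) != 0))
                 else if k < 2 * n then nat_of_bool ((k - n <= D) && (D - (k - n) < j) && (ar s aH (D - (k - n)) != 0)) else ar s aP k)) => //.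
    have split1 k : (k %% 2 == bit) && (k %/ 2 < j.+1) && (ar s aY (k %/ 2) != 0) =
       ((k == bit + 2 * j) && (ar s aY j != 0)) || ((k %% 2 == bit) && (k %/ 2 < j) && (ar s aY (k %/ 2) != 0)).
      rewrite -key ltnS leq_eqVlt; case: eqP => //= _; case: eqP => [->|_] //=; by rewrite ltnn orbF.
    apply: t_if; first by oks; lia.
    + rewrite [eval _ _ _ _]/= eY => hc; apply: t_skip => k /=; rewrite IH split1.
      have -> : (ar s aY j != 0) = false by move: hc; case: (ar s aY j).
      by rewrite andbF.
    + rewrite [eval _ _ _ _]/= eY => hc; have hc' : ar s aY j != 0 by move: hc; case: (ar s aY j).
      apply: t_sto1; [by oks; lia|by oks|by apply: M_lim; rewrite /= eb; lia|by []|].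
      move=> k /=; rewrite eb split1 hc' andbT IH; case: (k =P bit + 2 * j) => //= ->.
      by rewrite (_ : bit + 2 * j < n) //; lia.
  move=> s3 h3 fr3 fa3.
  have ej : rg s3 zx = j by rewrite fr3.
  have {}eD : rg s3 sD = D by rewrite fr3.
  have {}en : rg s3 zn = n by rewrite fr3.
  have {}eH : ar s3 aH j = ar s aH j by rewrite fa3.
  have split2 k : n <= k -> (k - n <= D) && (D - (k - n) < j.+1) && (ar s aH (D - (k - n)) != 0) =
       ((k == n + (D - j)) && (ar s aH j != 0)) || ((k - n <= D) && (D - (k - n) < j) && (ar s aH (D - (k - n)) != 0)).
    move=> hk; rewrite -key2 // ltnS (leq_eqVlt _ j).
    by case: (k - n <= D) => //=; case: (_ =P j) => [->|_] //=; rewrite ltnn orbF.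
  apply: t_if; first by oks; lia.
  + rewrite [eval _ _ _ _]/= ej eH => hc; apply: t_skip => k; rewrite h3; case: ltnP => // hk.
    have e0 : (ar s aH j != 0) = false by move: hc; case: (ar s aH j).
    by rewrite split2 // e0 andbF.
  + rewrite [eval _ _ _ _]/= ej eH => hc; have hc' : ar s aH j != 0 by move: hc; case: (ar s aH j).
    apply: t_sto1; [by oks; lia|by oks|by apply: M_lim; rewrite /= en eD ej; lia|by []|].
    move=> k /=; rewrite en eD ej h3; case: (k =P n + (D - j)) => [->|ne].
      rewrite (_ : (n + (D - j) < n) = false); last by lia.
      rewrite (_ : n + (D - j) < 2 * n); last by lia.
      by rewrite split2 ?leq_addr // eqxx hc'.
    by case: ltnP => // hk; rewrite split2 // (introF eqP ne).
- by lia.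
- move=> s2 h2 _ _ k /=; rewrite h2; case: ltnP => // hk; case: ltnP => // hk2.
  by case: (leqP (k - n) D) => //= h; rewrite ltnS leq_subr.
Qed.
End Sparse.

(** The last condition bounds the scale of the transform times a convolution coefficient, which is a
    sum of at most [D.+1] products of residues modulo [p]. *)
Record nums M S D p L T : Prop := Nums {
  nDL : D < 2 ^ L; nLD : 2 ^ L <= 2 * D + 1; npp : prime p; npD : 4 * D + 8 < p;
  nSD : S <= D; nDM : 8 * D + 8 <= M; nLM : L <= M; npM : p <= M; nTM : T <= M;
  nPM : 16 * 2 ^ L * L.+2 * (D.+1 * (p * p)) <= M }.

Definition ssinv w s S D p L T :=
  [/\ rg s sS = S, rg s sD = D, rg s sP = p, rg s slg = L & rg s sT = T] /\
  (wbd w (ar s aP) /\ forall k, 0 < k <= D -> ar s aINV k < p /\ k * ar s aINV k %% p = 1).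

Definition ss_cost D L T := T * (5000 * D.+1 * L.+2 ^ 5) + 2 * D + 10.

(** The event on the random words under which the computed table misses no attained sum. The
    converse inclusion, [hit_sound], holds for all words. *)
Definition complete p D T RND S c := forall y, y <= D -> bss c S y ->
  has (fun tau => hit p c RND S tau y) (iota 0 T).

Lemma hit_sound p c RND S T y : has (fun tau => hit p c RND S tau y) (iota 0 T) -> bss c S y.
Proof. by case/hasP => tau _; apply: gf_sound. Qed.

Lemma carry_inv s t K Wd U k y : carry s t K Wd U k y -> k < K ->
  exists y' h, [/\ y' <= Wd, carry s t K Wd U k.+1 y', h <= Wd, bss (dig U k) s h
    & y + h = t %/ 2 ^ k %% 2 + 2 * y'].
Proof.
case=> [|{}k {}y y' h _ _ hc hh hb e _]; first by rewrite ltnn.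
by exists y', h; split=> //; case: hc.
Qed.

Lemma carry_last s t K Wd U k y : carry s t K Wd U k y -> k = K -> y = 0.
Proof. by case=> // {}k {}y y' h kK _ _ _ _ _ e; rewrite e ltnn in kK. Qed.

Lemma count_iota1 (P : pred nat) n : count P (iota 1 n) = \sum_(v < n) P v.+1.
Proof.
elim: n => [|n IH]; first by rewrite big_ord0.
by rewrite -{1}[n.+1]addn1 iotaD count_cat IH big_ord_recr /= addn0 add1n.
Qed.

Section Level.
Variables (w : nat) (inp : nat -> nat) (ilim lim M : nat).
Local Notation W := (2 ^ w).
Local Notation triple := (triple w inp ilim lim).
Local Notation wbd := (wbd w).
Hypotheses (M2 : 100 < M) (MW : M ^ 12 < W) (Mlim : M ^ 5 < lim).
Let M1 : 1 < M. Proof. exact: ltn_trans M2. Qed.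
Let c1 : 1 <= M. Proof. exact: ltnW M1. Qed.
Let c2 : 2 <= M. Proof. exact: M1. Qed.
Let c5 : 5 <= M. Proof. exact: leq_trans (ltnW M2). Qed.
Local Notation M_W := (M_W M2 MW).
Local Notation M_lim := (M_lim M2 Mlim).
Local Notation t_forc := (t_forc M2 MW).
Ltac okt := okd_tac M1 MW Mlim.
Ltac oks := oks_tac M1 MW Mlim.

Lemma ss_ok s S D p L T c : nums M S D p L T -> ssinv w s S D p L T ->
  (forall v, v <= S -> ar s aC v = c v) -> (forall v, c v < M) ->
  triple c_ss s (ss_cost D L T) (fun s' => wbd (ar s' aP) /\
    forall y, y <= D -> ar s' aH y = has (fun tau => hit p c (ar s aRND) S tau y) (iota 0 T)).
Proof.
case=> h1 h2 h3 h4 h5 h6 h7 h8 h9 h10 [[e1 e2 e3 e4 e5] [e6 e7]] hC cM.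
by apply: (@c_ss_ok w inp ilim lim M M2 MW Mlim s D S p L T c) => //; lia.
Qed.

Lemma read_ok s D q (P : nat -> nat) : rg s sD = D -> 2 * D + 2 <= M -> (forall k, k <= 2 * D -> ar s aP k = P k) ->
  triple (For zx zx' (!sD + #1)%X (If (aP$[!zx + !sD] == #0) {{ sto aY$[!zx] ::= #0 }} Else {{ sto aY$[!zx] ::= #1 }}))
    s (3 * D + 5 + q) (fun s' => forall y, y <= D -> ar s' aY y = (P (y + D) != 0)).
Proof.
move=> hD DM hP.
apply: (t_forc (N := D.+1) (B := 2) (I := fun j s1 => forall y, y < j -> ar s1 aY y = (P (y + D) != 0))).
- by oks; rewrite hD; lia.
- by rewrite /= hD addn1.
- by lia.
- by [].
- move=> j s1 hj IH fr fa.
  have eD : rg s1 sD = D by rewrite fr.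
  have eP : ar s1 aP (j + D) = P (j + D) by rewrite fa // hP //; lia.
  have st v : v = (P (j + D) != 0) -> forall y, y < j.+1 ->
      (if (aY == aY) && (y == j) then nat_of_bool v else ar s1 aY y) = (P (y + D) != 0).
    move=> -> y; rewrite ltnS (leq_eqVlt y j) => /orP[/eqP->|hy] /=; first by rewrite eqxx.
    by rewrite (ltn_eqF hy) IH.
  apply: t_if; first by oks; lia.
  + rewrite [eval _ _ _ _]/= eD eP => hc; apply: t_sto1; [by oks|by oks|by apply: M_lim; rewrite /=; lia|by []|].
    by apply: (st false); move: hc; case: (P (j + D)).
  + rewrite [eval _ _ _ _]/= eD eP => hc; apply: t_sto1; [by oks|by oks|by apply: M_lim; rewrite /=; lia|by []|].
    by apply: (st true); move: hc; case: (P (j + D)).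
- by lia.
- by move=> s1 h _ _ y hy /=; apply: h.
Qed.

Lemma sum_neq0 n (F : nat -> nat) : (\sum_(i < n) F i != 0) <-> exists2 i, i < n & F i != 0.
Proof.
rewrite sum_nat_eq0; split=> [|[i hi h]].
  by rewrite negb_forall => /existsP[i]; exists i.
by rewrite negb_forall; apply/existsP; exists (Ordinal hi).
Qed.

Definition level_cost S D L T K := ss_cost D L T + 2000 * 2 ^ L.+1 * L.+2 ^ 4 + 6 * S + 16 * 2 ^ L + 8 * D + 2 * K + 40.

Lemma c_level_ok s S D p L T K j tt (V : nat -> nat) (RND := ar s aRND)
  (G := forall k, k < K -> complete p D T RND S (dig V k)) (k := K - j.+1) :
  nums M S D p L T -> ssinv w s S D p L T -> j < K -> K <= M -> 2 ^ K <= M -> tt <= M ->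
  rg s zb = j -> rg s zK = K -> rg s ztp = tt -> rg s zn = 2 ^ L.+2 ->
  (forall v, v <= S -> ar s aV v = V v /\ V v < M) ->
  (forall y, y <= D -> ar s aY y != 0 -> carry S tt K D V k.+1 y) ->
  (G -> forall y, y <= D -> carry S tt K D V k.+1 y -> ar s aY y != 0) ->
  triple c_level s (level_cost S D L T K) (fun s' => ssinv w s' S D p L T /\
    (forall y, y <= D -> ar s' aY y != 0 -> carry S tt K D V k y) /\
    (G -> forall y, y <= D -> carry S tt K D V k y -> ar s' aY y != 0)).
Proof.
move=> hN hss jK KM pK tM hb hK ht hn hV hsnd hcmp.
have [h1 h2 h3 h4 h5 h6 h7 h8 h9 h10] := hN.
have [[e1 e2 e3 e4 e5] [e6 e7]] := hss.
have kK : k < K by rewrite /k; lia.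
have pk : 2 ^ k <= M by apply: leq_trans pK; rewrite leq_exp2l // ltnW.
have n4 : 2 ^ L.+2 = 4 * 2 ^ L by rewrite !expnS mulnA.
have LL : 0 < 2 ^ L by rewrite expn_gt0.
have p2 : 4 * 2 ^ L <= D.+1 * (p * p).
  apply: (@leq_trans (p * p)); last by rewrite leq_pmull.
  by apply: leq_mul; lia.
have hM16 : 16 * 2 ^ L * L.+2 * (4 * 2 ^ L) <= M by apply: leq_trans h10; rewrite leq_mul2l p2 orbT.
have cM16 : 16 * 2 ^ L * L.+2 <= M by apply: leq_trans hM16; rewrite leq_pmulr // muln_gt0.
have nM : 8 * 2 ^ L <= M by apply: leq_trans cM16; rewrite -mulnA mulnCA; have : 2 ^ L <= 2 ^ L * L.+2 by [rewrite leq_pmulr]; rewrite mulnCA; lia.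
apply: (@t_weak _ _ _ _ _ _ ((2 * k + 3) + ((6 * S + 8) + (ss_cost D L T + ((4 * 2 ^ L.+2 + 5 * D + 10) + ((2000 * 2 ^ L.+1 * L.+2 ^ 4) + (3 * D + 5 + 0)).+1).+1))).+1); last 2 first.
- rewrite /level_cost n4; move: (2000 * _ * _) (ss_cost _ _ _) (2 ^ L) kK => a b c; lia.
- by move=> s' hh; exact: hh.
apply: t_asg; first by oks; rewrite ?hK ?hb; lia.
set s1 := setr _ zk _.
have ek1 : rg s1 zk = k by rewrite /= hK hb /k; lia.
apply: (t_seq (T2 := (6 * S + 8) + (ss_cost D L T + ((4 * 2 ^ L.+2 + 5 * D + 10) + ((2000 * 2 ^ L.+1 * L.+2 ^ 4) + (3 * D + 5 + 0)).+1).+1)) (@c_pow_ok w inp ilim lim M M2 MW Mlim zpw zk s1 k isT isT ek1 _ pk)) => //.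
  by apply: ltnW; apply: leq_trans kK KM.
move=> s2 hp2 fr2 fa2.
apply: (t_seq (T2 := ss_cost D L T + ((4 * 2 ^ L.+2 + 5 * D + 10) + ((2000 * 2 ^ L.+1 * L.+2 ^ 4) + (3 * D + 5 + 0)).+1).+1) (@c_digits_ok w inp ilim lim M M2 MW Mlim s2 S k V _ hp2 pk _ _)) => //.
- by rewrite fr2.
- by lia.
- by move=> v hv; rewrite fa2 //; apply: hV.
move=> s3 hC3 fr3 fa3.
have rs3 x : x \notin [:: zpw; ci; ci'; zk; zm; zx; za; za'] -> rg s3 x = rg s x.
  rewrite !inE !negb_or => /and4P[n1 n2 n3 /and5P[n4' n5 n6 n7 n8]].
  rewrite fr3 ?inE ?negb_or ?n1 ?n2 ?n3 ?n4' ?n5 ?n6 ?n7 ?n8 // fr2 ?inE ?negb_or ?n1 ?n2 ?n3 //.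
  by rewrite /= (negbTE n4').
have ss3 : ssinv w s3 S D p L T.
  split; first by split; rewrite rs3.
  split; first by rewrite fa3 // fa2.
  by move=> u hu; rewrite fa3 // fa2 //; apply: e7.
have cM v : dig V k v < M by have [_ h _ _] := dig_le V k v; lia.
apply: (t_seq (T2 := ((4 * 2 ^ L.+2 + 5 * D + 10) + ((2000 * 2 ^ L.+1 * L.+2 ^ 4) + (3 * D + 5 + 0)).+1).+1) (ss_ok hN ss3 hC3 cM)) => //.
move=> s4 [w4 hH4] fr4 fa4.
have eR3 : ar s3 aRND = RND by rewrite fa3 // fa2.
have rs4 x : x \in [:: sS; sD; sP; slg; sT; ztp; zn] -> rg s4 x = rg s x.
  by rewrite !inE => hx; rewrite fr4 ?rs3 //; repeat case/orP: hx => [/eqP->//|hx]; move/eqP: hx => ->.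
have ep4 : rg s4 zpw = 2 ^ k by rewrite fr4 //= fr3.
have bitE : tt %/ 2 ^ k %% 2 < 2 by rewrite ltn_mod.
apply: t_asg.
  by oks; rewrite ?rs4 ?inE //; lia.
set s5 := setr _ zbit _.
have eb5 : rg s5 zbit = tt %/ 2 ^ k %% 2 by rewrite /= rs4 // ep4 ht.
apply: (t_seq (T2 := ((2000 * 2 ^ L.+1 * L.+2 ^ 4) + (3 * D + 5 + 0)).+1)
  (@c_load_ok w inp ilim lim M M2 MW Mlim s5 D (2 ^ L.+2) _ _ _ eb5 bitE _ _)) => //.
- by rewrite /= rs4.
- by rewrite /= rs4.
- by rewrite n4; lia.
- by rewrite n4; lia.
move=> s6 hP6 fr6 fa6.
have eL6 : rg s6 slg = L by rewrite fr6 //= rs4.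
apply: t_asg; first by oks; rewrite eL6; lia.
set s7 := setr _ cMU _.
have eMU : rg s7 cMU = L.+1 by rewrite /= eL6 addn1.
have eP7 k0 : ar s7 aP k0 = if k0 < 2 ^ L.+2 then nat_of_bool ((k0 %% 2 == tt %/ 2 ^ k %% 2) && (k0 %/ 2 <= D) && (ar s aY (k0 %/ 2) != 0))
                 else if k0 < 2 * 2 ^ L.+2 then nat_of_bool ((k0 - 2 ^ L.+2 <= D) && (ar s4 aH (D - (k0 - 2 ^ L.+2)) != 0)) else ar s4 aP k0.
  by rewrite /s7 [ar _ _ _]/= hP6 /s5 /= fa4 // fa3 // fa2.
have b1 (b : bool) : b <= M by apply: leq_trans (leq_b1 b) c1.
have w7 : wbd (ar s7 aP).
  move=> k0; rewrite eP7; case: ifP => _; first exact: M_W (b1 _).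
  by case: ifP => _; [exact: M_W (b1 _)|exact: w4].
have cs : conv_size L.+1 <= 16 * 2 ^ L * L.+2 by rewrite /conv_size expnS mulnA.
have cs' : conv_size L.+1 <= M by apply: leq_trans cs cM16.
have term k0 i : k0 < 2 ^ L.+2 -> i <= k0 -> ar s7 aP i * ar s7 aP (2 ^ L.+2 + (k0 - i)) =
   nat_of_bool ((i %% 2 == tt %/ 2 ^ k %% 2) && (i %/ 2 <= D) && (ar s aY (i %/ 2) != 0) && ((k0 - i <= D) && (ar s4 aH (D - (k0 - i)) != 0))).
  move=> hk0 hi; rewrite !eP7 (leq_ltn_trans hi hk0) (_ : (2 ^ L.+2 + (k0 - i) < 2 ^ L.+2) = false); last by lia.
  by rewrite (_ : 2 ^ L.+2 + (k0 - i) < 2 * 2 ^ L.+2) ?addKn ?mulnb //; lia.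
apply: (t_seq (T2 := 3 * D + 5 + 0) (@c_mul_ok w inp ilim lim M M2 MW Mlim s7 L.+1 (2 * D + 2) D.+1 eMU cs' w7 _ _ _ _)) => //.
- by rewrite n4; lia.
- move=> k0 hk0 hk1; rewrite eP7 hk1 (_ : (k0 %/ 2 <= D) = false) ?andbF //.
  apply: negbTE; rewrite -ltnNge leq_divRL //; lia.
- move=> k0 hk0 hk1; rewrite eP7 (_ : (2 ^ L.+2 + k0 < 2 ^ L.+2) = false); last by lia.
  by rewrite (_ : 2 ^ L.+2 + k0 < 2 * 2 ^ L.+2) ?addKn; [rewrite leqNgt hk0|lia].
- move=> k0 hk0; apply: leq_trans hM16; apply: leq_mul => //.
  apply: leq_trans (_ : \sum_(i < k0.+1) 1 <= _).
    by apply: leq_sum => i _; rewrite term ?leq_b1 // -ltnS.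
  by rewrite sum1_card card_ord -n4.
move=> s8 [Kc /andP[K0 _] [eK w8 hZ]] fr8 fa8.
have e8 y : y <= D -> (ar s8 aP (y + D) != 0) <-> exists y' h, [/\ y' <= D, ar s aY y' != 0, h <= D, ar s4 aH h != 0 & y + h = tt %/ 2 ^ k %% 2 + 2 * y'].
  move=> hy; have hyn : y + D < 2 ^ L.+2 by rewrite n4; lia.
  have [-> _] := hZ _ hyn; rewrite muln_eq0 negb_or -lt0n K0 /=.
  rewrite (eq_bigr (fun i : 'I_(y + D).+1 => nat_of_bool ((i %% 2 == tt %/ 2 ^ k %% 2) && (i %/ 2 <= D) && (ar s aY (i %/ 2) != 0) && ((y + D - i <= D) && (ar s4 aH (D - (y + D - i)) != 0))))); last first.
    by move=> i _; rewrite term // -ltnS.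
  rewrite (sum_neq0 _ (fun i => nat_of_bool ((i %% 2 == tt %/ 2 ^ k %% 2) && (i %/ 2 <= D) && (ar s aY (i %/ 2) != 0) && ((y + D - i <= D) && (ar s4 aH (D - (y + D - i)) != 0))))).
  split.
    case=> i hi; rewrite eqb0 negbK => /andP[/andP[/andP[/eqP i1 i2] i3] /andP[i4 i5]].
    exists (i %/ 2), (D - (y + D - i)); split=> //; first exact: leq_subr.
    by rewrite -i1; have := divn_eq i 2; lia.
  case=> y' [h [y1 y2 y3 y4 y5]]; exists (y + h); first by lia.
  rewrite (_ : (y + h) %/ 2 = y'); last by rewrite y5 addnC mulnC divnMDl // divn_small // addn0.
  rewrite (_ : (y + h) %% 2 = tt %/ 2 ^ k %% 2); last by rewrite y5 addnC mulnC modnMDl modn_small.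
  rewrite eqxx y1 y2 (_ : D - (y + D - (y + h)) = h); last by lia.
  by rewrite y4 (_ : y + D - (y + h) <= D) //; lia.
have rs8 x : x \in [:: sS; sD; sP; slg; sT] -> rg s8 x = rg s x.
  rewrite !inE => /or4P[/eqP->|/eqP->|/eqP->|/orP[/eqP->|/eqP->]];
    by rewrite fr8 //= fr6 //= rs4.
apply: t_weak (t_frame (@read_ok s8 D 0 (ar s8 aP) _ _ _)) (leqnn _) _ => //.
- by rewrite rs8.
- by lia.
move=> s9 [hY9 fr9 fa9]; split; [|split].
- split; first by split; rewrite fr9 // rs8.
  split; first by rewrite fa9.
  by move=> u hu; rewrite fa9 // fa8 //= fa6 //= fa4 // fa3 // fa2 //; apply: e7.
- move=> y hy; rewrite hY9 // eqb0 negbK => /(e8 _ hy)[y' [h [y1 y2 y3 y4 y5]]].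
  apply: (carryS kK hy (hsnd _ y1 y2) y3 _ y5).
  by move: y4; rewrite hH4 // eqb0 negbK => /hit_sound.
- move=> hG y hy hc; rewrite hY9 // eqb0 negbK; apply/(e8 _ hy).
  have [y' [h [y1 y2 y3 y4 y5]]] := carry_inv hc kK.
  exists y', h; split=> //; first exact: hcmp.
  by rewrite hH4 // eqb0 negbK eR3; apply: (hG k kK).
Qed.

Lemma c_sparse_ok s S D p L T lg t (U : nat -> nat) (RND := ar s aRND) (KK := S ^ 3 + S) (K := 5 * lg + 3)
  (V := resU U (gp t U) KK) :
  nums M S D p L T -> ssinv w s S D p L T -> 0 < S -> S < M -> S < 2 ^ lg -> rg s zlg = lg ->
  rg s zt = t -> t <= M -> KK <= M -> K <= M -> 2 ^ K <= M -> 2 * KK < M ->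
  (forall v, v <= S -> ar s aU v = U v /\ U v <= M) -> U 0 = 0 -> ar s aV 0 = 0 ->
  2 * S * count (fun v => 0 < U v) (iota 1 S) <= D -> t <= \sum_(v < S.+1) v * U v ->
  triple c_sparse s (12 * S + 2 * D + 2 * L + 25 + K * (level_cost S D L T K).+1) (fun s' =>
    [/\ ssinv w s' S D p L T, rg s' zans != 0 -> bss U S t &
     (forall k, k < K -> complete p D T RND S (dig V k)) -> bss U S t -> rg s' zans != 0]).
Proof.
move=> hN hss S0 SM Slg hlg ht tM KM kM pK KM2 hU U0 hV0 hcnt tS.
have [h1 h2 h3 h4 h5 h6 h7 h8 h9 h10] := hN.
have [[e1 e2 e3 e4 e5] [e6 e7]] := hss.
have LL : 0 < 2 ^ L by rewrite expn_gt0.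
have nM : 4 * 2 ^ L <= M.
  apply: leq_trans h10; apply: (@leq_trans (16 * 2 ^ L * L.+2 * 1)); last by rewrite leq_mul2l !muln_gt0 (prime_gt0 h3) orbT.
  by rewrite muln1 -mulnA; have : 2 ^ L <= 2 ^ L * L.+2 by [rewrite leq_pmulr]; lia.
have e : 12 * S + 2 * D + 2 * L + 25 + K * (level_cost S D L T K).+1 = (12 * S + 5) + ((2 * L.+2 + 3) + ((2 * D + 4) + ((K * (level_cost S D L T K).+1 + 2) + 1).+1)).+2 + 3.
  by move: (K * _.+1) => z; clear; lia.
apply: (t_seq (T2 := ((2 * L.+2 + 3) + ((2 * D + 4) + ((K * (level_cost S D L T K).+1 + 2) + 1).+1)).+2)
   (@c_reduce_ok w inp ilim lim M M2 MW Mlim s S t U e1 ht SM tM KM hU)).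
  by rewrite e leq_addr.
move=> s1 [hV [hV1 htp]] fr1 fa1.
have lg1 : rg s1 zlg = lg by rewrite fr1.
apply: t_asg; first by oks; rewrite ?lg1; lia.
apply: t_asg; first by oks; rewrite ?fr1 //; lia.
set s2 := setr _ cx _.
have ex2 : rg s2 cx = L.+2 by rewrite /= fr1 //= e4 addn2.
have n4 : 2 ^ L.+2 = 4 * 2 ^ L by rewrite !expnS mulnA.
apply: (t_seq (T2 := (2 * D + 4) + ((K * (level_cost S D L T K).+1 + 2) + 1).+1)
  (@c_pow_ok w inp ilim lim M M2 MW Mlim zn cx s2 L.+2 isT isT ex2 _ _)) => //.
- have := ltn_expl L.+2 (ltnSn 1); lia.
- by rewrite n4.
move=> s3 hn3 fr3 fa3.
apply: (t_seq (T1 := 2 * D + 4) (T2 := ((K * (level_cost S D L T K).+1 + 2) + 1).+1)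
   (Q1 := fun s4 => forall k, k <= D -> ar s4 aY k = 0)) => //.
  apply: (t_forc (N := D.+1) (B := 1) (I := fun j s4 => forall k, k < j -> ar s4 aY k = 0)) => //.
  + by oks; rewrite fr3 //= fr1 //; lia.
  + by rewrite /= fr3 //= fr1 //= e2 addn1.
  + by lia.
  + move=> j s4 hj IH fr fa; apply: t_sto1; [by oks|by oks|by apply: M_lim; rewrite /=; lia|by []|].
    by move=> k; rewrite ltnS leq_eqVlt => /orP[/eqP->|/IH h] /=; rewrite ?eqxx // h if_same.
  + by lia.
move=> s4 hY4 fr4 fa4.
apply: t_sto; [by oks|by oks|by apply: M_lim|].
set s5 := seta _ aY _ _.
pose tt := t - \sum_(v < S.+1) v * (gp t U v - KK).
have hY5 y : y <= D -> ar s5 aY y = (y == 0) by move=> hy /=; case: eqP => // _; rewrite hY4.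
have ds := rm_lt S0 tS.
have hgp v : gp t U v <= U v by apply: geq_minl.
have hred := @bss_res S (rm t U S) t U (gp t U) hgp (gp_sum t U S) ds.
rewrite -/KK -/V -/tt in hred.
have V2K v : V v <= 2 * KK by rewrite /V /resU; lia.
have ttM : tt <= M by apply: leq_trans tM; apply: leq_subr.
have s5b : S ^ 5 < 2 ^ (5 * lg) by rewrite mulnC expnM ltn_exp2r.
(* Origin of [K]: the residual target is at most [S * (S * KK) + S], of order [S ^ 5], and the
   factor 8 from the [+ 3] absorbs the lower terms. The residual multiplicities are smaller
   still. *)
have KKb : 2 * KK + 1 < 2 ^ K /\ S * (S * KK) + S < 2 ^ K.
  rewrite /K expnD (_ : 2 ^ 3 = 8) // /KK.
  have p3 : S ^ 3 <= S ^ 5 by rewrite leq_exp2l' || rewrite leq_pexp2l.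
  have p1 : S <= S ^ 3 by rewrite -{1}[S]expn1 leq_pexp2l.
  have -> : S * (S * (S ^ 3 + S)) = S ^ 5 + S ^ 3 by ring.
  lia.
have ttK : tt < 2 ^ K.
  apply: leq_ltn_trans KKb.2.
  have h := gp_sum t U S.
  suff : \sum_(v < S.+1) v * gp t U v <= \sum_(v < S.+1) v * (gp t U v - KK) + S * (S * KK) by rewrite /tt; lia.
  apply: (@leq_trans (\sum_(v < S.+1) (v * (gp t U v - KK) + v * KK))).
    by apply: leq_sum => v _; rewrite -mulnDr leq_mul2l; apply/orP; right; lia.
  rewrite big_split /= leq_add2l -big_distrl /= mulnA leq_mul2r; apply/orP; right.
  rewrite big_ord_recl add0n; apply: (@leq_trans (\sum_(i < S) S)); last by rewrite sum_nat_const card_ord.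
  by apply: leq_sum => i _; rewrite lift0; exact: ltn_ord.
have VK v : (V v).+1 < 2 ^ K by apply: leq_ltn_trans KKb.1; have := V2K v; lia.
(* A digit is at most 2, so one level sums to at most [2 * S] times the number of distinct sizes,
   the value of [D] in this case. *)
have VW : \sum_(v < S.+1) v * (2 * (0 < V v)) <= D.
  apply: leq_trans hcnt; rewrite count_iota1 big_ord_recl mul0n add0n big_distrr /=.
  apply: leq_sum => v _; rewrite /bump leq0n add1n; have hv := ltn_ord v.
  have [u0|u0] := posnP (U v.+1); last first.
    by rewrite /= muln1 mulnC; apply: leq_mul => //; rewrite -[X in _ <= X]muln1 leq_mul2l leq_b1.
  by rewrite /V /resU u0 min0n muln0.
have rs5' x : x \in [:: sS; sD; sP; slg; sT] -> rg s5 x = rg s x.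
  rewrite !inE => /or4P[/eqP->|/eqP->|/eqP->|/orP[/eqP->|/eqP->]];
    by rewrite /= fr4 //= fr3 //= fr1.
have ar5 a k : a \notin [:: aV; aY] -> ar s5 a k = ar s a k.
  rewrite !inE negb_or => /andP[n1 n2]; rewrite /= (negbTE n2) /= fa4 ?inE // fa3 // fa1 //.
  by rewrite inE.
have ss5 : ssinv w s5 S D p L T.
  split; first by split; rewrite rs5'.
  by split=> [k|k hk]; rewrite ar5 //; apply: e7.
have K5 : rg s5 zK = K by rewrite /= fr4 //= fr3 //= lg1.
have t5 : rg s5 ztp = tt by rewrite /= fr4 //= fr3.
have n5 : rg s5 zn = 2 ^ L.+2 by rewrite /= fr4.
have R5 : ar s5 aRND = RND by rewrite /= fa4 // fa3 // fa1.
have V5 v : v <= S -> ar s5 aV v = V v /\ V v < M.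
  move=> hv; split; last by apply: leq_ltn_trans KM2.
  rewrite /= fa4 //= fa3 //=; case: v hv => [|v] hv; last by rewrite hV.
  by rewrite hV1 hV0 /V /resU U0 min0n.
apply: (t_seq (T1 := K * (level_cost S D L T K).+1 + 2) (T2 := 1) (Q1 := fun s6 => ssinv w s6 S D p L T /\
    ((forall y, y <= D -> ar s6 aY y != 0 -> carry S tt K D V 0 y) /\
    ((forall k, k < K -> complete p D T RND S (dig V k)) -> forall y, y <= D -> carry S tt K D V 0 y -> ar s6 aY y != 0)))) => //.
  apply: (t_forc (N := K) (B := level_cost S D L T K) (I := fun j s6 => ssinv w s6 S D p L T /\
    ((forall y, y <= D -> ar s6 aY y != 0 -> carry S tt K D V (K - j) y) /\
    ((forall k, k < K -> complete p D T RND S (dig V k)) -> forall y, y <= D -> carry S tt K D V (K - j) y -> ar s6 aY y != 0)))).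
  + by oks.
  + by rewrite /= -K5.
  + exact: kM.
  + split; first by exact: ss5.
    rewrite subn0; split=> [y hy|_ y hy hc].
      by rewrite [ar _ _ _]hY5 // eqb0 negbK => /eqP->; apply: carryK.
    rewrite [ar _ _ _]hY5 // eqb0 negbK.
    by rewrite (carry_last hc erefl).
  + move=> j s6 hj [ss6 [i1 i2]] fr fa.
    have aR6 : ar (setr s6 zb j) aRND = RND by rewrite /= fa.
    have eS : (K - j.+1).+1 = K - j by lia.
    move: (@c_level_ok (setr s6 zb j) S D p L T K j tt V); cbv zeta; rewrite aR6 eS => HH; apply: HH => //.
    * by rewrite /= fr.
    * by rewrite /= fr.
    * by rewrite /= fr.
    * by move=> v hv; rewrite /= fa //; apply: V5.
  + by [].
  + by move=> s6 [ss6 h]; rewrite subnn in h.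
move=> s6 [ss6 [i1 i2]] fr6 fa6.
apply: t_asg1; [by oks|by []|].
split; first by exact: ss6.
- move=> h; apply/hred/(carryP ttK VK VW); apply: i1 => //.
- by move=> hG /hred /(carryP ttK VK VW) hc; apply: i2.
Qed.
End Level.

(** * The program for many distinct sizes *)

Definition c_delta :=
  zdl ::= #0;;
  for zb upto !zq in zb' {{
    zcnt ::= #0;;
    for za upto !sS + #1 in za' {{
      If aU$[!za] == #0 {{ Skip }} Else {{
        If aU$[!za + (!zb + #1)] == #0 {{ Skip }} Else {{ zcnt ::= !zcnt + #1 }} }} }};;
    If !zcnt < #10 * !zq {{ Skip }} Else {{ zdl ::= !zb + #1 }} }}.

(** Working from the saved table [aR2] prevents one copy of an item from being used several
    times. *)
Definition c_copy_item :=
  for zx upto !zdl in zx' {{ sto aR2$[!zx] ::= aR$[!zx] }};;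
  for zx upto !zdl in zx' {{
    If aR2$[!zx] == #0 {{ Skip }} Else {{ sto aR$[(!zx + (!za + #1)) %% !zdl] ::= #1 }} }}.

(** Copies are added one by one. Capping the multiplicity at the modulus [zdl <= zq] keeps the total
    work at [O(S * q ^ 2)]. *)
Definition c_res :=
  for zx upto !zdl in zx' {{ sto aR$[!zx] ::= #0 }};;
  sto aR$[#0] ::= #1;;
  for za upto !sS in za' {{
    If aU$[!za + #1] < !zdl {{ zm ::= aU$[!za + #1] }} Else {{ zm ::= !zdl }};;
    for zb upto !zm in zb' {{ c_copy_item }} }}.

Definition c_dense :=
  for za upto !sS + #1 in za' {{ sto aC$[!za] ::= aU$[!za] }};;
  If !zt < !sD + #1 {{ c_ss;; zans ::= aH$[!zt] }} Else {{
    If (!zSig - !zt) < !sD + #1 {{ c_ss;; zans ::= aH$[!zSig - !zt] }} Else {{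
      c_delta;; c_res;; zans ::= aR$[!zt %% !zdl] }} }}.

Lemma pcE (U : nat -> nat) S d : (forall v, S < v -> U v = 0) ->
  pc d [seq v <- iota 1 S | 0 < U v] = \sum_(v < S.+1) ((0 < U v) && (0 < U (v + d)) && (0 < v)).
Proof.
move=> hU; rewrite /pc count_filter big_ord_recl andbF add0n count_iota1.
apply: eq_bigr => v _; rewrite lift0 /= andbT andbC; congr (nat_of_bool (_ && _)).
rewrite mem_filter mem_iota; have [h|h] := posnP (U (v.+1 + d)) => //=.
by rewrite addSn /= add1n ltnS; case: leqP => // hl; rewrite addSn hU in h.
Qed.

Lemma sub_consP x l y : sub (x :: l) y <-> sub l y \/ exists2 z, y = x + z & sub l z.
Proof.
split; first exact: sub_cons.
case=> [[l1 [l2 [p e]]]|[z -> h]].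
  exists l1, (x :: l2); split=> //; by rewrite -(cat1s x l2) perm_sym perm_catCA /= perm_cons perm_sym.
by apply: (@sub_cat [:: x] l); rewrite // -{2}[x]addn0; exact: (sub_all [:: x]).
Qed.

Definition rset d l x := exists2 y, sub l y & y %% d = x.

Lemma rset_nil d x : 0 < d -> rset d [::] x <-> x = 0.
Proof.
move=> d0; split=> [[y [l1 [l2 [p e]]] <-]|->].
  by move/perm_size: p; rewrite size_cat -e; case: l1 {e} => //=; rewrite mod0n.
by exists 0; rewrite ?mod0n //; exact: sub0.
Qed.

Lemma rset_cons d a l x : x < d -> rset d (a :: l) x <->
  rset d l x \/ exists2 x', x' < d & rset d l x' /\ (x' + a) %% d = x.
Proof.
move=> xd; have d0 : 0 < d by apply: leq_ltn_trans xd.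
split.
  move=> [y /sub_consP[h|[z -> h]] e]; first by left; exists y.
  by right; exists (z %% d); rewrite ?ltn_mod //; split; [exists z|rewrite modnDml addnC].
move=> [[y h e]|[x' _ [[y h e'] e]]].
  by exists y => //; apply/sub_consP; left.
by exists (a + y); [apply/sub_consP; right; exists y|rewrite addnC -modnDml e'].
Qed.

Section Dense.
Variables (w : nat) (inp : nat -> nat) (ilim lim M : nat).
Local Notation W := (2 ^ w).
Local Notation triple := (triple w inp ilim lim).
Local Notation wbd := (wbd w).
Hypotheses (M2 : 100 < M) (MW : M ^ 12 < W) (Mlim : M ^ 5 < lim).
Let M1 : 1 < M. Proof. exact: ltn_trans M2. Qed.
Let c1 : 1 <= M. Proof. exact: ltnW M1. Qed.
Let c2 : 2 <= M. Proof. exact: M1. Qed.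
Let c10 : 10 <= M. Proof. exact: leq_trans (ltnW M2). Qed.
Local Notation M_W := (M_W M2 MW).
Local Notation M_lim := (M_lim M2 Mlim).
Local Notation t_forc := (t_forc M2 MW).
Ltac okt := okd_tac M1 MW Mlim.
Ltac oks := oks_tac M1 MW Mlim.

Definition cntf (U : nat -> nat) S d := \sum_(v < S.+1) ((0 < U v) && (0 < U (v + d))).

Lemma c_delta_ok s S q (U : nat -> nat) : rg s sS = S -> rg s zq = q -> S < M -> q < M ->
  (forall v, ar s aU v = U v) ->
  triple c_delta s (q * (4 * S + 12) + 3) (fun s' =>
    (exists2 d, 0 < d <= q & 10 * q <= cntf U S d) ->
    0 < rg s' zdl <= q /\ 10 * q <= cntf U S (rg s' zdl)).
Proof.
move=> hS hq SM qM hU; rewrite addnS; apply: t_asg; first by oks.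
apply: (t_forc (N := q) (B := 4 * S + 11) (I := fun j s1 => (exists2 d, 0 < d <= j & 10 * q <= cntf U S d) ->
    0 < rg s1 zdl <= q /\ 10 * q <= cntf U S (rg s1 zdl))).
- by oks.
- by rewrite /= hq.
- exact: ltnW.
- by case=> d; lia.
- move=> j s1 hj IH fr fa.
  have eU v : ar s1 aU v = U v by rewrite fa // hU.
  have eS : rg s1 sS = S by rewrite fr.
  have eq : rg s1 zq = q by rewrite fr.
  rewrite addnS; apply: t_asg; first by oks.
  apply: (t_seq (T1 := 4 * S + 8) (T2 := 2) (Q1 := fun s2 => rg s2 zcnt = cntf U S j.+1)).
  + apply: (t_forc (N := S.+1) (B := 3) (I := fun v s2 => rg s2 zcnt <= v /\
       rg s2 zcnt = \sum_(u < v) ((0 < U u) && (0 < U (u + j.+1))))).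
    * by oks; lia.
    * by rewrite /= eS addn1.
    * exact: SM.
    * by rewrite /= big_ord0.
    * move=> v s2 hv [i1 i2] fr2 fa2.
      have eU2 u : ar s2 aU u = U u by rewrite fa2 // eU.
      have ej : rg s2 zb = j by rewrite fr2.
      apply: t_if; first by oks; lia.
      - rewrite [eval _ _ _ _]/= eU2 => hc; apply: t_skip.
        have -> : rg (setr s2 za v) zcnt = rg s2 zcnt by [].
        rewrite big_ord_recr /= -i2; have -> : 0 < U v = false by move: hc; case: (U v).
        by rewrite addn0; split=> //; apply: leqW.
      - rewrite [eval _ _ _ _]/= eU2 => hc.
        apply: t_if; first by oks; lia.
        + rewrite [eval _ _ _ _]/= eU2 ej addn1 => hc2; apply: t_skip.
          have -> : rg (setr s2 za v) zcnt = rg s2 zcnt by [].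
          rewrite big_ord_recr /= -i2; have -> : 0 < U (v + j.+1) = false by move: hc2; case: (U _).
          by rewrite andbF addn0; split=> //; apply: leqW.
        + rewrite [eval _ _ _ _]/= eU2 ej addn1 => hc2; apply: t_asg1; [by oks; lia|by []|].
          have -> : rg (setr (setr s2 za v) zcnt (eval w inp (!zcnt + #1)%X (setr s2 za v))) zcnt = rg s2 zcnt + 1 by [].
          rewrite big_ord_recr /= -i2; have -> : 0 < U v by move: hc; case: (U v).
          have -> : 0 < U (v + j.+1) by move: hc2; case: (U _).
          by rewrite addn1.
    * by lia.
    * by move=> s2 [_ h] _ _.
  + by lia.
  move=> s2 hc2 fr2 fa2.
  have ej2 : rg s2 zb = j by rewrite fr2.
  have eq2 : rg s2 zq = q by rewrite fr2.
  have ed2 : rg s2 zdl = rg s1 zdl by rewrite fr2.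
  have cM : cntf U S j.+1 <= M.
    apply: leq_trans SM; rewrite /cntf -[X in _ <= X]card_ord -sum1_card; apply: leq_sum => v _; exact: leq_b1.
  apply: t_if; first by oks; rewrite ?eq2; lia.
  + rewrite [eval _ _ _ _]/= hc2 eq2 => hc; apply: t_skip; rewrite ed2 => -[d hd1 hd2].
    apply: IH; exists d => //; case: (d =P j.+1) hd2 => [->|ne _]; last by lia.
    by move: hc; case: ltnP => //; lia.
  + rewrite [eval _ _ _ _]/= hc2 eq2 => hc; apply: t_asg1; [by oks; lia|by []|] => _.
    rewrite [rg _ _]/= ej2 addn1; split; first by lia.
    by move: hc; case: ltnP.
- by lia.
- by move=> s1 h _ _; exact: h.
Qed.

Definition Rok d l s := forall x, x < d -> (ar s aR x != 0 <-> rset d l x).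

Lemma c_copy_item_ok s d a l : rg s zdl = d -> rg s za = a -> d <= M -> a < M -> 0 < d -> Rok d l s ->
  (forall x, x < d -> ar s aR x <= 1) ->
  triple c_copy_item s (5 * d + 4) (fun s' => Rok d (a.+1 :: l) s' /\ forall x, x < d -> ar s' aR x <= 1).
Proof.
move=> hd ha dM aM d0 hR hR1.
apply: (t_seq (T1 := 2 * d + 2) (T2 := 3 * d + 2) (Q1 := fun s1 => forall x, x < d -> ar s1 aR2 x = ar s aR x)).
- apply: (t_forc (N := d) (B := 1) (I := fun j s1 => forall x, x < j -> ar s1 aR2 x = ar s aR x)).
  + by oks.
  + by rewrite /= hd.
  + exact: dM.
  + by [].
  + move=> j s1 hj IH fr fa; apply: t_sto1; [by oks; lia|by oks; lia|by apply: M_lim; rewrite /=; lia|by []|].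
    move=> x; rewrite ltnS leq_eqVlt => /orP[/eqP->|hx] /=; first by rewrite eqxx fa.
    by rewrite (ltn_eqF hx) IH.
  + by lia.
  + by move=> s1 h _ _; exact: h.
- by lia.
move=> s1 h1 fr1 fa1.
apply: (t_forc (N := d) (B := 2) (I := fun j s2 => forall x, x < d -> ar s2 aR x <= 1 /\
   (ar s2 aR x != 0 <-> ar s aR x != 0 \/ exists2 x', x' < j & ar s aR x' != 0 /\ (x' + a.+1) %% d = x))).
- by oks.
- by rewrite /= fr1.
- exact: dM.
- move=> x hx; rewrite /= fa1 //; split; first exact: hR1.
  by split=> [->|[//|[x']]]; [left|].
- move=> j s2 hj IH fr fa.
  have e2 : ar s2 aR2 j = ar s aR j by rewrite fa // h1.
  have ed : rg s2 zdl = d by rewrite fr //= fr1.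
  have ea : rg s2 za = a by rewrite fr //= fr1.
  have md : (j + a.+1) %% d < d by rewrite ltn_mod.
  apply: t_if; first by oks; lia.
  + rewrite [eval _ _ _ _]/= e2 => hc; have {}hc : ar s aR j = 0 by move: hc; case: (ar s aR j).
    apply: t_skip => x hx; have [i1 i2] := IH x hx; split=> //; rewrite [ar _ _ _]/=; apply: (iff_trans i2).
    split=> [[h|[x' hx' h]]|[h|[x' hx' h]]]; [by left|by right; exists x' => //; apply: leqW|by left|right].
    exists x' => //; move: hx'; rewrite ltnS leq_eqVlt => /orP[/eqP ej|//].
    by case: h; rewrite ej hc.
  + rewrite [eval _ _ _ _]/= e2 => hc; have {}hc : ar s aR j != 0 by move: hc; case: (ar s aR j).
    apply: t_sto1; [by oks; rewrite ?ed ?ea; lia|by oks|by apply: M_lim; rewrite /= ea ed addn1; lia|by []|].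
    move=> x hx; have [i1 i2] := IH x hx; rewrite [ar _ _ _]/= ea ed addn1.
    case: (x =P (j + a.+1) %% d) => [->|ne].
      by split=> //; split=> // _; right; exists j.
    split=> //; apply: (iff_trans i2).
    split=> [[h|[x' hx' h]]|[h|[x' hx' h]]]; [by left|by right; exists x' => //; apply: leqW|by left|right].
    exists x' => //; move: hx'; rewrite ltnS leq_eqVlt => /orP[/eqP ej|//].
    by case: h => _ h; case: ne; rewrite -h ej.
- by lia.
- move=> s2 h2 _ _; split=> x hx; last by have [] := h2 x hx.
  have [_ i2] := h2 x hx; apply: (iff_trans i2); apply: iff_sym; apply: (iff_trans (rset_cons _ _ hx)).
  split=> [[h|[x' hx' [h e]]]|[h|[x' hx' [h e]]]]; [by left; apply/hR|right|by left; apply/hR|right];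
    by exists x' => //; split=> //; apply/hR.
Qed.

Lemma c_res_ok s S d q (U : nat -> nat) : rg s sS = S -> rg s zdl = d -> S < M -> q <= M -> 0 < d <= q ->
  (forall v, v <= S -> ar s aU v = U v /\ U v <= M) ->
  triple c_res s (S * (q * (5 * q + 5) + 5) + 2 * q + 5) (fun s' =>
    Rok d (msi (fun v => minn (U v) d) S) s').
Proof.
move=> hS hd SM qM /andP[d0 dq] hU.
have dM : d <= M by apply: leq_trans qM.
apply: (t_seq (T1 := 2 * d + 2) (T2 := (S * (q * (5 * q + 5) + 5) + 2).+1) (Q1 := fun s1 => forall x, x < d -> ar s1 aR x = 0)).
- apply: (t_forc (N := d) (B := 1) (I := fun j s1 => forall x, x < j -> ar s1 aR x = 0)).
  + by oks.
  + by rewrite /= hd.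
  + exact: dM.
  + by [].
  + move=> j s1 hj IH fr fa; apply: t_sto1; [by oks; lia|by oks; lia|by apply: M_lim; rewrite /=; lia|by []|].
    move=> x; rewrite ltnS leq_eqVlt => /orP[/eqP->|hx] /=; first by rewrite eqxx.
    by rewrite (ltn_eqF hx) IH.
  + by lia.
  + by move=> s1 h _ _; exact: h.
- by move: (S * _) => z; lia.
move=> s1 h1 fr1 fa1.
apply: t_sto; [by oks|by oks|by apply: M_lim|].
set s2 := seta _ _ _ _.
apply: (t_forc (N := S) (B := q * (5 * q + 5) + 4) (I := fun v s3 => Rok d (msi (fun v => minn (U v) d) v) s3 /\ forall x, x < d -> ar s3 aR x <= 1)).
- by oks.
- by rewrite /= fr1.
- exact: ltnW.
- split=> x hx; rewrite /s2 [ar _ _ _]/=; last by case: eqP => // _; rewrite h1.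
  apply: iff_sym; apply: (iff_trans (rset_nil x d0)).
  by case: (x =P 0) => [->|ne]; [split|rewrite h1].
- move=> v s3 hv [i1 i2] fr fa.
  have [u1 u2] := hU v.+1 hv.
  have eU : ar s3 aU v.+1 = U v.+1 by rewrite fa //= fa1.
  have ed : rg s3 zdl = d by rewrite fr //= fr1.
  apply: (t_seq (T1 := 2) (T2 := q * (5 * q + 5) + 2) (Q1 := fun s4 => rg s4 zm = minn (U v.+1) d)).
  + apply: t_if; first by oks; rewrite ?addn1 ?eU; lia.
    * rewrite [eval _ _ _ _]/= addn1 eU ed => hc; apply: t_asg1; [by oks; lia|by []|].
      by rewrite [rg _ _]/= addn1 eU; move: hc; case: ltnP => //; lia.
    * rewrite [eval _ _ _ _]/= addn1 eU ed => hc; apply: t_asg1; [by oks; lia|by []|].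
      by rewrite [rg _ _]/= ed; move: hc; case: ltnP => //; lia.
  + by rewrite addnC addnA || idtac; lia.
  move=> s4 hm fr4 fa4.
  have mq : minn (U v.+1) d <= q by apply: leq_trans (geq_minr _ _) dq.
  apply: (t_forc (N := minn (U v.+1) d) (B := 5 * q + 4) (I := fun j s5 =>
     Rok d (nseq j v.+1 ++ msi (fun v => minn (U v) d) v) s5 /\ forall x, x < d -> ar s5 aR x <= 1)).
  + by oks.
  + by rewrite /= hm.
  + by lia.
  + by split=> x hx; rewrite [ar _ _ _]/= fa4 //; [exact: i1|exact: i2].
  + move=> j s5 hj [k1 k2] fr5 fa5.
    apply: t_weak (@c_copy_item_ok (setr s5 zb j) d v (nseq j v.+1 ++ msi (fun v => minn (U v) d) v) _ _ dM _ d0 k1 k2) _ _ => //.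
    * by rewrite /= fr5 //= fr4.
    * by rewrite /= fr5 //= fr4.
    * by lia.
    * by rewrite leq_add2r leq_mul2l dq.
  + by rewrite leq_add2r; apply: leq_mul => //; lia.
  + move=> s5 [k1 k2] _ _; split=> // x hx; apply: (iff_trans (k1 x hx)).
    have hp : perm_eq (nseq (minn (U v.+1) d) v.+1 ++ msi (fun v => minn (U v) d) v) (msi (fun v => minn (U v) d) v.+1).
      by rewrite msiS perm_catC.
    split=> -[y h e]; exists y => //; apply: sub_perm h => //; by rewrite perm_sym.
- by move: (q * (5 * q + 5)) => z; rewrite leq_add2r leq_mul2l; apply/orP; right; lia.
- by move=> s3 [h _] _ _.
Qed.

(** A multiplicity above [d] can be replaced by its remainder modulo [d] without changing the
    residue of the sum, so the capped multiset attains the same residues. *)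
Lemma residue_sub S d (U : nat -> nat) t : 0 < d ->
  (bss U S t -> rset d (msi (fun v => minn (U v) d) S) (t %% d)) /\
  (forall y, sub (msi (fun v => minn (U v) d) S) y -> sub (msi U S) y).
Proof.
move=> d0; split.
  case=> x [hx ex].
  pose e v := if x v <= d then x v else x v %% d.
  have he v : e v <= minn (U v) d.
    rewrite /e leq_min; case: (leqP (x v) d) => h; first by rewrite hx h.
    by rewrite (leq_trans (leq_mod _ _) (hx v)) ltnW // ltn_mod.
  exists (\sum_(v < S.+1) v * e v); first by apply/bss_sub; exists e.
  rewrite -ex; elim/big_ind2: _ => // [a b a' b' h h'|v _].
    by rewrite -modnDm h h' modnDm.
  by rewrite /e; case: leqP => // _; rewrite modnMmr.
move=> y /bss_sub[x [hx ex]]; apply/bss_sub; exists x; split=> // v.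
by apply: leq_trans (hx v) (geq_minl _ _).
Qed.

Definition dense_cost S D L T q := ss_cost D L T + S * (q * (5 * q + 5) + 5) + q * (4 * S + 14) + 2 * S + 30.

Lemma c_dense_ok s S D p L T lg q t Sig (U : nat -> nat) (RND := ar s aRND) :
  nums M S D p L T -> ssinv w s S D p L T -> 0 < S -> S < M -> q < M -> 0 < q -> S <= q ^ 3 -> S < 2 ^ lg ->
  rg s zt = t -> rg s zq = q -> rg s zSig = Sig -> Sig = \sum_(v < S.+1) v * U v -> Sig <= M -> t <= Sig ->
  (forall v, ar s aU v = U v) -> (forall v, U v < M) -> U 0 = 0 -> (forall v, S < v -> U v = 0) ->
  16 * q ^ 2 * (lg + 3) <= count (fun v => 0 < U v) (iota 1 S) ->
  2 * S * (16 * q ^ 2 * (lg + 3)) <= D ->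
  triple c_dense s (dense_cost S D L T q) (fun s' =>
    [/\ rg s' zans != 0 -> bss U S t &
     complete p D T RND S U -> bss U S t -> rg s' zans != 0]).
Proof.
move=> hN hss S0 SM qM q0 Sq Slg ht hq hSig eSig SigM tS hU UM U0 US hcnt hD.
have [h1 h2 h3 h4 h5 h6 h7 h8 h9 h10] := hN.
have [[e1 e2 e3 e4 e5] [e6 e7]] := hss.
have tM : t <= M by apply: leq_trans tS SigM.
apply: (t_seq (T1 := 2 * S + 4) (T2 := ss_cost D L T + S * (q * (5 * q + 5) + 5) + q * (4 * S + 14) + 20)
   (Q1 := fun s1 => forall v, v <= S -> ar s1 aC v = U v)).
- apply: (t_forc (N := S.+1) (B := 1) (I := fun j s1 => forall x, x < j -> ar s1 aC x = U x)).
  + by oks; lia.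
  + by rewrite /= e1 addn1.
  + exact: SM.
  + by [].
  + move=> j s1 hj IH fr fa; apply: t_sto1; [by oks; lia|by oks; lia|by apply: M_lim; rewrite /=; lia|by []|].
    move=> x; rewrite ltnS leq_eqVlt => /orP[/eqP->|hx] /=; first by rewrite eqxx fa.
    by rewrite (ltn_eqF hx) IH.
  + by lia.
  + by move=> s1 h _ _; exact: h.
- by rewrite /dense_cost; move: (ss_cost _ _ _) (S * (_ + 5)) (q * (_ + 14)) => a b c; lia.
move=> s1 hC fr1 fa1.
have ss1 : ssinv w s1 S D p L T.
  split; first by split; rewrite fr1.
  by split=> [k|k hk]; rewrite fa1 //; apply: e7.
have R1 : ar s1 aRND = RND by rewrite fa1.
have t1 : rg s1 zt = t by rewrite fr1.
have Sig1 : rg s1 zSig = Sig by rewrite fr1.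
have D1 : rg s1 sD = D by rewrite fr1.
rewrite (_ : ss_cost D L T + _ + _ + _ = (ss_cost D L T + S * (q * (5 * q + 5) + 5) + q * (4 * S + 14) + 19).+1); last by rewrite -addnS.
have hb (b : bool) : (nat_of_bool b != 0) = b by case: b.
apply: t_if; first by oks; lia.
- rewrite [eval _ _ _ _]/= t1 D1 addn1 ltnS => hc; have {}hc : t <= D by move: hc; case: leqP.
  apply: (t_seq (T2 := 1) (@ss_ok w inp ilim lim M M2 MW Mlim s1 S D p L T U hN ss1 hC UM)).
    by move: (ss_cost _ _ _) => z; lia.
  move=> s2 [_ hH] fr2 fa2; apply: t_asg1; [by oks; rewrite fr2 //; lia|by []|].
  rewrite [rg _ _]/= fr2 // t1 hH // R1 hb; split; first exact: hit_sound.
  by move=> hG hbs; apply: hG.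
- rewrite [eval _ _ _ _]/= t1 D1 addn1 ltnS => hc; have {}hc : D < t by move: hc; case: leqP.
  rewrite (_ : ss_cost D L T + _ + _ + _ = (ss_cost D L T + S * (q * (5 * q + 5) + 5) + q * (4 * S + 14) + 18).+1); last by rewrite -addnS.
  apply: t_if; first by oks; rewrite ?t1 ?Sig1; lia.
  + rewrite [eval _ _ _ _]/= t1 Sig1 D1 addn1 ltnS => hc2; have {}hc2 : Sig - t <= D by move: hc2; case: leqP.
    apply: (t_seq (T2 := 1) (@ss_ok w inp ilim lim M M2 MW Mlim s1 S D p L T U hN ss1 hC UM)).
      by move: (ss_cost _ _ _) => z; lia.
    move=> s2 [_ hH] fr2 fa2; apply: t_asg1; [by oks; rewrite ?fr2 // ?t1 ?Sig1; lia|by []|].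
    rewrite [rg _ _]/= !fr2 // t1 Sig1 hH // R1 hb; split.
      by move/hit_sound; rewrite eSig; apply: bss_compl; rewrite -eSig.
    move=> hG hbs; apply: hG => //; rewrite eSig; apply: bss_compl; first by apply: leq_subr.
    by rewrite -eSig subKn.
  + rewrite [eval _ _ _ _]/= t1 Sig1 D1 addn1 ltnS => hc2; have {}hc2 : D < Sig - t by move: hc2; case: leqP.
    apply: (t_seq (T2 := (S * (q * (5 * q + 5) + 5) + 2 * q + 5) + 1) (@c_delta_ok s1 S q U _ _ SM qM _)).
    * by rewrite fr1.
    * by rewrite fr1.
    * by move=> v; rewrite fa1.
    * by rewrite !mulnDr; move: (ss_cost _ _ _) (S * _) => z1 z2; lia.
    move=> s2 hdl fr2 fa2.
    set X := [seq v <- iota 1 S | 0 < U v].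
    have uX : uniq X by rewrite filter_uniq ?iota_uniq.
    have XS x : x \in X -> x <= S by rewrite mem_filter mem_iota; lia.
    have pcc d : pc d X = cntf U S d.
      rewrite pcE //; apply: eq_bigr => -[[|v] hv] _ /=; first by rewrite U0 andbF.
      by rewrite andbT.
    have sX : 16 * q ^ 2 * (lg + 3) <= size X by rewrite size_filter.
    have q2 : 0 < q ^ 2 by rewrite expn_gt0 q0.
    (* At least [48 * q ^ 2] distinct sizes are present, more than the [22 * q ^ 2 + 2] that force a
       frequent difference, so the search has succeeded. *)
    have [|dl1 dl2] := hdl.
      have [|d hd1 hd2] := @exists_delta X S q uX XS q0 Sq; last by exists d => //; rewrite -pcc.
      by apply: leq_trans sX; rewrite mulnDr; lia.
    have [d0 dq] := andP dl1.
    apply: (t_seq (T2 := 1) (@c_res_ok s2 S (rg s2 zdl) q U _ erefl SM (ltnW qM) dl1 _)) => //.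
    * by rewrite fr2 // fr1.
    * by move=> v hv; rewrite fa2 // fa1 // hU; split=> //; apply: ltnW.
    move=> s3 hR fr3 fa3.
    apply: t_asg1; [by oks; rewrite ?fr3 // ?fr2 // ?t1; lia|by []|].
    rewrite [rg _ _]/= !fr3 // fr2 // t1.
    have tm : t %% rg s2 zdl < rg s2 zdl by rewrite ltn_mod.
    have [r1 r2] := @residue_sub S (rg s2 zdl) U t d0.
    split; last by move=> _ hb'; apply/hR => //; apply: r1.
    move=> /(hR _ tm)[y hy ey].
    apply/bss_sub; apply: (@dense_reach S q lg (rg s2 zdl) X (msi U S) t y) => //.
    * by move=> x; rewrite mem_filter mem_iota mem_msi => /andP[-> h]; rewrite andbT; lia.
    * by move=> x; rewrite mem_msi; lia.
    * by rewrite pcc.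
    * by lia.
    * by rewrite sumn_msi -eSig; lia.
    * exact: r2.
Qed.
End Dense.

(** * Preprocessing *)

Notation yn := 82 (only parsing). Notation ym := 83 (only parsing).
Notation yf := 84 (only parsing). Notation yi := 85 (only parsing).
Notation yNR := 86 (only parsing). Notation yl := 87 (only parsing).

Definition c_agg :=
  yn ::= Inp (#0);; zt ::= Inp (#1);; sS ::= #0;; zSig ::= #0;;
  for za upto !yn in za' {{
    zx ::= Inp (#2 + !za);; zm ::= Inp (#2 + !yn + !za);;
    If !sS < !zx {{ sS ::= !zx }} Else {{ Skip }};;
    sto aU$[!zx] ::= aU$[!zx] + !zm;;
    zSig ::= !zSig + !zx * !zm }}.

Definition c_cnt :=
  zcnt ::= #0;;
  for za upto !sS in za' {{
    If aU$[!za + #1] == #0 {{ Skip }} Else {{ zcnt ::= !zcnt + #1 }} }}.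

(** A linear scan is affordable here and for the logarithms, as the total may contain terms linear
    in [n], [S] and [D]. *)
Definition c_root :=
  zq ::= #0;;
  for za upto !sS in za' {{
    If !za * !za * !za < !sS {{ zq ::= !za + #1 }} Else {{ Skip }} }}.

Definition c_log y b :=
  y ::= #0;; zpw ::= #1;;
  for za upto !b in za' {{
    If !zpw < !b + #1 {{ zpw ::= #2 * !zpw;; y ::= !y + #1 }} Else {{ Skip }} }}.

Definition lgf n := (trunc_log 2 n).+1.

Lemma lgfP n : 0 < n -> n < 2 ^ lgf n <= 2 * n.
Proof. by move=> n0; have := @trunc_log_bounds 2 n isT n0; rewrite /lgf !expnS; lia. Qed.

Arguments lgf : simpl never.

Lemma lgf_uniq n y : 0 < n -> n < 2 ^ y <= 2 * n -> y = lgf n.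
Proof.
move=> n0 /andP[h1 h2]; have /andP[h3 h4] := lgfP n0.
have a1 : y < (lgf n).+1 by rewrite -(@ltn_exp2l 2) // expnS; apply: leq_ltn_trans h2 _; rewrite ltn_pmul2l.
have a2 : lgf n < y.+1 by rewrite -(@ltn_exp2l 2) // expnS; apply: leq_ltn_trans h4 _; rewrite ltn_pmul2l.
by apply/eqP; rewrite eqn_leq -ltnS a1 -ltnS a2.
Qed.

Lemma qf_ex S : exists q, S <= q ^ 3.
Proof. by case: S => [|S]; [exists 0|exists S.+1; rewrite -{1}[S.+1]expn1 leq_pexp2l]. Qed.
Definition qf S := ex_minn (qf_ex S).

Lemma qf_ge S : S <= qf S ^ 3.
Proof. by rewrite /qf; case: ex_minnP. Qed.

Lemma qf_uniq S q : S <= q ^ 3 -> q.-1 ^ 3 < S -> q = qf S.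
Proof.
rewrite /qf; case: ex_minnP => m h1 h2 h3 h4; apply/eqP; rewrite eqn_leq h2 // andbT leqNgt; apply/negP => mq.
have : m ^ 3 <= q.-1 ^ 3 by rewrite leq_exp2r //; lia.
lia.
Qed.

Lemma qfP S : 0 < S -> [/\ 0 < qf S <= S, S <= qf S ^ 3 & (qf S).-1 ^ 3 < S].
Proof.
move=> S0; have h := qf_ge S; split=> //.
  rewrite lt0n; apply/andP; split; first by apply/eqP => e; rewrite e in h; lia.
  by rewrite /qf; case: ex_minnP => m _ hm; apply: hm; rewrite -{1}[S]expn1 leq_pexp2l.
rewrite /qf; case: ex_minnP => m h1 hm; rewrite ltnNge; apply/negP => h2; have := hm _ h2.
by case: m h1 {hm h2} => [|m _]; rewrite /= ?ltnn //; lia.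
Qed.

Definition mf S := 16 * qf S * qf S * (lgf S + 3).
Definition Df S cnt := if cnt < mf S then 2 * S * cnt else 2 * S * mf S.
(** [2 ^ Tf] is at least [(n + S) ^ a] times the number of events in the union bound: [D.+1] targets
    for each of the [5 * lgf S + 4] multiplicity functions. *)
Definition Tf a n S cnt := a * (lgf n + lgf S) + lgf (Df S cnt) + lgf S + 3.
(** The upper end of the interval in [prime_between] for [N = 4 * D + 8] and
    [l = 2 * lgf D + 10]. *)
Definition Bof D := 2 * ((2 * lgf D + 10) * (4 * D + 8) + 1).
Definition pre_cost n S D := 12 * n + 10 * S + 7 * D + 44 + 10 * (Bof D).+1 * (up_log 2 (Bof D).+1).+1 + 4 * Bof D.

Lemma Bof_le D : 0 < D -> Bof D <= 2 ^ (2 * lgf D + 10).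
Proof.
move=> D0; have /andP[h _] := lgfP D0; rewrite /Bof; set L := lgf D in h *.
have hL : L < 2 ^ L by apply: ltn_expl.
rewrite expnD mulnC (mulnC 2 L) expnM (_ : 2 ^ 10 = 1024) //.
have h1 : (L * 2 + 10) <= 12 * 2 ^ L by lia.
have h2 : 4 * D + 8 <= 12 * 2 ^ L by lia.
have h3 := leq_mul h1 h2; have h4 : 0 < 2 ^ L by lia.
rewrite -mulnn; move: h3 h4; rewrite (_ : 12 * 2 ^ L * (12 * 2 ^ L) = 144 * (2 ^ L * 2 ^ L)); last by ring.
move: ((L * 2 + 10) * (4 * D + 8)) (2 ^ L) => x y h3 h4; have : 0 < y * y by rewrite muln_gt0 h4.
by move: (y * y) h3 => z; clear; lia.
Qed.

Definition c_dim :=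
  ym ::= #16 * !zq * !zq * (!zlg + #3);;
  yf ::= (!zcnt < !ym);;
  If !yf {{ sD ::= #2 * !sS * !zcnt }} Else {{ sD ::= #2 * !sS * !ym }}.

Definition c_par2 a :=
  sB ::= #2 * ((#2 * !slg + #10) * (#4 * !sD + #8) + #1);;
  sT ::= #a * (!yl + !zlg) + !slg + !zlg + #3;;
  yNR ::= !sT * (!sS + #1).

Definition c_pre a :=
  c_agg;; c_cnt;; c_root;; c_log zlg sS;; c_dim;; c_log slg sD;; c_log yl yn;;
  c_par2 a;; c_sieve;; c_prime;; c_inv.

Definition c_post :=
  zans ::= #0;;
  If !zSig < !zt {{ Skip }} Else {{ If !yf {{ c_sparse }} Else {{ c_dense }} }}.

Section Pre.
Variables (w : nat) (inp : nat -> nat) (ilim lim M : nat).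
Local Notation W := (2 ^ w).
Local Notation triple := (triple w inp ilim lim).
Local Notation wbd := (wbd w).
Hypotheses (M2 : 100 < M) (MW : M ^ 12 < W) (Mlim : M ^ 5 < lim).
Let M1 : 1 < M. Proof. exact: ltn_trans M2. Qed.
Let c1 : 1 <= M. Proof. exact: ltnW M1. Qed.
Let c2 : 2 <= M. Proof. exact: M1. Qed.
Local Notation M_W := (M_W M2 MW).
Local Notation M_lim := (M_lim M2 Mlim).
Local Notation t_forc := (t_forc M2 MW).
Ltac okt := okd_tac M1 MW Mlim.
Ltac oks := oks_tac M1 MW Mlim.

Lemma c_agg_ok n t (si ui : nat -> nat) (s0 : st) :
  inp 0 = n -> inp 1 = t -> (forall i, i < n -> inp (2 + i) = si i /\ inp (2 + n + i) = ui i) ->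
  ilim = 2 * n + 2 -> n < M -> t <= M -> (forall i, i < n -> si i <= M /\ ui i <= M) ->
  \sum_(i < n) ui i <= M -> \sum_(i < n) si i * ui i <= M ->
  (forall v, ar s0 aU v = 0) ->
  triple c_agg s0 (8 * n + 6) (fun s' => [/\ rg s' yn = n, rg s' zt = t, rg s' sS = \max_(i < n) si i,
    rg s' zSig = \sum_(i < n) si i * ui i &
    forall v, ar s' aU v = \sum_(i < n) (if si i == v then ui i else 0)]).
Proof.
move=> h0 h1 hi hl nM tM hM sM SM hU.
have -> : 8 * n + 6 = (8 * n + 2).+4 by lia.
do 4 (apply: t_asg; first by rewrite /= ?hl; try lia; apply: M_W; lia).
set s1 := setr _ zSig _.
have [n1 t1 S1 g1 U1] : [/\ rg s1 yn = n, rg s1 zt = t, rg s1 sS = 0, rg s1 zSig = 0 & forall v, ar s1 aU v = 0].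
  by split=> //=; rewrite ?h0 ?h1.
move: s1 n1 t1 S1 g1 U1 => s1 n1 t1 S1 g1 U1.
apply: (t_forc (N := n) (B := 7) (I := fun j s2 => [/\ rg s2 sS = \max_(i < j) si i,
    rg s2 zSig = \sum_(i < j) si i * ui i & forall v, ar s2 aU v = \sum_(i < j) (if si i == v then ui i else 0)])).
- by oks.
- by rewrite /= n1.
- exact: ltnW.
- by split=> [||v]; rewrite /= ?S1 ?g1 ?U1 ?big_ord0.
- move=> j s2 hj [i1 i2 i3] fr fa.
  have en : rg s2 yn = n by rewrite fr.
  have [a1 a2] := hi j hj; have [b1 b2] := hM j hj.
  have le_sum (F : nat -> nat) : \sum_(i < j) F i <= \sum_(i < n) F i.
    rewrite -!(big_mkord xpredT F) [X in _ <= X](@big_cat_nat _ _ _ j) //= ?leq_addr //; exact: ltnW.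
  have mM : \max_(i < j) si i <= M by apply/bigmax_leqP => i _; have [] := hM i (ltn_trans (ltn_ord i) hj).
  have uM v : \sum_(i < j) (if si i == v then ui i else 0) <= M.
    apply: leq_trans sM; apply: leq_trans (le_sum ui); apply: leq_sum => i _; by case: ifP.
  have gM : \sum_(i < j) si i * ui i <= M by apply: leq_trans SM; apply: (le_sum (fun i => si i * ui i)).
  apply: t_asg; first by oks; lia.
  apply: t_asg; first by oks; rewrite ?en; lia.
  set s3 := setr _ zm _.
  have x3 : rg s3 zx = si j by rewrite /= a1.
  have m3 : rg s3 zm = ui j by rewrite /= en a2.
  have [S3 g3] : rg s3 sS = \max_(i < j) si i /\ rg s3 zSig = \sum_(i < j) si i * ui i by [].
  have U3 v : ar s3 aU v = \sum_(i < j) (if si i == v then ui i else 0) by rewrite -i3.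
  move: s3 x3 m3 S3 g3 U3 => s3 x3 m3 S3 g3 U3.
  apply: (t_seq (T1 := 2) (T2 := 2) (Q1 := fun s4 => rg s4 sS = \max_(i < j.+1) si i)) => //.
    apply: t_if; first by oks; lia.
    + rewrite [eval _ _ _ _]/= S3 x3 => hc; apply: t_asg1; [by oks|by []|].
      by rewrite [rg _ _]/= x3 big_ord_recr /=; move: hc; case: (ltnP _ (si j)) => [hc _|//]; rewrite ?(maxn_idPr (ltnW hc)).
    + rewrite [eval _ _ _ _]/= S3 x3 => hc; apply: t_skip; rewrite S3 big_ord_recr /=; move: hc; case: (ltnP _ (si j)) => [_ //|hc _].
      by rewrite ?(maxn_idPl hc).
  move=> s4 h4 fr4 fa4.
  have [x4 m4 g4] : [/\ rg s4 zx = si j, rg s4 zm = ui j & rg s4 zSig = \sum_(i < j) si i * ui i] by rewrite !fr4.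
  have U4 v : ar s4 aU v = \sum_(i < j) (if si i == v then ui i else 0) by rewrite fa4.
  apply: t_sto; [by oks; lia|by oks; rewrite ?x4 ?U4 ?m4 //; lia|by apply: M_lim; rewrite /= x4|].
  apply: t_asg1; [by oks; rewrite ?g4; lia|by []|].
  split; first by rewrite [rg _ _]/= h4.
    by rewrite [rg _ _]/= g4 x4 m4 [RHS]big_ord_recr.
  move=> v; rewrite [ar _ _ _]/= x4 m4 !U4 [RHS]big_ord_recr /= eq_sym.
  by case: eqP => [->|_]; rewrite ?addn0.
- by lia.
- move=> s2 [i1 i2 i3] fr fa; split=> //.
  + by rewrite [rg _ _]/= fr.
  + by rewrite [rg _ _]/= fr.
Qed.

Lemma c_cnt_ok s S (U : nat -> nat) : rg s sS = S -> S < M -> (forall v, ar s aU v = U v) ->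
  triple c_cnt s (3 * S + 3) (fun s' => rg s' zcnt = count (fun v => 0 < U v) (iota 1 S)).
Proof.
move=> hS SM hU; rewrite addnS; apply: t_asg; first by oks.
apply: (t_forc (N := S) (B := 2) (I := fun v s2 => rg s2 zcnt <= v /\ rg s2 zcnt = \sum_(u < v) (0 < U u.+1))).
- by oks.
- by rewrite /= hS.
- exact: ltnW.
- by rewrite big_ord0.
- move=> v s2 hv [i1 i2] fr fa.
  have eU : ar s2 aU v.+1 = U v.+1 by rewrite fa // hU.
  apply: t_if; first by oks; lia.
  + rewrite [eval _ _ _ _]/= addn1 eU => hc; apply: t_skip.
    rewrite [rg _ _]/= big_ord_recr /= -i2; have -> : 0 < U v.+1 = false by move: hc; case: (U v.+1).
    by rewrite addn0; split=> //; apply: leqW.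
  + rewrite [eval _ _ _ _]/= addn1 eU => hc; apply: t_asg1; [by oks; lia|by []|].
    rewrite [rg _ _]/= big_ord_recr /= -i2; have -> : 0 < U v.+1 by move: hc; case: (U v.+1).
    by rewrite addn1.
- by lia.
- by move=> s2 [_ h] _ _; rewrite [rg _ _]/= h count_iota1.
Qed.

Lemma c_root_ok s S : rg s sS = S -> S < M -> 0 < S ->
  triple c_root s (3 * S + 3) (fun s' => rg s' zq = qf S).
Proof.
move=> hS SM S0; rewrite addnS; apply: t_asg; first by oks.
apply: (t_forc (N := S) (B := 2) (I := fun v s2 => [/\ rg s2 zq <= v, 0 < v -> 0 < rg s2 zq,
   (rg s2 zq < v -> S <= rg s2 zq ^ 3) & (rg s2 zq).-1 ^ 3 < S])).
- by oks.
- by rewrite /= hS.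
- exact: ltnW.
- by split.
- move=> v s2 hv [i1 i0 i2 i3] fr fa.
  have eS : rg s2 sS = S by rewrite fr.
  have cube : v * v * v = v ^ 3 by rewrite !expnS expn0 muln1 mulnA.
  apply: t_if; first by oks; lia.
  + rewrite [eval _ _ _ _]/= eS cube => hc; have {}hc : v ^ 3 < S by move: hc; case: ltnP.
    apply: t_asg1; [by oks; lia|by []|].
    by rewrite [rg _ _]/= addn1 ltnn; split.
  + rewrite [eval _ _ _ _]/= eS cube => hc; have {}hc : S <= v ^ 3 by move: hc; case: ltnP.
    have v0 : 0 < v by rewrite lt0n; apply/eqP => e; rewrite e in hc; lia.
    apply: t_skip; rewrite [rg _ _]/=; split=> //; first exact: leqW.
      by move=> _; apply: i0.
    move=> _; case: (ltngtP (rg s2 zq) v) i1 => // [h _|e _]; first exact: i2.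
    by rewrite e.
- by lia.
- move=> s2 [i1 i0 i2 i3] _ _; rewrite [rg _ _]/=; apply: qf_uniq => //.
  have [h|h] := ltnP (rg s2 zq) S; first exact: i2.
  have -> : rg s2 zq = S by lia.
  by rewrite -{1}[S]expn1 leq_pexp2l.
Qed.

Lemma c_log_ok s y b n : y \notin [:: zpw; za; za'] -> b \notin [:: y; zpw; za; za'] ->
  rg s b = n -> 0 < n -> 2 * n < M ->
  triple (c_log y b) s (4 * n + 4) (fun s' => rg s' y = lgf n).
Proof.
rewrite !inE !negb_or => /and3P[/negbTE y1 /negbTE y2 /negbTE y3] /and4P[/negbTE b1 /negbTE b2 /negbTE b3 /negbTE b4] hb n0 nM.
have -> : 4 * n + 4 = (4 * n + 2).+2 by lia.
apply: t_asg; first by oks.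
apply: t_asg; first by oks.
have y1' : (zpw == y) = false by rewrite eq_sym.
have y2' : (za == y) = false by rewrite eq_sym.
apply: (t_forc (N := n) (B := 3) (I := fun j s2 => [/\ rg s2 zpw = 2 ^ rg s2 y, 2 ^ rg s2 y <= 2 * n, rg s2 y <= j
    & 2 ^ rg s2 y <= n -> rg s2 y = j])).
- by oks.
- by rewrite /= b2 b1.
- by lia.
- by rewrite /= ?eqxx ?y1 ?y2 ?y3; split=> //; lia.
- move=> j s2 hj [i1 i2 i3 i4] fr fa.
  have eb : rg s2 b = n.
    by rewrite fr ?inE /= ?negb_or ?b1 ?b2 ?b3 ?b4 //= b4 b2 b1.
  have yM : rg s2 y <= M by apply: leq_trans i3 _; lia.
  apply: t_if; first by oks; rewrite ?b3 ?eb ?i1 //; lia.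
  + rewrite [eval _ _ _ _]/= b3 eb i1 addn1 ltnS => hc; have {}hc : 2 ^ rg s2 y <= n by move: hc; case: leqP.
    apply: t_asg; first by oks; rewrite ?i1; lia.
    apply: t_asg1; [by oks; rewrite ?y1 ?y3 ?y2; lia|by []|].
    rewrite !/(rg (setr _ _ _) _) /= !eqxx ?y1 ?y1' ?y2 ?y3 i1 addn1 expnS -/(2 * _); split=> //; solve [lia | by rewrite i4 | by move=> _; rewrite i4].
  + rewrite [eval _ _ _ _]/= b3 eb i1 addn1 ltnS => hc; have {}hc : n < 2 ^ rg s2 y by move: hc; case: leqP.
    apply: t_skip; rewrite /= y2; split=> //; [exact: leqW|lia].
- by lia.
- move=> s2 [i1 i2 i3 i4] _ _; rewrite /= y2; apply: lgf_uniq => //.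
  rewrite i2 andbT ltnNge; apply/negP => h.
  have := i4 h => e; move: h; rewrite e; have := ltn_expl n (ltnSn 1); lia.
Qed.

Lemma c_pre_ok a n t (si ui : nat -> nat) (s0 : st) (S := \max_(i < n) si i)
   (U := fun v => \sum_(i < n) (if si i == v then ui i else 0)) (cnt := count (fun v => 0 < U v) (iota 1 S))
   (D := Df S cnt) (T := Tf a n S cnt) :
  inp 0 = n -> inp 1 = t -> (forall i, i < n -> inp (2 + i) = si i /\ inp (2 + n + i) = ui i) ->
  ilim = 2 * n + 2 -> 0 < n -> 0 < S -> 0 < cnt -> 2 * n < M -> t <= M -> (forall i, i < n -> si i <= M /\ ui i <= M) ->
  \sum_(i < n) ui i <= M -> \sum_(i < n) si i * ui i <= M -> a <= M ->
  2 * S < M -> 2 * D < M -> 4 * Bof D + 4 * D + 8 <= M -> mf S <= M -> T < M ->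
  (forall a i, ar s0 a i = 0) ->
  triple (c_pre a) s0 (pre_cost n S D) (fun s' => 
    [/\ [/\ rg s' sS = S, rg s' zSig = \sum_(i < n) si i * ui i, rg s' zt = t, rg s' zq = qf S & rg s' zlg = lgf S],
     [/\ rg s' sD = D, rg s' slg = lgf D, rg s' sT = T, rg s' yNR = T * S.+1 & rg s' yf = (cnt < mf S)],
     prime (rg s' sP) /\ 4 * D + 8 < rg s' sP <= Bof D,
     (forall k, 0 < k <= D -> ar s' aINV k < rg s' sP /\ k * ar s' aINV k %% rg s' sP = 1) &
     (forall v, ar s' aU v = U v) /\ forall a k, a \notin [:: aU; aMK; aINV] -> ar s' a k = 0]).
Proof.
move=> h0 h1 hi hl n0 S0 cnt0 nM tM hM sM SM aM S2 D2 BM mM TM z0.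
have [q0 Sq q1] := qfP S0.
have mf0 : 0 < mf S by rewrite /mf !muln_gt0; have /andP[-> _] := q0; rewrite addn3.
have D0 : 0 < D by rewrite /D /Df; case: ifP => _; rewrite (muln_gt0 (2 * S)) ?cnt0 ?mf0 andbT muln_gt0 S0.
have /andP[lS1 lS2] := lgfP S0; have /andP[lD1 lD2] := lgfP D0; have /andP[ln1 ln2] := lgfP n0.
have eD : D = Df S cnt by [].
have eT : T = Tf a n S cnt by [].
have ecnt : count (fun v => 0 < U v) (iota 1 S) = cnt by [].
have eS : \max_(i < n) si i = S by [].
clearbody D T; clearbody cnt; clearbody S.
have lgM k : 0 < k -> 2 * k < M -> lgf k <= M.
  by move=> k0 kM; have /andP[_ h] := lgfP k0; have := ltn_expl (lgf k) (ltnSn 1); lia.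
have c3 : 3 <= M by lia. have c4 : 4 <= M by lia. have c8 : 8 <= M by lia. have c10 : 10 <= M by lia. have c16 : 16 <= M by lia.
have lSM := lgM _ S0 S2; have lDM := lgM _ D0 D2; have lnM := lgM _ n0 nM.
have [B eB] : exists B, B = Bof D by exists (Bof D).
rewrite /pre_cost -eB; rewrite -eB in BM.
have [CS eCS] : exists CS, CS = 10 * B.+1 * (up_log 2 B.+1).+1 by eexists.
rewrite -eCS.
apply: (t_seq (T2 := (3 * S + 3) + ((3 * S + 3) + ((4 * S + 4) + (4 + ((4 * D + 4) + ((4 * n + 4) + (3 + ((CS + 2) + ((4 * B + 8) + (3 * D + 3))))))))))
  (@c_agg_ok n t si ui s0 h0 h1 hi hl _ tM hM sM SM _)).
- by clear -n0 nM; lia.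
- by [].
- by clear; lia.
move=> s1 [n1 t1 S1 g1 U1] fr1 fa1; rewrite eS in S1.
apply: (t_seq (T2 := (3 * S + 3) + ((4 * S + 4) + (4 + ((4 * D + 4) + ((4 * n + 4) + (3 + ((CS + 2) + ((4 * B + 8) + (3 * D + 3)))))))))
  (@c_cnt_ok s1 S U S1 _ U1)).
- by clear -S2; move: S2; generalize S; lia.
- by [].
move=> s2 k2 fr2 fa2; rewrite ecnt in k2.
have S_2 : rg s2 sS = S by rewrite fr2.
apply: (t_seq (T2 := (4 * S + 4) + (4 + ((4 * D + 4) + ((4 * n + 4) + (3 + ((CS + 2) + ((4 * B + 8) + (3 * D + 3))))))))
  (@c_root_ok s2 S S_2 _ S0)).
- by clear -S2; move: S2; generalize S; lia.
- by [].
move=> s3 k3 fr3 fa3.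
have S_3 : rg s3 sS = S by rewrite fr3.
apply: (t_seq (T2 := 4 + ((4 * D + 4) + ((4 * n + 4) + (3 + ((CS + 2) + ((4 * B + 8) + (3 * D + 3)))))))
  (@c_log_ok s3 zlg sS S isT isT S_3 S0 S2)) => //.
move=> s4 k4 fr4 fa4.
have S_4 : rg s4 sS = S by rewrite fr4.
have q_4 : rg s4 zq = qf S by rewrite fr4.
have c_4 : rg s4 zcnt = cnt by rewrite fr4 //= fr3.
have S_M : S <= M by clear -S2; lia.
have D_M : D <= M by clear -D2; lia.
have T_M : T <= M by exact: ltnW.
have c2' : 2 <= M by [].
have n_M : n <= M by clear -nM; lia.
have qM : qf S <= M by have /andP[_ h] := q0; apply: leq_trans h S_M.
have cM : cnt <= M by rewrite -ecnt; apply: leq_trans (count_size _ _) _; rewrite size_iota.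
have mE : 16 * qf S * qf S * (lgf S + 3) = mf S by [].
apply: (t_seq (T1 := 4) (T2 := (4 * D + 4) + ((4 * n + 4) + (3 + ((CS + 2) + ((4 * B + 8) + (3 * D + 3))))))
  (Q1 := fun s5 => rg s5 sD = D /\ rg s5 yf = (cnt < mf S))) => //.
  apply: t_asg; first by oks; rewrite ?q_4 ?k4.
  apply: t_asg; first by oks; rewrite ?q_4 ?k4 ?mE.
  set s5 := setr _ yf _.
  have f5 : rg s5 yf = (cnt < mf S) by rewrite /= q_4 k4 mE c_4.
  have m5 : rg s5 ym = mf S by rewrite /= q_4 k4 mE.
  have [S5 c5] : rg s5 sS = S /\ rg s5 zcnt = cnt by [].
  move: s5 f5 m5 S5 c5 => s5 f5 m5 S5 c5.
  apply: t_if; first by oks.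
  + move=> hc; have {}hc : rg s5 yf != 0 := hc; have hc' : cnt < mf S by move: hc; rewrite f5; case: (cnt < _).
    apply: t_asg1; [by oks; rewrite ?S5 ?c5|by []|].
    by split; [rewrite /= S5 c5 eD /Df hc'|exact: f5].
  + move=> hc; have {}hc : rg s5 yf = 0 := hc; have hc' : (cnt < mf S) = false by move: hc; rewrite f5; case: (cnt < _).
    apply: t_asg1; [by oks; rewrite ?S5 ?m5|by []|].
    by split; [rewrite /= S5 m5 eD /Df hc'|exact: f5].
move=> s5 [D5 f5] fr5 fa5.
apply: (t_seq (T2 := (4 * n + 4) + (3 + ((CS + 2) + ((4 * B + 8) + (3 * D + 3)))))
  (@c_log_ok s5 slg sD D isT isT D5 D0 D2)) => //.
move=> s6 k6 fr6 fa6.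
have n6 : rg s6 yn = n by rewrite fr6 //= fr5 //= fr4 //= fr3 //= fr2.
apply: (t_seq (T2 := 3 + ((CS + 2) + ((4 * B + 8) + (3 * D + 3))))
  (@c_log_ok s6 yl yn n isT isT n6 n0 nM)) => //.
move=> s7 k7 fr7 fa7.
have L7 : rg s7 slg = lgf D by rewrite fr7.
have D7 : rg s7 sD = D by rewrite fr7 //= fr6.
have g7 : rg s7 zlg = lgf S by rewrite fr7 //= fr6 //= fr5.
have S7 : rg s7 sS = S by rewrite fr7 //= fr6 //= fr5.
have f7 : rg s7 yf = (cnt < mf S) by rewrite fr7 //= fr6.
have q7 : rg s7 zq = qf S by rewrite fr7 //= fr6 //= fr5.
have old x : x \in [:: zt; zSig] -> rg s7 x = rg s1 x.
  by rewrite !inE => /orP[]/eqP->; rewrite fr7 //= fr6 //= fr5 //= fr4 //= fr3 //= fr2.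
have arr a' k : ar s7 a' k = ar s1 a' k by rewrite fa7 //= fa6 //= fa5 //= fa4 //= fa3 //= fa2.
apply: (t_seq (T1 := 3) (T2 := (CS + 2) + ((4 * B + 8) + (3 * D + 3)))
  (Q1 := fun s8 => [/\ rg s8 sB = B, rg s8 sT = T & rg s8 yNR = T * S.+1])) => //.
  have TfM : a * (lgf n + lgf S) + lgf D + lgf S + 3 <= M by have := T_M; rewrite eT /Tf -eD.
  apply: t_asg; first by oks; rewrite ?L7 ?D7.
  apply: t_asg; first by oks; rewrite ?L7 ?g7 ?k7.
  apply: t_asg1; [by oks; rewrite ?S7 ?g7 ?L7 ?k7 //|by []|].
  split; [by rewrite /= L7 D7 eB|by rewrite /= L7 g7 k7 eT /Tf -eD|by rewrite /= S7 L7 g7 k7 addn1 eT /Tf -eD].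
move=> s8 [B8 T8 N8] fr8 fa8.
have arr8 a' k : ar s8 a' k = ar s1 a' k by rewrite fa8 ?arr.
apply: (t_seq (T2 := (4 * B + 8) + (3 * D + 3)) (@c_sieve_ok w inp ilim lim M M2 MW Mlim s8 B B8 _ _)).
- by clear -BM D0; lia.
- by move=> k; rewrite arr8 fa1.
- by rewrite -eCS.
move=> s9 k9 fr9 fa9.
have B9 : rg s9 sB = B by rewrite fr9.
have D9 : rg s9 sD = D by rewrite fr9 //= fr8.
have PB : exists2 p, prime p & 4 * D + 8 < p <= B by rewrite eB; apply: prime_between; exact: Bof_le.
apply: (t_seq (T2 := 3 * D + 3) (@c_prime_ok w inp ilim lim M M2 MW Mlim s9 D B B9 D9 _ k9 PB)).
- by have [p0 _ hp0] := PB; clear -BM hp0; lia.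
- by [].
move=> s10 [p10 b10] fr10 fa10.
have D10 : rg s10 sD = D by rewrite fr10.
apply: t_weak (t_frame (@c_inv_ok w inp ilim lim M M2 MW Mlim s10 D _ D10 erefl p10 _ _)) (leqnn _) _.
- by clear -b10; lia.
- by clear -b10 BM; lia.
move=> s11 [k11 fr11 fa11].
have rs x : x \notin [:: 42; si'; sj; sj'; sP; sx; sy] -> rg s11 x = rg s8 x.
  rewrite !inE !negb_or => /and4P[m1 m2 m3 /and4P[m4 m5 m6 m7]].
  rewrite fr11 ?inE ?negb_or ?m1 ?m2 ?m6 // fr10 ?inE ?negb_or ?m5 ?m6 ?m7 //.
  by rewrite fr9 ?inE ?negb_or ?m1 ?m2 ?m3 ?m4.
have p11 : rg s11 sP = rg s10 sP by rewrite fr11.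
have ars a' k : a' \notin [:: aMK; aINV] -> ar s11 a' k = ar s1 a' k.
  rewrite !inE negb_or => /andP[m1 m2]; by rewrite fa11 ?inE ?negb_or ?m2 // fa10 // fa9 ?inE ?m1.
split.
- by rewrite !rs //; split; rewrite fr8 // old.
- by rewrite !rs //; split=> //; rewrite fr8.
- by rewrite p11; split.
- by move=> k hk; rewrite p11; apply: k11.
- split; first by move=> v; rewrite ars // U1.
  move=> a' k; rewrite inE negb_or => /andP[m1 m2]; rewrite ars // fa1 // ?inE //.
Qed.
End Pre.

(** * Success probability *)

Section Resample.
Variables (Om : finType) (V NR : nat) (X : nat -> Om -> 'I_V) (upd : nat -> 'I_V -> Om -> Om).
Hypotheses (XU : forall i j x om, i < NR -> j < NR -> X i (upd j x om) = if i == j then x else X i om)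
  (UX : forall i om, i < NR -> upd i (X i om) om = om)
  (UU : forall i x y om, i < NR -> upd i x (upd i y om) = upd i x om).

Definition indep (E : pred Om) k := forall x om, E (upd k x om) = E om.

(** The map sending [(om, x)] to [(upd k x om, X k om)] is an involution that exchanges the word at
    [k] with a fresh one. Counting [om] together with a spare word thus equals counting after
    resampling word [k], which leaves [E] untouched. *)
Lemma resample (A E : pred Om) k b : k < NR -> indep E k ->
  (forall om, E om -> #|[set x | A (upd k x om)]| <= b) ->
  #|[pred om | A om && E om]| * V <= b * #|E|.
Proof.
move=> kN hE hA.
pose f (z : Om * 'I_V) := (upd k z.2 z.1, X k z.1).
have fK : involutive f by case=> om x; rewrite /f /= XU // eqxx UU // UX.
have e1 : #|[pred om | A om && E om]| * V = \sum_(z : Om * 'I_V) (A z.1 && E z.1).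
  rewrite -(pair_big xpredT xpredT (fun om x => (A om && E om : nat))) /=.
  rewrite -sum1_card big_distrl /= big_mkcond; apply: eq_bigr => om _.
  by rewrite sum_nat_const card_ord inE; case: (A om && E om); rewrite ?muln1 ?mul1n ?muln0.
rewrite e1 (reindex_inj (inv_inj fK)) /=.
rewrite -(pair_big xpredT xpredT (fun om x => (A (upd k x om) && E (upd k x om) : nat))) /=.
rewrite mulnC -sum1_card big_distrl /= [X in _ <= X]big_mkcond; apply: leq_sum => om _.
rewrite (eq_bigr (fun x => (A (upd k x om) && E om : nat))); last by move=> x _; rewrite hE.
case: ifP => [h|h].
  have {}h : E om := h.
  rewrite mul1n (eq_bigr (fun x => (A (upd k x om) : nat))); last by move=> x _; rewrite h andbT.
  apply: leq_trans (hA om h); rewrite -sum1_card [X in _ <= X]big_mkcond; apply: leq_sum => x _.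
  by rewrite inE; case: ifP.
by rewrite big1 // => x _; rewrite (_ : E om = false) ?andbF.
Qed.
End Resample.

Lemma gf_ext (F : fieldType) c (r r' : nat -> F) s :
  (forall v, 0 < v <= s -> r v = r' v) -> gf c r s = gf c r' s.
Proof.
elim: s => //= s IH h; rewrite IH; last by move=> v /andP[v0 vs]; apply: h; rewrite v0 leqW.
by rewrite /fac h // ltnSn.
Qed.

(* Each residue class modulo [p] has at most [V / p + 1] representatives below [V]. *)
Lemma bad_words p V (P : {poly 'F_p}) j : prime p -> P != 0%R -> (size P <= j.+1)%N ->
  #|[set x : 'I_V | root P ((val x)%:R)%R]| <= j * (V %/ p).+1.
Proof.
move=> pp P0 sP; have p0 := prime_gt0 pp.
have hR : #|[set a : 'F_p | root P a]| <= j.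
  rewrite -ltnS; apply: leq_trans sP; rewrite cardE; apply: max_poly_roots => //.
    by apply/allP => a; rewrite mem_enum inE.
  exact: enum_uniq.
have hf (x : 'I_V) : x %/ p < (V %/ p).+1 by rewrite ltnS leq_div2r // ltnW.
pose f (x : 'I_V) := (((val x)%:R)%R : 'F_p, Ordinal (hf x)).
have finj : injective f.
  move=> x y [e1 e2]; apply: val_inj; rewrite /= (divn_eq x p) (divn_eq y p) e2.
  by move/(congr1 val): e1; rewrite /= !val_Fp_nat // => ->.
rewrite -(card_imset _ finj).
apply: (@leq_trans #|setX [set a : 'F_p | root P a] [set: 'I_(V %/ p).+1]|).
  apply: subset_leq_card; apply/subsetP => z /imsetP[x]; rewrite inE => hx ->.
  by rewrite !inE hx.
by rewrite cardsX cardsT card_ord leq_mul2r hR orbT.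
Qed.

Lemma bss_dec c s y : bss c s.+1 y -> exists2 j, j <= c s.+1 & s.+1 * j <= y /\ bss c s (y - s.+1 * j).
Proof.
case=> x [hx <-]; exists (x s.+1); first exact: hx.
rewrite big_ord_recr /=; split; first exact: leq_addl.
by rewrite addnK; exists x.
Qed.

Section SchwartzZippel.
Variables (Om : finType) (V NR : nat) (X : nat -> Om -> 'I_V) (upd : nat -> 'I_V -> Om -> Om).
Hypotheses (XU : forall i j x om, i < NR -> j < NR -> X i (upd j x om) = if i == j then x else X i om)
  (UX : forall i om, i < NR -> upd i (X i om) om = om)
  (UU : forall i x y om, i < NR -> upd i x (upd i y om) = upd i x om).
Variables (p : nat) (c : nat -> nat).
Hypothesis pp : prime p.
Local Notation indep := (indep upd).

Let Z s o y om : 'F_p := ((gf c (fun v => ((val (X (o + v) om))%:R)%R : 'F_p) s)`_y)%R.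

Let Z_upd s o y k x om : o + s < NR -> k < NR -> (k <= o) || (o + s < k) ->
  Z s o y (upd k x om) = Z s o y om.
Proof.
move=> h1 h2 h3; rewrite /Z (@gf_ext _ c _ (fun v => ((val (X (o + v) om))%:R)%R)) // => v hv.
by rewrite XU //; [case: eqP => // e; lia|lia].
Qed.

Lemma schwartz_zippel s o y (E : pred Om) : o + s < NR -> bss c s y ->
  (forall v, 0 < v <= s -> indep E (o + v)) ->
  #|[pred om | (Z s o y om == 0%R) && E om]| * V <= y * (V %/ p).+1 * #|E|.
Proof.
elim: s y E => [|s IH] y E hN hb hE.
  case: hb => x [_]; rewrite big_ord1 mul0n => <-.
  rewrite (_ : #|_| = 0) ?mul0n //; apply: eq_card0 => om; rewrite !inE /Z /= coef1 eqxx.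
  by rewrite oner_eq0.
have ex : exists j, [&& j <= c s.+1, s.+1 * j <= y & `[< bss c s (y - s.+1 * j) >]].
  by have [j j1 [j2 j3]] := bss_dec hb; exists j; rewrite j1 j2; apply/asboolP.
have ub j : [&& j <= c s.+1, s.+1 * j <= y & `[< bss c s (y - s.+1 * j) >]] -> j <= c s.+1.
  by case/and3P.
case: (ex_maxnP ex ub) => m /and3P[m1 m2 /asboolP m3] mmax.
set y' := y - s.+1 * m in m3.
pose A0 om := Z s o y' om == 0%R.
have kN : o + s.+1 < NR by [].
have i0 : indep (fun om => ~~ A0 om && E om) (o + s.+1).
  move=> x om; rewrite /A0 Z_upd //; [|by lia|by apply/orP; right; lia].
  by rewrite (hE s.+1) // ltnSn.
have cond : #|[pred om | (Z s.+1 o y om == 0%R) && (~~ A0 om && E om)]| * V <= m * (V %/ p).+1 * #|(fun om => ~~ A0 om && E om)|.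
  apply: (resample XU UX UU kN i0) => om /andP[hA _].
  pose P : {poly 'F_p} := (\poly_(j < m.+1) (if (s.+1 * j <= y)%N then Z s o (y - s.+1 * j) om else 0))%R.
  have P0 : P != 0%R.
    apply/eqP => /(congr1 (fun Q : {poly 'F_p} => Q`_m)%R); rewrite coef_poly ltnSn m2 coef0.
    by apply/eqP.
  apply: leq_trans (bad_words V pp P0 (size_poly _ _)).
  apply: subset_leq_card; apply/subsetP => x; rewrite !inE => /eqP hz.
  rewrite /root; apply/eqP; rewrite -[RHS]hz /Z gfS.
  have eX : X (o + s.+1) (upd (o + s.+1) x om) = x by rewrite XU // eqxx.
  have eg : gf c (fun v => ((val (X (o + v) (upd (o + s.+1) x om)))%:R)%R : 'F_p) s =
            gf c (fun v => ((val (X (o + v) om))%:R)%R) s.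
    by apply: gf_ext => v hv; rewrite XU //; [case: eqP => // e; lia|lia].
  rewrite eX eg horner_poly.
  rewrite (big_ord_widen_cond (c s.+1).+1 xpredT (fun j => (if (s.+1 * j <= y)%N then Z s o (y - s.+1 * j) om else 0) * (val x)%:R ^+ j)%R) ?ltnS //=.
  rewrite big_mkcond /=; apply: eq_bigr => j _.
  case: ifP => hj; first by case: ifP => _; rewrite ?mul0r // mulrC.
  case: ifP => // hsj.
  rewrite (_ : (gf c _ s)`_(y - s.+1 * j) = 0)%R ?mulr0 //.
  apply/eqP; apply: contraFT hj => /gf_sound hbj; rewrite ltnS; apply: mmax.
  by rewrite hsj -ltnS ltn_ord; apply/asboolP.
have prev := IH y' E ltac:(lia) m3 (fun v hv => hE v ltac:(lia)).
have split : #|[pred om | (Z s.+1 o y om == 0%R) && E om]| <=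
   #|[pred om | (Z s o y' om == 0%R) && E om]| + #|[pred om | (Z s.+1 o y om == 0%R) && (~~ A0 om && E om)]|.
  rewrite -cardUI; apply: leq_trans (leq_addr _ _); apply: subset_leq_card; apply/subsetP => om; rewrite !inE /A0.
  by case: (Z s o y' om == 0%R) => /= [/andP[_ ->]|->].
have cE : #|(fun om => ~~ A0 om && E om)| <= #|E|.
  by apply: subset_leq_card; apply/subsetP => om; rewrite !unfold_in => /andP[].
apply: leq_trans (leq_mul split (leqnn V)) _; rewrite mulnDl.
apply: leq_trans (leq_add prev (leq_trans cond (leq_mul (leqnn _) cE))) _.
rewrite -mulnDl -mulnDl leq_mul2r leq_mul2r; apply/orP; right; apply/orP; right.
have : m <= s.+1 * m by rewrite leq_pmull.
by rewrite /y'; lia.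
Qed.
End SchwartzZippel.

(** * Repeated trials and the union bound *)

Section Trials.
Variables (Om : finType) (V NR : nat) (X : nat -> Om -> 'I_V) (upd : nat -> 'I_V -> Om -> Om).
Hypotheses (XU : forall i j x om, i < NR -> j < NR -> X i (upd j x om) = if i == j then x else X i om)
  (UX : forall i om, i < NR -> upd i (X i om) om = om)
  (UU : forall i x y om, i < NR -> upd i x (upd i y om) = upd i x om).
Variables (p D S T : nat).
Hypotheses (pp : prime p) (pD : 4 * D + 8 < p) (DV : 4 * D <= V) (V0 : 0 < V) (hNR : NR = T * S.+1).

Definition RNDof om i := val (X i om).

(** The failure of the first [j] trials does not depend on the words of the next one, so it can
    serve as the event [E]. With [p] above [4 * D] and [V] at least [4 * D] one has
    [2 * y * (V %/ p).+1 <= V], and each trial halves the set of failures. *)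
Lemma trials c y j : j <= T -> y <= D -> bss c S y ->
  #|[pred om | ~~ has (fun tau => hit p c (RNDof om) S tau y) (iota 0 j)]| * 2 ^ j <= #|Om|.
Proof.
move=> + yD hb; elim: j => [|j IH] jT; first by rewrite muln1 max_card.
pose E om := ~~ has (fun tau => hit p c (RNDof om) S tau y) (iota 0 j).
have hj : j * S.+1 + S < NR.
  by rewrite hNR; apply: leq_trans (_ : j.+1 * S.+1 <= _); [rewrite mulSn; lia|rewrite leq_mul2r jT orbT].
have iE v : 0 < v <= S -> indep upd E (j * S.+1 + v).
  move=> hv x om; rewrite /E; congr (~~ _); apply: eq_in_has => tau; rewrite mem_iota add0n => /andP[_ tj].
  have ht : tau * S.+1 + S.+1 <= j * S.+1 by rewrite -mulSnr leq_mul2r tj orbT.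
  rewrite /hit (@gf_ext _ c _ (fun v => ((RNDof om (tau * S.+1 + v)%N)%:R)%R)) // => u hu.
  by rewrite /RNDof XU; [case: eqP => // e; lia|lia|lia].
have := schwartz_zippel XU UX UU pp hj hb iE.
set A := #|_|; have -> : A = #|[pred om | ~~ has (fun tau => hit p c (RNDof om) S tau y) (iota 0 j.+1)]|.
  apply: eq_card => om; rewrite !inE -{1}[j.+1]addn1 iotaD has_cat negb_or /= orbF andbC /E.
  by rewrite /hit negbK.
set B := #|_| => h.
have h2 : y * (V %/ p).+1 * 2 <= V.
  apply: leq_trans (_ : D * (V %/ p).+1 * 2 <= V); first by rewrite !leq_mul2r yD !orbT.
  have h3 : V %/ p * p <= V := leq_trunc_div V p.
  have h4 : V %/ p * (4 * D) <= V %/ p * p by rewrite leq_mul2l; apply/orP; right; lia.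
  have h6 : 4 * (D * (V %/ p)) <= V by apply: leq_trans h3; apply: leq_trans h4; rewrite (_ : V %/ p * (4 * D) = 4 * (D * (V %/ p))) //; ring.
  by rewrite [D * _.+1]mulnS; move: h6 DV; generalize (D * (V %/ p)); clear; lia.
have h5 : B * 2 <= #|E|.
  rewrite -(leq_pmul2r V0) mulnAC; apply: leq_trans (leq_mul h (leqnn 2)) _.
  by rewrite mulnAC [#|E| * V]mulnC leq_mul2r h2 orbT.
rewrite expnS mulnA; apply: leq_trans (IH (ltnW jT)); rewrite leq_mul2r; apply/orP; right.
exact: h5.
Qed.

Lemma all_trials m (cs : nat -> nat -> nat) :
  #|[pred om | ~~ `[< forall i, i < m -> complete p D T (RNDof om) S (cs i) >] ]| * 2 ^ T <= m * D.+1 * #|Om|.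
Proof.
pose bad (z : 'I_m * 'I_D.+1) om := `[< bss (cs z.1) S z.2 >] && ~~ has (fun tau => hit p (cs z.1) (RNDof om) S tau z.2) (iota 0 T).
have bb z : #|[pred om | bad z om]| * 2 ^ T <= #|Om|.
  rewrite /bad; case: asboolP => hb /=; first by apply: trials => //; rewrite -ltnS.
  by rewrite (_ : #|_| = 0) ?mul0n //; apply: eq_card0 => om; rewrite !inE.
have le : #|[pred om | ~~ `[< forall i, i < m -> complete p D T (RNDof om) S (cs i) >] ]| <=
  \sum_(z : 'I_m * 'I_D.+1) #|[pred om | bad z om]|.
  apply: (@leq_trans (\sum_om \sum_(z : 'I_m * 'I_D.+1) (bad z om : nat))).
    rewrite -sum1_card big_mkcond; apply: leq_sum => om _; rewrite inE; case: ifP => // hno.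
    have [z hz] : exists z, bad z om.
      apply: contrapT => ne; move/asboolPn: hno; apply => i hi y yD hb.
      apply: contrapT => nh; apply: ne.
      exists (Ordinal hi, Ordinal (yD : y < D.+1)); rewrite /bad /=; apply/andP; split; first by apply/asboolP.
      by apply/negP.
    by rewrite (bigD1 z) //= hz.
  rewrite exchange_big /=; apply: leq_sum => z _.
  by rewrite -sum1_card [X in _ <= X]big_mkcond; apply: leq_sum => om _; rewrite inE; case: (bad z om).
apply: leq_trans (leq_mul le (leqnn _)) _; rewrite big_distrl /=.
apply: leq_trans (leq_sum _ (fun z _ => bb z)) _.
by rewrite sum_nat_const card_prod !card_ord.
Qed.
End Trials.

(** * The second phase: both cases together *)

Definition level_total S D T := let L := lgf D in let K := 5 * lgf S + 3 in
  12 * S + 2 * D + 2 * L + 25 + K * (level_cost S D L T K).+1.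
Definition post_cost S D T := let L := lgf D in
  level_total S D T + dense_cost S D L T (qf S) + 5.

Section Post.
Variables (w : nat) (inp : nat -> nat) (ilim lim M : nat).
Local Notation W := (2 ^ w).
Local Notation triple := (triple w inp ilim lim).
Local Notation wbd := (wbd w).
Hypotheses (M2 : 100 < M) (MW : M ^ 12 < W) (Mlim : M ^ 5 < lim).
Let M1 : 1 < M. Proof. exact: ltn_trans M2. Qed.
Ltac oks := oks_tac M1 MW Mlim.

(* The multiplicity functions whose bounded subset sums the second phase computes. *)
Definition calls S t U i := if i is k.+1 then dig (resU U (gp t U) (S ^ 3 + S)) k else U.

Lemma c_post_ok s S cnt D T p t Sig (U : nat -> nat) (RND := ar s aRND) (L := lgf D) (lg := lgf S) (K := 5 * lg + 3) :
  cnt = count (fun v => 0 < U v) (iota 1 S) -> D = Df S cnt -> Sig = \sum_(v < S.+1) v * U v ->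
  0 < S -> 0 < cnt ->
  rg s sS = S -> rg s zSig = Sig -> rg s zt = t -> rg s zq = qf S -> rg s zlg = lg ->
  rg s sD = D -> rg s slg = L -> rg s sT = T -> rg s yf = (cnt < mf S) ->
  rg s sP = p -> prime p -> 4 * D + 8 < p ->
  (forall k, 0 < k <= D -> ar s aINV k < p /\ k * ar s aINV k %% p = 1) ->
  (forall v, ar s aU v = U v) -> (forall k, ar s aP k = 0) -> ar s aV 0 = 0 ->
  U 0 = 0 -> (forall v, S < v -> U v = 0) -> (forall v, U v < M) -> Sig <= M -> t <= M ->
  8 * D + 8 <= M -> L <= M -> p <= M -> T <= M -> 16 * 2 ^ L * L.+2 * (D.+1 * (p * p)) <= M ->
  S < M -> 2 * (S ^ 3 + S) < M -> K <= M -> 2 ^ K <= M ->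
  triple c_post s (post_cost S D T) (fun s' =>
    (rg s' zans != 0 -> bss U S t) /\
    ((forall i, i < K.+1 -> complete p D T RND S (calls S t U i)) -> bss U S t -> rg s' zans != 0)).
Proof.
move=> ecnt eD eSig S0 cnt0 hS hSig ht hq hlg hD hL hT hf hp pp pD hI hU hP hV U0 US UM SigM tM DM LM pM TM PM SM KKM KM pKM.
have [q0 Sq q1] := qfP S0.
have /andP[lS1 lS2] := lgfP S0.
have mf0 : 0 < mf S by rewrite /mf !muln_gt0; have /andP[-> _] := q0; rewrite addn3.
have D0 : 0 < D by rewrite eD /Df; case: ifP => _; rewrite (muln_gt0 (2 * S)) ?cnt0 ?mf0 andbT muln_gt0 S0.
have /andP[lD1 lD2] := lgfP D0.
have SD : S <= D.
  by rewrite eD /Df; case: ifP => _; rewrite -mulnA mulnCA; apply: leq_trans (leq_pmulr S (n := 2 * _) _) _ => //; rewrite muln_gt0.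
have hN : nums M S D p L T by split=> //; rewrite /L; lia.
have c1 : 1 <= M by exact: ltnW M1.
pose s1 := setr s zans 0.
have ss1 : ssinv w s1 S D p L T.
  split; first by split.
  by split=> [k|//]; rewrite /= hP expn_gt0.
rewrite /post_cost -/L; set A := level_total _ _ _; set B := dense_cost _ _ _ _ _.
rewrite (_ : A + B + 5 = (A + B + 4).+1); last by rewrite -addnS.
apply: t_asg; first by oks.
rewrite -[setr s zans _]/s1.
rewrite (_ : A + B + 4 = (A + B + 3).+1); last by rewrite -addnS.
have ev1 : eval w inp (!zSig < !zt)%X s1 = (Sig < t) by rewrite /= hSig ht.
apply: t_if; first by oks.
  rewrite ev1 => hc; have hc' : Sig < t by move: hc; case: (Sig < t).
  apply: t_skip; split; first by [].
  by move=> _ /bss_le; rewrite -eSig leqNgt hc'.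
rewrite ev1 => hc; have tS : t <= Sig by move: hc; case: ltnP.
rewrite (_ : A + B + 3 = (A + B + 2).+1); last by rewrite -addnS.
have ev2 : eval w inp (!yf)%X s1 = (cnt < mf S) by rewrite /= hf.
apply: t_if; first by oks.
  rewrite ev2 => hcf; have cf : cnt < mf S by move: hcf; case: (cnt < mf S).
  have hcnt : 2 * S * count (fun v => 0 < U v) (iota 1 S) <= D by rewrite -ecnt eD /Df cf.
  have tS' : t <= \sum_(v < S.+1) v * U v by rewrite -eSig.
  have KK1 : S ^ 3 + S <= M by apply: leq_trans (ltnW KKM); rewrite leq_pmull.
  apply: t_weak (@c_sparse_ok w inp ilim lim M M2 MW Mlim s1 S D p L T lg t U hN ss1 S0 SM lS1 hlg ht tM KK1 KM pKM KKM _ U0 hV hcnt tS') _ _.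
  - by move=> v _; split; [exact: hU|exact: ltnW].
  - by apply: leq_trans (leq_addr (B + 2) A) _; rewrite addnA.
  move=> s' [_ h1 h2]; split; first exact: h1.
  by move=> hG; apply: h2 => k hk; apply: (hG k.+1).
rewrite ev2 => hcf; have cf : (cnt < mf S) = false by move: hcf; case: (cnt < mf S).
have mfE : 16 * qf S ^ 2 * (lg + 3) = mf S by rewrite /mf -/lg; ring.
apply: t_weak (@c_dense_ok w inp ilim lim M M2 MW Mlim s1 S D p L T lg (qf S) t Sig U hN ss1 S0 SM _ _ Sq lS1 ht hq hSig eSig SigM tS hU UM U0 US _ _) _ _.
- by have /andP[_ h] := q0; apply: leq_ltn_trans h SM.
- by have /andP[h _] := q0.
- by rewrite mfE -ecnt leqNgt cf.
- by rewrite mfE eD /Df cf.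
- by apply: leq_trans (leq_addl A B) _; apply: leq_addr.
move=> s' [h1 h2]; split; first exact: h1.
by move=> hG; apply: h2; apply: (hG 0).
Qed.
End Post.

(** * Drawing the random words *)

Section Run.
Variables (w : nat) (P : program).
Local Notation W := (2 ^ w).

(** Puts [2 * n + 2], the number of input cells, into register 1, where compiled code expects the
    base of its arrays. *)
Definition startup : program := [:: Const 2 0; Read 2 2; Const 3 2; Op Mul 2 2 3; Op Add 1 2 3].

(** Written by hand, as the while language is deterministic. A round takes 12 instructions with
    [Rand] at offset 7, so word [i] is read at tape position [12 * i + 7] counted from the entry of
    the loop. *)
Definition draw l : program :=
  [:: Op Lt 2 (30 + yi) (30 + yNR); Jzero 2 (l + 12); Const 3 32; Op Mul 2 (30 + yi) 3; Const 3 aRND;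
      Op Add 2 2 3; Op Add 2 2 1; Rand 3; Write 2 3; Const 3 1; Op Add (30 + yi) (30 + yi) 3; Jzero 0 l].

Definition drawn (s : st) (f : nat -> nat) j :=
  St (fun x => if x == yi then j else rg s x)
     (fun a i => if (a == aRND) && (i < j) then f i else ar s a i).

Variables (inp : nat -> nat) (ilim lim : nat).
Hypotheses (W1 : 32 < W) (fitW : ilim + 32 * lim <= W).
Local Notation rel := (rel inp ilim lim).

Lemma draw_step l s f j g m (r : seq nat) NR : code_at P l (draw l) -> rg s yNR = NR -> j < NR -> NR < lim ->
  size r = 12 -> f j = nth 0 r 7 ->
  rel (drawn s f j) (State l g m) ->
  exists g' m', foldl (step w P) (State l g m) r = State l g' m' /\ rel (drawn s f j.+1) (State l g' m').
Proof.
move=> hc hN jN NL sr hf [/= r0 r1 r2 r3 r4].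
case: r sr hf => [|x0 [|x1 [|x2 [|x3 [|x4 [|x5 [|x6 [|x7 [|x8 [|x9 [|x10 [|x11 []]]]]]]]]]]]] // _ hf.
have c i : i < 12 -> nth (Halt false) P (l + i) = nth (Halt false) (draw l) i by exact: hc.
have gi : g (30 + yi) = j by rewrite r2.
have gN : g (30 + yNR) = NR by rewrite r2.
have NW : 32 * NR + 32 <= W by lia.
have jW : j < W by lia.
pose A := ilim + (32 * j + 1).
have AW : A < W by rewrite /A; lia.
have st k g0 m0 x i : k < 12 -> nth (Halt false) (draw l) k = i ->
  step w P (State (l + k) g0 m0) x = match i with
  | Const d v => State (l + k).+1 (update g0 d (v %% W)) m0
  | Op o d x y => State (l + k).+1 (update g0 d (eval_op w o (g0 x) (g0 y))) m0
  | Read d x => State (l + k).+1 (update g0 d (m0 (g0 x))) m0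
  | Write x y => State (l + k).+1 g0 (update m0 (g0 x) (g0 y))
  | Rand d => State (l + k).+1 (update g0 d x) m0
  | Jzero x l' => State (if g0 x == 0 then l' else (l + k).+1) g0 m0
  | Halt _ => State (l + k) g0 m0
  end.
  by move=> hk hi; rewrite /step /current /= (c k hk) hi; case: i {hi}.
pose g1 := update g 2 1. pose g2 := update g1 3 32. pose g3 := update g2 2 (32 * j).
pose g4 := update g3 3 1. pose g5 := update g4 2 (32 * j + 1). pose g6 := update g5 2 A.
pose g7 := update g6 3 x7. pose m8 := update m A x7. pose g9 := update g7 3 1.
pose g10 := update g9 (30 + yi) j.+1.
have fc q x r : foldl (step w P) q (x :: r) = foldl (step w P) (step w P q x) r by [].
have sm a : a < W -> a %% W = a by move=> h; rewrite modn_small.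
have e0 : step w P (State l g m) x0 = State (l + 1) g1 m.
  rewrite -[l in State l](addn0 l) (st 0 _ _ _ (Op Lt 2 (30 + yi) (30 + yNR)) isT erefl); cbv beta iota; rewrite /eval_op gi gN jN sm ?addn0 ?addn1 //; lia.
have e1 : step w P (State (l + 1) g1 m) x1 = State (l + 2) g1 m.
  by rewrite (st 1 _ _ _ (Jzero 2 (l + 12)) isT erefl) -addnS.
have e2 : step w P (State (l + 2) g1 m) x2 = State (l + 3) g2 m.
  by rewrite (st 2 _ _ _ (Const 3 32) isT erefl); cbv beta iota; rewrite sm // -addnS.
have e3 : step w P (State (l + 3) g2 m) x3 = State (l + 4) g3 m.
  rewrite (st 3 _ _ _ (Op Mul 2 (30 + yi) 3) isT erefl); cbv beta iota; rewrite /eval_op.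
  have -> : g2 (30 + yi) = j by exact: gi.
  have -> : g2 3 = 32 by [].
  rewrite mulnC sm -?addnS //; lia.
have e4 : step w P (State (l + 4) g3 m) x4 = State (l + 5) g4 m.
  rewrite (st 4 _ _ _ (Const 3 aRND) isT erefl); cbv beta iota; rewrite sm -?addnS //; lia.
have e5 : step w P (State (l + 5) g4 m) x5 = State (l + 6) g5 m.
  rewrite (st 5 _ _ _ (Op Add 2 2 3) isT erefl); cbv beta iota; rewrite /eval_op.
  have -> : g4 2 = 32 * j by [].
  have -> : g4 3 = 1 by [].
  rewrite sm -?addnS //; lia.
have e6 : step w P (State (l + 6) g5 m) x6 = State (l + 7) g6 m.
  rewrite (st 6 _ _ _ (Op Add 2 2 1) isT erefl); cbv beta iota; rewrite /eval_op.
  have -> : g5 2 = 32 * j + 1 by [].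
  have -> : g5 1 = ilim by exact: r1.
  rewrite [_ + ilim]addnC sm -?addnS //; lia.
have e7 : step w P (State (l + 7) g6 m) x7 = State (l + 8) g7 m.
  by rewrite (st 7 _ _ _ (Rand 3) isT erefl) -addnS.
have e8 : step w P (State (l + 8) g7 m) x8 = State (l + 9) g7 m8.
  by rewrite (st 8 _ _ _ (Write 2 3) isT erefl) -addnS.
have e9 : step w P (State (l + 9) g7 m8) x9 = State (l + 10) g9 m8.
  rewrite (st 9 _ _ _ (Const 3 1) isT erefl); cbv beta iota; rewrite sm -?addnS //; lia.
have e10 : step w P (State (l + 10) g9 m8) x10 = State (l + 11) g10 m8.
  rewrite (st 10 _ _ _ (Op Add (30 + yi) (30 + yi) 3) isT erefl); cbv beta iota; rewrite /eval_op.
  have -> : g9 (30 + yi) = j by exact: gi.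
  have -> : g9 3 = 1 by [].
  rewrite addn1 sm -?addnS //; lia.
have e11 : step w P (State (l + 11) g10 m8) x11 = State l g10 m8.
  rewrite (st 11 _ _ _ (Jzero 0 l) isT erefl); cbv beta iota.
  by have -> : g10 0 = 0 by exact: r0.
exists g10, m8; split; first by rewrite fc e0 fc e1 fc e2 fc e3 fc e4 fc e5 fc e6 fc e7 fc e8 fc e9 fc e10 fc e11.
split=> /=.
- exact: r0.
- exact: r1.
- move=> x; have := r2 x; rewrite /= => hx.
  have e x' : g10 (30 + x') = if x' == yi then j.+1 else g (30 + x').
    by rewrite /g10 /update eqn_add2l; case: eqP => // _.
  by rewrite e hx; case: eqP.
- move=> a i a32 iL; rewrite /m8 /update /addr /A /=.
  have -> : (ilim + (32 * i + a) == ilim + (32 * j + 1)) = (a == aRND) && (i == j) by lia.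
  have := r3 a i a32 iL; rewrite /= /addr => hm.
  rewrite hm ltnS (leq_eqVlt i j); case: (a == aRND) => //=; case: (i =P j) => [->|ne] //=.
- by move=> k hk; rewrite /m8 /update; case: eqP => [e|_]; [rewrite /A in e; lia|exact: r4].
Qed.

Lemma draw_all l s f g m NR : code_at P l (draw l) -> rg s yNR = NR -> rg s yi = 0 -> NR < lim ->
  rel s (State l g m) -> forall j (r : seq nat), j <= NR -> size r = 12 * j ->
  (forall i, i < j -> f i = nth 0 r (12 * i + 7)) ->
  exists g' m', foldl (step w P) (State l g m) r = State l g' m' /\ rel (drawn s f j) (State l g' m').
Proof.
move=> hc hN hi NL hrel; elim=> [|j IH] r jN sr hf.
  case: r sr hf => // _ _; exists g, m; split=> //.
  have [/= r0 r1 r2 r3 r4] := hrel; split=> //= [x|a i a32 iL].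
    by rewrite r2; case: eqP => // ->.
  by rewrite ltn0 andbF r3.
have st1 : size (take (12 * j) r) = 12 * j by rewrite size_takel // sr leq_mul2l leqnSn.
have st2 : size (drop (12 * j) r) = 12 by rewrite size_drop sr; lia.
have [|g1 [m1 [h1 h2]]] := IH (take (12 * j) r) (ltnW jN) st1.
  by move=> i hij; rewrite nth_take ?hf //; lia.
have [|g2 [m2 [k1 k2]]] := @draw_step l s f j g1 m1 (drop (12 * j) r) NR hc hN jN NL st2 _ h2.
  by rewrite nth_drop hf.
by exists g2, m2; rewrite -(cat_take_drop (12 * j) r) foldl_cat h1.
Qed.

(** A halted machine stays where it is, so an upper bound on the time can serve as the exact length
    of the tape. *)
Lemma halt_run q b (r : seq nat) : current P q = Halt b -> foldl (step w P) q r = q.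
Proof.
move=> h; elim: r => //= x r IH; rewrite {2}/step h; case: q h IH => l g m h IH; exact: IH.
Qed.
End Run.

(** * The whole program *)

Definition tail_code l : program := [:: Jzero (30 + zans) (l + 2); Halt true; Halt false].

Definition prog a : program :=
  startup ++ cC (c_pre a) 5 ++ draw (5 + len (c_pre a)) ++ cC c_post (5 + len (c_pre a) + 12) ++
  tail_code (5 + len (c_pre a) + 12 + len c_post).

Definition sizeK a := maxn (csz (c_pre a)) (csz c_post).

Definition total_time a n S cnt := let D := Df S cnt in let T := Tf a n S cnt in
  5 + sizeK a * pre_cost n S D + 12 * (T * S.+1) + 2 + sizeK a * post_cost S D T + 1.

Lemma cwf_pre a : cwf (c_pre a).
Proof. by []. Qed.

Lemma cwf_post : cwf c_post.
Proof. by vm_compute. Qed.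

Lemma code_mid pre cs post : code_at (pre ++ cs ++ post) (size pre) cs.
Proof.
by move=> i hi; rewrite nth_cat ltnNge leq_addr /= addKn nth_cat hi.
Qed.

Lemma code_five (A B C E F P : program) : P = A ++ B ++ C ++ E ++ F ->
  [/\ code_at P 0 A, code_at P (size A) B, code_at P (size A + size B) C, code_at P (size A + size B + size C) E
   & code_at P (size A + size B + size C + size E) F].
Proof.
move=> ->; split.
- by apply: (@code_mid [::]).
- by apply: code_mid.
- by rewrite catA -size_cat; apply: code_mid.
- by rewrite 2!catA -!size_cat; apply: code_mid.
- by rewrite 3!catA -!size_cat -[X in code_at X]cats0 -[X in code_at X]catA; apply: code_mid.
Qed.

Lemma step_const w P l g m x d v : nth (Halt false) P l = Const d v ->
  step w P (State l g m) x = State l.+1 (update g d (v %% 2 ^ w)) m.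
Proof. by rewrite /step /current => ->. Qed.

Lemma step_op w P l g m x o d y z : nth (Halt false) P l = Op o d y z ->
  step w P (State l g m) x = State l.+1 (update g d (eval_op w o (g y) (g z))) m.
Proof. by rewrite /step /current => ->. Qed.

Lemma step_read w P l g m x d y : nth (Halt false) P l = Read d y ->
  step w P (State l g m) x = State l.+1 (update g d (m (g y))) m.
Proof. by rewrite /step /current => ->. Qed.

Lemma step_jzero w P l g m x y l' : nth (Halt false) P l = Jzero y l' ->
  step w P (State l g m) x = State (if g y == 0 then l' else l.+1) g m.
Proof. by rewrite /step /current => ->. Qed.

Lemma total_timeE a n S cnt (D := Df S cnt) (T := Tf a n S cnt) :
  total_time a n S cnt = 5 + sizeK a * pre_cost n S D + (12 * (T * S.+1) + 2 + sizeK a * post_cost S D T + 1).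
Proof.
have gen x y z : 5 + x + y + 2 + z + 1 = 5 + x + (y + 2 + z + 1) by rewrite !addnA.
exact: gen.
Qed.

Lemma budget PRE X n1 N : N = 5 + PRE + (X + 1) -> n1 <= PRE -> [/\ 5 <= N, n1 <= N - 5 & X < N - 5 - n1].
Proof. by move=> -> h; split; lia. Qed.

Lemma slot_lt i N : i < N -> 12 * i + 7 < 12 * N.
Proof. by lia. Qed.

Lemma draw_exit w P l g m N : code_at P l (draw l) -> g (30 + yi) = N -> g (30 + yNR) = N ->
  forall r : seq nat, size r = 2 -> foldl (step w P) (State l g m) r = State (l + 12) (update g 2 0) m.
Proof.
move=> cdr gi gN [|x0 [|x1 []]] // _.
have d0 : nth (Halt false) P l = Op Lt 2 (30 + yi) (30 + yNR) by have := cdr 0 isT; rewrite addn0.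
have d1 : nth (Halt false) P l.+1 = Jzero 2 (l + 12) by have := cdr 1 isT; rewrite addn1.
have st0 : step w P (State l g m) x0 = State l.+1 (update g 2 0) m.
  by rewrite (step_op _ _ _ _ d0) /eval_op gi gN ltnn mod0n.
have st1 : step w P (State l.+1 (update g 2 0) m) x1 = State (l + 12) (update g 2 0) m.
  by rewrite (step_jzero _ _ _ _ d1).
have fc q x r' : foldl (step w P) q (x :: r') = foldl (step w P) (step w P q x) r' by [].
by rewrite fc st0 fc st1.
Qed.

Lemma tail_run w P l g m z (r : seq nat) : code_at P l (tail_code l) -> g (30 + zans) = z -> 0 < size r ->
  current P (foldl (step w P) (State l g m) r) = Halt (z != 0).
Proof.
move=> ctl gz; case: r => // x r _.
have e0 : nth (Halt false) P l = Jzero (30 + zans) (l + 2) by have := ctl 0 isT; rewrite addn0.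
have e1 : nth (Halt false) P l.+1 = Halt true by have := ctl 1 isT; rewrite addn1.
have e2 : nth (Halt false) P (l + 2) = Halt false by have := ctl 2 isT.
have fc q y r' : foldl (step w P) q (y :: r') = foldl (step w P) (step w P q y) r' by [].
rewrite fc (step_jzero _ _ _ _ e0) gz; case: eqP => _.
  by rewrite (@halt_run w P _ false).
by rewrite (@halt_run w P _ true).
Qed.

Lemma drawn_zero s1 f N : (forall b k, b \notin [:: aU; aMK; aINV] -> ar s1 b k = 0) ->
  (forall b k, b \notin [:: aU; aMK; aINV; aRND] -> ar (drawn s1 f N) b k = 0) /\
  ar (drawn s1 f N) aRND = fun i => if i < N then f i else 0.
Proof.
move=> h; split=> [b k|]; last by apply/funext => i; rewrite /=; case: ifP => // _; rewrite h.
rewrite !inE !negb_or => /and4P[k1 k2 k3 k4]; rewrite /= (negbTE k4) /= h //.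
by rewrite !inE !negb_or k1 k2 k3.
Qed.

Lemma budget2 X POST N : X + 2 + POST < N -> [/\ X <= N, 2 <= N - X & POST + 1 <= N - X - 2].
Proof. by move=> h; split; lia. Qed.

Section Whole.
Variables (w a n t M : nat) (si ui : nat -> nat).
Local Notation W := (2 ^ w).
Let S := \max_(i < n) si i.
Let U v := \sum_(i < n) (if si i == v then ui i else 0).
Let cnt := count (fun v => 0 < U v) (iota 1 S).
Let D := Df S cnt.
Let T := Tf a n S cnt.
Let NR := T * S.+1.
Let K := 5 * lgf S + 3.
Variables (lim : nat) (m0 : nat -> nat).
Hypotheses (M2 : 100 < M) (MW : M ^ 12 < W) (Mlim : M ^ 5 < lim).
Hypotheses (fitW : 2 * n + 2 + 32 * lim <= W) (NRlim : NR < lim).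
Hypotheses (h0 : m0 0 = n) (h1 : m0 1 = t)
  (hi : forall i, i < n -> m0 (2 + i) = si i /\ m0 (2 + n + i) = ui i)
  (hz : forall i, 2 * n + 2 <= i -> m0 i = 0).
Hypotheses (n0 : 0 < n) (S0 : 0 < S) (cnt0 : 0 < cnt) (nM : 2 * n < M) (tM : t <= M)
  (hM : forall i, i < n -> 0 < si i /\ si i <= M /\ ui i <= M)
  (sM : \sum_(i < n) ui i < M) (SM : \sum_(i < n) si i * ui i <= M) (aM : a <= M)
  (S2 : 2 * S < M) (D2 : 8 * D + 8 <= M) (BM : 4 * Bof D + 4 * D + 8 <= M) (mM : mf S <= M) (TM : T < M)
  (PM : 16 * 2 ^ lgf D * (lgf D).+2 * (D.+1 * (Bof D * Bof D)) <= M)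
  (KKM : 2 * (S ^ 3 + S) < M) (KM : K <= M) (pKM : 2 ^ K <= M).
Hypothesis eSig : \sum_(i < n) si i * ui i = \sum_(v < S.+1) v * U v.

Lemma U_out v : S < v -> U v = 0.
Proof.
move=> h; rewrite /U big1 // => i _; case: eqP => // e.
have : si i <= S by apply: (leq_bigmax_cond i (F := fun i : 'I_n => si i)).
by rewrite e leqNgt h.
Qed.

Lemma U_0 : U 0 = 0.
Proof. by rewrite /U big1 // => i _; case: eqP => // e; have [] := hM (ltn_ord i); rewrite e. Qed.

Lemma U_lt v : U v < M.
Proof. by apply: leq_ltn_trans sM; apply: leq_sum => i _; case: ifP. Qed.

Lemma prog_tail P l2 s1 g1 m1 :
  code_at P l2 (draw l2) -> code_at P (l2 + 12) (cC c_post (l2 + 12)) ->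
  code_at P (l2 + 12 + len c_post) (tail_code (l2 + 12 + len c_post)) ->
  rel m0 (2 * n + 2) lim s1 (State l2 g1 m1) -> rg s1 yi = 0 ->
  [/\ [/\ rg s1 sS = S, rg s1 zSig = \sum_(i < n) si i * ui i, rg s1 zt = t, rg s1 zq = qf S & rg s1 zlg = lgf S],
     [/\ rg s1 sD = D, rg s1 slg = lgf D, rg s1 sT = T, rg s1 yNR = NR & rg s1 yf = (cnt < mf S)],
     prime (rg s1 sP) /\ 4 * D + 8 < rg s1 sP <= Bof D,
     (forall k, 0 < k <= D -> ar s1 aINV k < rg s1 sP /\ k * ar s1 aINV k %% rg s1 sP = 1) &
     (forall v, ar s1 aU v = U v) /\ forall a k, a \notin [:: aU; aMK; aINV] -> ar s1 a k = 0] ->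
  forall r : seq nat, size r > 12 * NR + 2 + sizeK a * post_cost S D T ->
  exists2 b, current P (foldl (step w P) (State l2 g1 m1) r) = Halt b &
    (b -> bss U S t) /\
    ((forall i, i < K.+1 -> complete (rg s1 sP) D T (fun i => if i < NR then nth 0 r (12 * i + 7) else 0) S (calls S t U i)) ->
     bss U S t -> b).
Proof.
have W32 : 32 < W.
  by apply: leq_ltn_trans MW; apply: (@leq_trans (M ^ 1)); [rewrite expn1; lia|rewrite leq_exp2l; lia].
pose ilim := 2 * n + 2; rewrite -/ilim.
set l3 := l2 + 12 => cdr cpost ctl rel1 z_i preQ r sr.
have [[S_1 Sig_1 t_1 q_1 lg_1] [D_1 L_1 T_1 NR_1 f_1] [p1 p2] I_1 [U_1 z_1]] := preQ.
have [b3 b4 b5] := budget2 sr; clear sr.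
(* The tape is cut into the drawing rounds of 12 steps, the two instructions that leave the loop,
   the compiled second phase, and the answer. *)
pose f i := nth 0 r (12 * i + 7).
pose r3 := take (12 * NR) r; pose rc := drop (12 * NR) r.
pose r4 := take 2 rc; pose rd := drop 2 rc.
have sc' : size rc = size r - 12 * NR by rewrite size_drop.
have sd : size rd = size r - 12 * NR - 2 by rewrite size_drop sc'.
have er : r = r3 ++ r4 ++ rd by rewrite !cat_take_drop.
have s3 : size r3 = 12 * NR by apply: size_takel; exact: b3.
have hf3 i : i < NR -> f i = nth 0 r3 (12 * i + 7).
  by move=> hiN; rewrite /f /r3 (nth_take _ (slot_lt hiN)).
have [g2 [m2 [run2 rel2]]] := @draw_all w P m0 ilim lim W32 fitW l2 s1 f g1 m1 NR cdr NR_1 z_i NRlim rel1 NR r3 (leqnn _) s3 hf3.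
set sd2 := drawn s1 f NR in rel2.
have [r20 r21 r22 r23 r24] := rel2.
have gi2 : g2 (30 + yi) = NR by have := r22 yi; rewrite /sd2 /drawn.
have gN2 : g2 (30 + yNR) = NR by exact: etrans (r22 yNR) NR_1.
pose g3 := update g2 2 0.
have run3 : foldl (step w P) (State l2 g2 m2) r4 = State l3 g3 m2.
  by apply: (@draw_exit w P l2 g2 m2 NR cdr gi2 gN2); apply: size_takel; rewrite sc'; exact: b4.
have rel3 : rel m0 ilim lim sd2 (State l3 g3 m2).
  by split; [exact: r20|exact: r21|exact: r22|exact: r23|exact: r24].
have [z_a z_r] := @drawn_zero s1 f NR z_1.
have D4 : D <= M by move: D2; clear; generalize D; clear; lia.
have pB : rg s1 sP <= Bof D by have /andP[] := p2.
have lD : lgf D <= M.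
  have D0 : 0 < D.
    have mf0 : 0 < mf S by rewrite /mf !muln_gt0; have [/andP[-> _] _ _] := qfP S0; rewrite addn3.
    by rewrite /D /Df; case: ifP => _; rewrite (muln_gt0 (2 * S)) ?cnt0 ?mf0 andbT muln_gt0 S0.
  have /andP[_ h] := lgfP D0; have := ltn_expl (lgf D) (ltnSn 1); clear -h D2; lia.
have PMp : 16 * 2 ^ lgf D * (lgf D).+2 * (D.+1 * (rg s1 sP * rg s1 sP)) <= M.
  by apply: leq_trans PM; rewrite leq_mul2l leq_mul2l leq_mul ?orbT.
have [postok postt postQ] := @c_post_ok w m0 ilim lim M M2 MW Mlim sd2 S cnt D T (rg s1 sP) t (\sum_(i < n) si i * ui i) U
  erefl erefl eSig S0 cnt0 S_1 Sig_1 t_1 q_1 lg_1 D_1 L_1 T_1 f_1 erefl p1 ltac:(by have /andP[] := p2) I_1 U_1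
  (fun k => z_a aP k isT) (z_a aV 0 isT) U_0 U_out U_lt SM tM D2 lD ltac:(clear -BM pB; lia) (ltnW TM) PMp ltac:(clear -S2; lia) KKM KM pKM.
set s4 := exec w m0 c_post sd2 in postQ.
have [n2 [g4 [m4 [run4 rel4 n2K]]]] := @compile_ok w m0 ilim lim P W32 fitW (sizeK a) c_post sd2 l3 g3 m2 postok cwf_post (leq_maxr _ _) cpost rel3.
have n2b : n2 <= sizeK a * post_cost S D T by apply: leq_trans n2K _; rewrite leq_mul2l postt orbT.
pose r5 := take n2 rd; pose re := drop n2 rd.
have r5s : size r5 = n2.
  apply: size_takel; rewrite sd; apply: leq_trans b5; apply: leq_trans n2b _; apply: leq_addr.
have run5 := run4 r5 r5s.
have se : 0 < size re by rewrite size_drop sd subn_gt0; apply: leq_trans b5; rewrite addn1 ltnS.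
have [_ _ r42 _ _] := rel4.
have fin := @tail_run w P _ g4 m4 _ re ctl (r42 zans) se.
exists (rg s4 zans != 0).
  by rewrite er !foldl_cat run2 run3 -(cat_take_drop n2 rd) foldl_cat run5.
case: postQ => q1 q2; split; first exact: q1.
move=> hG; apply: q2; rewrite z_r; exact: hG.
Qed.

(** The step count [n1] of the first phase and the prime [p] are fixed before the tape [r] is
    chosen. The positions of the random words are therefore the same for all tapes, which the
    counting of bad tapes requires. *)
Lemma prog_run : exists n1 p, [/\ n1 <= sizeK a * pre_cost n S D, prime p, 4 * D + 8 < p <= Bof D &
  forall r : seq nat, size r = total_time a n S cnt ->
  exists2 b, current (prog a) (foldl (step w (prog a)) (State 0 (fun=> 0) m0) r) = Halt b &
    (b -> bss U S t) /\
    ((forall i, i < K.+1 -> complete p D T (fun i => if i < NR then nth 0 r (5 + n1 + (12 * i + 7)) else 0) S (calls S t U i)) ->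
     bss U S t -> b)].
Proof.
have W32 : 32 < W.
  by apply: leq_ltn_trans MW; apply: (@leq_trans (M ^ 1)); [rewrite expn1; lia|rewrite leq_exp2l; lia].
have ilimW : 2 * n + 2 + 32 * lim <= W := fitW.
pose ilim := 2 * n + 2.
have eP : prog a = startup ++ cC (c_pre a) 5 ++ draw (5 + len (c_pre a)) ++ cC c_post (5 + len (c_pre a) + 12) ++
  tail_code (5 + len (c_pre a) + 12 + len c_post) by [].
have ln1 : len (c_pre a) = size (cC (c_pre a) 5) by rewrite (size_cC W32 ilimW).
have ln2 : len c_post = size (cC c_post (5 + len (c_pre a) + 12)) by rewrite (size_cC W32 ilimW).
have [cst cpre cdr cpost ctl] := code_five eP.
have sz1 : size startup = 5 by [].
have sz2 : size (draw (5 + len (c_pre a))) = 12 by [].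
rewrite sz1 in cpre; rewrite sz1 -ln1 in cdr.
rewrite sz1 -ln1 sz2 in cpost; rewrite sz1 -ln1 sz2 -ln2 in ctl.
move: cst cpre cdr cpost ctl; move: (prog a) {eP ln1 ln2} => P.
set l2 := 5 + len (c_pre a); set l3 := l2 + 12 => cst cpre cdr cpost ctl.
pose z0 := St (fun=> 0) (fun _ _ => 0).
have D2' : 2 * D < M by clear -D2; move: D2; generalize D; clear; lia.
have [preok pret preQ] := @c_pre_ok w m0 (2 * n + 2) lim M M2 MW Mlim a n t si ui z0 h0 h1 hi erefl n0 S0 cnt0 nM tM
   (fun i h => (hM h).2) (ltnW sM) SM aM S2 D2' BM mM TM (fun _ _ => erefl).
rewrite -/S -/U -/cnt -/D -/T in preQ pret.
set s1 := exec w m0 (c_pre a) z0 in preQ.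
have [g0 hst hrel0] : exists2 g, (forall r : seq nat, size r = 5 -> foldl (step w P) (State 0 (fun=> 0) m0) r = State 5 g m0) & rel m0 ilim lim z0 (State 5 g m0).
  have n2W : 2 * n + 2 < W by apply: leq_trans fitW; rewrite -addn1 leq_add2l; lia.
  pose g1 := update (fun=> 0) 2 0; pose g2 := update g1 2 n; pose g3 := update g2 3 2.
  pose g4 := update g3 2 (2 * n); pose g5 := update g4 1 ilim.
  have fc q x r : foldl (step w P) q (x :: r) = foldl (step w P) (step w P q x) r by [].
  have sm b : b < W -> b %% W = b by move=> h; rewrite modn_small.
  have cc i : i < 5 -> nth (Halt false) P i = nth (Halt false) startup i by exact: cst.
  exists g5; last by split=> // b i hb hil; rewrite [LHS]/= hz // /addr /ilim leq_addr.
  case=> [|x0 [|x1 [|x2 [|x3 [|x4 []]]]]] // _.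
  have st0 : step w P (State 0 (fun=> 0) m0) x0 = State 1 g1 m0.
    by rewrite (step_const _ _ _ _ (cc 0 isT)) sm //; clear -W32; lia.
  have st1 : step w P (State 1 g1 m0) x1 = State 2 g2 m0.
    have e : m0 (g1 2) = n by exact: h0.
    by rewrite (step_read _ _ _ _ (cc 1 isT)) e.
  have st2 : step w P (State 2 g2 m0) x2 = State 3 g3 m0.
    by rewrite (step_const _ _ _ _ (cc 2 isT)) sm //; clear -W32; lia.
  have st3 : step w P (State 3 g3 m0) x3 = State 4 g4 m0.
    have e : eval_op w Mul (g3 2) (g3 3) = 2 * n by rewrite /eval_op (mulnC (g3 2)) sm //; clear -n2W; apply: leq_trans n2W; rewrite ltnS leq_addr.
    by rewrite (step_op _ _ _ _ (cc 3 isT)) e.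
  have st4 : step w P (State 4 g4 m0) x4 = State 5 g5 m0.
    have e : eval_op w Add (g4 2) (g4 3) = ilim by rewrite /eval_op sm.
    by rewrite (step_op _ _ _ _ (cc 4 isT)) e.
  by rewrite fc st0 fc st1 fc st2 fc st3 fc st4.
have [n1 [g1 [m1 [run1 rel1 n1K]]]] := @compile_ok w m0 ilim lim P W32 fitW (sizeK a) (c_pre a) z0 5 g0 m0 preok (cwf_pre a) (leq_maxl _ _) cpre hrel0.
rewrite -/l2 in run1 rel1; clearbody l2.
have n1b : n1 <= sizeK a * pre_cost n S D by apply: leq_trans n1K _; rewrite leq_mul2l pret orbT.
have z_i : rg s1 yi = 0 by rewrite /s1 exec_rg.
have [_ _ [p1 p2] _ _] := preQ.
exists n1, (rg s1 sP); split; [exact: n1b|exact: p1|exact: p2|move=> r sr].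
have [b1 b2 b3] := budget (etrans sr (total_timeE a n S cnt)) n1b.
pose r1 := take 5 r; pose ra := drop 5 r.
pose r2 := take n1 ra; pose rb := drop n1 ra.
have sa : size ra = size r - 5 by rewrite size_drop.
have sb : size rb = size r - 5 - n1 by rewrite size_drop sa.
have er : r = r1 ++ r2 ++ rb by rewrite !cat_take_drop.
have run0 := hst r1 (size_takel b1).
have r2s : size r2 = n1 by apply: size_takel; rewrite sa; exact: b2.
have run1' := run1 r2 r2s.
have rbs : 12 * NR + 2 + sizeK a * post_cost S D T < size rb by rewrite sb; exact: b3.
have [b hb [q1 q2]] := @prog_tail P l2 s1 g1 m1 cdr cpost ctl rel1 z_i preQ rb rbs.
exists b; first by rewrite er !foldl_cat run0 run1'.
split; first exact: q1.
have eF : (fun i => if i < NR then nth 0 rb (12 * i + 7) else 0) = fun i => if i < NR then nth 0 r (5 + n1 + (12 * i + 7)) else 0.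
  by apply/funext => i; case: (i < NR) => //; rewrite !nth_drop addnA.
by move=> hG; apply: q2; rewrite eF; exact: hG.
Qed.

End Whole.

Lemma complete_ext p D T R1 R2 S c : (forall i, i < T * S.+1 -> R1 i = R2 i) ->
  complete p D T R1 S c -> complete p D T R2 S c.
Proof.
move=> h hc y yD hb; have := hc y yD hb.
rewrite (@eq_in_has _ _ (fun tau => hit p c R2 S tau y)) // => tau; rewrite mem_iota add0n => /andP[_ tT].
rewrite /hit (@gf_ext _ c _ (fun v => ((R2 (tau * S.+1 + v)%N)%:R)%R)) // => u /andP[_ hu].
rewrite h //; apply: (@leq_trans (tau.+1 * S.+1)); last by rewrite leq_mul2r tT orbT.
by rewrite mulSn addnC ltn_add2r ltnS.
Qed.

(** Realises the abstract resampling space by tapes: word [i] is the tape entry at [pos i], and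
    injectivity of [pos] makes updates of different words independent. *)
Lemma tuple_trials V TT NR T S p D (pos : nat -> nat) m cs : prime p -> 4 * D + 8 < p -> 4 * D <= V -> 0 < V ->
  NR = T * S.+1 -> (forall i, i < NR -> pos i < TT) -> (forall i j, pos i = pos j -> i = j) -> 0 < TT ->
  #|[pred om : TT.-tuple 'I_V | ~~ `[< forall i, i < m ->
      complete p D T (fun j => if j < NR then nth 0 [seq val r | r <- om] (pos j) else 0) S (cs i) >]]| * 2 ^ T
  <= m * D.+1 * #|{: TT.-tuple 'I_V}|.
Proof.
case: TT => // TT pp pD DV V0 hNR posT posI _.
pose X i (om : TT.+1.-tuple 'I_V) := tnth om (inord (pos i)).
pose upd i x (om : TT.+1.-tuple 'I_V) := [tuple (if k == inord (pos i) then x else tnth om k) | k < TT.+1].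
have inj i j : i < NR -> j < NR -> (inord (pos i) == inord (pos j) :> 'I_TT.+1) = (i == j).
  move=> hi hj; apply/eqP/eqP => [/(congr1 val)|-> //].
  by rewrite /= !inordK; [exact: posI|exact: posT|exact: posT].
have XU i j x om : i < NR -> j < NR -> X i (upd j x om) = if i == j then x else X i om.
  by move=> hi hj; rewrite /X tnth_mktuple inj.
have UX i om : i < NR -> upd i (X i om) om = om.
  by move=> hi; apply: eq_from_tnth => k; rewrite tnth_mktuple; case: eqP => [->|].
have UU i x y om : i < NR -> upd i x (upd i y om) = upd i x om.
  by move=> hi; apply: eq_from_tnth => k; rewrite !tnth_mktuple; case: eqP.
pose G om := forall i, i < m -> complete p D T (RNDof X om) S (cs i).
pose F (om : TT.+1.-tuple 'I_V) j := if j < NR then nth 0 [seq val r | r <- om] (pos j) else 0.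
have hF om j : j < NR -> RNDof X om j = F om j.
  move=> hj; rewrite /RNDof /X /F hj (tnth_nth (tnth om ord0)) inordK; last exact: posT.
  by rewrite (nth_map (tnth om ord0)) // size_tuple; exact: posT.
have GH om : G om -> forall i, i < m -> complete p D T (F om) S (cs i).
  by move=> h i hi; apply: complete_ext (h i hi) => j; rewrite -hNR; apply: hF.
apply: leq_trans (@all_trials _ V NR X upd XU UX UU p D S T pp pD DV V0 hNR m cs).
rewrite leq_mul2r; apply/orP; right; apply: subset_leq_card; apply/subsetP => om hn.
have {}hn : ~~ `[< forall i, i < m -> complete p D T (F om) S (cs i) >] by exact: hn.
have : ~~ `[< G om >] by apply: contraNN hn => /asboolP h; apply/asboolP; exact: GH.
by rewrite inE.
Qed.

(** * Merging items of equal size, and the memory image of the input *)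

Lemma split_sum n (u : nat -> nat) y : y <= \sum_(i < n) u i ->
  exists z : nat -> nat, (forall i, z i <= u i) /\ \sum_(i < n) z i = y.
Proof.
elim: n y => [|n IH] y.
  by rewrite big_ord0 leqn0 => /eqP ->; exists (fun=> 0); split=> //; rewrite big_ord0.
rewrite big_ord_recr /= => h.
have h2 : y - minn (u n) y <= \sum_(i < n) u i.
  by rewrite leq_subLR; case: (leqP (u n) y) => hy; [rewrite addnC|rewrite leq_addr].
have [z [hz ez]] := IH _ h2.
exists (fun i => if i == n then minn (u n) y else z i); split=> [i|].
  by case: eqP => [->|_]; [apply: geq_minl|].
rewrite big_ord_recr /= eqxx (eq_bigr (fun i : 'I_n => z i)); last by move=> i _; rewrite ltn_eqF.
by rewrite ez subnK // geq_minr.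
Qed.

Lemma class_sum n S (si : nat -> nat) (f : nat -> nat -> nat) : (forall i, i < n -> si i <= S) ->
  (forall v i, si i != v -> f v i = 0) ->
  \sum_(v < S.+1) v * \sum_(i < n) f v i = \sum_(i < n) si i * f (si i) i.
Proof.
move=> hS hf; rewrite (eq_bigr (fun v : 'I_S.+1 => \sum_(i < n) v * f v i)); last by move=> v _; rewrite big_distrr.
rewrite exchange_big; apply: eq_bigr => i _.
have hi : si i < S.+1 by rewrite ltnS hS.
rewrite (bigD1 (Ordinal hi)) //= big1 ?addn0 // => v hv.
by rewrite hf ?muln0 //; apply: contraNN hv => /eqP e; apply/eqP/val_inj.
Qed.

(** Backwards, the multiplicity chosen for a size is distributed over the items of that size by
    [split_sum], and [choice] collects these distributions for all sizes. *)
Lemma aggregate n (si ui : nat -> nat) S t : (forall i, i < n -> si i <= S) ->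
  (exists x : nat -> nat, (forall i, i < n -> x i <= ui i) /\ \sum_(i < n) si i * x i = t) <->
  bss (fun v => \sum_(i < n) (if si i == v then ui i else 0)) S t.
Proof.
move=> hS; split=> [[x [hx <-]]|[x [hx <-]]].
  exists (fun v => \sum_(i < n) (if si i == v then x i else 0)); split.
    by move=> v; apply: leq_sum => i _; case: eqP => // _; apply: hx.
  rewrite (class_sum (si := si) (S := S) (f := fun v i => if si i == v then x i else 0)) //; last by move=> v i /negbTE ->.
  by apply: eq_bigr => i _; rewrite eqxx.
have /choice[z hz] : forall v, exists z : nat -> nat, (forall i, z i <= if si i == v then ui i else 0) /\ \sum_(i < n) z i = x v.
  by move=> v; apply: split_sum; apply: hx.
exists (fun i => z (si i) i); split=> [i _|].
  by have [h _] := hz (si i); have := h i; rewrite eqxx.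
rewrite -(class_sum (f := z) hS).
  by apply: eq_bigr => v _; have [_ ->] := hz v.
by move=> v i /negbTE hv; have [h _] := hz v; have := h i; rewrite hv leqn0 => /eqP.
Qed.

Definition ext n (s : 'I_n -> nat) k := oapp s 0 (insub k).

Lemma extE n (s : 'I_n -> nat) (i : 'I_n) : ext s i = s i.
Proof. by rewrite /ext valK. Qed.

Lemma subset_sum_bss n (s u : 'I_n -> nat) t : subset_sum s u t <->
  bss (fun v => \sum_(i < n) (if ext s i == v then ext u i else 0)) (\max_(i < n) ext s i) t.
Proof.
rewrite -(aggregate (ext u) t (S := \max_(i < n) ext s i)); last first.
  by move=> i hi; apply: (leq_bigmax_cond (Ordinal hi) (F := fun i : 'I_n => ext s i)).
split=> [[x [hx <-]]|[x [hx <-]]].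
  exists (ext x); split.
    by move=> i hi; have := hx (Ordinal hi); rewrite -(extE x (Ordinal hi)) -(extE u (Ordinal hi)).
  by apply: eq_bigr => i _; rewrite !extE.
exists (fun i : 'I_n => x i); split; first by move=> i; have := hx i (ltn_ord i); rewrite extE.
by apply: eq_bigr => i _; rewrite extE.
Qed.

Lemma input_mem n (s u : 'I_n -> nat) t (m0 := nth 0 (input_seq s u t)) :
  [/\ m0 0 = n, m0 1 = t, forall i, i < n -> m0 (2 + i) = ext s i /\ m0 (2 + n + i) = ext u i
    & forall i, 2 * n + 2 <= i -> m0 i = 0].
Proof.
have se (f : 'I_n -> nat) : size [seq f i | i <- enum 'I_n] = n by rewrite size_map size_enum_ord.
have nt (f : 'I_n -> nat) i : i < n -> nth 0 [seq f i | i <- enum 'I_n] i = ext f i.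
  move=> hi; rewrite (nth_map (Ordinal hi)) ?size_enum_ord //.
  by rewrite -extE nth_enum_ord.
split=> // [i hi|i hi].
  rewrite /m0 /input_seq -addnA; split.
    by rewrite [LHS]/= nth_cat se hi nt.
  change (nth 0 ([seq s i | i <- enum 'I_n] ++ [seq u i | i <- enum 'I_n]) (n + i) = ext u i).
  by rewrite nth_cat se ltnNge leq_addr [LHS]/= addKn nt.
by rewrite /m0 nth_default // /input_seq 2!size_cat !se /=; lia.
Qed.

(** * Word size *)

Section Powers.
Variable N : nat.
Hypothesis N2 : 1 < N.
Lemma pW i j x : i <= j -> x <= N ^ i -> x <= N ^ j.
Proof. by move=> ij h; apply: leq_trans h _; rewrite leq_exp2l. Qed.
Lemma pD i x y : x <= N ^ i -> y <= N ^ i -> x + y <= N ^ i.+1.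
Proof.
move=> h1 h2; rewrite expnS; apply: (@leq_trans (2 * N ^ i)); last by rewrite leq_mul2r N2 orbT.
by rewrite mul2n -addnn leq_add.
Qed.
Lemma pM i j x y : x <= N ^ i -> y <= N ^ j -> x * y <= N ^ (i + j).
Proof. by move=> h1 h2; rewrite expnD leq_mul. Qed.
Lemma pX i k x : x <= N ^ i -> x ^ k <= N ^ (i * k).
Proof. by move=> h; rewrite expnM; elim: k => // k IH; rewrite !expnS leq_mul. Qed.
Lemma pC k x : x <= 2 ^ k -> x <= N ^ k.
Proof. by move=> h; apply: leq_trans h _; case: k => // k; rewrite leq_exp2r. Qed.
End Powers.

(** Each quantity is bounded by a power of the input sum [N]. The parameter [a] enters the exponent
    because [a <= 2 ^ a <= N ^ a]; the constant 100 leaves room above the largest fixed exponent,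
    47, which comes from the convolution bound. *)
Lemma prog_bounds a N n S cnt (D := Df S cnt) (T := Tf a n S cnt) (M := N ^ (a + 100)) :
  1 < N -> 2 * n <= N -> 0 < n -> 0 < S <= N -> 0 < cnt <= N ->
  [/\ [/\ 100 < M, 2 * n < M, a <= M, 2 * S < M & 8 * D + 8 <= M],
      [/\ 4 * Bof D + 4 * D + 8 <= M, mf S <= M, T < M
        & 16 * 2 ^ lgf D * (lgf D).+2 * (D.+1 * (Bof D * Bof D)) <= M],
      [/\ 2 * (S ^ 3 + S) < M, 5 * lgf S + 3 <= M & 2 ^ (5 * lgf S + 3) <= M],
      T * S.+1 < M ^ 6 & forall x, x <= N ^ 3 -> x < M].
Proof.
move=> N2 nN n0 /andP[S0 SN] /andP[c0 cN].
have q x k : x <= N ^ k -> k <= a + 99 -> x < M.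
  move=> h hk; apply: leq_ltn_trans h _; rewrite /M ltn_exp2l //; lia.
have w x k : x <= N ^ k -> k <= a + 100 -> x <= M by move=> h hk; apply: pW h.
have c k x : x <= 2 ^ k -> x <= N ^ k := @pC N N2 k x.
have nn : n <= N ^ 1 by rewrite expn1; lia.
have SS : S <= N ^ 1 by rewrite expn1.
have CC : cnt <= N ^ 1 by rewrite expn1.
have DD : D <= N ^ 3.
  apply: (@leq_trans (2 * S * cnt)); last by apply: (pM (i := 2) _ CC); apply: (pM (i := 1) _ SS); apply: c.
  by rewrite /D /Df; case: ltnP => // h; rewrite leq_mul2l h orbT.
have q0 : 0 < qf S by have [/andP[]] := qfP S0.
have mf0 : 0 < mf S by rewrite /mf !muln_gt0 q0 addn3.
have D0 : 0 < D by rewrite /D /Df; case: ifP => _; rewrite (muln_gt0 (2 * S)) ?c0 ?mf0 andbT muln_gt0 S0.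
have qq : qf S <= N ^ 1 by apply: leq_trans SS; have [/andP[]] := qfP S0.
have /andP[_ D1] := lgfP D0; have /andP[_ S1] := lgfP S0; have /andP[_ n1] := lgfP n0.
have PD : 2 ^ lgf D <= N ^ 4 by apply: leq_trans D1 _; apply: (pM (i := 1) _ DD); apply: c.
have PS : 2 ^ lgf S <= N ^ 2 by apply: leq_trans S1 _; apply: (pM (i := 1) _ SS); apply: c.
have LD : lgf D < N ^ 4 by apply: leq_trans PD; apply: ltn_expl.
have LS : lgf S <= N ^ 2 by apply: leq_trans PS; apply: ltnW; apply: ltn_expl.
have Ln : lgf n <= N ^ 2.
  apply: leq_trans (_ : 2 ^ lgf n <= _); first by apply: ltnW; apply: ltn_expl.
  by apply: leq_trans n1 _; apply: (pM (i := 1) _ nn); apply: c.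
have BB : Bof D <= N ^ 15.
  rewrite /Bof; apply: (pM (i := 1) (j := 14)); first exact: c.
  apply: (pD N2); last by apply: (pW N2 (i := 0)).
  apply: (pM (i := 6) (j := 7)).
    apply: (pD N2); last by apply: (pW N2 (i := 4)) => //; apply: c.
    by apply: (pM (i := 1)); [apply: c|apply: ltnW].
  apply: (pD N2); last by apply: (pW N2 (i := 3)) => //; apply: c.
  by apply: (pW N2 (i := 2 + 3)) => //; apply: pM => //; apply: c.
have MF : mf S <= N ^ 9.
  rewrite /mf; apply: (pM (i := 6) (j := 3)).
    by apply: (pM (i := 5) (j := 1)) => //; apply: (pM (i := 4) (j := 1)) => //; apply: c.
  by apply: (pD N2) => //; apply: c.
have aa : a <= N ^ a by apply: leq_trans (_ : 2 ^ a <= _); [apply: ltnW; apply: ltn_expl|apply: c].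
have TT : T <= N ^ (a + 10).
  rewrite /T /Tf -/D; apply: (pW N2 (i := (a + 9).+1)); first by rewrite -addnS.
  apply: (pD N2); last by apply: (pW N2 (i := 2)); [rewrite addnC|apply: c].
  apply: (pW N2 (i := (a + 8).+1)); first by rewrite -addnS.
  apply: (pD N2); last by apply: (pW N2 (i := 2)) => //; rewrite addnC.
  apply: (pW N2 (i := (a + 7).+1)); first by rewrite -addnS.
  apply: (pD N2); last by apply: (pW N2 (i := 4)); [rewrite addnC|apply: ltnW].
  apply: (pW N2 (i := a + 3)); first by rewrite leq_add2l.
  by apply: (pM (j := 3)) => //; apply: (pD N2).
have K13 : 2 ^ (5 * lgf S + 3) <= N ^ 13.
  rewrite expnD; apply: (pM (i := 10) (j := 3)); last exact: c.
  by rewrite mulnC expnM; apply: (pX (i := 2) 5).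
split; [split|split|split| |].
- by apply: (q _ 7); [apply: leq_trans (_ : 2 ^ 7 <= _) => //; apply: c|lia].
- by apply: (q _ 2); [apply: (pM (i := 1)) => //; apply: c|lia].
- by apply: (w _ a); [|lia].
- by apply: (q _ 2); [apply: (pM (i := 1)) => //; apply: c|lia].
- apply: (w _ 7); last by lia.
  by apply: (pD N2); [apply: (pM (i := 3)) => //; apply: c|apply: (pW N2 (i := 3)) => //; apply: c].
- apply: (w _ 19); last by lia.
  apply: (pD N2); last by apply: (pW N2 (i := 3)) => //; apply: c.
  apply: (pD N2); first by apply: (pM (i := 2)) => //; apply: c.
  by apply: (pW N2 (i := 2 + 3)) => //; apply: pM => //; apply: c.
- by apply: (w _ 9); [|lia].
- by apply: (q _ (a + 10)); [|lia].
- apply: (w _ (4 + 4 + 5 + (4 + (15 + 15)))); last by lia.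
  apply: pM; last first.
    by apply: pM; [rewrite -addn1; apply: (pD N2) => //; apply: (pW N2 (i := 0))|apply: pM].
  apply: pM; first by apply: pM => //; apply: c.
  by rewrite -addn1; apply: (pD N2); [|apply: (pW N2 (i := 0))].
- apply: (q _ (1 + 4)); last by lia.
  apply: pM; first exact: c.
  by apply: (pD N2); [apply: (pX (i := 1))|apply: (pW N2 (i := 1))].
- by apply: (w _ 13); [apply: leq_trans K13; apply: ltnW; apply: ltn_expl|lia].
- by apply: (w _ 13); [|lia].
- apply: (@leq_ltn_trans (N ^ (a + 10 + 2))).
    by apply: pM => //; rewrite -addn1; apply: (pD N2) => //; apply: (pW N2 (i := 0)).
  by rewrite /M -expnM ltn_exp2l //; lia.
- by move=> x h; apply: (q _ 3); [|lia].
Qed.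

Lemma trials_enough a n S cnt (D := Df S cnt) (T := Tf a n S cnt) : 0 < n -> 0 < S -> 0 < D ->
  (n + S) ^ a * ((5 * lgf S + 3).+1 * D.+1) <= 2 ^ T.
Proof.
move=> n0 S0 D0.
have /andP[D1 _] := lgfP D0; have /andP[S1 _] := lgfP S0; have /andP[n1 _] := lgfP n0.
have -> : T = (lgf n + lgf S) * a + (lgf S + 3 + lgf D) by rewrite /T /Tf -/D [(lgf n + _) * a]mulnC; lia.
rewrite expnD; apply: leq_mul.
  rewrite expnM; have h : n + S <= 2 ^ (lgf n + lgf S).
    rewrite expnD; have l1 : 1 <= 2 ^ lgf n by rewrite expn_gt0.
    apply: (@leq_trans (n.+1 * S.+1)); last by apply: leq_mul.
    by rewrite mulSn mulnS; lia.
  have hX b : (n + S) ^ b <= (2 ^ (lgf n + lgf S)) ^ b by elim: b => // b IH; rewrite !(expnS _ b) leq_mul.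
  exact: hX.
rewrite expnD; apply: leq_mul; last exact: D1.
have := ltn_expl (lgf S) (ltnSn 1); rewrite expnD; lia.
Qed.

(** * Running time *)

(** Integer stand-in for [n + S ^ (5/3)], since [qf S] is the cube root of [S] rounded up. *)
Definition volume n S := n + S * qf S * qf S.
Definition logs n S := lgf n + lgf S.

(** [g] is [~O(h)], uniformly in the number [c] of distinct sizes. Closure under sums and products
    lets the tactic [bg] bound a cost by following its syntax, with at most one factor per product
    of size [volume] and the others polylogarithmic. *)
Definition big (h : nat -> nat -> nat) (g : nat -> nat -> nat -> nat) :=
  exists A e, forall n S c, 0 < n -> 0 < S -> 0 < c -> g n S c <= A * h n S * logs n S ^ e.
Definition one (n S : nat) := 1.

Lemma logs_gt0 n S : 0 < logs n S.
Proof. by rewrite /logs /lgf addSn. Qed.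

Lemma big_le h g1 g2 : (forall n S c, 0 < n -> 0 < S -> 0 < c -> g1 n S c <= g2 n S c) -> big h g2 -> big h g1.
Proof. by move=> l [A [e H]]; exists A, e => n S c n0 S0 c0; apply: leq_trans (l _ _ _ n0 S0 c0) (H _ _ _ n0 S0 c0). Qed.

Lemma bigD h g1 g2 : big h g1 -> big h g2 -> big h (fun n S c => g1 n S c + g2 n S c).
Proof.
move=> [A [e H]] [B [d K]]; exists (A + B), (e + d) => n S c n0 S0 c0.
rewrite 2!mulnDl; apply: leq_add.
  by apply: leq_trans (H _ _ _ n0 S0 c0) _; rewrite leq_mul2l leq_pexp2l ?orbT ?logs_gt0 ?leq_addr.
by apply: leq_trans (K _ _ _ n0 S0 c0) _; rewrite leq_mul2l leq_pexp2l ?orbT ?logs_gt0 ?leq_addl.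
Qed.

Lemma bigMl h g1 g2 : big one g1 -> big h g2 -> big h (fun n S c => g1 n S c * g2 n S c).
Proof.
move=> [A [e H]] [B [d K]]; exists (A * B), (e + d) => n S c n0 S0 c0.
apply: leq_trans (leq_mul (H _ _ _ n0 S0 c0) (K _ _ _ n0 S0 c0)) _.
by rewrite /one muln1 expnD -!mulnA leq_mul2l; apply/orP; right; rewrite mulnCA (mulnCA (logs n S ^ e)).
Qed.

Lemma bigMr h g1 g2 : big h g1 -> big one g2 -> big h (fun n S c => g1 n S c * g2 n S c).
Proof. by move=> h1 h2; apply: big_le (bigMl h2 h1) => n S c _ _ _; rewrite mulnC. Qed.

Lemma bigX g k : big one g -> big one (fun n S c => g n S c ^ k).
Proof.
move=> h; elim: k => [|k IH]; first by exists 1, 0 => n S c _ _ _.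
by apply: big_le (bigMl h IH) => n S c _ _ _; rewrite expnS.
Qed.

Lemma big_weak h g : (forall n S, 0 < n -> 0 < h n S) -> big one g -> big h g.
Proof.
move=> h0 [A [e H]]; exists A, e => n S c n0 S0 c0; apply: leq_trans (H _ _ _ n0 S0 c0) _.
by rewrite leq_mul2r leq_mul2l h0 ?orbT.
Qed.

Lemma bigc k : big one (fun _ _ _ => k).
Proof. by exists k, 0 => n S c _ _ _; rewrite muln1 muln1. Qed.

Lemma big_vol g : big one g -> big volume g.
Proof. by apply: big_weak => n S n0; rewrite addn_gt0 n0. Qed.

Lemma bigS h g : big one (fun _ _ _ => 1) -> big h (fun _ _ _ => 1) -> big h g -> big h (fun n S c => (g n S c).+1).
Proof. by move=> _ h1 hg; apply: big_le (bigD hg h1) => n S c _ _ _; rewrite addn1. Qed.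

Ltac bg := match goal with
  | H : big ?h ?g |- big ?h ?g => exact H
  | |- big one (fun _ _ _ => ?k) => exact: (bigc k)
  | |- big volume (fun _ _ _ => ?k) => exact: (big_vol (bigc k))
  | |- big _ (fun n S c => _ + _) => apply: bigD; bg
  | |- big one (fun n S c => _ * _) => apply: bigMl; bg
  | |- big volume (fun n S c => _ * _) => first [solve [apply: bigMl; bg] | solve [apply: bigMr; bg] | apply: big_vol; bg]
  | |- big _ (fun n S c => _ ^ _) => first [solve [apply: bigX; bg] | apply: big_vol; apply: bigX; bg]
  | |- big _ (fun n S c => (_).+1) => apply: bigS; bg
  | |- big volume _ => apply: big_vol; bg
  end.

Section Cost.
Variable a : nat.

Lemma bl : big one (fun n S c => logs n S).
Proof. by exists 1, 1 => n S c _ _ _; rewrite expn1 !mul1n. Qed.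
Lemma bln : big one (fun n S c => lgf n).
Proof. by apply: big_le bl => n S c _ _ _; apply: leq_addr. Qed.
Lemma blS : big one (fun n S c => lgf S).
Proof. by apply: big_le bl => n S c _ _ _; apply: leq_addl. Qed.
Lemma bn : big volume (fun n S c => n).
Proof. by exists 1, 0 => n S c _ _ _; rewrite mul1n muln1 leq_addr. Qed.
Lemma bQ : big volume (fun n S c => S * qf S * qf S).
Proof. by exists 1, 0 => n S c _ _ _; rewrite mul1n muln1 leq_addl. Qed.
Lemma bSq : big volume (fun n S c => S * qf S).
Proof. by apply: big_le bQ => n S c _ S0 _; rewrite leq_pmulr //; have [/andP[]] := qfP S0. Qed.
Lemma bS : big volume (fun n S c => S).
Proof. by apply: big_le bSq => n S c _ S0 _; rewrite leq_pmulr //; have [/andP[]] := qfP S0. Qed.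
Lemma bq : big volume (fun n S c => qf S).
Proof. by apply: big_le bS => n S c _ S0 _; have [/andP[]] := qfP S0. Qed.

Lemma Df_gt0 S c : 0 < S -> 0 < c -> 0 < Df S c.
Proof.
move=> S0 c0; have q0 : 0 < qf S by have [/andP[]] := qfP S0.
have mf0 : 0 < mf S by rewrite /mf !muln_gt0 q0 addn3.
by rewrite /Df; case: ifP => _; rewrite (muln_gt0 (2 * S)) ?c0 ?mf0 andbT muln_gt0 S0.
Qed.

Lemma Df_le S c : Df S c <= 32 * (S * qf S * qf S) * (lgf S + 3).
Proof.
apply: (@leq_trans (2 * S * mf S)); last by rewrite /mf; apply: eq_leq; ring.
by rewrite /Df; case: ltnP => h //; rewrite leq_mul2l (ltnW h) orbT.
Qed.

Lemma bD : big volume (fun n S c => Df S c).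
Proof.
have h1 := bQ; have h2 := blS.
by apply: (@big_le _ _ (fun n S c => 32 * (S * qf S * qf S) * (lgf S + 3))); [move=> n S c _ _ _; apply: Df_le|bg].
Qed.

Lemma bPD : big volume (fun n S c => 2 ^ lgf (Df S c)).
Proof.
have h := bD.
apply: (@big_le _ _ (fun n S c => 2 * Df S c)); last by bg.
by move=> n S c _ S0 c0; have /andP[] := lgfP (Df_gt0 S0 c0).
Qed.

Lemma bL : big one (fun n S c => lgf (Df S c)).
Proof.
have h := blS.
apply: (@big_le _ _ (fun n S c => 8 + 4 * lgf S)); last by bg.
move=> n S c _ S0 c0; rewrite -(leq_exp2l (m := 2)) //.
have /andP[_ h1] := lgfP (Df_gt0 S0 c0); apply: leq_trans h1 _.
have /andP[h2 _] := lgfP S0; have [/andP[q0 q1] _ _] := qfP S0.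
have h3 : lgf S + 3 <= 4 * 2 ^ lgf S by have := ltn_expl (lgf S) (ltnSn 1); lia.
apply: (@leq_trans (2 * (32 * (2 ^ lgf S * 2 ^ lgf S * 2 ^ lgf S) * (4 * 2 ^ lgf S)))).
  rewrite leq_mul2l; apply: leq_trans (Df_le S c) _; apply: leq_mul => //.
  have q2 : qf S <= 2 ^ lgf S by apply: leq_trans q1 (ltnW h2).
  by rewrite leq_mul2l; apply: leq_mul => //; apply: leq_mul => //; apply: ltnW.
rewrite expnD (mulnC 4 (lgf S)) expnM (_ : 2 ^ 8 = 256) //; generalize (2 ^ lgf S) => x.
by apply: eq_leq; rewrite !expnS expn0; ring.
Qed.

Lemma bT : big one (fun n S c => Tf a n S c).
Proof. have h1 := bln; have h2 := blS; have h3 := bL; rewrite /Tf; bg. Qed.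

Lemma bB : big volume (fun n S c => Bof (Df S c)).
Proof. have h1 := bL; have h2 := bD; rewrite /Bof; bg. Qed.

Lemma bup : big one (fun n S c => up_log 2 (Bof (Df S c)).+1).
Proof.
have h1 := bL.
apply: (@big_le _ _ (fun n S c => 10 + (lgf (Df S c) + lgf (Df S c)))); last by bg.
move=> n S c _ S0 c0; apply: up_log_min => //.
have /andP[h2 _] := lgfP (Df_gt0 S0 c0); set D := Df S c in h2 *.
have D0 : 0 < D := Df_gt0 S0 c0.
have h3 := ltn_expl (lgf D) (ltnSn 1).
clearbody D; rewrite 2!expnD /Bof; move: h2 h3; generalize (2 ^ lgf D) => X; generalize (lgf D) => L h2 h3.
have : (2 * L + 10) * (4 * D + 8) <= (10 * X) * (12 * X) by apply: leq_mul; lia.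
have : 1 <= X * X by rewrite muln_gt0; lia.
rewrite (_ : 10 * X * (12 * X) = 120 * (X * X)); last by ring.
generalize (X * X) ((2 * L + 10) * (4 * D + 8)); lia.
Qed.

Lemma big_time : big volume (fun n S c => total_time a n S c).
Proof.
have h1 := bL; have h2 := bD; have h3 := bT; have h4 := bup; have h5 := bB; have h6 := bPD.
have h7 := bS; have h8 := bq; have h9 := bSq; have h10 := bQ; have h11 := bn; have h12 := blS; have h13 := bln.
have pre : big volume (fun n S c => pre_cost n S (Df S c)) by rewrite /pre_cost; bg.
have ss : big volume (fun n S c => ss_cost (Df S c) (lgf (Df S c)) (Tf a n S c)) by rewrite /ss_cost; bg.
have lev : big volume (fun n S c => level_cost S (Df S c) (lgf (Df S c)) (Tf a n S c) (5 * lgf S + 3)).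
  have h14 : big volume (fun n S c => 2 ^ (lgf (Df S c)).+1).
    by apply: (@big_le _ _ (fun n S c => 2 * 2 ^ lgf (Df S c))); [move=> n S c _ _ _; rewrite expnS|bg].
  by rewrite /level_cost; bg.
have lt : big volume (fun n S c => level_total S (Df S c) (Tf a n S c)) by rewrite /level_total; bg.
have h14 : big volume (fun n S c => S * (qf S * (5 * qf S + 5) + 5)).
  apply: (@big_le _ _ (fun n S c => 5 * (S * qf S * qf S) + 5 * (S * qf S) + 5 * S)); last by bg.
  by move=> n S c _ _ _; apply: eq_leq; ring.
have h15 : big volume (fun n S c => qf S * (4 * S + 14)).
  apply: (@big_le _ _ (fun n S c => 4 * (S * qf S) + 14 * qf S)); last by bg.
  by move=> n S c _ _ _; apply: eq_leq; ring.
have dn : big volume (fun n S c => dense_cost S (Df S c) (lgf (Df S c)) (Tf a n S c) (qf S)) by rewrite /dense_cost; bg.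
have post : big volume (fun n S c => post_cost S (Df S c) (Tf a n S c)) by rewrite /post_cost; bg.
have nr : big volume (fun n S c => Tf a n S c * S.+1) by bg.
by rewrite /total_time; bg.
Qed.
End Cost.

(** * Passage to real exponents and logarithms *)

Section Real.
Variable R : realType.
Local Open Scope ring_scope.

(** [qf S] is at most twice the real cube root of [S], because the cube of its predecessor is below
    [S]. The two factors [qf S] yield the constant 4. *)
Lemma volume_le (n S : nat) : (0 < n)%N -> (0 < S)%N ->
  (volume n S)%:R <= 4 * (n%:R + S%:R `^ (5%:R / 3%:R)) :> R.
Proof.
move=> n0 S0; have S0' : (0 : R) < S%:R by rewrite ltr0n.
pose x : R := S%:R `^ (3%:R^-1).
have x0 : 0 < x by apply: powR_gt0.
have x3 : x ^+ 3 = S%:R by rewrite -powR_mulrn ?ltW // -powRrM mulVf ?powRr1 ?ltW // pnatr_eq0.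
have x5 : S%:R `^ (5%:R / 3%:R) = x ^+ 5 by rewrite -powR_mulrn ?ltW // -powRrM mulrC.
have [/andP[q0 q1] q2 q3] := qfP S0.
have q8 : (qf S ^ 3 <= 8 * S)%N.
  (* [q <= 2 * q.-1] fails only for [q = 1]; the summand [qf S == 1] repairs that case. *)
  apply: (@leq_trans ((2 * (qf S).-1 + (qf S == 1)) ^ 3))%N.
    by rewrite leq_exp2r //; case: (qf S) q0 => [|[|q]] //= _; lia.
  case: (qf S) q0 q3 => [|[|q]] //= _ q3; first by rewrite (_ : (2 * 0 + 1) ^ 3 = 1)%N //; lia.
  by rewrite addn0 expnMn leq_pmul2l // ltnW.
have e8 : (2 : R) ^+ 3 * S%:R = (8 * S)%N%:R by rewrite natrM (_ : (2 : R) ^+ 3 = 8%:R) // -natrX.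
have q8' : (qf S)%:R ^+ 3 <= (8 * S)%N%:R :> R by rewrite -natrX ler_nat; exact: q8.
have hq : (qf S)%:R <= 2 * x.
  have x2 : 0 <= 2 * x by rewrite mulr_ge0 // ltW.
  rewrite -(@ler_pXn2r R 3 isT (qf S)%:R (2 * x)) ?nnegrE ?ler0n //.
  by apply: le_trans q8' _; rewrite -e8 exprMn x3.
rewrite /volume natrD !natrM x5 mulrDr; apply: lerD; first by rewrite ler_peMl ?ler0n ?ler1n.
rewrite -x3; have q0' : (0 : R) <= (qf S)%:R by rewrite ler0n.
apply: (@le_trans _ _ (x ^+ 3 * (2 * x) * (2 * x))); last by rewrite le_eqVlt; apply/orP; left; apply/eqP; ring.
have p3 : 0 <= x ^+ 3 by rewrite exprn_ge0 // ltW.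
by apply: ler_pM => //; [rewrite mulr_ge0|apply: ler_wpM2l].
Qed.

(** From [2 ^ lgf m <= 2 * m <= 2 * f] and [ln 2 <= ln f] each logarithm is at most
    [2 / ln 2 * ln f]. The bound [2 <= f] keeps [ln f] away from 0, so constants are absorbed. *)
Lemma logs_le (n S : nat) (f : R) : (0 < n)%N -> (0 < S)%N -> n%:R <= f -> S%:R <= f -> 2 <= f ->
  (logs n S)%:R <= 4 / ln 2 * ln f.
Proof.
move=> n0 S0 nf Sf f2; have l2 : 0 < ln 2 :> R by apply: ln_gt0; rewrite ltr1n.
have lf : ln 2 <= ln f by rewrite ler_ln ?posrE; lra.
have h m : (0 < m)%N -> m%:R <= f -> (lgf m)%:R <= 2 / ln 2 * ln f :> R.
  move=> m0 mf; have /andP[_ h] := lgfP m0.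
  have h1 : ln (2 ^+ lgf m) <= ln (2 * f) :> R.
    rewrite ler_ln ?posrE ?exprn_gt0 ?mulr_gt0 //; last by lra.
    apply: (@le_trans _ _ (2 * m)%:R); first by rewrite -natrX ler_nat.
    by rewrite natrM; lra.
  rewrite lnXn // lnM ?posrE // in h1; last by lra.
  rewrite mulrAC ler_pdivlMr // mulr_natl; lra.
rewrite /logs natrD; have := h n n0 nf; have := h S S0 Sf.
by rewrite (_ : 4 / ln 2 * ln f = 2 / ln 2 * ln f + 2 / ln 2 * ln f); [lra|lra].
Qed.

Lemma time_le a : exists (C : R) k, forall n S c : nat, (0 < n)%N -> (0 < S)%N -> (0 < c)%N ->
  let f : R := n%:R + S%:R `^ (5%:R / 3%:R) in (total_time a n S c)%:R <= C * f * ln f ^+ k.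
Proof.
have [A [e H]] := big_time a.
exists (A%:R * 4 * (4 / ln 2) ^+ e), e; move=> n S c n0 S0 c0; cbv zeta; set f : R := n%:R + _.
have S1 : 1 <= S%:R :> R by rewrite ler1n.
have Sp : S%:R <= S%:R `^ (5%:R / 3%:R) :> R.
  by rewrite -[X in X <= _]powRr1 ?ler0n // ler_powR //; lra.
have n1 : 1 <= n%:R :> R by rewrite ler1n.
have f2 : 2 <= f by rewrite /f; lra.
have lg := logs_le n0 S0 (f := f) ltac:(rewrite /f; lra) ltac:(rewrite /f; lra) f2.
apply: (@le_trans _ _ (A * volume n S * logs n S ^ e)%N%:R); first by rewrite ler_nat; exact: H.
rewrite natrM natrM natrX.
rewrite (_ : _ * f * _ = A%:R * (4 * f) * (4 / ln 2 * ln f) ^+ e); last by rewrite [in RHS]exprMn; ring.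
apply: ler_pM; rewrite ?mulr_ge0 ?exprn_ge0 ?ler0n //.
  by rewrite ler_wpM2l ?ler0n //; apply: volume_le.
by rewrite lerXn2r ?nnegrE ?ler0n //; apply: le_trans lg; rewrite ler0n.
Qed.
End Real.

Theorem theorem3 (R : realType) (a : nat) :
  exists (P : program) (c k : nat) (C : R),
    0 < c /\
    forall (n : nat) (s u : 'I_n -> nat) (t : nat),
      0 < n -> (forall i, 0 < s i) -> (forall i, 0 < u i) ->
      let smax := \max_(i < n) s i in
      let f : R := (n%:R + smax%:R `^ (5%:R / 3%:R))%R in
      let w := word_size c s u t in
      exists T : nat,
        [/\ (T%:R <= C * f * ln f ^+ k)%R,
            forall omega : T.-tuple 'I_(2 ^ w), answer P s u t omega <> None,
            ~ subset_sum s u t ->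
              forall omega : T.-tuple 'I_(2 ^ w),
                answer P s u t omega = Some false
          & subset_sum s u t ->
              (1 - (n + smax)%:R ^- a <=
               Pr R (fun omega : T.-tuple 'I_(2 ^ w) =>
                       answer P s u t omega == Some true))%R].
Proof.
have [C [k htime]] := time_le R a.
(* With [M = N ^ (a + 100)] this word size parameter makes [2 ^ w] exceed [M ^ 12], as the degree
   count demands. *)
exists (prog a), (12 * (a + 100)), k, C; split; first by rewrite muln_gt0 addn_gt0 orbT.
move=> n s u t n0 s0 u0.
have -> : \max_(i < n) s i = \max_(i < n) ext s i by apply: eq_bigr => i _; rewrite extE.
cbv zeta; set S := \max_(i < n) ext s i; set w := word_size _ _ _ _.
pose U v := \sum_(i < n) (if ext s i == v then ext u i else 0).
pose cnt := count (fun v => 0 < U v) (iota 1 S).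
pose N := input_sum s u t; pose M := N ^ (a + 100).
have eN : N = t + (\sum_(i < n) ext s i + \sum_(i < n) ext u i).
  by rewrite /N /input_sum -big_split; congr addn; apply: eq_bigr => i _; rewrite !extE.
have sS i : i < n -> ext s i <= S.
  by move=> hi; apply: (leq_bigmax_cond (Ordinal hi) (F := fun i : 'I_n => ext s i)).
have s0' i : i < n -> 0 < ext s i by move=> hi; rewrite (extE s (Ordinal hi)).
have u0' i : i < n -> 0 < ext u i by move=> hi; rewrite (extE u (Ordinal hi)).
have S0 : 0 < S by apply: leq_trans (s0' 0 n0) (sS 0 n0).
have sum_ge (g : nat -> nat) : (forall i, i < n -> 0 < g i) -> n <= \sum_(i < n) g i.
  by move=> hg; rewrite -[X in X <= _](card_ord n) -sum1_card; apply: leq_sum => i _; apply: hg.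
have SN : S <= \sum_(i < n) ext s i.
  by apply/bigmax_leqP => i _; rewrite (bigD1 i) //= leq_addr.
have ns := sum_ge _ s0'; have nu := sum_ge _ u0'.
have cnt0 : 0 < cnt.
  rewrite -has_count; apply/hasP; exists (ext s 0); first by rewrite mem_iota s0' //= add1n ltnS sS.
  by rewrite /U (bigD1 (Ordinal n0)) //= eqxx addn_gt0 u0'.
have cS : cnt <= S by rewrite -[X in _ <= X](size_iota 1 S) count_size.
have N2 : 1 < N by rewrite eN; lia.
have bnd := @prog_bounds a N n S cnt N2 ltac:(rewrite eN; clear -ns nu; lia) n0
  ltac:(rewrite S0 eN; clear -SN; lia) ltac:(rewrite cnt0 eN; clear -cS SN; lia).
cbv zeta in bnd; rewrite -/M in bnd.
have [[M100 nM aM S2 D2] [BM mM TM PM] [KKM KM pKM] NRlim N3] := bnd.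
have pw1 x : x <= N -> x < M.
  by move=> h; apply: N3; apply: leq_trans h _; rewrite -{1}[N]expn1 leq_exp2l.
have tN : t <= N by rewrite eN leq_addr.
have uN : \sum_(i < n) ext u i <= N by rewrite eN addnA leq_addl.
have sN i : i < n -> ext s i <= N.
  by move=> hi; apply: leq_trans (sS i hi) _; apply: leq_trans SN _; rewrite eN addnCA leq_addr.
have uiN i : i < n -> ext u i <= N.
  by move=> hi; apply: leq_trans uN; rewrite (bigD1 (Ordinal hi)) //= leq_addr.
have SM : \sum_(i < n) ext s i * ext u i <= M.
  apply: ltnW; apply: N3; apply: (@leq_trans (S * \sum_(i < n) ext u i)).
    by rewrite big_distrr; apply: leq_sum => i _; rewrite leq_mul2r sS ?orbT.
  apply: (@leq_trans (N * N)).
    by apply: leq_mul => //; apply: leq_trans SN _; rewrite eN addnCA leq_addr.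
  by rewrite -[N * N]/(N ^ 2) leq_exp2l.
have M1 : 1 < M by apply: ltn_trans M100.
have MW : M ^ 12 < 2 ^ w.
  rewrite /M -expnM /w /word_size -/N (mulnC 12) (mulnC _ (trunc_log 2 N).+1) [X in _ < X]expnM.
  by rewrite ltn_exp2r ?muln_gt0 ?addn_gt0 ?orbT //; apply: trunc_log_ltn.
have Mlim : M ^ 5 < M ^ 6 by rewrite ltn_exp2l.
(* Each of the 32 arrays gets [M ^ 6] cells: more than the [M ^ 5] needed for checked indices and
   more than the number of random words. A word can address all of them. *)
have fitW : 2 * n + 2 + 32 * M ^ 6 <= 2 ^ w.
  apply: (@leq_trans (M ^ 8)); last by apply: leq_trans (ltnW MW); rewrite leq_exp2l.
  rewrite (expnS M 7) (expnS M 6); have : M <= M ^ 6 by rewrite -{1}[M]expn1 leq_exp2l.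
  have : 100 * (M * M ^ 6) <= M * (M * M ^ 6) by rewrite leq_mul2r (ltnW M100) orbT.
  have : 100 * M ^ 6 <= M * M ^ 6 by rewrite leq_mul2r (ltnW M100) orbT.
  move: nM M100; clear; generalize (M ^ 6) => y; generalize (M * y) => z; generalize (M * z); lia.
have [h0 h1 hi hz] := input_mem s u t.
have eSig : \sum_(i < n) ext s i * ext u i = \sum_(v < S.+1) v * U v.
  rewrite (class_sum (si := ext s) (S := S) (f := fun v i => if ext s i == v then ext u i else 0) sS).
    by apply: eq_bigr => i _; rewrite eqxx.
  by move=> v i /negbTE ->.
have hM i : i < n -> 0 < ext s i /\ ext s i <= M /\ ext u i <= M.
  by move=> h; split; [exact: s0'|split; apply: ltnW; apply: pw1; [exact: sN|exact: uiN]].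
have [n1 [p [n1b pp /andP[p1 p2] HR]]] := @prog_run w a n t M (ext s) (ext u) (M ^ 6) _ M100 MW Mlim fitW NRlim h0 h1 hi hz n0 S0 cnt0 nM
  (ltnW (pw1 _ tN)) hM (pw1 _ uN) SM aM S2 D2 BM mM TM PM KKM KM pKM eSig.
rewrite -/S -/U -/cnt in n1b p1 p2 HR.
have ss : subset_sum s u t <-> bss U S t := subset_sum_bss s u t.
have D0 : 0 < Df S cnt := Df_gt0 S0 cnt0.
have TE := total_timeE a n S cnt; cbv zeta in TE.
have enough := @trials_enough a n S cnt n0 S0 D0; cbv zeta in enough.
have ht := htime n S cnt n0 S0 cnt0; cbv zeta in ht.
have W0 : 0 < 2 ^ w by rewrite expn_gt0.
have DW : 4 * Df S cnt <= 2 ^ w.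
  apply: (@leq_trans M); last by apply: leq_trans (ltnW MW); rewrite -{1}[M]expn1 leq_exp2l.
  by move: D2; clear; generalize (Df S cnt); clear; lia.
exists (total_time a n S cnt).
move: (total_time a n S cnt) (Df S cnt) (Tf a n S cnt) TE enough D0 p1 p2 HR ht DW n1b {BM mM TM PM NRlim D2 bnd}
  => TT D T TE enough D0 p1 p2 HR ht DW n1b.
set K := 5 * lgf S + 3 in enough HR.
pose pos i := 5 + n1 + (12 * i + 7).
pose good (om : TT.-tuple 'I_(2 ^ w)) := forall i, i < K.+1 ->
  complete p D T (fun j => if j < T * S.+1 then nth 0 [seq val r | r <- om] (pos j) else 0) S (calls S t U i).
have key om : exists2 b, answer (prog a) s u t om = Some b & (b -> subset_sum s u t) /\ (good om -> subset_sum s u t -> b).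
  have sz : size [seq val r | r <- om] = TT by rewrite size_map size_tuple.
  have [b hb [q1 q2]] := HR _ sz.
  exists b; first by rewrite /answer /init hb.
  split=> [hb'|hg hs]; first by apply/ss; apply: q1.
  by apply: q2; [exact: hg|apply/ss].
split.
- exact: ht.
- by move=> om; have [b ->] := key om.
- by move=> ns' om; have [[] -> [q1 _]] := key om => //; case: ns'; apply: q1.
move=> hs.
have posT i : i < T * S.+1 -> pos i < TT.
  move=> h; have := slot_lt h; rewrite TE /pos; move: n1b; clear.
  generalize (sizeK a * pre_cost n S D) (sizeK a * post_cost S D T) (12 * (T * S.+1)) (12 * i + 7); lia.
have posI i j : pos i = pos j -> i = j by rewrite /pos => /addnI /addIn /eqP; rewrite eqn_pmul2l // => /eqP.
have TT0 : 0 < TT by rewrite TE.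
have := @tuple_trials (2 ^ w) TT _ T S p D pos K.+1 (calls S t U) pp p1 DW W0 erefl posT posI TT0.
set B := #|_|; set Om := #|_| => hB.
set A := fun om : TT.-tuple 'I_(2 ^ w) => answer (prog a) s u t om == Some true.
(* A tape is either accepted or bad, so it remains to compare the number of bad tapes with the
   fraction [(n + S) ^- a] of all tapes. *)
have hAB : Om <= #|A| + B.
  rewrite /Om -cardUI; apply: leq_trans (leq_addr _ _); apply: subset_leq_card; apply/subsetP => om _.
  rewrite inE; apply/orP; case: (asboolP (good om)) => hg; [left|right].
    by have [b hb [_ q2]] := key om; rewrite unfold_in /A hb (q2 hg hs).
  by rewrite inE; apply/asboolPn.
have hBX : (n + S) ^ a * B <= Om.
  have Y0 : 0 < K.+1 * D.+1 by [].
  rewrite -(leq_pmul2r Y0) mulnAC [Om * _]mulnC; apply: leq_trans hB.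
  by rewrite [B * _]mulnC leq_mul2r enough orbT.
have Om0 : 0 < Om.
  by apply/card_gt0P; exists [tuple Ordinal W0 | _ < TT].
rewrite /Pr -/A -/Om ler_pdivlMr ?ltr0n //.
have X0 : (0 < ((n + S)%:R : R) ^+ a)%R by rewrite exprn_gt0 // ltr0n addn_gt0 n0.
have r1 : (Om%:R <= #|A|%:R + B%:R :> R)%R by rewrite -natrD ler_nat.
have r2 : (((n + S)%:R : R) ^+ a * B%:R <= Om%:R)%R by rewrite -natrX -natrM ler_nat.
have r3 : (B%:R <= ((n + S)%:R : R) ^- a * Om%:R)%R by rewrite -ler_pdivrMl ?invr_gt0 // invrK.
by rewrite mulrBl mul1r; move: r1 r3; set x := (_ ^- a * _)%R; lra.
Qed.
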